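(* Let $F(t)=Z(t)/Z(\Upsilon)$ be a normalized IAP driven random measure, with $Z(t)=\int k(t,x)\,dL_A(x)$ and $L_A$ an extended gamma process with parameters $\alpha,\beta$ and, possibly, fixed points of discontinuity, where $\Upsilon$ is the maximum time up to which the process is observed, and let $T_1$ be a random sample (of size one) from $F$. Let $S_1,U_1$ be latent variables such that, given $L_A$, $(T_1,S_1,U_1)$ has joint law $$p(t,s,u\mid L_A)=\exp(-uZ(\Upsilon))\,k'(t,s)\,dL_A(s),\qquad u\ge0,\ s\in\mathbb{R},$$ where $k'(t,s)=\frac{\partial}{\partial t}k(t,s)$. Denote by $M=\{\tau_1,\tau_2,\dots\}$ the set of prior fixed points of discontinuity of $L_A$, by $f_{\tau_j}$ the density of the jump $L_A\{\tau_j\}$, by $L_A^c$ the part of $L_A$ without fixed points of discontinuity, and by $\star$ an updated parameter or function. (i) Given $T_1=t_1$, $S_1=s_1\in M$ and $U_1=u_1$, the posterior parameters are $M^\star=M$, $$f_{\tau_j}^\star(x)\propto\begin{cases}x\,e^{-u_1k(\Upsilon,\tau_j)x}f_{\tau_j}(x),&\text{if }\tau_j=s_1,\\ e^{-u_1k(\Upsilon,\tau_j)x}f_{\tau_j}(x),&\text{if }\tau_j\ne s_1,\ \tau_j\le\Upsilon.\end{cases}$$ (ii) Given $T_1=t_1$, $S_1=s_1\notin M$ and $U_1=u_1$, the posterior parameters are $M^\star=M\cup\{s_1\}$, with $$f_{s_1}(x)=\mathcal{G}(x\mid1,\beta(s_1)+u_1k(\Upsilon,s_1)),\qquad f_{\tau_j}^\star(x)\propto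 e^{-u_1k(\Upsilon,\tau_j)x}f_{\tau_j}(x)\quad\text{if }\tau_j\le\Upsilon.$$ Furthermore, given $T_1=t_1$ and $U_1=u_1$, the posterior distribution for the continuous part $L_A^c(\cdot)$ is $L_A^c(s)\sim\Gamma_A\{\alpha(s),\beta^\star(s)\}$, where $\beta^\star(s)=\beta(s)+u_1k(\Upsilon,s)$. Thus, the posterior distribution of the normalized random measure is $F^\star(t)=Z^\star(t)/\bar Z^\star$ with $Z^\star(t)=\int k(t,x)\,dL_A^\star(x)$ and $\bar Z^\star=Z^\star(\Upsilon)$, where $L_A^\star$ is the posterior (updated) process.
   Context: An increasing additive process (IAP) is a nondecreasing right-continuous process with independent increments. The prior is $L_A(s)=\sum_{j:\tau_j\le s}L_A\{\tau_j\}+L_A^c(s)$, where $L_A\{s\}=L_A(s)-L_A(s-)$, the jumps $L_A\{\tau_j\}$ at the fixed points of discontinuity are independent with densities $f_{\tau_j}$ and independent of $L_A^c$, and $L_A^c\sim\Gamma_A\{\alpha(\cdot),\beta(\cdot)\}$ has no fixed points of discontinuity. Here $\Gamma_A\{\alpha(\cdot),\beta(\cdot)\}$ denotes the extended gamma process with parameters $\alpha$ (a finite nonzero measure) and $\beta$ (a nonnegative piecewise continuous function), i.e. the IAP with Poisson intensity measure $e^{-\beta(x)v}v^{-1}\,dv\,\alpha(dx)$ on $\mathbb{R}\times(0,+\infty)$. Conditionally on the observation and the latent variables, $L_A$ remains an additive process, and ''posterior parameters'' are those describing this conditional law. $\mathcal{G}(x\mid c,d)$ is the gamma density with shape $c$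 and rate $d$. ''$\propto$'' means equality up to normalization to a probability density in $x\in(0,\infty)$. The kernel $k$ is nonnegative and, for each $x$, $t\mapsto k(t,x)$ is nondecreasing and absolutely continuous with limit $0$ at $-\infty$; $k$ and $L_A$ are such that $0<Z(\Upsilon)<\infty$ almost surely, so that the normalization makes sense. Under the joint law above, the marginal density of $T_1$ given $L_A$ is $f(t)=\int k'(t,x)\,dL_A(x)/Z(\Upsilon)$, the density of $F$. *)

(* Defs.v *)
(* MathComp-Analysis, over an arbitrary realType. *)
From HB Require Import structures.
From mathcomp Require Import all_boot all_order all_algebra.
From mathcomp Require Import all_classical all_reals all_analysis.
From mathcomp Require Import measurable_realfun.
Set Implicit Arguments.
Unset Strict Implicit.
Unset Printing Implicit Defensive.
Import Order.TTheory GRing.Theory Num.Theory numFieldNormedType.Exports.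
Local Open Scope classical_set_scope.
Local Open Scope ring_scope.

(* Sample paths of increasing processes indexed by the real line: nondecreasing
   and right-continuous (library structure [cumulative]), started at 0 at -oo. *)
Record iap_path (R : realType) := IapPath {
  path_fun :> cumulative R R ;
  path_cvgNy : path_fun y @[y --> -oo] --> (0 : R) }.

Section path_space.
Context (R : realType).

Let zero_nd : nondecreasing (fun _ : R => 0 : R).
Proof. by move=> x y _. Qed.
Let zero_rc : right_continuous (fun _ : R => 0 : R).
Proof. by move=> x; exact: cvg_cst. Qed.
Definition zero_fun (x : R) : R := 0.
HB.instance Definition _ := isCumulative.Build R _ R zero_fun zero_nd zero_rc.
Definition zero_path : iap_path R :=
  @IapPath R (zero_fun : cumulative R R) (cvg_cst (0 : R)).

HB.instance Definition _ := gen_eqMixin (iap_path R).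
HB.instance Definition _ := gen_choiceMixin (iap_path R).
HB.instance Definition _ := isPointed.Build (iap_path R) zero_path.

Definition path_cylinders : set (set (iap_path R)) :=
  [set A | exists t, exists2 B, measurable B & A = [set X : iap_path R | B (X t)]].

HB.instance Definition _ :=
  Measurable.copy (iap_path R) (g_sigma_algebraType path_cylinders).

(* The cylinder sigma-algebra on all functions R -> R. *)
Definition function_cylinders : set (set (R -> R)) :=
  [set A | exists t, exists2 B, measurable B & A = [set g : R -> R | B (g t)]].

End path_space.

Section processes.
Context (R : realType).
Implicit Types (X : iap_path R) (k : R -> R -> R).
Local Notation mu := (@lebesgue_measure R).

(* L{x} = L(x) - L(x-) *)
Definition jump X (x : R) : R := X x - lim (X y @[y --> x^'-]).

(* Z(t) = \int k(t, x) dL(x) *)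
Definition kmix k X (t : R) : \bar R :=
  (\int[lebesgue_stieltjes_measure X]_x (k t x)%:E)%E.

(* F(t) = Z(t) / Z(Ups) *)
Definition nrm k (Ups : R) X (t : R) : R :=
  fine (kmix k X t) / fine (kmix k X Ups).

(* Increasing additive process: monotonicity and right-continuity are part of
   [iap_path]; the first increment is the one over ]-oo, s 0]. *)
Definition increasing_additive d (Om : measurableType d)
    (P : {measure set Om -> \bar R}) (X : Om -> iap_path R) : Prop :=
  measurable_fun setT X /\
  forall (n : nat) (s : nat -> R), {homo s : i j / (i <= j)%N >-> i <= j} ->
  forall (A : set R) (B : 'I_n -> set R),
    measurable A -> (forall i, measurable (B i)) ->
    let incr (i : 'I_n) := [set w | B i (X w (s i.+1) - X w (s i))] in
    (P ([set w | A (X w (s 0%N))] `&` \bigcap_(i in [set: 'I_n]) incr i) =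
     P [set w | A (X w (s 0%N))] * \big[*%E/1%E]_(i < n) P (incr i))%E.

Definition poisson_random_measure d (W : measurableType d)
    (P : {measure set W -> \bar R}) (N : R.-ker W ~> (R * R)%type)
    (nu : set (R * R) -> \bar R) : Prop :=
  [/\ forall B, measurable B -> (nu B < +oo)%E -> forall n : nat,
        P [set w | N w B = (n%:R)%:E] =
          (fine (nu B) ^+ n / n`!%:R * expR (- fine (nu B)))%:E,
      forall B, measurable B -> nu B = +oo%E -> P [set w | N w B = +oo%E] = 1%E
    & forall (n : nat) (B : 'I_n -> set (R * R)) (A : 'I_n -> set (\bar R)),
        (forall i, measurable (B i)) -> (forall i, measurable (A i)) ->
        trivIset setT B ->
        P (\bigcap_(i in [set: 'I_n]) [set w | A i (N w (B i))]) =
          (\big[*%E/1%E]_(i < n) P [set w | A i (N w (B i))])%E].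

(* exp(-beta(x) v) v^-1 dv alpha(dx), carried by R x ]0, +oo[ *)
Definition gamma_intensity (alpha : {measure set R -> \bar R}) (beta : R -> R)
    (B : set (R * R)) : \bar R :=
  (\int[alpha]_x \int[mu]_(v in `]0%R, +oo[)
     (\1_B (x, v) * (expR (- (beta x * v)) / v))%:E)%E.

(* X ~ Gamma_A(alpha, beta): X is an increasing additive process with the law of
   s |-> \int_(]-oo, s] x ]0, +oo[) v N(dx, dv), N a Poisson random measure. *)
Definition extended_gamma d (Om : measurableType d)
    (P : {measure set Om -> \bar R}) (X : Om -> iap_path R)
    (alpha : {measure set R -> \bar R}) (beta : R -> R) : Prop :=
  increasing_additive P X /\
  exists (d' : measure_display) (W : measurableType d') (P' : probability W R)
    (N : R.-ker W ~> (R * R)%type) (Y : W -> iap_path R),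
  [/\ poisson_random_measure P' N (gamma_intensity alpha beta),
      measurable_fun setT Y,
      {ae P', forall w, forall s : R,
        (Y w s)%:E = (\int[N w]_(z in `]-oo, s] `*` `]0%R, +oo[) (z.2)%:E)%E}
    & forall E, measurable E -> P (X @^-1` E) = P' (Y @^-1` E)].

Definition no_fixed_discontinuity d (Om : measurableType d)
    (P : {measure set Om -> \bar R}) (X : Om -> iap_path R) : Prop :=
  forall x, P [set w | jump (X w) x != 0] = 0%E.

Definition pos_density (f : R -> R) : Prop :=
  [/\ measurable_fun setT f, forall x, 0 <= f x
    & (\int[mu]_(x in `]0%R, +oo[) (f x)%:E = 1)%E].

(* X(s) = \sum_(tau in M, tau <= s) X{tau} + Xc(s) *)
Definition decomposes (M : set R) X (Xc : iap_path R) : Prop :=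
  forall s : R, (X s)%:E =
    (\esum_(tau in M `&` `]-oo, s]) (jump X tau)%:E + (Xc s)%:E)%E.

(* X is an extended gamma process with fixed points of discontinuity M, jump
   densities (f tau), tau in M, and continuous part Gamma_A(alpha, beta); the
   values of f off M are irrelevant. *)
Definition extended_gamma_fixed d (Om : measurableType d)
    (P : {measure set Om -> \bar R}) (X : Om -> iap_path R)
    (M : set R) (f : R -> R -> R)
    (alpha : {measure set R -> \bar R}) (beta : R -> R) : Prop :=
  [/\ increasing_additive P X,
      forall tau, M tau -> pos_density (f tau) /\
        forall B, measurable B -> P [set w | B (jump (X w) tau)] =
          (\int[mu]_(x in B `&` `]0%R, +oo[) (f tau x)%:E)%E
    & exists Xc : Om -> iap_path R,
      [/\ forall w, decomposes M (X w) (Xc w),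
          extended_gamma P Xc alpha beta,
          no_fixed_discontinuity P Xc
        & forall (n : nat) (tau : 'I_n -> R) (B : 'I_n -> set R)
            (E : set (iap_path R)),
          injective tau -> (forall i, M (tau i)) ->
          (forall i, measurable (B i)) -> measurable E ->
          let J (i : 'I_n) := [set w | B i (jump (X w) (tau i))] in
          (P (\bigcap_(i in [set: 'I_n]) J i `&` Xc @^-1` E) =
           \big[*%E/1%E]_(i < n) P (J i) * P (Xc @^-1` E))%E]].

(* Q is a regular conditional law of X given Y. For X valued in [iap_path R],
   whose sigma-algebra is countably generated, Q y is unique for almost all y. *)
Definition conditional_law d d1 d2 (Om : measurableType d)
    (V : measurableType d1) (H : measurableType d2)
    (P : {measure set Om -> \bar R}) (X : Om -> V) (Y : Om -> H)
    (Q : R.-pker H ~> V) : Prop :=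
  forall E C, measurable E -> measurable C ->
    P (X @^-1` E `&` Y @^-1` C) = (\int[P]_(w in Y @^-1` C) Q (Y w) E)%E.

(* f(x) \propto g(x) on ]0, +oo[ *)
Definition propto_density (f g : R -> R) : Prop :=
  pos_density f /\ exists2 c : R, 0 < c & forall x, 0 < x -> f x = c * g x.

Definition Gamma_fun (c : R) : R :=
  fine (\int[mu]_(x in `]0%R, +oo[) (x `^ (c - 1) * expR (- x))%:E)%E.

(* shape c, rate d *)
Definition gamma_pdf (c d x : R) : R :=
  d `^ c / Gamma_fun c * x `^ (c - 1) * expR (- (d * x)).

Definition piecewise_continuous (g : R -> R) : Prop :=
  exists D : set R,
  [/\ forall a b, finite_set (D `&` `[a, b]),
      forall x, ~ D x -> {for x, continuous g}
    & forall x, D x -> cvg (g y @[y --> x^'-]) /\ cvg (g y @[y --> x^'+])].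

(* Absolute continuity on every compact interval. *)
Definition locally_absolutely_continuous (g : R -> R) : Prop :=
  forall a b e : R, 0 < e -> exists2 dl : R, 0 < dl &
  forall (n : nat) (I : 'I_n -> R * R),
    (forall i, [&& a <= (I i).1, (I i).1 <= (I i).2 & (I i).2 <= b]) ->
    trivIset setT (fun i => [set` `](I i).1, (I i).2[]) ->
    \sum_(i < n) ((I i).2 - (I i).1) < dl ->
    \sum_(i < n) `|g (I i).2 - g (I i).1| < e.

Definition kernel_assumptions k : Prop :=
  [/\ measurable_fun setT (fun z : R * R => k z.1 z.2),
      forall t x, 0 <= k t x,
      forall x, {homo k ^~ x : s t / s <= t},
      forall x, locally_absolutely_continuous (k ^~ x)
    & forall x, k t x @[t --> -oo] --> (0 : R)].

(* Integral over C (a set of triples (t, s, u)) of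
   exp(-u Z(Ups)) k'(t, s) dt dL(s) du, t <= Ups, u >= 0. For every s, k(., s) is
   derivable at almost every t, so the default value of [derive1] elsewhere is
   immaterial. *)
Definition latent_law k (Ups : R) X (C : set (R * R * R)) : \bar R :=
  (\int[mu]_(t in `]-oo, Ups]) \int[mu]_(u in `[0%R, +oo[)
   \int[lebesgue_stieltjes_measure X]_s
     (\1_C (t, s, u) *
      (expR (- (u * fine (kmix k X Ups))) * derive1 (k ^~ s) t))%:E)%E.

End processes.

(* Main.v *)
Require Import Defs.
From HB Require Import structures.
From mathcomp Require Import all_boot all_order all_algebra finmap.
From mathcomp Require Import all_classical all_reals all_analysis.
From mathcomp Require Import measurable_realfun.
From mathcomp Require Import ring lra.
Set Implicit Arguments.
Unset Strict Implicit.
Unset Printing Implicit Defensive.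
Import Order.TTheory GRing.Theory Num.Theory numFieldNormedType.Exports.
Local Open Scope classical_set_scope.
Local Open Scope ring_scope.
Import HBNNSimple.

(** The posterior is found by writing E[q(L, (T, S, U))], for an arbitrary q, in two
    ways. By hypothesis it is the integral of q against
    e^{-u Z} k'(t, s) dL(s) dt du dP, where Z is the integral of k(Ups, .) against dL
    ([latent_expectation]). For fixed t and u everything thus depends on measures of
    the form e^{-u Z} dL(s) dP on pairs (path, time), and the proof disintegrates
    these along s.

    Let Lc be the part of L without fixed atoms. In integrals against dL(s), the fixed
    atoms contribute a sum over s in M, with the jump at s as a weight. For Lc one has
    the Palm formula ([palm_formula]): a pair (L, s) with s chosen according to dLc has
    the law of (L + v delta_s, s), with (s, v) drawn from alpha(ds) e^{-beta(s) v} dv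
    independently of L. It is obtained from the joint Laplace functional of L and Lc:
    its derivative in the second argument gives E[e^{-int theta dL} Lc(A)]
    ([palm_laplace]), and Laplace functionals determine finite measures on paths
    ([path_laplace_unique]). Combining both parts ([atom_exchange]), and since an
    additional atom v at s multiplies e^{-u Z} by e^{-u k(Ups, s) v}, the path given
    (t, s, u) has the following law, up to normalisation ([posterior_kernel]):
    - for s in M, the law of L weighted by L{s} e^{-u Z};
    - for s outside M, the law of L weighted by e^{-u Z}, with an independent
      additional atom at s whose size has density e^{-(beta(s) + u k(Ups, s)) v}.
    This is Bayes' rule ([disintegration]).

    It remains to recognise these laws ([posterior_at]). The weight e^{-u Z} is the
    product of the e^{-u k(Ups, tau) L{tau}}, tau in M, and of the weight of Lc, so the
    jumps and Lc remain independent and each is tilted by its own factor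
    ([tilt_product]); the product over M, possibly infinite, is a limit of finite ones.
    A Poisson random measure is characterised by its Laplace functional
    ([prm_laplace], [laplace_prm]), and weighting by e^{-int h dLc} multiplies its
    intensity by e^{-h(x) v}: the tilted Lc is an extended gamma process with beta
    replaced by beta + u k(Ups, .) ([extended_gamma_tilt]). This last law does not
    involve s, hence is also the law of the continuous part given (t, u) alone.

    The weights are finite and positive, so that one may normalise, on the set of
    (t, s, u) with t < Ups, u > 0 and k(Ups, s) > 0, which has full probability since
    k' vanishes where k(Ups, s) = 0 ([good_triples_full]). Measurability of k' in
    (t, s) comes from the continuity of k in t, which reduces the existence of the
    derivative to rational increments ([measurable_derive1]). *)

(** * Weighted measures and expectations *)

Section integration_tools.
Context {R : realType}.

Lemma cvge_eq (u v : (\bar R)^nat) (l l' : \bar R) : (forall n, u n = v n) ->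
  (u n @[n --> \oo] --> l)%E -> (v n @[n --> \oo] --> l')%E -> l = l'.
Proof.
move=> /funext uv ul vl'; rewrite uv in ul.
by move/cvg_lim : ul => <-//; move/cvg_lim : vl' => <-.
Qed.

Lemma integral_setE d (T : measurableType d) (m : {measure set T -> \bar R})
    (A : set T) (f : T -> \bar R) :
  (\int[m]_(x in A) f x = \int[m]_x (f x * (\1_A x)%:E))%E.
Proof.
rewrite integral_mkcond; apply: eq_integral => x _.
by rewrite patchE indicE; case: ifPn => _; rewrite ?mule1 ?mule0.
Qed.

(** Approximation by simple functions extends the defining identity from events to
    nonnegative functions. *)
Lemma density_measure d (T : measurableType d) (m : {measure set T -> \bar R})
    (rho : T -> R) :
  measurable_fun setT rho -> (forall x, 0 <= rho x) ->
  exists m' : {measure set T -> \bar R},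
    (forall A, measurable A -> m' A = \int[m]_(x in A) (rho x)%:E)%E /\
    (forall f : T -> \bar R, measurable_fun setT f -> (forall x, 0 <= f x)%E ->
      \int[m']_x f x = \int[m]_x (f x * (rho x)%:E))%E.
Proof.
move=> mrho' rho0'.
have mrho : measurable_fun setT (EFin \o rho) by exact/measurable_EFinP.
have rho0 x : (0 <= (rho x)%:E)%E by rewrite lee_fin.
pose nu (A : set T) := (\int[m]_(x in A) (rho x)%:E)%E.
have nu0 : nu set0 = 0%E by rewrite /nu integral_set0.
have nuge0 A : (0 <= nu A)%E by apply: integral_ge0.
have nuD : semi_sigma_additive nu by exact: semi_sigma_additive_nng_induced.
pose B := isMeasure.Build _ _ _ nu nu0 nuge0 nuD.
pose m' : {measure set T -> \bar R} := HB.pack nu B.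
have m'E A : m' A = (\int[m]_(x in A) (rho x)%:E)%E by [].
exists m'; split => // f mf f0.
pose g := nnsfun_approx measurableT mf.
have gf x : (g n x)%:E @[n --> \oo] --> f x by apply: cvg_nnsfun_approx.
have ndg a b : (a <= b)%N -> forall x, g a x <= g b x.
  by move=> ab x; exact/lefP/nd_nnsfun_approx.
have mg n : measurable_fun setT (fun x => (g n x)%:E).
  exact/measurable_EFinP.
have g0 n x : (0 <= (g n x)%:E)%E by rewrite lee_fin.
have key n : (\int[m']_x (g n x)%:E = \int[m]_x ((g n x)%:E * (rho x)%:E))%E.
  under eq_integral do rewrite fimfunE -fsumEFin//.
  rewrite ge0_integral_fsum//; last 2 first.
  - by move=> r; exact/measurable_EFinP/measurableT_comp.
  - by move=> r x _; rewrite EFinM nnfun_muleindic_ge0.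
  transitivity (\int[m]_x \sum_(k \in range (g n))
     ((k * \1_((g n) @^-1` [set k]) x)%:E * (rho x)%:E))%E; last first.
    apply: eq_integral => x _; rewrite fimfunE -fsumEFin// ge0_mule_fsuml//.
    by move=> r; rewrite EFinM nnfun_muleindic_ge0.
  rewrite ge0_integral_fsum//; last 2 first.
  - move=> r; apply: emeasurable_funM => //.
    exact/measurable_EFinP/measurableT_comp.
  - by move=> r x _; rewrite mule_ge0// EFinM nnfun_muleindic_ge0.
  apply: eq_fsbigr => r _.
  rewrite (integralZl_indic _ (fun r => (g n) @^-1` [set r]))//; last first.
    by move=> r0; rewrite preimage_nnfun0.
  rewrite integral_indic// setIT m'E//.
  have [r0|r0] := leP 0 r; last first.
    rewrite preimage_nnfun0// integral_set0 mule0 integral0_eq// => x _.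
    by rewrite indic0 mulr0 mul0e.
  rewrite integral_setE -ge0_integralZl//; last 2 first.
  - apply: emeasurable_funM => //; apply/measurable_EFinP.
    exact: measurable_indic.
  - by move=> x _; rewrite mule_ge0// lee_fin.
  by apply: eq_integral => x _; rewrite EFinM -muleA [X in (r%:E * X)%E]muleC.
have -> : (\int[m']_x f x = limn (fun n => \int[m']_x (g n x)%:E))%E.
  rewrite -monotone_convergence//.
  - by apply: eq_integral => x _; apply/esym/cvg_lim => //; exact: gf.
  - by move=> x _ a b ab; rewrite lee_fin; exact: ndg.
rewrite (_ : (fun n => _) = (fun n => \int[m]_x ((g n x)%:E * (rho x)%:E))%E); last first.
  by apply/funext.
rewrite -monotone_convergence//.
- apply: eq_integral => x _; apply/cvg_lim => //.
  by apply: cvgeZr => //.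
- by move=> n; exact: emeasurable_funM.
- by move=> n x _; rewrite mule_ge0.
- by move=> x _ a b ab; rewrite lee_wpmul2r// lee_fin; exact: ndg.
Qed.

Lemma tilted_probability d (T : measurableType d) (m : {measure set T -> \bar R})
    (rho : T -> R) (c : R) :
  measurable_fun setT rho -> (forall x, 0 <= rho x) ->
  0 < c -> (\int[m]_x (rho x)%:E = c%:E)%E ->
  exists P' : probability T R,
    (forall A, measurable A -> P' A = c^-1%:E * \int[m]_(x in A) (rho x)%:E)%E /\
    (forall f : T -> \bar R, measurable_fun setT f -> (forall x, 0 <= f x)%E ->
      \int[P']_x f x = c^-1%:E * \int[m]_x (f x * (rho x)%:E))%E.
Proof.
move=> mrho rho0 c0 mc.
have [|x|m' [m'E im']] := @density_measure _ _ m (fun x => c^-1 * rho x).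
- exact: measurable_funM.
- by rewrite mulr_ge0// invr_ge0 ltW.
have ci0 : (0 <= c^-1%:E)%E by rewrite lee_fin invr_ge0 ltW.
have m'T : m' setT = 1%E.
  rewrite m'E//; under eq_integral do rewrite EFinM.
  rewrite ge0_integralZl//; last 2 first.
  - exact/measurable_EFinP.
  - by move=> x _; rewrite lee_fin.
  by rewrite mc -EFinM mulVf// gt_eqF.
pose P' : probability T R := mnormalize m' (dirac point : probability T R).
have P'E A : P' A = m' A.
  by rewrite /P' /= /mnormalize/= m'T onee_eq0/= invr1 mule1.
exists P'; split => [A mA|f mf f0].
  rewrite P'E m'E//; under eq_integral do rewrite EFinM.
  rewrite ge0_integralZl//.
  - by apply/measurable_EFinP; exact: measurable_funTS.
  - by move=> x _; rewrite lee_fin.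
have -> : (\int[P']_x f x = \int[m']_x f x)%E by apply: eq_measure_integral => A mA _; exact: P'E.
rewrite im'// -ge0_integralZl//.
- by apply: eq_integral => x _; rewrite EFinM muleCA.
- by apply: emeasurable_funM => //; exact/measurable_EFinP.
- by move=> x _; rewrite mule_ge0// lee_fin.
Qed.

Lemma bounded_convergence d (T : measurableType d) (m : {measure set T -> \bar R})
    (g : (T -> R)^nat) (h : T -> R) (C : R) :
  (m setT < +oo)%E -> (forall n, measurable_fun setT (g n)) ->
  (forall n x, `|g n x| <= C) -> (forall x, g n x @[n --> \oo] --> h x) ->
  (\int[m]_x (g n x)%:E @[n --> \oo] --> \int[m]_x (h x)%:E)%E.
Proof.
move=> mT mg gC gh.
have mh : measurable_fun setT h.
  by apply: (measurable_fun_cvg mg) => x _; exact: gh.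
have := @dominated_convergence _ _ _ m setT measurableT
  (fun n x => (g n x)%:E) (fun x => (h x)%:E) (fun=> C%:E).
case => //.
- by move=> n; exact/measurable_EFinP.
- exact/measurable_EFinP.
- by apply/aeW => x _; apply: cvg_EFin; [exact: nearW|exact: gh].
- apply/integrableP; split; first exact: measurable_cst.
  by rewrite integral_cst// lte_mul_pinfty// lee_fin.
- by apply/aeW => x n _; rewrite abse_EFin lee_fin.
Qed.

Lemma eq_law_integral d1 d2 d3 (T1 : measurableType d1) (T2 : measurableType d2)
    (S : measurableType d3) (m1 : {measure set T1 -> \bar R})
    (m2 : {measure set T2 -> \bar R}) (X1 : T1 -> S) (X2 : T2 -> S)
    (h : S -> \bar R) :
  measurable_fun setT X1 -> measurable_fun setT X2 ->
  (forall A, measurable A -> m1 (X1 @^-1` A) = m2 (X2 @^-1` A)) ->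
  measurable_fun setT h -> (forall y, 0 <= h y)%E ->
  (\int[m1]_x h (X1 x) = \int[m2]_x h (X2 x))%E.
Proof.
move=> mX1 mX2 E mh h0.
transitivity (\int[pushforward m1 X1]_y h y)%E.
  by rewrite ge0_integral_pushforward.
transitivity (\int[pushforward m2 X2]_y h y)%E; last first.
  by rewrite ge0_integral_pushforward.
apply: eq_measure_integral => A mA _; exact: E.
Qed.

(** Serves to expand powers of 1 - e^{-sX} into Laplace transforms. *)
Lemma integral_subE d (T : measurableType d) (m : {measure set T -> \bar R})
    (a b : T -> R) (C : R) :
  (m setT < +oo)%E -> measurable_fun setT a -> measurable_fun setT b ->
  (forall x, 0 <= b x <= a x) -> (forall x, a x <= C) ->
  (\int[m]_x (a x - b x)%:E = \int[m]_x (a x)%:E - \int[m]_x (b x)%:E)%E.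
Proof.
move=> mT ma mb ba aC.
have C0 : 0 <= C.
  by have /andP[b0 ba0] := ba point; rewrite (le_trans _ (aC point))// (le_trans b0).
have a0 x : 0 <= a x by have /andP[b0 /(le_trans b0)] := ba x.
have b0 x : 0 <= b x by have /andP[] := ba x.
have fin (h : T -> R) : measurable_fun setT h -> (forall x, 0 <= h x <= C) ->
    (\int[m]_x (h x)%:E)%E \is a fin_num.
  move=> mh hC; rewrite ge0_fin_numE; last first.
    by apply: integral_ge0 => x _; rewrite lee_fin; have /andP[] := hC x.
  apply: (@le_lt_trans _ _ (\int[m]_x (cst C%:E x))%E).
    apply: ge0_le_integral => //=.
    - by move=> x _; rewrite lee_fin; have /andP[] := hC x.
    - exact/measurable_EFinP.
    - by move=> x _; rewrite lee_fin; have /andP[] := hC x.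
  by rewrite integral_cst// lte_mul_pinfty// lee_fin.
have -> : (\int[m]_x (a x)%:E =
           \int[m]_x (a x - b x)%:E + \int[m]_x (b x)%:E)%E.
  rewrite -ge0_integralD//.
  - by apply: eq_integral => x _; rewrite -EFinD subrK.
  - by move=> x _; rewrite lee_fin subr_ge0; have /andP[] := ba x.
  - by apply/measurable_EFinP; exact: measurable_funB.
  - by move=> x _; rewrite lee_fin.
  - exact/measurable_EFinP.
rewrite addeK// fin// => x; rewrite b0/=.
by have /andP[_ /le_trans] := ba x; apply.
Qed.

(** e^{-x} for x in [0, +oo], with e^{-oo} = 0: Laplace transforms are taken of
    masses that may be infinite. *)
Definition nexp (x : \bar R) : R := if x is r%:E then expR (- r) else 0.

Lemma nexp_ge0 x : 0 <= nexp x.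
Proof. by case: x => //= r; exact: expR_ge0. Qed.

Lemma nexp_le1 x : (0 <= x)%E -> nexp x <= 1.
Proof. by case: x => //= r; rewrite lee_fin -oppr_le0 -expR0 ler_expR. Qed.

Lemma nexp_norm x : (0 <= x)%E -> `|nexp x| <= 1.
Proof. by move=> x0; rewrite ger0_norm ?nexp_ge0// nexp_le1. Qed.

Lemma nexp0 : nexp 0 = 1. Proof. by rewrite /= oppr0 expR0. Qed.

Lemma nexp_gt0 x : (0 <= x < +oo)%E -> 0 < nexp x.
Proof.
case: x => [r| |]; rewrite ?ltxx ?andbF//= => _; exact: expR_gt0.
Qed.

Lemma nexp_eq0 x : (0 <= x)%E -> nexp x = 0 -> x = +oo%E.
Proof. by case: x => //= r _ /eqP; rewrite expR_eq0. Qed.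

Lemma nexpD x y : (0 <= x)%E -> (0 <= y)%E -> nexp (x + y) = nexp x * nexp y.
Proof.
case: x => [r| |]//; case: y => [s| |]//= _ _; rewrite ?mulr0 ?mul0r//.
by rewrite opprD expRD.
Qed.

Lemma nexp_sum (I : Type) (s : seq I) (P : pred I) (x : I -> \bar R) :
  (forall i, 0 <= x i)%E ->
  nexp (\sum_(i <- s | P i) x i)%E = \prod_(i <- s | P i) nexp (x i).
Proof.
move=> x0; elim: s => [|i s ih]; first by rewrite !big_nil nexp0.
rewrite !big_cons; case: ifP => // _.
by rewrite nexpD ?ih//; exact: sume_ge0.
Qed.

Lemma le_nexp x y : (0 <= x)%E -> (x <= y)%E -> nexp y <= nexp x.
Proof.
case: x => [r| |]//; case: y => [s| |]//= _; rewrite ?expR_ge0//.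
by rewrite lee_fin ler_expR lerN2.
Qed.

Lemma measurable_nexp : measurable_fun setT nexp.
Proof.
have -> : nexp = fun x => if x \in [set` `]-oo%E, +oo%E[] then expR (- fine x) else 0.
  by apply/funext => -[r| |] /=; rewrite mem_setE in_itv/= ?ltNyr ?ltry ?ltxx ?andbF.
apply: measurable_fun_ifT => //.
- apply: (measurable_fun_bool true); rewrite setTI.
  rewrite (_ : _ @^-1` _ = [set` `]-oo%E, +oo%E[] :> set (\bar R)).
    exact: emeasurable_itv.
  by apply/seteqP; split => x /=; rewrite mem_setE.
- by apply: measurableT_comp => //; apply: measurableT_comp => //; exact: measurable_fine.
Qed.

Lemma cvg_nexp (u : (\bar R)^nat) l : (forall n, 0 <= u n)%E ->
  (u n @[n --> \oo] --> l)%E -> nexp (u n) @[n --> \oo] --> nexp l.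
Proof.
move=> u0; case: l => [r| |] ul.
- move/fine_cvgP: ul => [uf ur].
  have : expR (- fine (u n)) @[n --> \oo] --> expR (- r).
    apply: continuous_cvg; first exact: continuous_expR.
    exact: cvgN.
  apply: cvg_trans; apply: near_eq_cvg; near=> n.
  have : u n \is a fin_num by near: n.
  by case: (u n).
- apply/cvgrPdist_le => e e0 /=.
  move/cvgeyPge : ul => /(_ (- ln e)) ul; near=> n.
  have : ((- ln e)%:E <= u n)%E by near: n.
  rewrite sub0r normrN ger0_norm ?nexp_ge0//.
  case: (u n) => [s h|_|_] /=; [|exact: ltW|exact: ltW].
  by move: h; rewrite lee_fin => h; rewrite -[leRHS]lnK ?posrE// ler_expR lerNl.
- have /cvgeNyPle/(_ (-1)) [N _ /(_ N (leqnn _))] /= := ul.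
  by move=> /(le_trans (u0 N)); rewrite lee_fin; lra.
Unshelve. all: by end_near. Qed.

End integration_tools.
(** * Uniqueness of Laplace transforms *)

Section laplace.
Context {R : realType}.
Implicit Types (a lam t : R).

Let step (n : nat) (lam : R) (x : \bar R) : R :=
  (1 - nexp ((n%:R * lam)%:E * x)) ^+ (n * 2 ^ n).

(** With l = ln 2 / a one has e^{-n l x} = 2^{-n x / a}; the exponent n 2^n is
    large enough to kill x <= a and small enough to keep x > a. *)
Let step_cvg a (x : \bar R) : 0 < a -> (0 <= x)%E ->
  step n (ln 2 / a) x @[n --> \oo] --> ((a%:E < x)%E%:R : R).
Proof.
move=> a0; set lam := ln 2 / a.
have l20 : 0 < ln 2 :> R by rewrite ln_gt0// ltr1n.
have lam0 : 0 < lam by rewrite divr_gt0.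
case: x => [r| |]//; last first.
  move=> _; rewrite ltry; apply: cvg_near_cst; near=> n.
  rewrite /step gt0_muley ?lte_fin; last first.
    by rewrite mulr_gt0// ltr0n; near: n; exists 1%N.
  by rewrite subr0 expr1n.
rewrite lee_fin lte_fin => r0.
pose y n := expR (- (n%:R * lam * r)).
have yE n : step n lam r%:E = (1 - y n) ^+ (n * 2 ^ n) by [].
have y01 n : 0 <= y n <= 1.
  by rewrite /y expR_ge0 -expR0 ler_expR oppr_le0 mulr_ge0// mulr_ge0// ltW.
have NE n : (n * 2 ^ n)%:R * y n = n%:R * expR (n%:R * (ln 2 - lam * r)).
  rewrite natrM natrX -mulrA; congr (_ * _).
  rewrite -[2%:R ^+ n](@lnK R) ?posrE ?exprn_gt0// lnXn// -expRD; congr expR.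
  by rewrite mulr_natl; ring.
have H : harmonic n @[n --> \oo] --> (0 : R) by exact: cvg_harmonic.
have [ar|ra] := ltP a r.
- pose dl := lam * r - ln 2.
  have dl0 : 0 < dl.
    by rewrite /dl subr_gt0 /lam mulrAC ltr_pdivlMr// ltr_pM2l.
  pose c := Num.min 1 (dl / 2).
  have c0 : 0 < c by rewrite lt_min ltr01 divr_gt0.
  have bern (z : R) N : 0 <= z <= 1 -> 1 - N%:R * z <= (1 - z) ^+ N.
    move=> /andP[z0 z1]; elim: N => [|N ih]; first by rewrite mul0r subr0 expr0.
    rewrite exprS (le_trans _ (ler_wpM2l _ ih)) ?subr_ge0// -natr1.
    have : 0 <= N%:R * (z * z) by rewrite !mulr_ge0.
    by nra.
  have bnd n : (n * 2 ^ n)%:R * y n <= c ^- 2 * harmonic n.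
    rewrite NE /harmonic.
    have h1 : c * n.+1%:R <= expR (n%:R * dl / 2).
      apply: le_trans (expR_ge1Dx _); rewrite -natr1 mulrDr mulr1 addrC lerD//.
        by rewrite ge_min lexx.
      by rewrite mulrC -mulrA ler_wpM2l// ge_min lexx orbT.
    have h2 : (c * n.+1%:R) ^+ 2 <= expR (n%:R * dl).
      have -> : n%:R * dl = 2%:R * (n%:R * dl / 2) by field.
      rewrite expRM_natl lerXn2r ?nnegrE ?expR_ge0//.
      by rewrite mulr_ge0// ltW.
    rewrite (_ : n%:R * (ln 2 - lam * r) = - (n%:R * dl)); last by rewrite /dl; ring.
    rewrite expRN ler_pdivrMr ?expR_gt0//.
    apply: (@le_trans _ _ (c ^- 2 * n.+1%:R^-1 * (c * n.+1%:R) ^+ 2)); last first.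
      by rewrite ler_wpM2l// mulr_ge0// invr_ge0 ?exprn_ge0// ltW.
    have -> : c ^- 2 * n.+1%:R^-1 * (c * n.+1%:R) ^+ 2 = n.+1%:R.
      have cn : c != 0 by rewrite gt_eqF.
      have nn : n.+1%:R != 0 :> R by rewrite pnatr_eq0.
      by move: nn; move: (n.+1%:R : R) => N nn; field; rewrite cn nn.
    by rewrite ler_nat.
  have Hc : 1 - c ^- 2 * harmonic n @[n --> \oo] --> (1 : R).
    rewrite -[X in _ --> X](subr0 1) -[X in _ --> _ - X](mulr0 (c ^- 2)).
    by apply: cvgB; [exact: cvg_cst|apply: cvgMr; exact: H].
  suff Hn n : 1 - c ^- 2 * harmonic n <= step n lam r%:E <= 1.
    rewrite mulr1n; apply: squeeze_cvgr Hc (cvg_cst _); exact: nearW.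
  rewrite yE; apply/andP; split.
    by rewrite (le_trans _ (bern _ _ (y01 n)))// lerB.
  have /andP[? ?] := y01 n.
  by rewrite exprn_ile1// ?subr_ge0// lerBlDr lerDl.
- suff Hn n : 0 <= step n lam r%:E <= harmonic n.
    rewrite mulr0n; apply: squeeze_cvgr (cvg_cst _) H; exact: nearW.
  rewrite yE; have /andP[yn0 yn1] := y01 n.
  rewrite exprn_ge0 ?subr_ge0//=.
  apply: (@le_trans _ _ (expR (- y n) ^+ (n * 2 ^ n))).
    rewrite lerXn2r ?nnegrE ?subr_ge0 ?expR_ge0//.
    exact: expR_ge1Dx.
  rewrite -expRM_natl mulrN NE expRN /harmonic lef_pV2 ?posrE ?expR_gt0//.
  apply: le_trans (expR_ge1Dx _); rewrite -natr1 addrC lerD//.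
  rewrite -[leLHS]mulr1 ler_wpM2l// -[leLHS]expR0 ler_expR mulr_ge0// subr_ge0.
  by rewrite /lam mulrAC ler_pdivrMr// ler_pM2l.
Unshelve. all: by end_near. Qed.

(** Expanding the N-th power gives Laplace transforms at the points t + j s. *)
Let stepE d (T : measurableType d) (m : {measure set T -> \bar R})
  d' (T' : measurableType d') (m' : {measure set T' -> \bar R})
  (X : T -> \bar R) (X' : T' -> \bar R) :
  (m setT < +oo)%E -> (m' setT < +oo)%E ->
  measurable_fun setT X -> measurable_fun setT X' ->
  (forall x, 0 <= X x)%E -> (forall x, 0 <= X' x)%E ->
  (forall t : R, (0 <= t)%R ->
    \int[m]_x (nexp (t%:E * X x))%:E = \int[m']_x (nexp (t%:E * X' x))%:E)%E ->
  forall (N : nat) (s t : R), 0 <= s -> 0 <= t ->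
  (\int[m]_x (nexp (t%:E * X x) * (1 - nexp (s%:E * X x)) ^+ N)%:E =
   \int[m']_x (nexp (t%:E * X' x) * (1 - nexp (s%:E * X' x)) ^+ N)%:E)%E.
Proof.
move=> mT m'T mX mX' X0 X'0 E; elim=> [|N ih] s t s0 t0.
  by under eq_integral do rewrite expr0 mulr1; under [RHS]eq_integral do rewrite expr0 mulr1; exact: E.
have key d1 (S : measurableType d1) (p : {measure set S -> \bar R}) (Y : S -> \bar R) :
    (p setT < +oo)%E -> measurable_fun setT Y -> (forall x, 0 <= Y x)%E ->
    (\int[p]_x (nexp (t%:E * Y x) * (1 - nexp (s%:E * Y x)) ^+ N.+1)%:E =
     \int[p]_x (nexp (t%:E * Y x) * (1 - nexp (s%:E * Y x)) ^+ N)%:E -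
     \int[p]_x (nexp ((t + s)%:E * Y x) * (1 - nexp (s%:E * Y x)) ^+ N)%:E)%E.
  move=> pT mY Y0.
  have m1 r : measurable_fun setT (fun x => nexp (r%:E * Y x)).
    apply: (measurableT_comp measurable_nexp); exact: measurable_funeM.
  have m2 : measurable_fun setT (fun x => (1 - nexp (s%:E * Y x)) ^+ N).
    by apply: measurable_funX; exact: measurable_funB.
  have b0 r x : 0 <= r -> 0 <= nexp (r%:E * Y x) <= 1.
    by move=> r0; rewrite nexp_ge0/= nexp_le1// mule_ge0// lee_fin.
  have b1 x : 0 <= (1 - nexp (s%:E * Y x)) ^+ N <= 1.
    have /andP[? ?] := b0 s x s0.
    by rewrite exprn_ge0 ?subr_ge0//= exprn_ile1 ?subr_ge0// lerBlDr lerDl.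
  have tsE x : nexp ((t + s)%:E * Y x) = nexp (t%:E * Y x) * nexp (s%:E * Y x).
    by rewrite EFinD ge0_muleDl ?lee_fin// nexpD// mule_ge0// lee_fin.
  rewrite -(@integral_subE _ _ _ _ _ _ 1)//.
  - by apply: eq_integral => x _; rewrite tsE exprSr; congr (_%:E); ring.
  - exact: measurable_funM.
  - exact: measurable_funM.
  - move=> x; rewrite tsE.
    have /andP[? ?] := b0 t x t0; have /andP[? ?] := b0 s x s0.
    have /andP[? ?] := b1 x.
    by rewrite !mulr_ge0//= ler_pM// ?mulr_ge0// ler_piMr.
  - move=> x; have /andP[? ?] := b0 t x t0; have /andP[? ?] := b1 x.
    by rewrite mulr_ile1.
by rewrite !key// !ih// addr_ge0.
Qed.

(** The functions [step] are combinations of exponentials and tend to the indicator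
    of a < x, so both laws give the same mass to the rays, which generate. *)
Lemma laplace_unique d (T : measurableType d) (m : {measure set T -> \bar R})
  d' (T' : measurableType d') (m' : {measure set T' -> \bar R})
  (X : T -> \bar R) (X' : T' -> \bar R) :
  (m setT < +oo)%E -> (m' setT < +oo)%E ->
  measurable_fun setT X -> measurable_fun setT X' ->
  (forall x, 0 <= X x)%E -> (forall x, 0 <= X' x)%E ->
  (forall t : R, (0 <= t)%R ->
    \int[m]_x (nexp (t%:E * X x))%:E = \int[m']_x (nexp (t%:E * X' x))%:E)%E ->
  forall A, measurable A -> m (X @^-1` A) = m' (X' @^-1` A).
Proof.
move=> mT m'T mX mX' X0 X'0 E.
have mpre d1 (S : measurableType d1) (Y : S -> \bar R) A :
    measurable_fun setT Y -> measurable A -> measurable (Y @^-1` A).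
  by move=> mY mA; rewrite -[X in measurable X]setTI; exact: mY.
have mray (a : \bar R) : measurable ([set y : \bar R | a < y]%E).
  by rewrite -set_itvoy; exact: emeasurable_itv.
have lim_ray d1 (S : measurableType d1) (p : {measure set S -> \bar R}) (Y : S -> \bar R) a :
    (p setT < +oo)%E -> measurable_fun setT Y -> (forall x, 0 <= Y x)%E -> 0 < a ->
    (\int[p]_x (step n (ln 2 / a) (Y x))%:E @[n --> \oo] -->
      p [set x | a%:E < Y x])%E.
  move=> pT mY Y0 a0.
  have mYa : measurable [set x | a%:E < Y x]%E by exact: (mpre _ _ _ _ mY (mray a%:E)).
  have -> : (p [set x | a%:E < Y x] = \int[p]_x ((a%:E < Y x)%E%:R)%:E)%E.
    set A := [set x | _]; transitivity (\int[p]_x (\1_A x)%:E)%E.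
      by rewrite integral_indic// setIT.
    by apply: eq_integral => x _; rewrite indicE mem_setE.
  have l0 : 0 <= ln 2 / a :> R by rewrite divr_ge0 ?ln_ge0 ?ltW// ltr1n.
  apply: (@bounded_convergence _ _ _ _ _ _ 1) => //.
  - move=> n; apply: measurable_funX; apply: measurable_funB => //.
    by apply: (measurableT_comp measurable_nexp); exact: measurable_funeM.
  - move=> n x; rewrite /step.
    have Y1 : (0 <= (n%:R * (ln 2 / a))%:E * Y x)%E by rewrite mule_ge0// lee_fin mulr_ge0.
    rewrite ger0_norm; first by rewrite exprn_ile1// ?subr_ge0 ?nexp_le1// lerBlDr lerDl nexp_ge0.
    by rewrite exprn_ge0// subr_ge0 nexp_le1.
  - by move=> x; exact: step_cvg.
have ray_pos a : 0 < a -> (m [set x | a%:E < X x] = m' [set x | a%:E < X' x])%E.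
  move=> a0; have l0 : 0 <= ln 2 / a :> R by rewrite divr_ge0 ?ln_ge0 ?ltW// ltr1n.
  apply: cvge_eq (lim_ray _ _ m _ _ mT mX X0 a0) (lim_ray _ _ m' _ _ m'T mX' X'0 a0).
  move=> n.
  have := @stepE _ _ _ _ _ _ _ _ mT m'T mX mX' X0 X'0 E (n * 2 ^ n) (n%:R * (ln 2 / a)) 0.
  have st0 d1 (S : measurableType d1) (p : {measure set S -> \bar R}) (Y : S -> \bar R) :
    (\int[p]_x (nexp (0%:E * Y x) *
        (1 - nexp ((n%:R * (ln 2 / a))%:E * Y x)) ^+ (n * 2 ^ n))%:E =
     \int[p]_x (step n (ln 2 / a) (Y x))%:E)%E.
    by apply: eq_integral => x _; rewrite mul0e nexp0 mul1r.
  by rewrite !st0; apply => //; rewrite mulr_ge0.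
have rayT : m setT = m' setT.
  have := E 0 (lexx _).
  under eq_integral do rewrite mul0e nexp0.
  under [in X in _ = X -> _]eq_integral do rewrite mul0e nexp0.
  by rewrite !integral_cst// !mul1e.
(* the ray at 0 is an increasing union of rays at 1/(n+1) *)
have ray a : (m [set x | a%:E < X x] = m' [set x | a%:E < X' x])%E.
  have [a0|a0] := ltP 0 a; first exact: ray_pos.
  have [->|an0] := eqVneq a 0; last first.
    have al : a < 0 by rewrite lt_neqAle an0.
    rewrite (_ : [set x | _] = setT); last first.
      by apply/seteqP; split => // x _ /=; rewrite (lt_le_trans _ (X0 x))// lte_fin.
    rewrite [RHS](_ : _ = m' setT)//; congr (m' _).
    by apply/seteqP; split => // x _ /=; rewrite (lt_le_trans _ (X'0 x))// lte_fin.
  have cup (y : \bar R) : (0 < y)%E <-> exists n : nat, ((n.+1%:R^-1 : R)%:E < y)%E.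
    split => [|[n]]; last by apply: lt_trans; rewrite lte_fin.
    case: y => [r| |]//; last by move=> _; exists 0%N; rewrite ltry.
    by rewrite lte_fin => /ltr_add_invr[n]; rewrite add0r => ?; exists n; rewrite lte_fin.
  have lim d1 (S : measurableType d1) (p : {measure set S -> \bar R}) (Y : S -> \bar R) :
    measurable_fun setT Y ->
    (p [set x | (n.+1%:R^-1 : R)%:E < Y x] @[n --> \oo] --> p [set x | 0%:E < Y x])%E.
    move=> mY; rewrite (_ : [set x | 0%:E < Y x]%E =
      \bigcup_n [set x | (n.+1%:R^-1 : R)%:E < Y x]%E).
      apply: nondecreasing_cvg_mu.
      - by move=> n; exact: (mpre _ _ _ _ mY (mray _)).
      - by apply: bigcupT_measurable => n; exact: (mpre _ _ _ _ mY (mray _)).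
      - move=> i j ij; apply/subsetPset => x /=; apply: le_lt_trans.
        by rewrite lee_fin lef_pV2 ?posrE// ler_nat.
    apply/seteqP; split => x /=; first by move/cup => [n ?]; exists n.
    by move=> [n _ /= ?]; apply/cup; exists n.
  apply: cvge_eq (lim _ _ m _ mX) (lim _ _ m' _ mX').
  by move=> n; apply: ray_pos; rewrite invr_gt0.
move=> A mA.
pose G := [set A : set \bar R | A = setT \/ exists r : R, A = [set y | r%:E < y]%E].
apply: (@measure_unique _ _ _ G (fun=> setT) _ _ _ _
  (pushforward m X) (pushforward m' X')) => //.
- rewrite -[LHS]/(emeasurable (@ocitv R)) ErealGenOInfty.measurableE.
  apply/seteqP; split.
    apply: sub_sigma_algebra2 => _ [r ->]; right; exists r.
    by rewrite set_itvoy.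
  apply: smallest_sub; first exact: smallest_sigma_algebra.
  move=> _ [->|[r ->]]; first exact: (@measurableT _ (g_sigma_algebraType (@ErealGenOInfty.G R))).
  by apply: sub_sigma_algebra; exists r; rewrite set_itvoy.
- move=> B C [->|[r ->]] [->|[s ->]]; rewrite ?setTI ?setIT; [by left|by right; exists s|by right; exists r|].
  right; exists (Num.max r s); apply/seteqP; split => y /=.
    by move=> [? ?]; rewrite EFin_max gt_max; apply/andP.
  by rewrite EFin_max gt_max => /andP[].
- by move=> _; left.
- by rewrite bigcup_const.
- by move=> B [->|[r ->]]; [exact: rayT|exact: ray].
Qed.


Lemma measurable_pre d (T : measurableType d) d' (S : measurableType d')
    (X : T -> S) (A : set S) :
  measurable_fun setT X -> measurable A -> measurable (X @^-1` A).
Proof. by move=> mX mA; rewrite -[X in measurable X]setTI; exact: mX. Qed.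

(** Events of X are replaced by functions of X while the other factors of a product
    are kept as a weight w; [indep_functions] does this for each factor in turn. *)
Lemma weight_transfer d (T : measurableType d) d' (S : measurableType d')
    (P : {measure set T -> \bar R}) (X : T -> S) (w : T -> R) (c : R) (g : S -> \bar R) :
  measurable_fun setT X -> measurable_fun setT w -> (forall x, 0 <= w x) -> 0 <= c ->
  (forall A, measurable A ->
     \int[P]_x (\1_A (X x) * w x)%:E = c%:E * P (X @^-1` A))%E ->
  measurable_fun setT g -> (forall y, 0 <= g y)%E ->
  (\int[P]_x (g (X x) * (w x)%:E) = c%:E * \int[P]_x g (X x))%E.
Proof.
move=> mX mw w0 c0 H mg g0.
have [m1 [m1E i1]] := density_measure P mw w0.
have [m2 [m2E i2]] := density_measure P (rho := fun=> c) (measurable_cst _) (fun=> c0).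
have mgX : measurable_fun setT (fun x => g (X x)) by exact: measurableT_comp.
have mpre A : measurable A -> measurable (X @^-1` A) by move=> mA; exact: measurable_pre.
rewrite -i1//.
have -> : (\int[m1]_x g (X x) = \int[m2]_x g (X x))%E.
  apply: eq_law_integral => // A mA; rewrite m1E ?m2E; [|exact: mpre|exact: mpre].
  rewrite (@integral_cst _ _ _ P _ (mpre _ mA) c%:E) -H// integral_setE.
  by apply: eq_integral => x _; rewrite -EFinM mulrC.
rewrite i2//; under eq_integral do rewrite muleC.
by rewrite ge0_integralZl.
Qed.

Lemma prod_fin_num (I : Type) (s : seq I) (x : I -> \bar R) :
  (forall i, 0 <= x i)%E -> (forall i, x i \is a fin_num) ->
  exists2 c : R, 0 <= c & \big[*%E/1%E]_(i <- s) x i = c%:E.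
Proof.
move=> x0 xf; elim: s => [|i s [c c0 ih]]; first by exists 1; rewrite ?big_nil.
exists (fine (x i) * c); first by rewrite mulr_ge0// fine_ge0.
by rewrite big_cons ih EFinM fineK.
Qed.

Lemma integral_bnd d (T : measurableType d) (P : probability T R) (h : T -> R) (C : R) :
  measurable_fun setT h -> (forall x, 0 <= h x <= C) ->
  (0 <= \int[P]_x (h x)%:E <= C%:E)%E.
Proof.
move=> mh hC; apply/andP; split.
  by apply: integral_ge0 => x _; rewrite lee_fin; have /andP[] := hC x.
have -> : C%:E = (\int[P]_x C%:E)%E.
  by rewrite integral_cst//= [X in (_ * X)%E](@probability_setT _ _ _ P) mule1.
apply: ge0_le_integral => //.
- by move=> x _; rewrite lee_fin; have /andP[] := hC x.
- exact/measurable_EFinP.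
- by move=> x _; rewrite lee_fin; have /andP[] := hC x.
Qed.

Lemma integral_bnd_fin d (T : measurableType d) (P : probability T R) (h : T -> R) (C : R) :
  measurable_fun setT h -> (forall x, 0 <= h x <= C) ->
  (\int[P]_x (h x)%:E \is a fin_num)%E.
Proof.
move=> mh hC; have /andP[? ?] := integral_bnd P mh hC.
by rewrite ge0_fin_numE// (le_lt_trans _ (ltry C)).
Qed.

Lemma expectation_gt0 d (T : measurableType d) (P : probability T R) (h : T -> R) (C : R) :
  measurable_fun setT h -> (forall x, 0 <= h x <= C) -> {ae P, forall x, 0 < h x} ->
  exists2 c : R, 0 < c & (\int[P]_x (h x)%:E = c%:E)%E.
Proof.
move=> mh hC hpos; have h0 x : 0 <= h x by have /andP[] := hC x.
exists (fine (\int[P]_x (h x)%:E)%E); last by rewrite fineK//; exact: (integral_bnd_fin P mh hC).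
rewrite lt_neqAle fine_ge0 ?integral_ge0// ?andbT => [|x _]; last by rewrite lee_fin.
apply/eqP => e; have ie : (\int[P]_x (h x)%:E = 0)%E.
  by rewrite -(fineK (integral_bnd_fin P mh hC)) -e.
have ae0 : ae_eq P setT (fun x => (h x)%:E) (cst 0%E).
  apply/ae_eq_integral_abs => //; first exact/measurable_EFinP.
  by under eq_integral do rewrite /= ger0_norm//.
have [A [mA PA sub]] : {ae P, forall x : T, False}.
  by apply: filterS2 ae0 hpos => x /(_ I) /= [->]; rewrite ltxx.
have : P setT = 0%E by apply: (subset_measure0 _ mA _ PA) => // x _; exact: sub.
by rewrite probability_setT => /eqP; rewrite onee_eq0.
Qed.

Lemma prod01 (I : Type) (s : seq I) (h : I -> R) :
  (forall i, 0 <= h i <= 1) -> 0 <= \prod_(i <- s) h i <= 1.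
Proof.
move=> h01; elim: s => [|i s /andP[? ?]]; first by rewrite big_nil ler01 lexx.
by rewrite big_cons; have /andP[? ?] := h01 i; rewrite mulr_ge0//= mulr_ile1.
Qed.

Lemma measurable_prodr (I : Type) d (T : measurableType d) (s : seq I) (h : I -> T -> R) :
  (forall i, measurable_fun setT (h i)) ->
  measurable_fun setT (fun x => \prod_(i <- s) h i x).
Proof.
move=> mh; elim: s => [|i s ih].
  by under eq_fun do rewrite big_nil; exact: measurable_cst.
by under eq_fun do rewrite big_cons; exact: measurable_funM.
Qed.

Lemma measurable_indicT d (T : measurableType d) d' (S : measurableType d')
    (X : T -> S) (A : set S) :
  measurable_fun setT X -> measurable A -> measurable_fun setT (fun x => \1_A (X x) : R).
Proof.
by move=> mX mA; apply: (measurableT_comp (measurable_indic _)).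
Qed.

Lemma indic01 (T : Type) (A : set T) x : 0 <= (\1_A x : R) <= 1.
Proof. by rewrite indicE; case: (_ \in _); rewrite ?lexx ?ler01. Qed.

Lemma integral_indicT d (T : measurableType d) d' (S : measurableType d')
    (P : {measure set T -> \bar R}) (X : T -> S) (A : set S) :
  measurable_fun setT X -> measurable A ->
  (\int[P]_x (\1_A (X x))%:E = P (X @^-1` A))%E.
Proof.
move=> mX mA; rewrite -[X in P X]setIT -integral_indic//.
exact: measurable_pre.
Qed.

(** One factor at a time, uniqueness of Laplace transforms replaces the exponentials
    by indicators: the other factors only weight the two measures compared. *)
Lemma indep_of_laplace d (T : measurableType d) (P : probability T R) (I : eqType)
    (s : seq I) (X : I -> T -> \bar R) :
  uniq s -> (forall i, measurable_fun setT (X i)) -> (forall i x, 0 <= X i x)%E ->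
  (forall t : I -> R, (forall i, 0 <= t i)%R ->
     \int[P]_x (\prod_(i <- s) nexp ((t i)%:E * X i x))%:E =
     \big[*%E/1%E]_(i <- s) \int[P]_x (nexp ((t i)%:E * X i x))%:E)%E ->
  forall A : I -> set (\bar R), (forall i, measurable (A i)) ->
  (\int[P]_x (\prod_(i <- s) \1_(A i) (X i x))%:E =
   \big[*%E/1%E]_(i <- s) P (X i @^-1` A i))%E.
Proof.
move=> us mX X0 H A mA.
have mN i (t : R) : measurable_fun setT (fun x => nexp (t%:E * X i x)).
  by apply: (measurableT_comp measurable_nexp); exact: measurable_funeM.
have N01 i (t : R) x : 0 <= t -> 0 <= nexp (t%:E * X i x) <= 1.
  by move=> t0; rewrite nexp_ge0 nexp_le1// mule_ge0// lee_fin.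
suff K s1 s2 : s = s1 ++ s2 -> forall t : I -> R, (forall i, 0 <= t i) ->
    (\int[P]_x (\prod_(i <- s1) \1_(A i) (X i x) *
                \prod_(i <- s2) nexp ((t i)%:E * X i x))%:E =
     \big[*%E/1%E]_(i <- s1) P (X i @^-1` A i) *
     \big[*%E/1%E]_(i <- s2) \int[P]_x (nexp ((t i)%:E * X i x))%:E)%E.
  have := K s [::]; rewrite cats0 => /(_ erefl (fun=> 0) (fun=> lexx _)).
  rewrite big_nil mule1 => <-.
  by apply: eq_integral => x _; rewrite big_nil mulr1.
elim/last_ind: s1 s2 => [|s1 i ih] s2 ss t t0.
  rewrite /= in ss; rewrite -ss big_nil mul1e -H//.
  by apply: eq_integral => x _; rewrite big_nil mul1r.
have {}ih := ih (i :: s2) _.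
rewrite cat_rcons in ss; have {}ih := ih ss.
have is2 : i \notin s2 by move: us; rewrite ss cat_uniq/= => /and3P[_ _ /andP[]].
pose w x := \prod_(i <- s1) \1_(A i) (X i x) * \prod_(i <- s2) nexp ((t i)%:E * X i x) : R.
have mw : measurable_fun setT w.
  by apply: measurable_funM; apply: measurable_prodr => j //; exact: measurable_indicT.
have w01 x : 0 <= w x <= 1.
  have /andP[? ?] := prod01 s1 (fun i => indic01 (A i) (X i x)).
  have /andP[? ?] := prod01 s2 (fun i => N01 i (t i) x (t0 i)).
  by rewrite mulr_ge0//= mulr_ile1.
have w0 x : 0 <= w x by have /andP[] := w01 x.
have [c1 c10 c1E] := @prod_fin_num _ s1 (fun i => P (X i @^-1` A i))
  (fun i => measure_ge0 _ _) (fun i => fin_num_measure _ _ (measurable_pre (mX i) (mA i))).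
have [c2 c20 c2E] := @prod_fin_num _ s2 (fun i => \int[P]_x (nexp ((t i)%:E * X i x))%:E)%E
  (fun i => proj1 (andP (integral_bnd P (mN i (t i)) (fun x => N01 i (t i) x (t0 i)))))
  (fun i => integral_bnd_fin P (mN i (t i)) (fun x => N01 i (t i) x (t0 i))).
have [m1 [m1E i1]] := density_measure P mw w0.
have c0 : 0 <= c1 * c2 by exact: mulr_ge0.
have [m2 [m2E i2]] := density_measure P (rho := fun=> c1 * c2) (measurable_cst _) (fun=> c0).
have m12 : m1 (X i @^-1` A i) = m2 (X i @^-1` A i).
  apply: laplace_unique => //.
  - rewrite m1E//; have /andP[_ /le_lt_trans] := integral_bnd P mw w01.
    by apply; rewrite ltry.
  - rewrite m2E// (@integral_cst _ _ _ P _ measurableT (c1 * c2)%:E).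
    by rewrite [X in (_ * X)%E](@probability_setT _ _ _ P) mule1 ltry.
  - move=> u u0; rewrite i1 ?i2//; last 4 first.
    + exact/measurable_EFinP.
    + by move=> x; rewrite lee_fin nexp_ge0.
    + exact/measurable_EFinP.
    + by move=> x; rewrite lee_fin nexp_ge0.
    pose t' j := if j == i then u else t j.
    have t'0 j : 0 <= t' j by rewrite /t'; case: ifP.
    have t'E j : j \in s2 -> t' j = t j.
      by rewrite /t'; case: eqP => // ->; rewrite (negbTE is2).
    have e : (\int[P]_x (nexp (u%:E * X i x) * w x)%:E =
              c1%:E * (\int[P]_x (nexp (u%:E * X i x))%:E * c2%:E))%E.
      transitivity (\int[P]_x (\prod_(i <- s1) \1_(A i) (X i x) *
         \prod_(i <- i :: s2) nexp ((t' i)%:E * X i x))%:E)%E.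
        apply: eq_integral => x _; rewrite big_cons {1}/t' eqxx /w.
        rewrite (_ : \prod_(j <- s2) nexp ((t' j)%:E * X j x) =
          \prod_(j <- s2) nexp ((t j)%:E * X j x)); first by congr (_%:E); ring.
        by apply: eq_big_seq => j js2; rewrite t'E.
      rewrite ih// c1E big_cons {1}/t' eqxx; congr (_ * (_ * _))%E.
      by rewrite -c2E; apply: eq_big_seq => j js2; rewrite t'E.
    transitivity (\int[P]_x (nexp (u%:E * X i x) * w x)%:E)%E.
      by apply: eq_integral => x _; rewrite EFinM.
    rewrite e muleCA -EFinM -ge0_integralZr//.
    + exact/measurable_EFinP.
    + by move=> x _; rewrite lee_fin nexp_ge0.
rewrite big_rcons/= c1E c2E muleAC -EFinM.
rewrite -(@integral_cst _ _ _ P) -?m2E -?m12; [|exact: measurable_pre..].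
rewrite m1E; last exact: measurable_pre.
rewrite integral_setE.
apply: eq_integral => x _; rewrite -EFinM; congr (_%:E).
by rewrite big_rcons/= /w; ring.
Qed.

(** Again one factor at a time, now from indicators to functions. *)
Lemma indep_functions d (T : measurableType d) (P : probability T R) (I : eqType)
    (s : seq I) d' (S : measurableType d') (X : I -> T -> S)
    d'' (V : measurableType d'') (Y : T -> V) :
  uniq s -> (forall i, measurable_fun setT (X i)) -> measurable_fun setT Y ->
  (forall (A : I -> set S) (E : set V), (forall i, measurable (A i)) -> measurable E ->
     \int[P]_x (\prod_(i <- s) \1_(A i) (X i x) * \1_E (Y x))%:E =
     \big[*%E/1%E]_(i <- s) P (X i @^-1` A i) * P (Y @^-1` E))%E ->
  forall (g : I -> S -> R) (G : V -> R) (C : R),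
  (forall i, measurable_fun setT (g i)) -> measurable_fun setT G ->
  (forall i y, 0 <= g i y <= C) -> (forall y, 0 <= G y <= C) ->
  (\int[P]_x (\prod_(i <- s) g i (X i x) * G (Y x))%:E =
   \big[*%E/1%E]_(i <- s) \int[P]_x (g i (X i x))%:E * \int[P]_x (G (Y x))%:E)%E.
Proof.
move=> us mX mY H g G C mg mG gC GC.
have C0 : 0 <= C by have /andP[h1 h2] := GC point; exact: le_trans h2.
have g0 i y : 0 <= g i y by have /andP[] := gC i y.
have G0 y : 0 <= G y by have /andP[] := GC y.
have mgX i : measurable_fun setT (fun x => g i (X i x)) by exact: measurableT_comp.
have ig0 i : (0 <= \int[P]_x (g i (X i x))%:E)%E.
  by have /andP[] := integral_bnd P (mgX i) (fun x => gC i (X i x)).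
have igf i : (\int[P]_x (g i (X i x))%:E \is a fin_num)%E.
  exact: (integral_bnd_fin P (mgX i) (fun x => gC i (X i x))).
have ind0 (U : Type) (B : set U) y : 0 <= \1_B y :> R by have /andP[] := indic01 B y.
have mI (A : I -> set S) (mA : forall i, measurable (A i)) i :
    measurable_fun setT (fun x => \1_(A i) (X i x) : R) by exact: measurable_indicT.
suff K s1 s2 : s = s1 ++ s2 -> forall (A : I -> set S) (E : set V),
    (forall i, measurable (A i)) -> measurable E ->
    (\int[P]_x (\prod_(i <- s1) g i (X i x) * \prod_(i <- s2) \1_(A i) (X i x) *
       \1_E (Y x))%:E =
     \big[*%E/1%E]_(i <- s1) \int[P]_x (g i (X i x))%:E *
     \big[*%E/1%E]_(i <- s2) P (X i @^-1` A i) * P (Y @^-1` E))%E.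
  have [c c0 cE] := prod_fin_num s ig0 igf.
  rewrite cE.
  have := @weight_transfer _ _ _ _ P Y (fun x => \prod_(i <- s) g i (X i x)) c (EFin \o G).
  move=> <- //.
  - by apply: eq_integral => x _; rewrite -EFinM mulrC.
  - exact: measurable_prodr.
  - by move=> x; apply: prodr_ge0.
  - move=> B mB; have := K s [::]; rewrite cats0 => /(_ erefl (fun=> setT) B (fun=> measurableT) mB).
    rewrite big_nil mule1 cE => <-.
    by apply: eq_integral => x _; rewrite big_nil mulr1 mulrC.
  - exact/measurable_EFinP.
elim/last_ind: s1 s2 => [|s1 i ih] s2 ss A E mA mE.
  rewrite /= in ss; rewrite -ss big_nil mul1e -H//.
  by apply: eq_integral => x _; rewrite big_nil mul1r.
rewrite cat_rcons in ss; have {}ih := ih _ ss.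
have is2 : i \notin s2 by move: us; rewrite ss cat_uniq/= => /and3P[_ _ /andP[]].
pose w x := \prod_(i <- s1) g i (X i x) * \prod_(i <- s2) \1_(A i) (X i x) * \1_E (Y x).
have mw : measurable_fun setT w.
  apply: measurable_funM; last exact: measurable_indicT.
  by apply: measurable_funM; apply: measurable_prodr => j //; exact: measurable_indicT.
have w0 x : 0 <= w x by rewrite !mulr_ge0// prodr_ge0.
have [c1 c10 c1E] := prod_fin_num s1 ig0 igf.
have [c2 c20 c2E] := @prod_fin_num _ s2 (fun i => P (X i @^-1` A i))
  (fun i => measure_ge0 _ _) (fun i => fin_num_measure _ _ (measurable_pre (mX i) (mA i))).
have mYE := measurable_pre mY mE.
have c3E : P (Y @^-1` E) = (fine (P (Y @^-1` E)))%:E by rewrite fineK// fin_num_measure.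
have c30 : 0 <= fine (P (Y @^-1` E)) by apply: fine_ge0.
rewrite !big_rcons/= c1E c2E c3E -muleA -EFinM muleAC -EFinM mulrA.
transitivity (\int[P]_x ((EFin \o g i) (X i x) * (w x)%:E))%E.
  by apply: eq_integral => x _; rewrite -EFinM big_rcons/= /w; congr (_%:E); ring.
apply: (weight_transfer (mX i) mw w0) => //.
- by rewrite !mulr_ge0.
- move=> B mB; pose A' j := if j == i then B else A j.
  have mA' j : measurable (A' j) by rewrite /A'; case: ifP.
  have A'E j : j \in s2 -> A' j = A j.
    by rewrite /A'; case: eqP => // ->; rewrite (negbTE is2).
  transitivity (\int[P]_x (\prod_(i <- s1) g i (X i x) *
     \prod_(i <- i :: s2) \1_(A' i) (X i x) * \1_E (Y x))%:E)%E.
    apply: eq_integral => x _; rewrite big_cons {1}/A' eqxx /w.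
    rewrite (_ : \prod_(j <- s2) \1_(A' j) (X j x) =
       \prod_(j <- s2) \1_(A j) (X j x)); first by congr (_%:E); ring.
    by apply: eq_big_seq => j js2; rewrite A'E.
  rewrite ih// c1E c3E big_cons {1}/A' eqxx.
  rewrite (_ : \big[*%E/1%E]_(j <- s2) P (X j @^-1` A' j) = c2%:E); last first.
    by rewrite -c2E; apply: eq_big_seq => j js2; rewrite A'E.
  by rewrite /= muleCA -muleA -!EFinM muleC.
- exact/measurable_EFinP.
- by move=> y; rewrite lee_fin.
Qed.

End laplace.

Notation ray s := (`]-oo, s]%classic).

(** * Paths and their Lebesgue-Stieltjes measures *)

Section path_measure.
Context {R : realType}.
Implicit Types (X Y : iap_path R).

(** [lebesgue_measure] is defined on [measurableTypeR R]; it is read here on R itself,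
    the type of the times of a path. *)
Definition leb (A : set R) : \bar R := lebesgue_measure (A : set (measurableTypeR R)).

Let leb0 : leb set0 = 0%E. Proof. exact: measure0. Qed.
Let leb_ge0 A : (0 <= leb A)%E. Proof. exact: measure_ge0. Qed.
Let leb_sigma : semi_sigma_additive leb.
Proof. exact: (@measure_semi_sigma_additive _ _ _ (@lebesgue_measure R)). Qed.
HB.instance Definition _ := isMeasure.Build _ _ _ leb leb0 leb_ge0 leb_sigma.
Let leb_sigma_finite : sigma_finite setT leb.
Proof. exact: (sigma_finiteT (@lebesgue_measure R)). Qed.
HB.instance Definition _ := @Measure_isSigmaFinite.Build _ _ _ leb leb_sigma_finite.

Definition LS X (A : set R) : \bar R :=
  lebesgue_stieltjes_measure X (A : set (measurableTypeR R)).

Let LS0 X : LS X set0 = 0%E. Proof. exact: measure0. Qed.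
Let LS_ge0 X A : (0 <= LS X A)%E. Proof. exact: measure_ge0. Qed.
Let LS_sigma X : semi_sigma_additive (LS X).
Proof. exact: (@measure_semi_sigma_additive _ _ _ (lebesgue_stieltjes_measure X)). Qed.
HB.instance Definition _ X := isMeasure.Build _ _ _ (LS X) (LS0 X) (LS_ge0 X) (@LS_sigma X).

Lemma integral_leb (D : set R) (f : R -> \bar R) :
  measurable D -> measurable_fun D f -> (forall x, D x -> 0 <= f x)%E ->
  (\int[@lebesgue_measure R]_(x in D) f x = \int[leb]_(x in D) f x)%E.
Proof.
move=> mD mf f0.
have mid : measurable_fun [set: measurableTypeR R] (fun x : measurableTypeR R => x : R).
  by move=> _ A mA; rewrite setTI.
transitivity (\int[pushforward (@lebesgue_measure R) (fun x : measurableTypeR R => x : R)]_(x in D) f x)%E.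
  by rewrite ge0_integral_pushforward// => y; rewrite inE; exact: f0.
exact: eq_measure_integral.
Qed.

Lemma integral_LS X (f : R -> \bar R) :
  measurable_fun setT f -> (forall x, 0 <= f x)%E ->
  (\int[lebesgue_stieltjes_measure X]_x f x = \int[LS X]_x f x)%E.
Proof.
move=> mf f0.
have mid : measurable_fun [set: measurableTypeR R] (fun x : measurableTypeR R => x : R).
  by move=> _ A mA; rewrite setTI.
transitivity (\int[pushforward (lebesgue_stieltjes_measure X) (fun x : measurableTypeR R => x : R)]_x f x)%E.
  by rewrite ge0_integral_pushforward.
exact: eq_measure_integral.
Qed.

Lemma path_nd X : {homo X : x y / x <= y}.
Proof. exact: cumulative_is_nondecreasing. Qed.

Lemma path_ge0 X s : 0 <= X s.
Proof.
have X0 := path_cvgNy X.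
rewrite -(cvg_lim (@Rhausdorff R) X0); apply: limr_le; first by apply/cvg_ex; exists 0.
by near=> y; apply: path_nd; near: y; apply: nbhs_ninfty_le; exact: num_real.
Unshelve. all: by end_near. Qed.

Lemma path_ext X Y : X =1 Y -> X = Y.
Proof.
move: X Y => [[X cX] hX] [[Y cY] hY] /= /funext XY.
move: cX hX; rewrite XY => cX hX.
have cXY : cX = cY.
  case: cX {hX} => -[n1 r1]; case: cY {hY} => -[n2 r2].
  by rewrite (Prop_irrelevance n1 n2) (Prop_irrelevance r1 r2).
by move: hX; rewrite cXY => hX; congr IapPath; exact: Prop_irrelevance.
Qed.

Lemma LS_oc X a b : a <= b -> LS X `]a, b]%classic = (X b - X a)%:E.
Proof.
move=> ab; rewrite /LS /lebesgue_stieltjes_measure /measure_extension/= measurable_mu_extE//=; last exact: is_ocitv.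
by rewrite wlength_itv_bnd.
Qed.

Lemma LS_ray X s : LS X (ray s) = (X s)%:E.
Proof.
have ndF : nondecreasing_seq (fun n : nat => `]s - n%:R, s]%classic : set R).
  move=> m n mn; apply/subsetPset => x /=; rewrite !in_itv/= => /andP[+ ->].
  by rewrite andbT; apply: le_lt_trans; rewrite lerB// ler_nat.
have cup : \bigcup_n `]s - n%:R, s]%classic = `]-oo, s]%classic :> set R.
  apply/seteqP; split => [x [n _]|x] /=; rewrite !in_itv/=; first by case/andP.
  move=> xs; exists (Num.bound (s - x)) => //=; rewrite in_itv/= xs andbT.
  by rewrite ltrBlDr -ltrBlDl archi_boundP// subr_ge0.
have := @nondecreasing_cvg_mu _ _ _ (LS X) (fun n : nat => `]s - n%:R, s]%classic : set R).
rewrite cup => /(_ (fun _ => measurable_itv _) (measurable_itv _) ndF) h.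
apply: (cvge_eq _ h (v := fun n => (X s - X (s - n%:R))%:E)) => [n|].
  by rewrite /= LS_oc// gerBl.
apply: cvg_EFin; first exact: nearW.
rewrite -[X in _ --> X]subr0; apply: cvgB; first exact: cvg_cst.
apply: (cvg_comp (fun n : nat => s - n%:R) X _ (path_cvgNy X)).
apply/cvgrNyPle => A; near=> n; rewrite lerBlDr -lerBlDl; near: n.
exact: nbhs_infty_ger.
Unshelve. all: by end_near. Qed.

Lemma ray_generates : measurable = <<s [set A : set R | exists s, A = `]-oo, s]%classic] >>.
Proof.
apply/seteqP; split.
  apply: smallest_sub; first exact: smallest_sigma_algebra.
  move=> _ /= [[a b] _ <-] /=.
  have [ab|ba] := leP a b; last first.
    rewrite set_itv_ge; last by rewrite -leNgt bnd_simp ltW.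
    exact: (@measurable0 _ (g_sigma_algebraType _)).
  rewrite (_ : `]a, b]%classic = `]-oo, b]%classic `\` `]-oo, a]%classic).
    apply: (@measurableD _ (g_sigma_algebraType _)); apply: sub_sigma_algebra.
    - by exists b.
    - by exists a.
  apply/seteqP; split => x /=; rewrite !in_itv/=.
    by move=> /andP[? ->]; split => //; apply/negP; rewrite -ltNge.
  by move=> [-> /negP]; rewrite -ltNge => ->.
apply: smallest_sub; first exact: sigma_algebra_measurable.
by move=> _ [s ->]; exact: measurable_itv.
Qed.

(** Rays form a pi-system generating the Borel sets, and exhaust the line. *)
Lemma ray_unique (m1 m2 : {measure set R -> \bar R}) :
  (forall s, m1 (ray s) < +oo)%E -> (forall s, m1 (ray s) = m2 (ray s)) ->
  forall A, measurable A -> m1 A = m2 A.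
Proof.
move=> f1 e A mA.
have cap (B C : set R) : (exists s, B = ray s) -> (exists s, C = ray s) -> exists s, B `&` C = ray s.
  move=> [a ->] [b ->]; exists (Num.min a b).
  by apply/seteqP; split => x /=; rewrite !in_itv/= le_min => /andP.
have cup : \bigcup_(n : nat) `]-oo, n%:R]%classic = setT :> set R.
  apply/seteqP; split => // x _; exists (Num.bound `|x|) => //=.
  by rewrite in_itv/= (le_trans (ler_norm x))// ltW// archi_boundP.
have Gg : forall i : nat, exists s : R, `]-oo, (i%:R : R)]%classic = ray s by move=> n; exists n%:R.
have key := (@measure_unique _ _ _ _ (fun n : nat => `]-oo, (n%:R : R)]%classic)
  ray_generates cap Gg cup m1 m2).
apply: key.
- by move=> _ [s ->].
- by [].
- by [].
Qed.

Lemma LS_unique X (m : {measure set R -> \bar R}) :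
  (forall s, m (ray s) = (X s)%:E) -> forall A, measurable A -> LS X A = m A.
Proof.
by move=> h; apply: ray_unique => s /=; rewrite LS_ray ?ltry// h.
Qed.

Lemma jumpE X s : LS X [set s] = (jump X s)%:E.
Proof.
have cupE : \bigcap_(n : nat) `]s - n.+1%:R^-1, s]%classic = [set s].
  apply/seteqP; split => [x h|x /= -> n _]; last first.
    by rewrite /= in_itv/= lexx andbT ltrBlDr ltrDl invr_gt0.
  apply/eqP; rewrite eq_le; apply/andP; split.
    by have := h 0%N I; rewrite /= in_itv/= => /andP[].
  rewrite leNgt; apply/negP => /ltr_add_invr[n xn].
  have := h n I; rewrite /= in_itv/= => /andP[+ _].
  by rewrite ltrBlDr ltNge (ltW xn).
have niF : nonincreasing_seq (fun n : nat => `]s - n.+1%:R^-1, s]%classic : set R).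
  move=> m n mn; apply/subsetPset => x /=; rewrite !in_itv/= => /andP[+ ->].
  by rewrite andbT; apply: le_lt_trans; rewrite lerB// lef_pV2 ?posrE// ler_nat.
have := @nonincreasing_cvg_mu _ _ _ (LS X) (fun n : nat => `]s - n.+1%:R^-1, s]%classic : set R).
have fin0 : (LS X `](s - 1^-1)%R, s]%classic < +oo)%E by rewrite LS_oc ?ltry// gerBl invr_ge0.
rewrite cupE => /(_ fin0 (fun _ => measurable_itv _) (measurable_set1 _) niF) h.
have cvl : cvg (X y @[y --> s^'-]).
  apply: nondecreasing_at_left_is_cvgr.
    by near=> y => a b _ _; exact: path_nd.
  by near=> y; exists (X s) => _ [z + <-]; rewrite /= in_itv/= => /andP[_ /ltW]; exact: path_nd.
apply: (cvge_eq _ h (v := fun n => (X s - X (s - n.+1%:R^-1))%:E)) => [n|].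
  by rewrite /= LS_oc// gerBl invr_ge0.
apply: cvg_EFin; first exact: nearW.
apply: cvgB; first exact: cvg_cst.
have /cvg_at_leftP := cvl; apply; split => [n|].
  by rewrite ltrBlDr ltrDl invr_gt0.
rewrite -[X in _ --> X]subr0; apply: cvgB; first exact: cvg_cst.
exact: cvg_harmonic.
Unshelve. all: by end_near. Qed.

Lemma jump_ge0 X s : 0 <= jump X s.
Proof. by rewrite -lee_fin -jumpE. Qed.

(** ** Paths from measures *)

Section path_of.
Variable m : {measure set R -> \bar R}.
Hypothesis mfin : forall s, (m (ray s) < +oo)%E.

Let mf s : m (ray s) \is a fin_num. Proof. by rewrite ge0_fin_numE. Qed.

Definition ray_fun (s : R) : R := fine (m (ray s)).

Lemma ray_fun_nd : {homo ray_fun : x y / x <= y}.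
Proof.
move=> x y xy; apply: fine_le => //; apply: le_measure; rewrite ?inE//.
by move=> z /=; rewrite !in_itv/= => /le_trans; apply.
Qed.

Lemma ray_fun_rc : right_continuous ray_fun.
Proof.
move=> s; apply/cvg_at_rightP => u [us u_s].
have v_s : ray_fun (s + n.+1%:R^-1) @[n --> \oo] --> ray_fun s.
  have niF : nonincreasing_seq (fun n : nat => `]-oo, s + n.+1%:R^-1]%classic : set R).
    move=> p n pn; apply/subsetPset => x /=; rewrite !in_itv/=.
    by move/le_trans; apply; rewrite lerD2l lef_pV2 ?posrE// ler_nat.
  have cap : \bigcap_(n : nat) `]-oo, s + n.+1%:R^-1]%classic = `]-oo, s]%classic :> set R.
    apply/seteqP; split => x /=; rewrite in_itv/=; last first.
      by move=> xs n _; rewrite /= in_itv/= (le_trans xs)// lerDl invr_ge0.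
    move=> h; rewrite leNgt; apply/negP => /ltr_add_invr[n sn].
    by have := h n I; rewrite /= in_itv/= leNgt sn.
  have := @nonincreasing_cvg_mu _ _ _ m (fun n : nat => `]-oo, s + n.+1%:R^-1]%classic : set R).
  rewrite cap => /(_ (mfin _) (fun _ => measurable_itv _) (measurable_itv _) niF).
  by rewrite -(fineK (mf s)) => /fine_cvg.
apply/cvgrPdist_le => e e0.
have /cvgrPdist_le/(_ e e0) [N _ /(_ N (leqnn _)) /= hN] := v_s.
near=> n.
have un : s <= u n by exact: ltW.
have uN : u n <= s + N.+1%:R^-1.
  near: n; have iN : 0 < N.+1%:R^-1 :> R by rewrite invr_gt0.
  have /cvgrPdist_le/(_ _ iN) [K _ hK] := u_s; exists K => // n Kn.
  have := hK n Kn; rewrite /= distrC ger0_norm ?lerBlDl// subr_ge0 ltW//.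
have := ray_fun_nd un; have := ray_fun_nd uN; have : s <= s + N.+1%:R^-1 by rewrite lerDl invr_ge0.
move=> /ray_fun_nd h1 h2 h3; rewrite distrC ger0_norm ?subr_ge0//.
by rewrite (le_trans _ hN)// distrC ger0_norm ?subr_ge0// lerB.
Unshelve. all: by end_near. Qed.

Lemma ray_fun_Ny : ray_fun y @[y --> -oo] --> (0 : R).
Proof.
have v_s : ray_fun (- n%:R) @[n --> \oo] --> (0 : R).
  have niF : nonincreasing_seq (fun n : nat => `]-oo, - n%:R]%classic : set R).
    move=> p n pn; apply/subsetPset => x /=; rewrite !in_itv/=.
    by move/le_trans; apply; rewrite lerN2 ler_nat.
  have cap : \bigcap_(n : nat) `]-oo, - n%:R]%classic = set0 :> set R.
    apply/seteqP; split => x //= h.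
    have := h (Num.bound `|x|) I; rewrite /= in_itv/= lerNr leNgt => /negP; apply.
    by rewrite (@le_lt_trans _ _ `|x|) ?archi_boundP// -normrN ler_norm.
  have := @nonincreasing_cvg_mu _ _ _ m (fun n : nat => `]-oo, - n%:R]%classic : set R).
  rewrite cap measure0 => /(_ (mfin _) (fun _ => measurable_itv _) measurable0 niF).
  by move=> h; exact: (fine_cvg h).
apply/cvgrPdist_le => e e0.
have /cvgrPdist_le/(_ e e0) [N _ /(_ N (leqnn _)) /= hN] := v_s.
near=> y; have yN : y <= - N%:R by near: y; apply: nbhs_ninfty_le; exact: num_real.
have h : 0 <= ray_fun y by exact: fine_ge0.
have := ray_fun_nd yN => h2.
move: hN; rewrite !sub0r !normrN !ger0_norm//; last exact: le_trans h2.
exact: le_trans.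
Unshelve. all: by end_near. Qed.

HB.instance Definition _ := isCumulative.Build R _ R ray_fun ray_fun_nd ray_fun_rc.

Definition ray_path : iap_path R := @IapPath R (ray_fun : cumulative R R) ray_fun_Ny.

End path_of.

(** The path whose Lebesgue-Stieltjes measure is m; the zero path is a default value
    for an m infinite on some ray. *)
Definition path_of (m : {measure set R -> \bar R}) : iap_path R :=
  match pselect (forall s, (m (ray s) < +oo)%E) with
  | left mfin => ray_path mfin
  | right _ => zero_path R
  end.

Lemma path_ofE (m : {measure set R -> \bar R}) :
  (forall s, (m (ray s) < +oo)%E) -> forall s, (path_of m s)%:E = m (ray s).
Proof.
move=> mfin s; rewrite /path_of; case: pselect => [h|//].
by rewrite /= /ray_fun fineK// ge0_fin_numE.
Qed.

Lemma LS_path_of (m : {measure set R -> \bar R}) :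
  (forall s, (m (ray s) < +oo)%E) -> forall A, measurable A -> LS (path_of m) A = m A.
Proof. by move=> mfin; apply: LS_unique => s; rewrite path_ofE. Qed.


(** ** Measurability of path-valued maps *)

Lemma measurable_path d (T : measurableType d) (f : T -> iap_path R) :
  (forall t, measurable_fun setT (fun x => f x t)) -> measurable_fun setT f.
Proof.
move=> mf; apply: (measurability (path_cylinders (R := R))) => //.
move=> _ [_ [t [B mB ->]] <-]; rewrite setTI.
exact: (measurable_pre (mf t) mB).
Qed.

Lemma measurable_eval t : measurable_fun setT (fun X : iap_path R => X t).
Proof.
move=> _ B mB; rewrite setTI; apply: sub_sigma_algebra.
by exists t; exists B.
Qed.

Lemma LS_ray_cvg X A : measurable A ->
  (LS X (A `&` ray (n%:R : R)) @[n --> \oo] --> LS X A)%E.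
Proof.
move=> mA; have cup : \bigcup_(n : nat) (A `&` `]-oo, n%:R]%classic) = A.
  rewrite -setI_bigcupr (_ : \bigcup_(n : nat) _ = setT) ?setIT//.
  apply/seteqP; split => // x _; exists (Num.bound `|x|) => //=.
  by rewrite in_itv/= (le_trans (ler_norm x))// ltW// archi_boundP.
rewrite -[X in _ --> LS _ X]cup; apply: nondecreasing_cvg_mu.
- by move=> n; exact: measurableI.
- by rewrite cup.
- move=> p n pn; apply/subsetPset => x [Ax] /=; rewrite !in_itv/= => xp; split => //=.
  by rewrite (le_trans xp)// ler_nat.
Qed.

Lemma measurable_LS B : measurable B -> measurable_fun setT (fun X => LS X B).
Proof.
move=> mB.
suff H n C : measurable C -> measurable_fun setT (fun X => LS X (C `&` ray (n%:R : R))).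
  apply: (emeasurable_fun_cvg (fun n X => LS X (B `&` ray (n%:R : R)))).
  - by move=> n; exact: H.
  - by move=> X _; exact: LS_ray_cvg.
have finr X (D : set R) : measurable D -> LS X (D `&` ray (n%:R : R)) \is a fin_num.
  move=> mD; rewrite ge0_fin_numE//.
  rewrite (@le_lt_trans _ _ (LS X (ray n%:R)))//; last by rewrite LS_ray ltry.
  by apply: le_measure; rewrite ?inE//; exact: measurableI.
rewrite ray_generates.
apply: (@dynkin_induction _ _ _
   (fun C => measurable_fun setT (fun X => LS X (C `&` ray (n%:R : R)))) ray_generates).
- move=> _ _ [a ->] [b ->]; exists (Num.min a b).
  by apply/seteqP; split => x /=; rewrite !in_itv/= le_min => /andP.
- rewrite setTI; under eq_fun do rewrite LS_ray.
  by apply/measurable_EFinP; exact: measurable_eval.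
- move=> _ [s ->].
  rewrite (_ : (fun X => _) = fun X => (X (Num.min s n%:R))%:E).
    by apply/measurable_EFinP; exact: measurable_eval.
  apply/funext => X; rewrite -LS_ray; congr (LS X _).
  by apply/seteqP; split => x /=; rewrite !in_itv/= le_min => /andP.
- move=> S mS mfS.
  rewrite (_ : (fun X => _) = fun X => ((X n%:R)%:E - LS X (S `&` ray (n%:R : R)))%E).
    apply: emeasurable_funB => //.
    by apply/measurable_EFinP; exact: measurable_eval.
  apply/funext => X; rewrite -LS_ray setIC -setDE measureD//=; last by rewrite LS_ray ltry.
  by rewrite setIC.
- move=> F mF tF mfF.
  rewrite (_ : (fun X => _) = fun X => (\sum_(k <oo) LS X (F k `&` ray (n%:R : R)))%E).
    exact: ge0_emeasurable_sum.
  apply/funext => X; rewrite setI_bigcupl measure_bigcup//=.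
  + by apply: eq_eseriesl => k; rewrite mem_setT.
  + by move=> k _; exact: measurableI.
  + by apply/trivIsetP => i j _ _ ij; rewrite setIACA; move/trivIsetP : tF => ->//; rewrite set0I.
Qed.

Definition LSker d (T : measurableType d) (f : T -> iap_path R)
    (mf : measurable_fun setT f) (z : T) : {measure set R -> \bar R} := LS (f z).

Section LSker.
Context d (T : measurableType d) (f : T -> iap_path R) (mf : measurable_fun setT f).

Let measurable_LSker B : measurable B -> measurable_fun setT (LSker mf ^~ B).
Proof. by move=> mB; exact: (measurableT_comp (measurable_LS mB)). Qed.

HB.instance Definition _ := isKernel.Build _ _ T _ R (LSker mf) measurable_LSker.

(** The measures of paths are finite on rays, where the sections of a measurable set
    have a measurable mass; the ray then grows to the whole line. *)
Lemma measurable_LS_xsection (A : set (T * R)) :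
  measurable A -> measurable_fun setT (fun z => LS (f z) (xsection A z)).
Proof.
move=> mA.
apply: (emeasurable_fun_cvg (fun n z => LS (f z) (xsection A z `&` ray (n%:R : R)))).
- move=> n.
  have := @measurable_prod_subset_xsection_kernel _ _ _ _ R (LSker mf) (ray n%:R)
    (measurable_itv _) _ A mA.
  case => // z; exists (f z n%:R + 1) => B mB; rewrite /mrestr /=.
  apply: (@le_lt_trans _ _ (LS (f z) (ray n%:R))).
    by apply: le_measure; rewrite ?inE//; exact: measurableI.
  by rewrite LS_ray lte_fin ltrDl.
- by move=> z _; apply: LS_ray_cvg; exact: measurable_xsection.
Qed.

Lemma measurable_integral_LS (h : T * R -> \bar R) :
  measurable_fun setT h -> (forall z, 0 <= h z)%E ->
  measurable_fun setT (fun z => \int[LS (f z)]_s h (z, s))%E.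
Proof.
move=> mh h0.
pose k_ := nnsfun_approx measurableT mh.
apply: (@measurable_fun_xsection_integral _ _ _ _ R h (LSker mf) k_).
- by move=> a b ab; exact/nd_nnsfun_approx.
- by move=> z; exact/cvg_nnsfun_approx.
- by move=> n r; exact: measurable_LS_xsection.
Qed.

End LSker.

Lemma measurable_LS_section d (T : measurableType d) (f : T -> iap_path R)
    (A : set (T * R)) :
  measurable_fun setT f -> measurable A ->
  measurable_fun setT (fun z => LS (f z) [set s | A (z, s)]).
Proof.
move=> mf mA.
rewrite (_ : (fun z => _) = fun z => LS (f z) (xsection A z)).
  exact: measurable_LS_xsection.
by apply/funext => z; congr (LS _ _); apply/seteqP; split => s; rewrite /xsection/= inE.
Qed.

Lemma measurable_graph d (T : measurableType d) (g : T -> R) :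
  measurable_fun setT g -> measurable [set zs : T * R | zs.2 = g zs.1].
Proof.
move=> mg.
have mh : measurable_fun setT (fun zs : T * R => zs.2 - g zs.1).
  by apply: measurable_funB => //; exact: (measurableT_comp mg).
rewrite (_ : [set _ | _] = (fun zs : T * R => zs.2 - g zs.1) @^-1` [set 0]).
  by apply: measurable_pre.
by apply/seteqP; split => zs /=; [move=> ->; rewrite subrr|move/subr0_eq].
Qed.

Lemma measurable_jump d (T : measurableType d) (f : T -> iap_path R) (g : T -> R) :
  measurable_fun setT f -> measurable_fun setT g ->
  measurable_fun setT (fun z => jump (f z) (g z)).
Proof.
move=> mf mg; apply/measurable_EFinP.
rewrite (_ : _ \o _ = fun z => LS (f z) [set s | [set zs : T * R | zs.2 = g zs.1] (z, s)]).
  by apply: measurable_LS_section => //; exact: measurable_graph.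
by apply/funext => z /=; rewrite -jumpE.
Qed.

Lemma measurable_jump_neq0 d (T : measurableType d) (f : T -> iap_path R) s :
  measurable_fun setT f -> measurable [set z | jump (f z) s != 0].
Proof.
move=> mf; have mj : measurable_fun setT (fun z => jump (f z) s).
  by apply: measurable_jump => //; exact: measurable_cst.
rewrite (_ : [set _ | _] = (fun z => jump (f z) s) @^-1` (~` [set 0])).
  by apply: measurable_pre => //; exact: measurableC.
by apply/seteqP; split => z /= /eqP.
Qed.

(** ** Countable sets of atoms *)

Lemma measurable_countable (M : set R) : countable M -> measurable M.
Proof. by apply: countable_measurable => t; exact: measurable_set1. Qed.

(** An increasing exhaustion by finite lists, so that finite and infinite M are
    treated alike. *)
Lemma countable_enum (M : set R) : countable M ->
  exists s_ : nat -> seq R, [/\ forall n, uniq (s_ n),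
    forall m n, (m <= n)%N -> {subset s_ m <= s_ n} &
    forall tau, M tau <-> exists n, tau \in s_ n].
Proof.
move=> /countable_injP[f finj].
pose e i := xget (0 : R) [set tau | M tau /\ f tau = i].
pose s_ n := undup [seq e i | i <- iota 0 n & `[< exists tau, M tau /\ f tau = i >]].
have memE n tau : tau \in s_ n <-> M tau /\ (f tau < n)%N.
  rewrite /s_ mem_undup; split.
    move=> /mapP[i]; rewrite mem_filter mem_iota add0n => /andP[/asboolP ex /andP[_ lt]] ->.
    have [h1 h2] : [set tau | M tau /\ f tau = i] (e i) by apply: xgetPex.
    by rewrite -/(e i); split => //; rewrite h2.
  move=> [Mt lt]; apply/mapP; exists (f tau).
    rewrite mem_filter mem_iota add0n lt /= andbT; apply/asboolP.
    by exists tau.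
  have [h1 h2] : [set t | M t /\ f t = f tau] (e (f tau)) by apply: xgetPex; exists tau.
  by apply: finj => //; rewrite ?inE.
exists s_; split.
- by move=> n; exact: undup_uniq.
- by move=> m n mn tau /memE[Mt lt]; apply/memE; split => //; exact: leq_trans lt mn.
- move=> tau; split => [Mt|[n /memE[]//]].
  by exists (f tau).+1; apply/memE.
Qed.

Lemma measurable_seqset (s : seq R) : measurable [set` s].
Proof. by apply: measurable_countable; apply: finite_set_countable. Qed.

Lemma integral_seqset (m : {measure set R -> \bar R}) (s : seq R) (g : R -> \bar R) :
  measurable_fun setT g -> (forall x, 0 <= g x)%E -> uniq s ->
  (\int[m]_(x in [set` s]) g x = \sum_(tau <- s) g tau * m [set tau])%E.
Proof.
move=> mg g0; elim: s => [|a s ih] us.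
  by rewrite big_nil set_nil integral_set0.
move: us => /= /andP[as_ us].
rewrite big_cons (_ : [set` a :: s] = [set a] `|` [set` s]); last first.
  by apply/seteqP; split => x /=; rewrite in_cons => /predU1P.
rewrite ge0_integral_setU//.
- rewrite ih//; congr (_ + _)%E; rewrite integral_setE.
  transitivity (\int[m]_x (g a * (\1_[set a] x)%:E))%E.
    apply: eq_integral => x _; rewrite indicE.
    by have [|] := boolP (x \in [set a]); [rewrite inE => ->|rewrite !mule0].
  rewrite ge0_integralZl//.
  + by rewrite integral_indic// setIT.
  + by apply/measurable_EFinP; exact: measurable_indic.
- exact: measurable_seqset.
- exact: measurable_funTS.
- apply/disj_setPS => x /= [-> h]; move: as_; by rewrite h.
Qed.

Lemma bigcup_seqset (M : set R) (s_ : nat -> seq R) :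
  (forall tau, M tau <-> exists n, tau \in s_ n) -> \bigcup_n [set` s_ n] = M.
Proof.
move=> h; apply/seteqP; split => tau.
  by move=> [n _ /= ?]; apply/h; exists n.
by move/h => [n ?]; exists n.
Qed.

Lemma seqset_cvg (m : {measure set R -> \bar R}) (M : set R) (s_ : nat -> seq R)
    (g : R -> \bar R) : measurable_fun setT g -> (forall x, 0 <= g x)%E ->
  (forall n, uniq (s_ n)) -> (forall m n, (m <= n)%N -> {subset s_ m <= s_ n}) ->
  (forall tau, M tau <-> exists n, tau \in s_ n) ->
  (\sum_(tau <- s_ n) g tau * m [set tau] @[n --> \oo] --> \int[m]_(x in M) g x)%E.
Proof.
move=> mg g0 us ss Ms; rewrite -(bigcup_seqset Ms).
under eq_fun do rewrite -integral_seqset//.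
apply: ge0_nondecreasing_set_cvg_integral => //.
- by move=> p n pn; apply/subsetPset => x /=; exact: ss.
- by move=> n; exact: measurable_seqset.
- by move=> n; exact: measurable_funTS.
Qed.

Lemma esum_LS X (S : set R) : countable S ->
  (\esum_(tau in S) (jump X tau)%:E = LS X S)%E.
Proof.
move=> cS; have [s_ [us ss Ss]] := countable_enum cS.
have mS := measurable_countable cS.
have fE (F : set R) : finite_set F -> (\sum_(x \in F) (jump X x)%:E = LS X F)%E.
  move=> finF; have {2}<- : \bigcup_(i in F) [set i] = F.
    by apply/seteqP; split => [x [i Fi ->]//|x Fx]; exists x.
  rewrite measure_fin_bigcup//=.
  + by apply: eq_fsbigr => x _; rewrite -jumpE.
  + by apply/trivIsetP => i j _ _ ij; apply/seteqP; split => x //= [-> /eqP]; rewrite (negbTE ij).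
apply/eqP; rewrite eq_le; apply/andP; split.
  apply: ub_ereal_sup => _ [F [finF FS] <-]; rewrite fE//.
  apply: le_measure; rewrite ?inE//.
  by apply: measurable_countable; exact: finite_set_countable.
have h := @seqset_cvg (LS X) S s_ (fun=> 1%E) (measurable_cst _) (fun=> lee01) us ss Ss.
rewrite integral_cst// mul1e in h.
rewrite -(cvg_lim _ h)//; apply: lime_le; first by apply/cvg_ex; exists (LS X S).
near=> n; apply: esum_ge; exists [set` s_ n].
  split; first exact: finite_seq.
  by move=> x /= xs; apply/Ss; exists n.
rewrite fE; last exact: finite_seq.
have -> : LS X [set` s_ n] = (\int[LS X]_(x in [set` s_ n]) 1)%E.
  by rewrite integral_cst ?mul1e//; exact: measurable_seqset.
by rewrite integral_seqset//; exact: measurable_cst.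
Unshelve. all: by end_near. Qed.

(** ** Removing the atoms in a countable set, adding an atom *)

(** The path that remains of X when its atoms in M are deleted. *)
Definition contpart (M : set R) X : iap_path R :=
  xget (zero_path R) [set Y | forall A, measurable A -> LS Y A = LS X (A `\` M)].

Lemma LS_contpart M X A : countable M -> measurable A ->
  LS (contpart M X) A = LS X (A `\` M).
Proof.
move=> cM; have mM : measurable (~` M) by apply: measurableC; exact: measurable_countable.
suff ex : exists Y, forall B, measurable B -> LS Y B = LS X (B `\` M).
  by move=> mA; have /(_ A mA) := xgetPex (zero_path R) ex.
have fin s : (mrestr (LS X) mM (ray s) < +oo)%E.
  rewrite /mrestr (@le_lt_trans _ _ (LS X (ray s)))//; last by rewrite LS_ray ltry.
  by apply: le_measure; rewrite ?inE//; exact: measurableI.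
exists (path_of (mrestr (LS X) mM)) => B mB.
by rewrite LS_path_of// /mrestr/= setDE.
Qed.

Lemma integral_contpart M X g : countable M -> measurable_fun setT g ->
  (forall x, 0 <= g x)%E ->
  (\int[LS (contpart M X)]_x g x = \int[LS X]_(x in ~` M) g x)%E.
Proof.
move=> cM mg g0.
have mM : measurable (~` M) by apply: measurableC; exact: measurable_countable.
rewrite [RHS]integral_setE.
have m1 : measurable_fun setT (fun x => \1_(~` M) x : R) by exact: measurable_indic.
have [m' [m'E im']] := @density_measure R _ _ (LS X) _ m1
  (fun x => proj1 (andP (indic01 (R := R) (~` M) x))).
rewrite -im'//; apply: eq_measure_integral => A mA _.
have mAM : measurable (A `\` M) by apply: measurableD => //; exact: measurable_countable.
transitivity (LS X (A `\` M)); first exact: LS_contpart.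
transitivity (\int[LS X]_x (\1_(A `\` M) x)%:E)%E; first by rewrite integral_indic// setIT.
rewrite m'E// integral_setE.
by apply: eq_integral => x _; rewrite -EFinM setDE indicI mulrC.
Qed.

Lemma decomposes_contpart M X : countable M -> decomposes M X (contpart M X).
Proof.
move=> cM s.
have mM := measurable_countable cM.
rewrite esum_LS; last by apply: sub_countable cM; apply: subset_card_le => x [].
rewrite -!LS_ray LS_contpart// -measureU//=.
- by rewrite setDE [M `&` _]setIC -setIUr setUv setIT.
- exact: measurableI.
- exact: measurableD.
- by apply/seteqP; split => x //= -[[? ?] []].
Qed.

(** No freedom is left for the continuous part: [contpart M] may replace the one that
    comes with the process. *)
Lemma decomposes_unique M X Y : countable M -> decomposes M X Y -> Y = contpart M X.
Proof.
move=> cM h; apply: path_ext => s.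
have := h s; rewrite (decomposes_contpart X cM s).
rewrite esum_LS; last by apply: sub_countable cM; apply: subset_card_le => x [].
have fin : LS X (M `&` ray s) \is a fin_num.
  rewrite ge0_fin_numE// (@le_lt_trans _ _ (LS X (ray s)))//; last by rewrite LS_ray ltry.
  by apply: le_measure; rewrite ?inE//; apply: measurableI => //; exact: measurable_countable.
rewrite -(fineK fin) -!EFinD => -[] /addrI ->//.
Qed.

(** |v| rather than v, so that this is a measure for every real v. *)
Definition atom_measure X (v s : R) : {measure set R -> \bar R} :=
  measure_add (LS X) (mscale (NngNum (normr_ge0 v)) (\d_s)).

Definition add_atom X (v s : R) : iap_path R := path_of (atom_measure X v s).

Let atomE X v s A : 0 <= v ->
  (atom_measure X v s A = LS X A + (v * \1_A s)%:E)%E.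
Proof.
move=> v0; transitivity (measure_add (LS X) (mscale (NngNum (normr_ge0 v)) (\d_s)) A) => //.
by rewrite measure_addE /= /mscale/= diracE EFinM indicE ger0_norm.
Qed.

Lemma LS_add_atom X v s A : 0 <= v -> measurable A ->
  (LS (add_atom X v s) A = LS X A + (v * \1_A s)%:E)%E.
Proof.
move=> v0 mA; rewrite -atomE//; apply: LS_path_of => // t.
by rewrite atomE// LS_ray -EFinD ltry.
Qed.

Lemma add_atomE X v s t : 0 <= v -> add_atom X v s t = X t + v * (s <= t)%R%:R.
Proof.
move=> v0; apply: EFin_inj; rewrite -LS_ray LS_add_atom// LS_ray -EFinD.
by congr (_ + _ * _)%:E; rewrite indicE mem_setE in_itv.
Qed.

Lemma integral_add_atom X v s g : 0 <= v -> measurable_fun setT g ->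
  (forall x, 0 <= g x)%E ->
  (\int[LS (add_atom X v s)]_x g x = \int[LS X]_x g x + v%:E * g s)%E.
Proof.
move=> v0 mg g0.
rewrite (@eq_measure_integral _ _ _ setT (atom_measure X v s)).
  rewrite ge0_integral_measure_add// ge0_integral_mscale// integral_dirac// diracT mul1e.
  by rewrite /= ger0_norm.
by move=> A mA _; apply: eq_trans (esym (atomE _ _ _ v0)); exact: LS_add_atom.
Qed.

End path_measure.

(** * Poisson random measures and their Laplace functionals *)

Section poisson.
Context {R : realType}.

Lemma prob_compl0 d (T : measurableType d) (P : probability T R) D :
  measurable D -> P D = 1%E -> P (~` D) = 0%E.
Proof. by move=> mD PD; rewrite probability_setC// PD subee. Qed.

Lemma prob_of_compl0 d (T : measurableType d) (P : probability T R) D :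
  measurable D -> P (~` D) = 0%E -> P D = 1%E.
Proof.
move=> mD; have mC : measurable (~` D) by exact: measurableC.
by have := probability_setC P mC; rewrite setCK => -> ->; rewrite sube0.
Qed.

Lemma prob_cst d (T : measurableType d) (P : probability T R) (c : R) :
  (\int[P]_x c%:E = c%:E)%E.
Proof. by rewrite integral_cst// [X in (_ * X)%E]probability_setT mule1. Qed.

Lemma exp_nneseries (x : R) : 0 <= x ->
  (\sum_(k <oo) (x ^+ k / k`!%:R)%:E = (expR x)%:E)%E.
Proof.
move=> x0; apply/cvg_lim => //.
rewrite (_ : (fun n => _) = EFin \o series (exp_coeff x)); last first.
  by apply/funext => n; rewrite /= /series/= -sumEFin.
apply: cvg_EFin; first exact: nearW.
exact: is_cvg_series_exp_coeff.
Qed.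

Lemma nexp_EFin (x : R) : nexp x%:E = expR (- x).
Proof. by []. Qed.

(** A density against the counting measure, which covers lam = 0. *)
Lemma poisson_law (lam : R) : 0 <= lam ->
  exists pi : {measure set nat -> \bar R},
  [/\ forall k, pi [set k] = (lam ^+ k / k`!%:R * expR (- lam))%:E,
      pi setT = 1%E &
      forall c : R, 0 <= c ->
        (\int[pi]_k (expR (- (c * k%:R)))%:E = (expR (- (lam * (1 - expR (- c)))))%:E)%E].
Proof.
move=> lam0; pose w k : R := lam ^+ k / k`!%:R * expR (- lam).
have w0 k : 0 <= w k by rewrite !mulr_ge0 ?exprn_ge0 ?expR_ge0// invr_ge0.
have mnat (f : nat -> R) : measurable_fun setT f by move=> _ B mB.
have mnatE (f : nat -> \bar R) : measurable_fun setT f by move=> _ B mB.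
have [pi [piE ipi]] := density_measure (@counting nat R) (mnat w) w0.
have lapl (c : R) : 0 <= c ->
    (\int[pi]_k (expR (- (c * k%:R)))%:E = (expR (- (lam * (1 - expR (- c)))))%:E)%E.
  move=> c0; rewrite ipi; [|exact: mnatE|by move=> k; rewrite lee_fin expR_ge0].
  rewrite ge0_integral_count; last by move=> k; rewrite -EFinM lee_fin mulr_ge0 ?expR_ge0.
  pose y := lam * expR (- c).
  have y0 : 0 <= y by rewrite mulr_ge0 ?expR_ge0.
  transitivity (\sum_(k <oo) (expR (- lam))%:E * (y ^+ k / k`!%:R)%:E)%E.
    apply: eq_eseriesr => k _; rewrite -!EFinM; congr (_%:E).
    by rewrite /w /y exprMn -expRM_natl mulrN [k%:R * c]mulrC; ring.
  rewrite nneseriesZl; last by move=> k _; rewrite lee_fin mulr_ge0 ?exprn_ge0 ?invr_ge0.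
  by rewrite exp_nneseries// -EFinM -expRD /y; congr (expR _)%:E; ring.
have pi1 k : pi [set k] = (w k)%:E.
  rewrite piE// integral_setE.
  transitivity (\int[counting]_j ((w k)%:E * (\1_[set k] j)%:E))%E.
    apply: eq_integral => j _; rewrite indicE.
    by have [|] := boolP (j \in [set k]); [rewrite inE => ->|rewrite !mule0].
  rewrite ge0_integralZl ?lee_fin//; try exact: mnatE.
  rewrite integral_indic// setIT -[X in (_ * X)%E]/(counting [set k]).
  by rewrite /counting asboolT//= fset_set1 cardfs1 mule1.
exists pi; split => //.
have := lapl 0 (lexx _); rewrite oppr0 expR0 subrr mulr0 oppr0 expR0 => <-.
under eq_integral do rewrite mul0r oppr0 expR0.
by rewrite integral_cst// mul1e.
Qed.

(** X is almost surely an integer because the masses of the integers add up to 1. *)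
Lemma poisson_laplace d (W : measurableType d) (P : probability W R)
    (X : W -> \bar R) (lam c : R) :
  measurable_fun setT X -> 0 <= lam -> 0 <= c ->
  (forall n : nat, P [set w | X w = (n%:R)%:E] =
     (lam ^+ n / n`!%:R * expR (- lam))%:E) ->
  (\int[P]_w (nexp (c%:E * X w))%:E = (nexp (lam * (1 - expR (- c)))%:E)%:E)%E.
Proof.
move=> mX lam0 c0 pX; have [pi [pi1 piT lapl]] := poisson_law lam0.
pose F n := [set w | X w = (n%:R)%:E].
have mF n : measurable (F n) by apply: (measurable_pre mX (A := [set _])).
have tF : trivIset setT F.
  apply/trivIsetP => i j _ _ ij; apply/seteqP; split => w //= -[h1 h2].
  by rewrite /F/= in h1 h2; move: h2; rewrite h1 => -[/eqP]; rewrite eqr_nat (negbTE ij).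
have mD : measurable (\bigcup_n F n) by exact: bigcupT_measurable.
have natE : \bigcup_k [set k] = [set: nat] by apply/seteqP; split => // k _; exists k.
have t1 : trivIset setT (fun k : nat => [set k]).
  by apply/trivIsetP => i j _ _ /eqP ij; apply/seteqP; split => x //= [-> /ij].
have PD : P (\bigcup_n F n) = 1%E.
  rewrite -piT -[X in _ = pi X]natE !measure_bigcup//.
  by apply: eq_eseriesr => n _; apply: (eq_trans (pX n)); exact/esym/pi1.
have mE : measurable_fun setT (fun w => (nexp (c%:E * X w))%:E).
  apply/measurable_EFinP; apply: (measurableT_comp measurable_nexp).
  exact: measurable_funeM.
rewrite (ge0_negligible_integral (measurableC mD))//; last 2 first.
- by move=> w _; rewrite lee_fin nexp_ge0.
- exact: prob_compl0.
rewrite setTD setCK ge0_integral_bigcup//; last 2 first.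
- exact: measurable_funTS.
- by move=> w _; rewrite lee_fin nexp_ge0.
rewrite nexp_EFin -lapl// -[in RHS]natE ge0_integral_bigcup//.
apply: eq_eseriesr => n _.
transitivity ((expR (- (c * n%:R)))%:E * P (F n))%E.
  rewrite -integral_cst//; apply: eq_integral => w; rewrite inE /F/= => ->.
  by rewrite -EFinM.
rewrite /F pX -pi1 -integral_cst//.
by apply: eq_integral => k; rewrite inE /= => ->.
Qed.

Lemma indic_bigcap_ord (T : Type) n (A : 'I_n -> set T) x :
  \1_(\bigcap_(i in [set: 'I_n]) A i) x = \prod_(i < n) \1_(A i) x :> R.
Proof.
have [h|/existsNP[i /existsNP[_ Aix]]] := pselect (forall i, setT i -> A i x).
  rewrite indicE mem_set// big1// => i _; rewrite indicE mem_set//; exact: h.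
rewrite (bigD1 i)//= [X in _ = X * _]indicE memNset// mul0r indicE memNset//.
by move=> /(_ i I).
Qed.

Lemma prob_bigcap d (W : measurableType d) (P : {measure set W -> \bar R})
    n (A : 'I_n -> set W) : (forall i, measurable (A i)) ->
  (P (\bigcap_(i in [set: 'I_n]) A i) = \int[P]_w (\prod_(i < n) \1_(A i) w)%:E)%E.
Proof.
move=> mA; under eq_integral do rewrite -indic_bigcap_ord.
by rewrite integral_indic ?setIT//; apply: fin_bigcap_measurable.
Qed.


Lemma measurable_ker_integral d (W : measurableType d) d' (S : measurableType d')
    (N : R.-ker W ~> S) (g : S -> R) :
  measurable_fun setT g -> (forall z, 0 <= g z) ->
  measurable_fun setT (fun w => \int[N w]_z (g z)%:E)%E.
Proof.
move=> mg g0; apply: (measurable_fun_integral_kernel (l := N)).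
- exact: measurable_kernel.
- by move=> z; rewrite lee_fin.
- exact/measurable_EFinP.
Qed.

(** The level sets of a simple function come as a list without repetition, whereas
    the independence of the counts is stated for families indexed by ordinals. *)
Lemma prm_indep_seq d (W : measurableType d) (P : probability W R)
    (N : R.-ker W ~> (R * R)%type) nu (I : eqType) (s : seq I)
    (B : I -> set (R * R)) (c : I -> R) :
  poisson_random_measure P N nu -> uniq s ->
  (forall i, measurable (B i)) -> (forall i, 0 <= c i) ->
  (forall i j, i \in s -> j \in s -> i != j -> B i `&` B j = set0) ->
  (\int[P]_w (\prod_(i <- s) nexp ((c i)%:E * N w (B i)))%:E =
   \big[*%E/1%E]_(i <- s) \int[P]_w (nexp ((c i)%:E * N w (B i)))%:E)%E.
Proof.
move=> [_ _ ind] us mB c0 dB.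
have mN i : measurable_fun setT (fun w => N w (B i)) by exact: measurable_kernel.
pose g i (y : \bar R) := nexp ((c i)%:E * `|y|).
have mg i : measurable_fun setT (g i).
  apply: (measurableT_comp measurable_nexp); apply: measurable_funeM.
  exact: abse_measurable.
have g01 i y : 0 <= g i y <= 1.
  by rewrite nexp_ge0 nexp_le1// mule_ge0// lee_fin.
have gE i w : nexp ((c i)%:E * N w (B i)) = g i (N w (B i)).
  by rewrite /g gee0_abs.
have mY : measurable_fun [set: W] (fun=> tt) by exact: measurable_cst.
have ID (A : I -> set (\bar R)) (E : set unit) :
    (forall i, measurable (A i)) -> measurable E ->
    (\int[P]_w (\prod_(i <- s) \1_(A i) (N w (B i)) * \1_E tt)%:E =
     \big[*%E/1%E]_(i <- s) P [set w | A i (N w (B i))] * P ((fun=> tt) @^-1` E))%E.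
  move=> mA mE.
  have [Ett|nEtt] := pselect (E tt); last first.
    rewrite [X in P X](_ : _ = set0); last by apply/seteqP; split.
    rewrite measure0 mule0; apply: integral0_eq => w _.
    by rewrite [X in _ * X]indicE memNset// mulr0.
  rewrite [X in P X](_ : _ = setT); last by apply/seteqP; split.
  rewrite probability_setT mule1; pose t := in_tuple s.
  have := ind (size s) (fun j => B (tnth t j)) (fun j => A (tnth t j)).
  rewrite prob_bigcap; last first.
    by move=> j; exact: (measurable_pre (mN (tnth t j)) (mA (tnth t j))).
  move=> H; rewrite [RHS]big_tnth -/t -H//.
    by apply: eq_integral => w _; rewrite big_tnth [X in _ * X]indicE mem_set// mulr1.
  apply/trivIsetP => j1 j2 _ _ j12; apply: dB; rewrite ?mem_tnth//.
  have /tuple_uniqP inj : uniq t by [].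
  by apply: contra_neq j12 => /inj.
have K := indep_functions us mN mY ID mg (@measurable_cst _ _ _ _ setT (1 : R)) g01
  (fun=> (introT andP (conj ler01 (lexx _)))).
transitivity (\int[P]_w (\prod_(i <- s) g i (N w (B i)) * 1)%:E)%E.
  by apply: eq_integral => w _; rewrite mulr1; congr (_%:E); apply: eq_bigr => i _.
rewrite K (prob_cst P) mule1.
by apply: eq_bigr => i _; apply: eq_integral => w _; rewrite gE.
Qed.


(** ** The Laplace functional *)

Definition laplace_functional d (W : measurableType d) (P : {measure set W -> \bar R})
    (N : R.-ker W ~> (R * R)%type) (nu : {measure set (R * R) -> \bar R}) : Prop :=
  forall g : R * R -> R, measurable_fun setT g -> (forall z, 0 <= g z) ->
  (\int[P]_w (nexp (\int[N w]_z (g z)%:E))%:E =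
   (nexp (\int[nu]_z (1 - expR (- g z))%:E))%:E)%E.

Lemma one_sub_expRN_ge0 (x : R) : 0 <= x -> 0 <= 1 - expR (- x).
Proof. by move=> x0; rewrite subr_ge0 -expR0 ler_expR oppr_le0. Qed.

Lemma measurable_one_sub d (S : measurableType d) (g : S -> R) :
  measurable_fun setT g -> measurable_fun setT (fun z => 1 - expR (- g z)).
Proof.
move=> mg; apply: measurable_funB => //; apply: measurableT_comp => //.
exact: measurableT_comp.
Qed.

(** An infinite intensity gives an infinite count, in accordance with e^{-oo} = 0. *)
Lemma prm_count_laplace d (W : measurableType d) (P : probability W R)
    (N : R.-ker W ~> (R * R)%type) (nu : set (R * R) -> \bar R) B (c : R) :
  poisson_random_measure P N nu -> (0 <= nu B)%E -> measurable B -> 0 <= c ->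
  (\int[P]_w (nexp (c%:E * N w B))%:E = (nexp ((1 - expR (- c))%:E * nu B))%:E)%E.
Proof.
move=> [H1 H2 _] nu0 mB c0.
have mN : measurable_fun setT (fun w => N w B) by exact: measurable_kernel.
have [nuf|] := boolP (nu B < +oo)%E.
  rewrite (poisson_laplace (lam := fine (nu B)) (P := P)) ?fine_ge0//.
    by rewrite EFinM muleC fineK// ge0_fin_numE.
  exact: H1.
rewrite -leNgt leye_eq => /eqP nuy.
have [->|cn0] := eqVneq c 0.
  under eq_integral do rewrite mul0e nexp0.
  by rewrite (prob_cst P) oppr0 expR0 subrr mul0e nexp0.
have cp : 0 < c by rewrite lt_neqAle eq_sym cn0.
rewrite nuy gt0_muley; last by rewrite lte_fin subr_gt0 -expR0 ltr_expR oppr_lt0.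
have mD : measurable [set w | N w B = +oo%E] by apply: (measurable_pre mN (A := [set _])).
rewrite (ge0_negligible_integral (measurableC mD))//; last 3 first.
- apply/measurable_EFinP; apply: (measurableT_comp measurable_nexp).
  exact: measurable_funeM.
- by move=> w _; rewrite lee_fin nexp_ge0.
- by apply: prob_compl0 => //; exact: H2.
rewrite setTD setCK; apply: integral0_eq => w /= ->.
by rewrite gt0_muley// lte_fin.
Qed.

(** The level sets do not depend on the measure, so that one and the same sum serves
    for the random measure and for its intensity. *)
Lemma nnsfun_decomp d (S : measurableType d) (g : {nnsfun S >-> R}) :
  exists (s : seq R), uniq s /\
    forall h : R -> R, (forall r, 0 <= h r) -> forall m : {measure set S -> \bar R},
    (\int[m]_z (h (g z))%:E = \sum_(r <- s) (h r)%:E * m (g @^-1` [set r]))%E.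
Proof.
have fin := fimfunP g.
exists (fset_set (range g)); split; first exact: fset_uniq.
move=> h h0 m.
have sub : forall z, (h (g z))%:E = (\sum_(r <- fset_set (range g)) (h r * \1_(g @^-1` [set r]) z)%:E)%E.
  move=> z; rewrite (bigD1_seq (g z)) ?fset_uniq//=; last first.
    by rewrite in_fset_set// inE; exists z.
  rewrite indicE mem_set// mulr1 big1_seq ?adde0// => r /andP[rg _].
  by rewrite indicE memNset ?mulr0// => /= e; move: rg; rewrite e eqxx.
under eq_integral do rewrite sub.
have ind0 r z : 0 <= \1_(g @^-1` [set r]) z :> R by have /andP[] := indic01 (R := R) (g @^-1` [set r]) z.
have mind r : measurable_fun setT (fun z => \1_(g @^-1` [set r]) z : R).
  by apply: measurable_indic.
rewrite ge0_integral_sum//.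
- apply: eq_bigr => r _.
  under eq_integral do rewrite EFinM.
  rewrite ge0_integralZl ?lee_fin ?h0//.
  + by rewrite integral_indic// setIT.
  + exact/measurable_EFinP.
- move=> r; apply/measurable_EFinP; exact: measurable_funM.
- by move=> r z _; rewrite lee_fin mulr_ge0.
Qed.

(** For a simple function the functional is a product of Laplace transforms of
    independent Poisson counts; both sides pass to increasing limits. *)
Lemma prm_laplace d (W : measurableType d) (P : probability W R)
    (N : R.-ker W ~> (R * R)%type) (nu : {measure set (R * R) -> \bar R}) nu' :
  (forall B, measurable B -> nu B = nu' B) ->
  poisson_random_measure P N nu' -> laplace_functional P N nu.
Proof.
move=> nuE prm.
have simple (g : {nnsfun (R * R) >-> R}) :
    (\int[P]_w (nexp (\int[N w]_z (g z)%:E))%:E =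
     (nexp (\int[nu]_z (1 - expR (- g z))%:E))%:E)%E.
  have [s [us gE]] := nnsfun_decomp g.
  pose B r := g @^-1` [set r].
  have mB r : measurable (B r) by apply: measurable_funPTI.
  have abs0 (r : R) : 0 <= `|r| by [].
  have one0 (r : R) : 0 <= 1 - expR (- `|r|) by exact: one_sub_expRN_ge0.
  transitivity (\int[P]_w (\prod_(r <- s) nexp (`|r|%:E * N w (B r)))%:E)%E.
    apply: eq_integral => w _; rewrite -nexp_sum; last by move=> r; rewrite mule_ge0.
    rewrite -(gE (fun r => `|r|) abs0); congr (nexp _)%:E; apply: eq_integral => z _.
    by rewrite ger0_norm.
  rewrite (prm_indep_seq prm)//; last first.
    move=> i j _ _ ij; apply/seteqP; split => z // -[]; rewrite /B/= => h1 h2.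
    by move: ij; rewrite -h1 -h2 eqxx.
  transitivity (\big[*%E/1%E]_(r <- s) (nexp ((1 - expR (- `|r|))%:E * nu (B r)))%:E)%E.
    by apply: eq_bigr => r _; rewrite (prm_count_laplace prm) ?nuE// -nuE.
  transitivity ((\prod_(r <- s) nexp ((1 - expR (- `|r|))%:E * nu (B r)))%:E)%E.
    elim: (s) => [|r s' ih]; first by rewrite !big_nil.
    by rewrite !big_cons ih EFinM.
  rewrite -nexp_sum; last by move=> r; rewrite mule_ge0// lee_fin.
  rewrite -(gE (fun r => 1 - expR (- `|r|)) one0).
  by congr (nexp _)%:E; apply: eq_integral => z _; rewrite ger0_norm.
move=> g mg g0.
have mg' : measurable_fun setT (EFin \o g) by exact/measurable_EFinP.
pose g_ := nnsfun_approx measurableT mg'.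
have gg z : g_ n z @[n --> \oo] --> g z.
  have g0' : forall x : R * R, setT x -> (0 <= (EFin \o g) x)%E by move=> x _; rewrite lee_fin.
  have := @cvg_nnsfun_approx _ _ _ _ measurableT _ mg' g0' z I.
  by move/fine_cvg.
have ndg a b : (a <= b)%N -> forall z, g_ a z <= g_ b z.
  by move=> ab z; exact/lefP/nd_nnsfun_approx.
have N_cvg w : (\int[N w]_z (g_ n z)%:E @[n --> \oo] --> \int[N w]_z (g z)%:E)%E.
  have := @cvg_monotone_convergence _ _ _ (N w) setT measurableT (fun n z => (g_ n z)%:E).
  rewrite (_ : (fun z => limn _) = fun z => (g z)%:E); last first.
    apply/funext => z; apply/cvg_lim => //.
    by apply: cvg_EFin; [exact: nearW|exact: gg].
  apply.
  - by move=> n; exact/measurable_EFinP.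
  - by move=> n z _; rewrite lee_fin.
  - by move=> z _ a b ab; rewrite lee_fin; exact: ndg.
have nu_cvg : (\int[nu]_z (1 - expR (- g_ n z))%:E @[n --> \oo] -->
    \int[nu]_z (1 - expR (- g z))%:E)%E.
  have := @cvg_monotone_convergence _ _ _ nu setT measurableT (fun n z => (1 - expR (- g_ n z))%:E).
  rewrite (_ : (fun z => limn _) = fun z => (1 - expR (- g z))%:E); last first.
    apply/funext => z; apply/cvg_lim => //.
    apply: cvg_EFin; first exact: nearW.
    apply: cvgB; first exact: cvg_cst.
    by apply: continuous_cvg; [exact: continuous_expR|apply: cvgN; exact: gg].
  apply.
  - by move=> n; apply/measurable_EFinP; exact: measurable_one_sub.
  - by move=> n z _; rewrite lee_fin one_sub_expRN_ge0.
  - by move=> z _ a b ab; rewrite lee_fin lerB// ler_expR lerN2; exact: ndg.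
apply: (cvge_eq (fun n => simple (g_ n))).
  apply: (bounded_convergence (C := 1)).
  - by rewrite [X in (X < _)%E]probability_setT ltry.
  - move=> n; apply: (measurableT_comp measurable_nexp).
    exact: measurable_ker_integral.
  - by move=> n w; rewrite nexp_norm// integral_ge0// => z _; rewrite lee_fin.
  - by move=> w; apply: cvg_nexp => // n; rewrite integral_ge0// => z _; rewrite lee_fin.
apply: cvg_EFin; first exact: nearW.
apply: cvg_nexp => // n; rewrite integral_ge0// => z _.
by rewrite lee_fin one_sub_expRN_ge0.
Qed.

(** Conversely, at combinations of indicators of disjoint sets the functional is the
    joint Laplace transform of the counts, and these determine laws and independence. *)
Lemma laplace_prm d (W : measurableType d) (P : probability W R)
    (N : R.-ker W ~> (R * R)%type) (nu : {measure set (R * R) -> \bar R}) nu' :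
  (forall B, measurable B -> nu B = nu' B) ->
  laplace_functional P N nu -> poisson_random_measure P N nu'.
Proof.
move=> nuE L.
have mN B : measurable B -> measurable_fun setT (fun w => N w B).
  by move=> mB; exact: measurable_kernel.
have cB (c : R) B (m : {measure set (R * R) -> \bar R}) : 0 <= c -> measurable B ->
    (\int[m]_z (c * \1_B z)%:E = c%:E * m B)%E.
  move=> c0 mB; under eq_integral do rewrite EFinM.
  rewrite ge0_integralZl ?lee_fin//.
  - by rewrite integral_indic// setIT.
  - by apply/measurable_EFinP; exact: measurable_indic.
have sumB n (c : 'I_n -> R) (B : 'I_n -> set (R * R)) (m : {measure set (R * R) -> \bar R}) :
    (forall i, 0 <= c i) -> (forall i, measurable (B i)) ->
    (\int[m]_z (\sum_(i < n) c i * \1_(B i) z)%:E = \sum_(i < n) (c i)%:E * m (B i))%E.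
  move=> c0 mB; under eq_integral do rewrite -sumEFin.
  rewrite ge0_integral_sum//.
  - by apply: eq_bigr => i _; exact: cB.
  - by move=> i; apply/measurable_EFinP; apply: measurable_funM.
  - by move=> i z _; rewrite lee_fin mulr_ge0.
have LB n (c : 'I_n -> R) (B : 'I_n -> set (R * R)) :
    (forall i, 0 <= c i) -> (forall i, measurable (B i)) -> trivIset setT B ->
    (\int[P]_w (\prod_(i < n) nexp ((c i)%:E * N w (B i)))%:E =
     (\prod_(i < n) nexp ((1 - expR (- c i))%:E * nu (B i)))%:E)%E.
  move=> c0 mB tB.
  have e0 i : 0 <= 1 - expR (- c i) by exact: one_sub_expRN_ge0.
  have ind0 (A : set (R * R)) z : 0 <= \1_A z :> R by have /andP[] := indic01 (R := R) A z.
  have := L (fun z => \sum_(i < n) c i * \1_(B i) z).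
  rewrite (_ : (\int[nu]_z _)%E = \sum_(i < n) (1 - expR (- c i))%:E * nu (B i))%E; last first.
    rewrite -(sumB _ _ _ nu e0)//; apply: eq_integral => z _; congr (_%:E).
    have [[i _ Biz]|nB] := pselect ((\bigcup_(i in [set: 'I_n]) B i) z).
      have oth j : j != i -> \1_(B j) z = 0 :> R.
        move=> ji; rewrite indicE memNset// => Bjz.
        have /trivIsetP/(_ j i I I ji) E := tB.
        by have : (B j `&` B i) z by []; rewrite E.
      rewrite (bigD1 i)//= [in RHS](bigD1 i)//= !indicE mem_set// !mulr1.
      by rewrite !big1 ?addr0// => j ji; rewrite oth// mulr0.
    have oth j : \1_(B j) z = 0 :> R by rewrite indicE memNset// => Bjz; apply: nB; exists j.
    rewrite !big1 ?oppr0 ?expR0 ?subrr// => j _; by rewrite oth mulr0.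
  move=> H.
  transitivity ((nexp (\sum_(i < n) (1 - expR (- c i))%:E * nu (B i))%E)%:E); last first.
    by rewrite nexp_sum// => i; rewrite mule_ge0// lee_fin.
  rewrite -H.
  - by apply: eq_integral => w _; rewrite sumB// nexp_sum// => i; rewrite mule_ge0// lee_fin.
  - apply: measurable_sum => i; apply: measurable_funM => //.
  - by move=> z; apply: sumr_ge0 => i _; rewrite mulr_ge0.
have L1 (c : R) B : 0 <= c -> measurable B ->
    (\int[P]_w (nexp (c%:E * N w B))%:E = (nexp ((1 - expR (- c))%:E * nu B))%:E)%E.
  move=> c0 mB; have := LB 1%N (fun=> c) (fun=> B) (fun=> c0) (fun=> mB).
  under eq_integral do rewrite big_ord1.
  rewrite big_ord1; apply.
  by apply/trivIsetP => i j _ _; rewrite !ord1.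
split.
- move=> B mB; rewrite -nuE// => nuf n.
  have lam0 : 0 <= fine (nu B) by exact: fine_ge0.
  have [pi [pi1 piT lapl]] := poisson_law lam0.
  rewrite -pi1.
  have mnat (f : nat -> \bar R) : measurable_fun setT f by move=> _ A mA.
  pose cE (k : nat) : \bar R := (k%:R)%:E.
  have mnE : measurable [set cE n] by exact: emeasurable_set1.
  have -> : pi [set n] = pi (cE @^-1` [set cE n]).
    congr (pi _); apply/seteqP; split => k /=; first by move=> ->.
    by move=> [/eqP]; rewrite eqr_nat => /eqP.
  apply: (@laplace_unique _ _ _ P _ _ pi (fun w => N w B) cE) => //.
  + by rewrite [X in (X < _)%E]probability_setT ltry.
  + by rewrite piT ltry.
  + exact: mN.
  + by move=> k; rewrite lee_fin.
  + move=> t t0; rewrite L1//; under [RHS]eq_integral do rewrite -EFinM nexp_EFin.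
    apply: (eq_trans _ (esym (lapl t t0))).
    have nuE' : nu B = (fine (nu B))%:E by rewrite fineK// ge0_fin_numE.
    by rewrite [in LHS]nuE' -EFinM nexp_EFin [in LHS]mulrC.
- move=> B mB; rewrite -nuE// => nuy.
  have E0 : (\int[P]_w (nexp (1%:E * N w B))%:E = 0)%E.
    rewrite L1// nuy gt0_muley// lte_fin subr_gt0 -expR0 ltr_expR; lra.
  have mE : measurable_fun setT (fun w => (nexp (1%:E * N w B))%:E).
    apply/measurable_EFinP; apply: (measurableT_comp measurable_nexp).
    by apply: measurable_funeM; exact: mN.
  have [A [mA PA0 sub]] : ae_eq P setT (fun w => (nexp (1%:E * N w B))%:E) (cst 0%E).
    apply/ae_eq_integral_abs => //; rewrite -[RHS]E0; apply: eq_integral => w _.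
    by rewrite gee0_abs// lee_fin nexp_ge0.
  have mD : measurable [set w | N w B = +oo%E] by apply: (measurable_pre (mN _ mB) (A := [set _])).
  have : P (~` [set w | N w B = +oo%E]) = 0%E.
    apply: (subset_measure0 _ mA _ PA0); first exact: measurableC.
    move=> w /= nw; apply: sub => /= /(_ I) [] /nexp_eq0 h; apply: nw.
    by rewrite -[LHS]mul1e h// mul1e.
  exact: prob_of_compl0.
- move=> n B A mB mA tB.
  have NB0 i w : (0 <= N w (B i))%E by [].
  have := @indep_of_laplace _ _ _ P _ (index_enum 'I_n) (fun i w => N w (B i))
    (index_enum_uniq _) (fun i => mN _ (mB i)) NB0 _ A mA.
  rewrite prob_bigcap; last by move=> i; exact: (measurable_pre (mN _ (mB i)) (mA i)).
  apply => t t0; rewrite LB//.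
  transitivity (\big[*%E/1%E]_(i < n) (nexp ((1 - expR (- t i))%:E * nu (B i)))%:E)%E.
    by rewrite (big_morph EFin (fun x y => EFinM x y) erefl).
  by apply: eq_bigr => i _; rewrite L1.
Qed.

(** By 1 - e^{-g-h} = (1 - e^{-g}) e^{-h} + (1 - e^{-h}), dividing by the mean of
    e^{-N(h)} leaves the functional of the intensity e^{-h} nu. *)
Lemma laplace_functional_tilt d (W : measurableType d) (P : probability W R)
    (N : R.-ker W ~> (R * R)%type) (nu nu' : {measure set (R * R) -> \bar R})
    (h : R * R -> R) (c : R) (P' : probability W R) :
  laplace_functional P N nu -> measurable_fun setT h -> (forall z, 0 <= h z) ->
  (forall g : R * R -> R, measurable_fun setT g -> (forall z, 0 <= g z)%R ->
     \int[nu']_z (g z)%:E = \int[nu]_z (g z * expR (- h z))%:E)%E ->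
  0 < c -> (\int[P]_w (nexp (\int[N w]_z (h z)%:E))%:E)%E = c%:E ->
  (forall f : W -> \bar R, measurable_fun setT f -> (forall x, 0 <= f x)%E ->
     \int[P']_w f w = c^-1%:E * \int[P]_w (f w * (nexp (\int[N w]_z (h z)%:E))%:E))%E ->
  laplace_functional P' N nu'.
Proof.
move=> L mh h0 nu'E c0 cE P'E g mg g0.
have mN (f : R * R -> R) : measurable_fun setT f -> (forall z, 0 <= f z) ->
    measurable_fun setT (fun w => nexp (\int[N w]_z (f z)%:E)%E).
  move=> mf f0; apply: (measurableT_comp measurable_nexp).
  exact: measurable_ker_integral.
have ig0 (m : {measure set (R * R) -> \bar R}) (f : R * R -> R) : (forall z, 0 <= f z) -> (0 <= \int[m]_z (f z)%:E)%E.
  by move=> f0; apply: integral_ge0 => z _; rewrite lee_fin.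
rewrite P'E; last 2 first.
- by apply/measurable_EFinP; exact: mN.
- by move=> w; rewrite lee_fin nexp_ge0.
transitivity (c^-1%:E * \int[P]_w (nexp (\int[N w]_z (g z + h z)%:E))%:E)%E.
  congr (_ * _)%E; apply: eq_integral => w _; rewrite -EFinM -nexpD ?ig0//.
  congr (nexp _)%:E; under [RHS]eq_integral do rewrite EFinD.
  rewrite ge0_integralD//.
  - by move=> z _; rewrite lee_fin.
  - exact/measurable_EFinP.
  - by move=> z _; rewrite lee_fin.
  - exact/measurable_EFinP.
have gh0 z : 0 <= g z + h z by rewrite addr_ge0.
rewrite L//; last exact: measurable_funD.
have s1 z : 0 <= 1 - expR (- g z) by exact: one_sub_expRN_ge0.
have s2 z : 0 <= 1 - expR (- h z) by exact: one_sub_expRN_ge0.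
have s3 z : 0 <= (1 - expR (- g z)) * expR (- h z) by rewrite mulr_ge0// expR_ge0.
have meh : measurable_fun setT (fun z => expR (- h z)).
  by apply: measurableT_comp => //; exact: measurableT_comp.
have -> : (\int[nu]_z (1 - expR (- (g z + h z)))%:E =
    \int[nu]_z ((1 - expR (- g z)) * expR (- h z))%:E + \int[nu]_z (1 - expR (- h z))%:E)%E.
  rewrite -ge0_integralD//.
  - apply: eq_integral => z _; rewrite -EFinD opprD expRD; congr (_%:E); ring.
  - by move=> z _; rewrite lee_fin.
  - by apply/measurable_EFinP; apply: measurable_funM => //; exact: measurable_one_sub.
  - by move=> z _; rewrite lee_fin.
  - by apply/measurable_EFinP; exact: measurable_one_sub.
rewrite nexpD ?ig0// -nu'E//; last exact: measurable_one_sub.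
have : (nexp (\int[nu]_z (1 - expR (- h z))%:E)%E) = c by apply: EFin_inj; rewrite -L.
by move=> ->; rewrite -EFinM mulrC mulfK// gt_eqF.
Qed.

End poisson.

(** * Extended gamma processes *)

Section extended_gamma_laplace.
Context {R : realType}.
Implicit Types (beta : R -> R) (alpha : {finite_measure set R -> \bar R}).

(** Off the exceptional set D the preimage of an open set is a neighbourhood of
    each of its points, and D itself is countable. *)
Lemma measurable_continuous_off (D : set R) (g : R -> R) : countable D ->
  (forall x, ~ D x -> {for x, continuous g}) -> measurable_fun setT g.
Proof.
move=> cD gcont; have mD := measurable_countable cD.
apply: (measurability _ ray_generates) => _ [_ [a ->] <-]; rewrite setTI.
rewrite -setCitvr preimage_setC; apply: measurableC; set A := (X in measurable X).
rewrite (_ : A = (A `&` D) `|` (A° `\` D)).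
  apply: measurableU; first by apply: measurable_countable; apply: sub_countable cD; exact/subset_card_le.
  by apply: measurableD => //; apply: open_measurable; exact: open_interior.
apply/seteqP; split => x; last by move=> [[]//|[/interior_subset]].
move=> Ax; have [Dx|nDx] := pselect (D x); [by left|right; split => //].
have nb : nbhs (g x) `]a, +oo[%classic by apply: open_nbhs_nbhs; split => //; exact: interval_open.
exact: (gcont x nDx _ nb).
Qed.

Lemma measurable_piecewise_continuous (g : R -> R) :
  piecewise_continuous g -> measurable_fun setT g.
Proof.
move=> [D [Dfin gcont _]]; apply: (measurable_continuous_off (D := D)) => //.
rewrite (_ : D = \bigcup_n (D `&` `[- (n%:R : R), n%:R]%classic)).
  by apply: bigcup_countable => // n _; exact: finite_set_countable.
apply/seteqP; split => [x Dx|x [n _ []]//].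
exists (Num.bound `|x|) => //; split => //=.
by rewrite in_itv/= -ler_norml ltW// archi_boundP.
Qed.

Lemma measurable_invr : measurable_fun setT (@GRing.inv R).
Proof.
apply: (measurable_continuous_off (D := [set 0])) => // x /= /eqP x0.
exact: inv_continuous.
Qed.

Definition gamma_density beta (z : R * R) : R :=
  (0 < z.2)%R%:R * (expR (- (beta z.1 * z.2)) / z.2).

Lemma gamma_density_ge0 beta z : 0 <= gamma_density beta z.
Proof.
rewrite /gamma_density; have [z0|] := ltP 0 z.2; last by rewrite mul0r.
by rewrite mul1r divr_ge0// ?expR_ge0// ltW.
Qed.

Lemma measurable_pos2 : measurable_fun setT (fun z : R * R => (0 < z.2)%R%:R : R).
Proof.
rewrite (_ : (fun z => _) = \1_[set z : R * R | 0 < z.2]).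
  apply: measurable_indic.
  rewrite (_ : [set _ | _] = snd @^-1` `]0, +oo[%classic); first exact: measurable_pre.
  by apply/seteqP; split => z /=; rewrite in_itv/= andbT.
apply/funext => z; rewrite indicE; congr (_%:R); congr nat_of_bool.
by apply/idP/idP; rewrite inE.
Qed.

Lemma measurable_gamma_density beta : measurable_fun setT beta ->
  measurable_fun setT (gamma_density beta).
Proof.
move=> mb; apply: measurable_funM; first exact: measurable_pos2.
apply: measurable_funM.
  apply: measurableT_comp => //; apply: measurableT_comp => //.
  by apply: measurable_funM => //; exact: (measurableT_comp mb).
exact: (measurableT_comp measurable_invr).
Qed.

(** [gamma_intensity] is a function of sets; integrals against it need a measure. *)
Lemma gamma_measure alpha beta : measurable_fun setT beta ->
  exists nu : {measure set (R * R) -> \bar R},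
    (forall B, measurable B -> nu B = gamma_intensity alpha beta B) /\
    (forall f : R * R -> \bar R, measurable_fun setT f -> (forall z, 0 <= f z)%E ->
      \int[nu]_z f z =
      \int[alpha]_x \int[leb]_v (f (x, v) * (gamma_density beta (x, v))%:E))%E.
Proof.
move=> mb; have mg := measurable_gamma_density mb.
have g0 := gamma_density_ge0 beta.
have [nu [nuE inu]] := density_measure (alpha \x leb)%E mg g0.
have key (f : R * R -> \bar R) : measurable_fun setT f -> (forall z, 0 <= f z)%E ->
    (\int[nu]_z f z =
     \int[alpha]_x \int[leb]_v (f (x, v) * (gamma_density beta (x, v))%:E))%E.
  move=> mf f0; rewrite inu//.
  rewrite (fubini_tonelli1 (fun z => f z * (gamma_density beta z)%:E)%E)//.
  - by apply: emeasurable_funM => //; exact/measurable_EFinP.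
  - by move=> z; rewrite mule_ge0// lee_fin.
exists nu; split => // B mB.
have -> : (nu B = \int[nu]_z (\1_B z)%:E)%E by rewrite integral_indic// setIT.
rewrite key; last 2 first.
- by apply/measurable_EFinP; exact: measurable_indic.
- by move=> z; rewrite lee_fin.
apply: eq_integral => x _.
rewrite integral_leb//; last 2 first.
- apply: measurable_funTS; apply/measurable_EFinP; apply: measurable_funM.
    by apply: (measurableT_comp (measurable_indic mB)); exact: measurable_pair1.
  apply: measurable_funM; last exact: measurable_invr.
  by apply: measurableT_comp => //; apply: measurableT_comp => //; apply: measurable_funM.
- move=> v; rewrite /= in_itv/= andbT => v0.
  by rewrite lee_fin !mulr_ge0 ?expR_ge0// invr_ge0 ltW.
rewrite [RHS]integral_setE; apply: eq_integral => v _.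
rewrite -!EFinM /gamma_density/= [X in _ = (_ * X)%:E]indicE; congr (_%:E).
rewrite (_ : (v \in `]0, +oo[%classic) = (0 < v)); first by ring.
by apply/idP/idP; rewrite inE /= in_itv/= andbT.
Qed.


(** ** Laplace functional *)

(** The value at the atom z = (x, v) of the functional v theta(x), on v > 0. *)
Definition lift_fun (theta : R -> R) (z : R * R) : R := theta z.1 * Num.max 0 z.2.

Lemma lift_fun_ge0 theta z : (forall x, 0 <= theta x) -> 0 <= lift_fun theta z.
Proof. by move=> t0; rewrite mulr_ge0// le_max lexx. Qed.

Lemma measurable_lift_fun theta : measurable_fun setT theta ->
  measurable_fun setT (lift_fun theta).
Proof.
move=> mt; apply: measurable_funM; first exact: (measurableT_comp mt).
exact: measurable_maxr.
Qed.

(** The path s |-> sum of the v over the atoms (x, v) with x <= s integrates theta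
    to the sum of the v theta(x). *)
Lemma integral_path_of_atoms (m : {measure set (R * R) -> \bar R}) (Y : iap_path R)
    (theta : R -> R) : measurable_fun setT theta -> (forall x, 0 <= theta x) ->
  (forall s : R, (Y s)%:E = (\int[m]_(z in `]-oo, s] `*` `]0%R, +oo[) (z.2)%:E)%E) ->
  (\int[LS Y]_s (theta s)%:E = \int[m]_z (lift_fun theta z)%:E)%E.
Proof.
move=> mt t0 Ys.
have mpos : measurable_fun setT (fun z : R * R => Num.max 0 z.2) by exact: measurable_maxr.
have pos0 (z : R * R) : 0 <= Num.max 0 z.2 by rewrite le_max lexx.
have [m' [m'E im']] := density_measure m mpos pos0.
have mf : measurable_fun setT (fun z : R * R => z.1) by exact: measurable_fst.
have LSE A : measurable A -> LS Y A = pushforward m' fst A.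
  move: A; apply: LS_unique => s; rewrite /= /pushforward m'E; last exact: measurable_pre.
  rewrite Ys [LHS]integral_setE [RHS]integral_setE.
  apply: eq_integral => z _; rewrite !indicE -!EFinM; congr (_%:E).
  have -> : (z \in `]-oo, s] `*` `]0, +oo[) = ((z \in fst @^-1` ray s) && (0 < z.2)).
    apply/idP/idP => [/set_mem[/= h1]|/andP[/set_mem h1 h2]].
      by rewrite in_itv/= andbT => ->; rewrite andbT; exact/mem_set.
    by apply/mem_set; split => //=; rewrite in_itv/= andbT.
  have [z0|z0] := ltP 0 z.2; first by rewrite andbT.
  by rewrite andbF mulr0 mul0r.
transitivity (\int[pushforward m' fst]_s (theta s)%:E)%E.
  by apply: eq_measure_integral => A mA _; exact: LSE.
rewrite ge0_integral_pushforward//; last 2 first.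
- exact/measurable_EFinP.
- by move=> y _; rewrite lee_fin.
rewrite im'.
- by apply: eq_integral => z _; rewrite -EFinM.
- by apply/measurable_EFinP; exact: (measurableT_comp mt).
- by move=> z; rewrite lee_fin.
Qed.

Lemma measurable_path_integral d (T : measurableType d) (X : T -> iap_path R)
    (theta : R -> R) : measurable_fun setT X ->
  measurable_fun setT theta -> (forall x, 0 <= theta x) ->
  measurable_fun setT (fun w => \int[LS (X w)]_s (theta s)%:E)%E.
Proof.
move=> mX mt t0; apply: (measurable_integral_LS mX (h := fun z => (theta z.2)%:E)).
  by apply/measurable_EFinP; exact: (measurableT_comp mt).
by move=> z; rewrite lee_fin.
Qed.

Lemma path_integral_ge0 (X : iap_path R) (theta : R -> R) :
  (forall x, 0 <= theta x) -> (0 <= \int[LS X]_s (theta s)%:E)%E.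
Proof. by move=> t0; apply: integral_ge0 => s _; rewrite lee_fin. Qed.

Lemma measurable_nexp_path d (T : measurableType d) (X : T -> iap_path R)
    (theta : R -> R) : measurable_fun setT X ->
  measurable_fun setT theta -> (forall x, 0 <= theta x) ->
  measurable_fun setT (fun w => nexp (\int[LS (X w)]_s (theta s)%:E)%E).
Proof.
by move=> mX mt t0; apply: (measurableT_comp measurable_nexp); exact: measurable_path_integral.
Qed.

Lemma path_integralD (X : iap_path R) (a b : R -> R) :
  measurable_fun setT a -> measurable_fun setT b ->
  (forall x, 0 <= a x) -> (forall x, 0 <= b x) ->
  (\int[LS X]_s (a s + b s)%:E =
   \int[LS X]_s (a s)%:E + \int[LS X]_s (b s)%:E)%E.
Proof.
move=> ma mb a0 b0; under eq_integral do rewrite EFinD.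
by rewrite ge0_integralD//; do ?[exact/measurable_EFinP|move=> s _; rewrite lee_fin].
Qed.

Lemma nexp_pathD (X : iap_path R) (a b : R -> R) :
  measurable_fun setT a -> measurable_fun setT b ->
  (forall x, 0 <= a x) -> (forall x, 0 <= b x) ->
  nexp (\int[LS X]_s (a s + b s)%:E)%E =
  nexp (\int[LS X]_s (a s)%:E)%E * nexp (\int[LS X]_s (b s)%:E)%E.
Proof.
move=> ma mb a0 b0; rewrite path_integralD//.
by apply: nexpD; exact: path_integral_ge0.
Qed.

(** Up to its law the path is an image of a Poisson random measure, whose functional
    is known. *)
Lemma extended_gamma_laplace d (Om : measurableType d) (P : probability Om R)
    (X : Om -> iap_path R) alpha beta (nu : {measure set (R * R) -> \bar R})
    (theta : R -> R) :
  (forall B, measurable B -> nu B = gamma_intensity alpha beta B) ->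
  extended_gamma P X alpha beta ->
  measurable_fun setT theta -> (forall x, 0 <= theta x) ->
  (\int[P]_w (nexp (\int[LS (X w)]_s (theta s)%:E))%:E =
   (nexp (\int[nu]_z (1 - expR (- lift_fun theta z))%:E))%:E)%E.
Proof.
move=> nuE [[mX _] [d' [W [P' [N [Y [prm mY Yae law]]]]]]] mt t0.
have ml := measurable_lift_fun mt.
have l0 z := lift_fun_ge0 z t0.
rewrite -(prm_laplace nuE prm)//.
have mF : measurable_fun setT (fun Z : iap_path R => (nexp (\int[LS Z]_s (theta s)%:E)%E)%:E).
  by apply/measurable_EFinP; exact: (@measurable_nexp_path _ _ id).
rewrite (eq_law_integral mX mY law mF); last by move=> y; rewrite lee_fin nexp_ge0.
apply: ge0_ae_eq_integral => //.
- exact: (measurableT_comp mF mY).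
- apply/measurable_EFinP; apply: (measurableT_comp measurable_nexp).
  exact: measurable_ker_integral.
- by move=> w _; rewrite lee_fin nexp_ge0.
- by move=> w _; rewrite lee_fin nexp_ge0.
apply: filterS Yae => w Yw _ /=; congr (nexp _)%:E.
exact: integral_path_of_atoms.
Qed.

(** A multiplicative Laplace functional means independent increments, since the
    increments are the masses of disjoint intervals. *)
Lemma increasing_additive_of_laplace d (Om : measurableType d) (P : probability Om R)
    (X : Om -> iap_path R) : measurable_fun setT X ->
  (forall a b : R -> R, measurable_fun setT a -> measurable_fun setT b ->
    (forall x, 0 <= a x)%R -> (forall x, 0 <= b x)%R ->
    (forall x, a x * b x = 0)%R ->
    \int[P]_w (nexp (\int[LS (X w)]_s (a s + b s)%:E))%:E =
    \int[P]_w (nexp (\int[LS (X w)]_s (a s)%:E))%:E *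
    \int[P]_w (nexp (\int[LS (X w)]_s (b s)%:E))%:E)%E ->
  increasing_additive P X.
Proof.
move=> mX mult; split => // n s sh A B mA mB /=.
pose I (i : nat) : set R := if i is j.+1 then `]s j, s i]%classic else ray (s 0%N).
pose D (i : nat) w : R := if i is j.+1 then X w (s i) - X w (s j) else X w (s 0%N).
have mI i : measurable (I i) by case: i => *; exact: measurable_itv.
have Isub i x : I i x -> x <= s i.
  by case: i => [|i]; rewrite /I/= in_itv/= => // /andP[].
have Ilow i j x : (i < j)%N -> I j x -> s i < x.
  case: j => // j ij; rewrite /I/= in_itv/= => /andP[+ _].
  by apply: le_lt_trans; exact: sh.
have Idisj i j x : i != j -> I i x -> I j x -> False.
  rewrite neq_ltn => /orP[] ij Ii Ij.
    by have := Ilow _ _ _ ij Ij; rewrite ltNge (Isub _ _ Ii).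
  by have := Ilow _ _ _ ij Ii; rewrite ltNge (Isub _ _ Ij).
have DE i w : LS (X w) (I i) = (D i w)%:E.
  by case: i => [|i]; rewrite /I/D ?LS_ray// LS_oc// sh.
have mL i : measurable_fun setT (fun w => LS (X w) (I i)).
  by apply: (measurableT_comp (measurable_LS (mI i))).
have ind0 i x : 0 <= \1_(I i) x :> R by have /andP[] := indic01 (R := R) (I i) x.
have intI (c : R) i w : 0 <= c ->
    (\int[LS (X w)]_x (c * \1_(I i) x)%:E = c%:E * LS (X w) (I i))%E.
  move=> c0; under eq_integral do rewrite EFinM.
  rewrite ge0_integralZl ?lee_fin//; last by apply/measurable_EFinP; exact: measurable_indic.
  by rewrite integral_indic// setIT.
have key (t : 'I_n.+1 -> R) : (forall i, 0 <= t i) -> forall r : seq 'I_n.+1, uniq r ->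
    (\int[P]_w (\prod_(i <- r) nexp ((t i)%:E * LS (X w) (I i)))%:E =
     \big[*%E/1%E]_(i <- r) \int[P]_w (nexp ((t i)%:E * LS (X w) (I i)))%:E)%E.
  move=> t0.
  pose th (r : seq 'I_n.+1) x : R := \sum_(i <- r) t i * \1_(I i) x.
  have mth r : measurable_fun setT (th r).
    by apply: measurable_sum => i; apply: measurable_funM.
  have th0 r x : 0 <= th r x by apply: sumr_ge0 => i _; rewrite mulr_ge0.
  have prodE r w : (\prod_(i <- r) nexp ((t i)%:E * LS (X w) (I i))%E =
      nexp (\int[LS (X w)]_x (th r x)%:E)%E).
    elim: r => [|i r ih].
      by rewrite big_nil /th; under eq_integral do rewrite big_nil; rewrite integral0 nexp0.
    rewrite big_cons ih -intI//; rewrite -nexpD ?path_integral_ge0//; last by move=> x; rewrite mulr_ge0.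
    rewrite -path_integralD//; last 2 first.
    - by apply: measurable_funM.
    - by move=> x; rewrite mulr_ge0.
    by congr (nexp _); apply: eq_integral => x _; rewrite /th big_cons.
  elim=> [_|i r ih /= /andP[ir ur]].
    by rewrite big_nil; under eq_integral do rewrite big_nil; exact: prob_cst.
  rewrite big_cons -ih//.
  transitivity (\int[P]_w (nexp (\int[LS (X w)]_x (t i * \1_(I i) x + th r x)%:E))%:E)%E.
    apply: eq_integral => w _; rewrite prodE; congr (nexp _)%:E.
    by apply: eq_integral => x _; rewrite /th big_cons.
  rewrite mult//.
  - congr (_ * _)%E; apply: eq_integral => w _; first by rewrite intI.
    by rewrite prodE.
  - by apply: measurable_funM.
  - by move=> x; rewrite mulr_ge0.
  - move=> x; have [Iix|nIi] := pselect (I i x); last by rewrite [X in _ * X * _]indicE memNset// mulr0 mul0r.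
    rewrite /th big1_seq ?mulr0// => j /andP[_ jr].
    rewrite [X in _ * X]indicE memNset ?mulr0// => Ijx.
    by apply: (@Idisj i j x) => //; apply: contraNneq ir => /val_inj ->.
pose C (i : 'I_n.+1) : set (\bar R) := EFin @` (if unlift ord0 i is Some k then B k else A).
have mC i : measurable (C i) by apply: measurable_image_EFin; case: unlift.
have L0 (i : 'I_n.+1) w : (0 <= LS (X w) (I i))%E by [].
have E0 : (fun w => LS (X w) (I (@ord0 n))) @^-1` C ord0 = [set w | A (X w (s 0%N))].
  apply/seteqP; split => w /=; rewrite LS_ray /C unlift_none.
    by move=> [x Ax [<-]].
  by move=> Ax; exists (X w (s 0%N)).
have ES (i : 'I_n) : (fun w => LS (X w) (I (lift ord0 i))) @^-1` C (lift ord0 i) =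
    [set w | B i (X w (s i.+1) - X w (s i))].
  have -> : (fun w => LS (X w) (I (lift ord0 i))) = fun w => (X w (s i.+1) - X w (s i))%:E.
    by apply/funext => w; rewrite DE.
  apply/seteqP; split => w /=; rewrite /C liftK.
    by move=> [x Ax [<-]].
  by move=> Ax; exists (X w (s i.+1) - X w (s i)).
have H := indep_of_laplace (index_enum_uniq 'I_n.+1) (fun i : 'I_n.+1 => mL i) L0
  (fun t t0 => key t t0 _ (index_enum_uniq _)) mC.
move: H; rewrite [RHS]big_ord_recl E0.
under [X in _ = (_ * X)%E -> _]eq_bigr do rewrite ES.
move=> <-.
have mD0 : measurable [set w | A (X w (s 0%N))].
  by rewrite -E0; exact: (measurable_pre (mL _)).
have mDi (i : 'I_n) : measurable [set w | B i (X w (s i.+1) - X w (s i))].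
  by rewrite -ES; exact: (measurable_pre (mL _)).
set F := (X in P X).
have mF : measurable F by apply: measurableI => //; apply: fin_bigcap_measurable.
have -> : (P F = \int[P]_w (\1_F w)%:E)%E by rewrite integral_indic// setIT.
apply: eq_integral => w _; congr (_%:E).
rewrite /F indicI/= indic_bigcap_ord big_ord_recl; congr (_ * _).
  by rewrite -E0.
by apply: eq_bigr => i _; rewrite -ES.
Qed.


(** For functions with disjoint supports the integrands add up pointwise. *)
Lemma lift_laplaceD (nu : {measure set (R * R) -> \bar R}) (a b : R -> R) :
  measurable_fun setT a -> measurable_fun setT b ->
  (forall x, 0 <= a x) -> (forall x, 0 <= b x) -> (forall x, a x * b x = 0) ->
  nexp (\int[nu]_z (1 - expR (- lift_fun (fun x => a x + b x) z))%:E)%E =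
  nexp (\int[nu]_z (1 - expR (- lift_fun a z))%:E)%E *
  nexp (\int[nu]_z (1 - expR (- lift_fun b z))%:E)%E.
Proof.
move=> ma mb a0 b0 ab.
have s0 (c : R -> R) z : (forall x, 0 <= c x) -> 0 <= 1 - expR (- lift_fun c z).
  by move=> c0; apply: one_sub_expRN_ge0; exact: lift_fun_ge0.
have ms (c : R -> R) : measurable_fun setT c ->
    measurable_fun setT (fun z => (1 - expR (- lift_fun c z))%:E).
  by move=> mc; apply/measurable_EFinP; apply: measurable_one_sub; exact: measurable_lift_fun.
rewrite -nexpD; do ?by apply: integral_ge0 => z _; rewrite lee_fin s0.
rewrite -ge0_integralD//; do ?[exact: ms|by move=> z _; rewrite lee_fin s0].
congr (nexp _); apply: eq_integral => z _; rewrite -EFinD; congr (_%:E).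
have := ab z.1; rewrite /lift_fun => /eqP; rewrite mulf_eq0 => /orP[] /eqP ->.
  by rewrite add0r mul0r oppr0 expR0 subrr add0r.
by rewrite addr0 mul0r oppr0 expR0 subrr addr0.
Qed.

(** The weight e^{-int h dX} is e^{-N(lift_fun h)} for the underlying Poisson random
    measure N: its intensity is multiplied by e^{-h(x) v}, and e^{-beta(x) v} becomes
    e^{-(beta(x) + h(x)) v}. *)
Lemma extended_gamma_tilt d (Om : measurableType d) (P P' : probability Om R)
    (X : Om -> iap_path R) alpha beta (h : R -> R) (c : R) :
  measurable_fun setT beta -> extended_gamma P X alpha beta ->
  measurable_fun setT h -> (forall x, 0 <= h x) -> 0 < c ->
  (\int[P]_w (nexp (\int[LS (X w)]_s (h s)%:E))%:E = c%:E)%E ->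
  (forall f : Om -> \bar R, measurable_fun setT f -> (forall x, 0 <= f x)%E ->
     \int[P']_w f w =
     c^-1%:E * \int[P]_w (f w * (nexp (\int[LS (X w)]_s (h s)%:E))%:E))%E ->
  extended_gamma P' X alpha (fun x => beta x + h x).
Proof.
move=> mb eg mh h0 c0 cE P'E.
have mbh : measurable_fun setT (fun x => beta x + h x) by exact: measurable_funD.
have [nu [nuE inu]] := gamma_measure alpha mb.
have [nu' [nu'E inu']] := gamma_measure alpha mbh.
have lap := extended_gamma_laplace nuE eg.
have [[mX _] [d' [W [PW [N [Y [prm mY Yae law]]]]]]] := eg.
have mlh := measurable_lift_fun mh.
have lh0 z := lift_fun_ge0 z h0.
have inu'' (g : R * R -> R) : measurable_fun setT g -> (forall z, 0 <= g z)%R ->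
    (\int[nu']_z (g z)%:E = \int[nu]_z (g z * expR (- lift_fun h z))%:E)%E.
  move=> mg g0; rewrite inu' ?inu.
  - apply: eq_integral => x _; apply: eq_integral => v _; rewrite -!EFinM; congr (_%:E).
    rewrite /gamma_density/= /lift_fun/=; have [v0|_] := ltP 0 v; last by rewrite !mul0r !mulr0.
    rewrite -mulrA mulrDl opprD expRD; ring.
  - by apply/measurable_EFinP; apply: measurable_funM => //; apply: measurableT_comp => //; exact: measurableT_comp.
  - by move=> z; rewrite lee_fin mulr_ge0// expR_ge0.
  - exact/measurable_EFinP.
  - by move=> z; rewrite lee_fin.
have L := prm_laplace nuE prm.
have mw : measurable_fun setT (fun w => nexp (\int[N w]_z (lift_fun h z)%:E)%E).
  by apply: (measurableT_comp measurable_nexp); exact: measurable_ker_integral.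
have w0 w : 0 <= nexp (\int[N w]_z (lift_fun h z)%:E)%E by exact: nexp_ge0.
have cN : (\int[PW]_w (nexp (\int[N w]_z (lift_fun h z)%:E))%:E = c%:E)%E.
  by rewrite L// -cE lap.
have [PW' [PW'E iPW']] := tilted_probability mw w0 c0 cN.
split.
  apply: increasing_additive_of_laplace => // a b ma mb' a0 b0 ab.
  have tl (e : R -> R) : measurable_fun setT e -> (forall x, 0 <= e x) ->
      (\int[P']_w (nexp (\int[LS (X w)]_s (e s)%:E))%:E =
       (nexp (\int[nu']_z (1 - expR (- lift_fun e z))%:E))%:E)%E.
    move=> me e0; rewrite P'E; last 2 first.
    - by apply/measurable_EFinP; exact: measurable_nexp_path.
    - by move=> w; rewrite lee_fin nexp_ge0.
    transitivity (c^-1%:E * \int[P]_w (nexp (\int[LS (X w)]_s (e s + h s)%:E))%:E)%E.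
      congr (_ * _)%E; apply: eq_integral => w _.
      by rewrite nexp_pathD.
    rewrite lap//; last 2 first.
    - exact: measurable_funD.
    - by move=> x; rewrite addr_ge0.
    have LT := laplace_functional_tilt L mlh lh0 inu'' c0 cN iPW'.
    rewrite -(LT (lift_fun e)) ?iPW'.
    - congr (_ * _)%E; rewrite -L.
      + apply: eq_integral => w _; rewrite -EFinM -nexpD.
        * congr (nexp _)%:E; rewrite -ge0_integralD//.
          - by apply: eq_integral => z _; rewrite -EFinD /lift_fun mulrDl.
          - by move=> z _; rewrite lee_fin lift_fun_ge0.
          - by apply/measurable_EFinP; exact: measurable_lift_fun.
          - by move=> z _; rewrite lee_fin lift_fun_ge0.
          - by apply/measurable_EFinP; exact: measurable_lift_fun.
        * by apply: integral_ge0 => z _; rewrite lee_fin lift_fun_ge0.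
        * by apply: integral_ge0 => z _; rewrite lee_fin lift_fun_ge0.
      + by apply: measurable_lift_fun; exact: measurable_funD.
      + by move=> z; apply: lift_fun_ge0 => x; rewrite addr_ge0.
    - apply/measurable_EFinP; apply: (measurableT_comp measurable_nexp).
      apply: measurable_ker_integral; first exact: measurable_lift_fun.
      by move=> z; exact: lift_fun_ge0.
    - by move=> w; rewrite lee_fin nexp_ge0.
    - exact: measurable_lift_fun.
    - by move=> z; exact: lift_fun_ge0.
  rewrite !tl//; last 2 first.
  - exact: measurable_funD.
  - by move=> x; rewrite addr_ge0.
  by rewrite lift_laplaceD// EFinM.
exists d', W, PW', N, Y; split; [|exact: mY| |].
- apply: (laplace_prm nu'E).
  exact: (laplace_functional_tilt L mlh lh0 inu'' c0 cN iPW').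
- have [A [mA PA0 sub]] := Yae; exists A; split; [exact: mA| |exact: sub].
  rewrite PW'E//; apply/eqP; rewrite mule_eq0; apply/orP; right; apply/eqP.
  apply: null_set_integral => //; first by apply: measurable_funTS; exact/measurable_EFinP.
- move=> E mE.
  have mEY : measurable (Y @^-1` E) by exact: measurable_pre.
  have mEX : measurable (X @^-1` E) by exact: measurable_pre.
  rewrite -(integral_indicT P' mX mE) -(integral_indicT PW' mY mE) P'E ?iPW'.
  + congr (_ * _)%E.
    pose H (Z : iap_path R) := ((\1_E Z)%:E * (nexp (\int[LS Z]_s (h s)%:E))%:E)%E.
    have mH : measurable_fun setT H.
      apply: emeasurable_funM; apply/measurable_EFinP; first exact: measurable_indic.
      exact: (@measurable_nexp_path _ _ id).
    have H0 Z : (0 <= H Z)%E by rewrite /H -EFinM lee_fin mulr_ge0// nexp_ge0.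
    rewrite (eq_law_integral mX mY law mH H0).
    apply: ge0_ae_eq_integral => //.
    * exact: (measurableT_comp mH mY).
    * apply: emeasurable_funM; apply/measurable_EFinP => //.
      exact: measurable_indicT.
    * by move=> w _; rewrite -EFinM lee_fin mulr_ge0.
    * apply: filterS Yae => w Yw _ /=; rewrite /H; congr (_ * (nexp _)%:E)%E.
      exact: integral_path_of_atoms.
  + by apply/measurable_EFinP; exact: measurable_indicT.
  + by move=> w; rewrite lee_fin.
  + by apply/measurable_EFinP; exact: measurable_indicT.
  + by move=> w; rewrite lee_fin.
Qed.

End extended_gamma_laplace.

(** * Paths: laws, jumps and independence *)

Section path_laws.
Context {R : realType}.
Local Notation path := (iap_path R).

(** Laplace transforms determine one coordinate at a time: restricting to a
    cylinder keeps the equality of the Laplace functionals. *)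
Lemma path_laplace_unique (m1 m2 : {measure set path -> \bar R}) :
  (m1 setT < +oo)%E -> (m2 setT < +oo)%E ->
  (forall theta : R -> R, measurable_fun setT theta -> (forall x, 0 <= theta x)%R ->
    \int[m1]_X (nexp (\int[LS X]_s (theta s)%:E))%:E =
    \int[m2]_X (nexp (\int[LS X]_s (theta s)%:E))%:E)%E ->
  forall E, measurable E -> m1 E = m2 E.
Proof.
move=> fin1 fin2 lap.
pose base := (R * {B : set R | measurable B})%type.
pose cyl (r : seq base) : set path :=
  foldr (fun p A => [set X : path | sval p.2 (X p.1)] `&` A) setT r.
have mbase (p : base) : measurable [set X : path | sval p.2 (X p.1)].
  by apply: (measurable_pre (measurable_eval p.1)); exact: (svalP p.2).
have mcyl r : measurable (cyl r).
  by elim: r => [|p r ih]; [exact: measurableT|apply: measurableI].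
have mnp (theta : R -> R) : measurable_fun setT theta -> (forall x, 0 <= theta x) ->
    measurable_fun setT (fun X : path => nexp (\int[LS X]_s (theta s)%:E)%E).
  by move=> mt t0; exact: (@measurable_nexp_path _ _ _ id).
have key r : forall theta : R -> R, measurable_fun setT theta -> (forall x, 0 <= theta x)%R ->
    (\int[m1]_X (\1_(cyl r) X * nexp (\int[LS X]_s (theta s)%:E))%:E =
     \int[m2]_X (\1_(cyl r) X * nexp (\int[LS X]_s (theta s)%:E))%:E)%E.
  elim: r => [|p r ih] theta mt t0.
    under eq_integral do rewrite indicT mul1r.
    by under [RHS]eq_integral do rewrite indicT mul1r; exact: lap.
  pose rho X : R := \1_(cyl r) X * nexp (\int[LS X]_s (theta s)%:E)%E.
  have mrho : measurable_fun setT rho.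
    by apply: measurable_funM; [exact: measurable_indic|exact: mnp].
  have rho0 X : 0 <= rho X by rewrite mulr_ge0 ?nexp_ge0.
  have rho1 X : rho X <= 1.
    have /andP[i0 i1] := indic01 (R := R) (cyl r) X.
    by rewrite mulr_ile1 ?nexp_ge0 ?nexp_le1 ?path_integral_ge0.
  have dens (m : {measure set path -> \bar R}) : (m setT < +oo)%E ->
      exists m' : {measure set path -> \bar R}, (m' setT < +oo)%E /\
      (forall A, measurable A -> m' A = \int[m]_(x in A) (rho x)%:E)%E /\
      (forall f : path -> \bar R, measurable_fun setT f -> (forall x, 0 <= f x)%E ->
        \int[m']_x f x = \int[m]_x (f x * (rho x)%:E))%E.
    move=> mfin; have [m' [m'E im']] := density_measure m mrho rho0.
    exists m'; split => //; rewrite m'E//.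
    apply: (@le_lt_trans _ _ (\int[m]_x 1%:E)%E); last by rewrite integral_cst// mul1e.
    apply: ge0_le_integral => //.
    - by move=> x _; rewrite lee_fin.
    - exact/measurable_EFinP.
    - by move=> x _; rewrite lee_fin.
  have [n1 [f1 [n1E in1]]] := dens _ fin1.
  have [n2 [f2 [n2E in2]]] := dens _ fin2.
  have mX : measurable_fun setT (fun X : path => (X p.1)%:E).
    by apply/measurable_EFinP; exact: measurable_eval.
  have X0 (X : path) : (0 <= (X p.1)%:E)%E by rewrite lee_fin path_ge0.
  have mp2 : measurable (sval p.2) := svalP p.2.
  have lapn (t : R) : 0 <= t ->
      (\int[n1]_x (nexp (t%:E * (x p.1)%:E))%:E = \int[n2]_x (nexp (t%:E * (x p.1)%:E))%:E)%E.
    move=> tt0; pose th' x : R := theta x + t * \1_(ray p.1) x.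
    have mth' : measurable_fun setT th'.
      by apply: measurable_funD => //; apply: measurable_funM.
    have th'0 x : 0 <= th' x by rewrite addr_ge0// mulr_ge0.
    have E (X : path) : ((nexp (t%:E * (X p.1)%:E))%:E * (rho X)%:E =
        (\1_(cyl r) X * nexp (\int[LS X]_s (th' s)%:E))%:E)%E.
      rewrite nexp_pathD//; [|by apply: measurable_funM|by move=> x; rewrite mulr_ge0].
      have -> : (\int[LS X]_s (t * \1_(ray p.1) s)%:E = t%:E * (X p.1)%:E)%E.
        under eq_integral do rewrite EFinM.
        rewrite ge0_integralZl ?lee_fin//; last by apply/measurable_EFinP; exact: measurable_indic.
        by congr (_ * _)%E; rewrite integral_indic// setIT; exact: LS_ray.
      by rewrite -EFinM /rho; congr (_%:E); ring.
    have mt' : measurable_fun setT (fun X : path => (nexp (t%:E * (X p.1)%:E))%:E).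
      apply/measurable_EFinP; apply: (measurableT_comp measurable_nexp).
      exact: measurable_funeM.
    rewrite in1//; last by move=> x; rewrite lee_fin nexp_ge0.
    rewrite in2//; last by move=> x; rewrite lee_fin nexp_ge0.
    under eq_integral do rewrite E.
    by under [RHS]eq_integral do rewrite E; exact: ih.
  have mB : measurable (EFin @` sval p.2) by exact: measurable_image_EFin.
  have preE : (fun X : path => (X p.1)%:E) @^-1` (EFin @` sval p.2) = [set X : path | sval p.2 (X p.1)].
    by apply/seteqP; split => X /=; [move=> [x Bx [<-]]|move=> BX; exists (X p.1)].
  have := laplace_unique f1 f2 mX mX X0 X0 lapn mB.
  rewrite preE n1E// n2E// integral_setE [in RHS]integral_setE => H.
  have F X : (\1_(cyl (p :: r)) X * nexp (\int[LS X]_s (theta s)%:E))%:E =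
      ((rho X)%:E * (\1_[set X : path | sval p.2 (X p.1)] X)%:E)%E.
    by rewrite /= indicI/= -EFinM /rho; congr (_%:E); ring.
  under eq_integral do rewrite F.
  by under [RHS]eq_integral do rewrite F.
have mE r : m1 (cyl r) = m2 (cyl r).
  have := key r (fun=> 0) (@measurable_cst _ _ _ _ setT (0 : R)) (fun=> lexx _).
  have F X : (\1_(cyl r) X * nexp (\int[LS X]_s 0%:E))%:E = (\1_(cyl r) X)%:E :> \bar R.
    by rewrite integral0 nexp0 mulr1.
  under eq_integral do rewrite F.
  under [RHS]eq_integral do rewrite F.
  by rewrite !integral_indic// !setIT.
move=> E mEE.
pose G : set (set path) := [set A | exists r, A = cyl r].
have cylI r1 r2 : cyl (r1 ++ r2) = cyl r1 `&` cyl r2.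
  by elim: r1 => [|p r1 ih]; rewrite /= ?setTI// ih setIA.
have Ggen : measurable = <<s G >>.
  apply/seteqP; split.
    apply: smallest_sub; first exact: smallest_sigma_algebra.
    move=> _ [t [B mB ->]]; apply: sub_sigma_algebra.
    by exists [:: (t, exist _ B mB)]; rewrite /= setIT.
  apply: smallest_sub; first exact: sigma_algebra_measurable.
  by move=> _ [r ->]; exact: mcyl.
have GI : setI_closed G by move=> _ _ [r1 ->] [r2 ->]; exists (r1 ++ r2); rewrite cylI.
have GT : forall i : nat, G setT by move=> _; exists [::].
apply: (@measure_unique _ _ _ _ (fun=> setT) Ggen GI GT _ m1 m2) => //.
- by rewrite bigcup_const//; exists 0%N.
- by move=> _ [r ->].
Qed.

End path_laws.

(** ** Fixed atoms *)

Section fixed_atoms.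
Context {R : realType} d (Om : measurableType d).
Variables (P : probability Om R) (L : Om -> iap_path R) (M : set R).
Hypotheses (mL : measurable_fun setT L) (cM : countable M).

Definition indep_jumps (Xc : Om -> iap_path R) : Prop :=
  forall (n : nat) (tau : 'I_n -> R) (B : 'I_n -> set R) (E : set (iap_path R)),
  injective tau -> (forall i, M (tau i)) ->
  (forall i, measurable (B i)) -> measurable E ->
  let J (i : 'I_n) := [set w | B i (jump (L w) (tau i))] in
  (P (\bigcap_(i in [set: 'I_n]) J i `&` Xc @^-1` E) =
   \big[*%E/1%E]_(i < n) P (J i) * P (Xc @^-1` E))%E.

Let mJ tau : measurable_fun setT (fun w => jump (L w) tau).
Proof. by apply: measurable_jump => //; exact: measurable_cst. Qed.

Lemma indep_jumps_fun (Xc : Om -> iap_path R) (s : seq R) (g : R -> R -> R)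
    (G : iap_path R -> R) (C : R) : measurable_fun setT Xc ->
  indep_jumps Xc -> uniq s -> (forall tau, tau \in s -> M tau) ->
  (forall tau, measurable_fun setT (g tau)) -> measurable_fun setT G ->
  (forall tau y, 0 <= g tau y <= C) -> (forall X, 0 <= G X <= C) ->
  (\int[P]_w (\prod_(tau <- s) g tau (jump (L w) tau) * G (Xc w))%:E =
   \big[*%E/1%E]_(tau <- s) \int[P]_w (g tau (jump (L w) tau))%:E *
   \int[P]_w (G (Xc w))%:E)%E.
Proof.
move=> mXc ind us sM mg mG g0 G0.
apply: (indep_functions us mJ mXc _ mg mG g0 G0) => A E mA mE.
pose t := in_tuple s.
have := ind (size s) (tnth t) (fun j => A (tnth t j)) E.
have /tuple_uniqP inj : uniq t by [].
move=> /(_ inj (fun i => sM _ (mem_tnth i t)) (fun j => mA _) mE) /= H.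
rewrite [in RHS]big_tnth -/t -[RHS]H.
set F := (X in P X); have mF : measurable F.
  apply: measurableI; last exact: measurable_pre.
  by apply: fin_bigcap_measurable => // i _; exact: (measurable_pre (mJ _)).
have -> : (P F = \int[P]_w (\1_F w)%:E)%E by rewrite integral_indic// setIT.
apply: eq_integral => w _; congr (_%:E).
by rewrite /F indicI/= indic_bigcap_ord big_tnth.
Qed.

End fixed_atoms.

Section atoms_limit.
Context {R : realType}.
Variables (M : set R) (s_ : nat -> seq R).
Hypotheses (cM : countable M) (us : forall n, uniq (s_ n))
  (nds : forall m n, (m <= n)%N -> {subset s_ m <= s_ n})
  (sM : forall tau, M tau <-> exists n, tau \in s_ n).

Lemma path_integral_atoms (X : iap_path R) (g : R -> \bar R) :
  measurable_fun setT g -> (forall x, 0 <= g x)%E ->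
  (\int[LS X]_s g s = \int[LS X]_(s in M) g s + \int[LS (contpart M X)]_s g s)%E.
Proof.
move=> mg g0; have mM := measurable_countable cM.
rewrite integral_contpart// -ge0_integral_setU//; first by rewrite setUv.
- exact: measurableC.
- by rewrite setUv.
- by apply/disj_setPS; rewrite setICr.
Qed.

(** The fixed atoms, possibly infinitely many, are reached through this limit of
    products over finitely many of them. *)
Lemma jumps_path_cvg (X : iap_path R) (theta : R -> R) :
  measurable_fun setT theta -> (forall x, 0 <= theta x) ->
  \prod_(tau <- s_ n) expR (- (theta tau * jump X tau)) *
    nexp (\int[LS (contpart M X)]_s (theta s)%:E)%E @[n --> \oo] -->
  nexp (\int[LS X]_s (theta s)%:E)%E.
Proof.
move=> mt t0; have mt' : measurable_fun setT (EFin \o theta) by exact/measurable_EFinP.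
have t0' x : (0 <= (EFin \o theta) x)%E by rewrite lee_fin.
have i0 (m : {measure set R -> \bar R}) D : (0 <= \int[m]_(s in D) (theta s)%:E)%E.
  by apply: integral_ge0 => s _; rewrite lee_fin.
have E : nexp (\int[LS X]_s (theta s)%:E)%E = nexp (\int[LS X]_(s in M) (theta s)%:E)%E *
    nexp (\int[LS (contpart M X)]_s (theta s)%:E)%E.
  by rewrite [in LHS]path_integral_atoms// nexpD.
rewrite [X in _ --> X]E; apply: cvgM; last exact: cvg_cst.
have := seqset_cvg (m := LS X) mt' t0' us nds sM.
move=> /(cvg_nexp _) H.
rewrite (_ : (fun n => _) = (fun n => nexp (\sum_(tau <- s_ n) (EFin \o theta) tau * LS X [set tau])%E)).
  by apply: H => n; apply: sume_ge0 => tau _; rewrite mule_ge0.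
apply/funext => n; rewrite nexp_sum; last by move=> tau; rewrite mule_ge0.
by apply: eq_bigr => tau _; rewrite jumpE -EFinM.
Qed.

End atoms_limit.

Lemma measurable_contpart {R : realType} (M : set R) : countable M ->
  measurable_fun setT (contpart M).
Proof.
move=> cM; have mM := measurable_countable cM.
apply: measurable_path => t; apply/measurable_EFinP.
rewrite (_ : _ \o _ = fun X => LS X (ray t `\` M)).
  by apply: measurable_LS; exact: measurableD.
by apply/funext => X /=; rewrite -LS_ray LS_contpart.
Qed.

Section tilt.
Context {R : realType} d (Om : measurableType d).
Variables (P : probability Om R) (L : Om -> iap_path R) (M : set R) (s_ : nat -> seq R).
Hypotheses (mL : measurable_fun setT L) (cM : countable M)
  (us : forall n, uniq (s_ n))
  (nds : forall m n, (m <= n)%N -> {subset s_ m <= s_ n})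
  (sM : forall tau, M tau <-> exists n, tau \in s_ n).
Let Lc w := contpart M (L w).
Hypothesis ind : indep_jumps P L M Lc.

Let mJ tau : measurable_fun setT (fun x => jump (L x) tau).
Proof. by apply: measurable_jump => //; exact: measurable_cst. Qed.

Let mLc : measurable_fun setT Lc.
Proof. exact: (measurableT_comp (measurable_contpart cM)). Qed.

Lemma subset_eventually (s0 : seq R) : (forall tau, tau \in s0 -> M tau) ->
  exists n0, {subset s0 <= s_ n0}.
Proof.
elim: s0 => [_|a s0 ih h]; first by exists 0%N.
have [n1 H1] := ih (fun tau h' => h tau (mem_behead (s := a :: s0) h')).
have [n2 H2] := (sM a).1 (h a (mem_head _ _)).
exists (maxn n1 n2) => tau; rewrite inE => /orP[/eqP ->|/H1].
  exact: (nds (leq_maxr n1 n2)).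
exact: (nds (leq_maxl n1 n2)).
Qed.

(** Under a weight that is a product of functions of the jumps and of the continuous
    part, these remain independent and each is tilted by its own factor. The weight
    omega is only a limit of such products, over the finite lists [s_ n]; the test
    functions concern finitely many atoms, so the remaining factors cancel between
    the numerator and the normalisation before the limit is taken. *)
Lemma tilt_product (wt : R -> R -> R) (psi : iap_path R -> R) (omega : Om -> R) (C C' c : R) :
  (forall tau, measurable_fun setT (wt tau)) -> (forall tau y, 0 <= wt tau y <= C) ->
  measurable_fun setT psi -> (forall X, 0 <= psi X <= C) ->
  (forall x, \prod_(tau <- s_ n) wt tau (jump (L x) tau) * psi (Lc x) @[n --> \oo] --> omega x) ->
  (forall n x, \prod_(tau <- s_ n) wt tau (jump (L x) tau) * psi (Lc x) <= C') ->
  (\int[P]_x (omega x)%:E = c%:E)%E -> 0 < c ->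
  let EW tau := fine (\int[P]_x (wt tau (jump (L x) tau))%:E)%E in
  let Epsi := fine (\int[P]_x (psi (Lc x))%:E)%E in
  [/\ forall tau, M tau -> 0 < EW tau, 0 < Epsi &
  forall (s0 : seq R) (g : R -> R -> R) (G : iap_path R -> R),
    uniq s0 -> (forall tau, tau \in s0 -> M tau) ->
    (forall tau, measurable_fun setT (g tau)) -> (forall tau y, 0 <= g tau y <= 1) ->
    measurable_fun setT G -> (forall X, 0 <= G X <= 1) ->
    (\int[P]_x (\prod_(tau <- s0) g tau (jump (L x) tau) * G (Lc x) * omega x)%:E =
     (c * (\prod_(tau <- s0)
        (fine (\int[P]_x (g tau (jump (L x) tau) * wt tau (jump (L x) tau))%:E)%E / EW tau) *
      (fine (\int[P]_x (G (Lc x) * psi (Lc x))%:E)%E / Epsi)))%:E)%E].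
Proof.
move=> mwt wtC mpsi psiC wlim wbd omE c0 EW Epsi.
have mwJ tau : measurable_fun setT (fun x => wt tau (jump (L x) tau)).
  by apply: (measurableT_comp (mwt tau)).
have mpL : measurable_fun setT (fun x => psi (Lc x)) by exact: (measurableT_comp mpsi).
have EWE tau : (\int[P]_x (wt tau (jump (L x) tau))%:E = (EW tau)%:E)%E.
  by rewrite fineK//; exact: (integral_bnd_fin P (mwJ tau) (fun x => wtC tau (jump (L x) tau))).
have EpsiE : (\int[P]_x (psi (Lc x))%:E = Epsi%:E)%E.
  by rewrite fineK//; exact: (integral_bnd_fin P mpL (fun x => psiC (Lc x))).
have EW0 tau : 0 <= EW tau.
  by rewrite fine_ge0//; apply: integral_ge0 => x _; rewrite lee_fin; have /andP[] := wtC tau (jump (L x) tau).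
have Epsi0 : 0 <= Epsi.
  by rewrite fine_ge0//; apply: integral_ge0 => x _; rewrite lee_fin; have /andP[] := psiC (Lc x).
have prodE (s : seq R) : uniq s -> (forall tau, tau \in s -> M tau) ->
    (\int[P]_x (\prod_(tau <- s) wt tau (jump (L x) tau) * psi (Lc x))%:E =
     (\prod_(tau <- s) EW tau * Epsi)%:E)%E.
  move=> us' sM'; rewrite (indep_jumps_fun mL mLc ind us' sM' mwt mpsi wtC psiC) EpsiE.
  rewrite EFinM (big_morph EFin (fun x y => EFinM x y) erefl).
  by congr (_ * _)%E; apply: eq_bigr => tau _.
have sMn n tau : tau \in s_ n -> M tau by move=> h; apply/sM; exists n.
have P1 : (P setT < +oo)%E by rewrite [X in (X < _)%E]probability_setT ltry.
have pw0 n x : 0 <= \prod_(tau <- s_ n) wt tau (jump (L x) tau).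
  by apply: prodr_ge0 => tau _; have /andP[] := wtC tau (jump (L x) tau).
have p0 X : 0 <= psi X by have /andP[] := psiC X.
have lim1 : \prod_(tau <- s_ n) EW tau * Epsi @[n --> \oo] --> c.
  have H : ((\prod_(tau <- s_ n) EW tau * Epsi)%:E @[n --> \oo] --> c%:E)%E.
    rewrite -omE; rewrite (_ : (fun n => (\prod_(tau <- s_ n) EW tau * Epsi)%:E) = fun n =>
      (\int[P]_x (\prod_(tau <- s_ n) wt tau (jump (L x) tau) * psi (Lc x))%:E)%E); last first.
      by apply/funext => n; rewrite prodE//; exact: sMn.
    apply: (bounded_convergence (C := C')) => //.
    - by move=> n; apply: measurable_funM => //; exact: measurable_prodr.
    - by move=> n x; rewrite ger0_norm// mulr_ge0.
  by move: H => /fine_cvg.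
(* the limit c is positive, so that no factor can vanish *)
have ev : exists n0, forall n, (n0 <= n)%N -> 0 < \prod_(tau <- s_ n) EW tau * Epsi.
  have /cvgrPdist_lt /(_ c c0) [n0 _ H] := lim1.
  exists n0 => n /H /=; rewrite ltr_norml ltrBlDr => /andP[_].
  by rewrite -[X in X < _]addr0 ltrD2l.
have [n0 pos] := ev.
have EWp tau : M tau -> 0 < EW tau.
  move=> Mtau; rewrite lt_neqAle EW0 andbT; apply/eqP => e.
  have [n1 h] := (sM tau).1 Mtau.
  have := pos _ (leq_maxl n0 n1).
  by rewrite (big_rem _ (nds (leq_maxr n0 n1) h))/= -e !mul0r ltxx.
have Epsip : 0 < Epsi.
  rewrite lt_neqAle Epsi0 andbT; apply/eqP => e.
  by have := pos _ (leqnn n0); rewrite -e mulr0 ltxx.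
split => // s0 g G us0 s0M mg g01 mG G01.
pose g' tau y : R := (if tau \in s0 then g tau y else 1) * wt tau y.
pose G' X : R := G X * psi X.
have mg' tau : measurable_fun setT (g' tau).
  apply: measurable_funM => //.
  by case: (tau \in s0); [exact: mg|exact: measurable_cst].
have C0 : 0 <= C by have /andP[a b] := psiC (zero_path R); exact: le_trans b.
have g'C tau y : 0 <= g' tau y <= C.
  have /andP[w0 w1] := wtC tau y; have /andP[h0 h1] := g01 tau y.
  rewrite /g'; case: ifP => _; last by rewrite mul1r w0.
  by rewrite mulr_ge0//= (le_trans _ w1)// ler_piMl.
have G'C X : 0 <= G' X <= C.
  have /andP[w0 w1] := psiC X; have /andP[h0 h1] := G01 X.
  by rewrite mulr_ge0//= (le_trans _ w1)// ler_piMl.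
have mG' : measurable_fun setT G' by exact: measurable_funM.
pose EG tau := fine (\int[P]_x (g' tau (jump (L x) tau))%:E)%E.
pose EGp := fine (\int[P]_x (G' (Lc x))%:E)%E.
(* from n1 on, the list s_ n contains all the atoms tested *)
have [n1 sub] := subset_eventually s0M.
have cvgl : ((\int[P]_x (\prod_(tau <- s0) g tau (jump (L x) tau) * G (Lc x) *
      (\prod_(tau <- s_ n) wt tau (jump (L x) tau) * psi (Lc x)))%:E)%E @[n --> \oo] -->
    (\int[P]_x (\prod_(tau <- s0) g tau (jump (L x) tau) * G (Lc x) * omega x)%:E)%E).
  apply: (bounded_convergence (C := C')) => //.
  - move=> n; apply: measurable_funM.
      apply: measurable_funM; last exact: (measurableT_comp mG).
      by apply: measurable_prodr => tau; apply: (measurableT_comp (mg tau)).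
    by apply: measurable_funM => //; exact: measurable_prodr.
  - move=> n x; have /andP[a0 a1] := prod01 s0 (fun tau => g01 tau (jump (L x) tau)).
    have /andP[b0 b1] := G01 (Lc x).
    rewrite ger0_norm; last by rewrite !mulr_ge0.
    rewrite (le_trans _ (wbd n x))// ler_piMl ?mulr_ge0// mulr_ile1//.
  - by move=> x; apply: cvgM; [exact: cvg_cst|exact: wlim].
apply: (cvg_unique _ cvgl) => //.
have step n : (n1 <= n)%N ->
    (\int[P]_x (\prod_(tau <- s0) g tau (jump (L x) tau) * G (Lc x) *
      (\prod_(tau <- s_ n) wt tau (jump (L x) tau) * psi (Lc x)))%:E =
     ((\prod_(tau <- s_ n) EW tau * Epsi) * (\prod_(tau <- s0) (EG tau / EW tau) * (EGp / Epsi)))%:E)%E.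
  move=> n1n.
  have split_prod (F : R -> R) : \prod_(tau <- s0) F tau =
      \prod_(tau <- s_ n) (if tau \in s0 then F tau else 1).
    rewrite -big_mkcond/= -[RHS]big_filter; apply: perm_big.
    apply: uniq_perm; rewrite ?filter_uniq// => tau; rewrite mem_filter.
    by apply/idP/andP => [h|[]//]; split => //; apply: (nds n1n); exact: sub.
  transitivity (\int[P]_x (\prod_(tau <- s_ n) g' tau (jump (L x) tau) * G' (Lc x))%:E)%E.
    apply: eq_integral => x _; congr (_%:E).
    rewrite /g' /G' big_split/= -(split_prod (fun tau => g tau (jump (L x) tau))); ring.
  rewrite (indep_jumps_fun mL mLc ind (us n) (sMn n) mg' mG' g'C G'C).
  have -> : (\int[P]_x (G' (Lc x))%:E = EGp%:E)%E.
    by rewrite fineK//; exact: (integral_bnd_fin P (measurableT_comp mG' mLc) (fun x => G'C (Lc x))).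
  transitivity ((\prod_(tau <- s_ n) EG tau)%:E * EGp%:E)%E.
    congr (_ * _)%E; rewrite (big_morph EFin (fun x y => EFinM x y) erefl).
    apply: eq_bigr => tau _; rewrite fineK//.
    exact: (integral_bnd_fin P (measurableT_comp (mg' tau) (mJ tau)) (fun x => g'C tau (jump (L x) tau))).
  rewrite -EFinM; congr (_%:E).
  have -> : \prod_(tau <- s_ n) EG tau =
      \prod_(tau <- s_ n) EW tau * \prod_(tau <- s0) (EG tau / EW tau).
    rewrite (split_prod (fun tau => EG tau / EW tau)) -big_split/=.
    rewrite [LHS]big_seq [RHS]big_seq; apply: eq_bigr => tau /sMn Mtau.
    case: ifPn => h; first by rewrite mulrCA divff ?mulr1// gt_eqF// EWp.
    rewrite mulr1 /EG /EW; congr fine; apply: eq_integral => x _.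
    by rewrite /g' (negbTE h) mul1r.
  by field; rewrite gt_eqF.
have rE : (\prod_(tau <- s0) (EG tau / EW tau) * (EGp / Epsi)) =
    (\prod_(tau <- s0)
        (fine (\int[P]_x (g tau (jump (L x) tau) * wt tau (jump (L x) tau))%:E)%E / EW tau) *
      (fine (\int[P]_x (G (Lc x) * psi (Lc x))%:E)%E / Epsi)).
  congr (_ * _); rewrite [LHS]big_seq [RHS]big_seq; apply: eq_bigr => tau h.
  by rewrite /EG; congr (fine _ / _); apply: eq_integral => x _; rewrite /g' h.
rewrite -rE.
set K := _ * (EGp / Epsi).
have lim2 : ((\prod_(tau <- s_ n) EW tau * Epsi * K)%:E @[n --> \oo] --> (c * K)%:E)%E.
  apply: cvg_EFin; first exact: nearW.
  by apply: cvgM; [exact: lim1|exact: cvg_cst].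
apply: (cvg_trans _ lim2); apply: near_eq_cvg.
by exists n1 => // n /= h; rewrite step.
Qed.

End tilt.

(** * Characterisation of extended gamma processes with fixed atoms *)

(** Being extended gamma, or without fixed discontinuity, depends on the law only. *)
Section laws.
Context {R : realType} d1 d2 (O1 : measurableType d1) (O2 : measurableType d2).
Variables (P1 : probability O1 R) (P2 : probability O2 R).
Variables (X1 : O1 -> iap_path R) (X2 : O2 -> iap_path R).
Hypothesis mX2 : measurable_fun setT X2.
Hypothesis law : forall E, measurable E -> P1 (X1 @^-1` E) = P2 (X2 @^-1` E).

Lemma extended_gamma_law alpha beta :
  extended_gamma P1 X1 alpha beta -> extended_gamma P2 X2 alpha beta.
Proof.
move=> [[mX1 iap] [d' [W [P' [N [Y [prm mY Yae lawY]]]]]]]; split; last first.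
  exists d', W, P', N, Y; split; [exact: prm|exact: mY|exact: Yae|].
  by move=> E mE; exact: (eq_trans (esym (law mE)) (lawY _ mE)).
split => // n s sh A B mA mB /=.
have mev t : measurable_fun setT (fun Z : iap_path R => Z t) := measurable_eval t.
have mincr t t' : measurable_fun setT (fun Z : iap_path R => Z t - Z t').
  exact: measurable_funB.
have lawA (t : R) C : measurable C -> P2 [set w | C (X2 w t)] = P1 [set w | C (X1 w t)].
  by move=> mC; have := law (measurable_pre (mev t) mC).
have lawB (t t' : R) C : measurable C ->
    P2 [set w | C (X2 w t - X2 w t')] = P1 [set w | C (X1 w t - X1 w t')].
  by move=> mC; have := law (measurable_pre (mincr t t') mC).
have := iap n s sh A B mA mB; rewrite /= lawA//.
under [in X in _ -> X]eq_bigr do rewrite lawB//.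
move=> <-; pose S := [set Z : iap_path R | A (Z (s 0%N))] `&`
  \bigcap_(i in [set: 'I_n]) [set Z : iap_path R | B i (Z (s i.+1) - Z (s i))].
have mS : measurable S.
  apply: measurableI; first exact: (measurable_pre (mev _)).
  apply: fin_bigcap_measurable => // i _.
  exact: (measurable_pre (mincr _ _)).
by have := law mS => /= <-.
Qed.

Lemma no_fixed_discontinuity_law :
  no_fixed_discontinuity P1 X1 -> no_fixed_discontinuity P2 X2.
Proof.
move=> h x; rewrite -(h x).
have mj : measurable_fun setT (fun Z : iap_path R => jump Z x).
  by apply: measurable_jump => //; exact: measurable_cst.
have mC : measurable (~` [set 0 : R]) by exact: measurableC.
have := law (measurable_pre mj mC).
rewrite [X in P1 X](_ : _ = [set w | jump (X1 w) x != 0]); last first.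
  by apply/seteqP; split => w /= /eqP.
by rewrite [X in P2 X](_ : _ = [set w | jump (X2 w) x != 0])//; apply/seteqP; split => w /= /eqP.
Qed.

End laws.

Section fixed_characterisation.
Context {R : realType}.
Variables (Q K : probability (iap_path R) R) (M : set R) (fs : R -> R -> R).
Variables (alpha : {finite_measure set R -> \bar R}) (beta : R -> R).
Hypotheses (cM : countable M) (mb : measurable_fun setT beta).
Hypothesis fs_density : forall tau, M tau -> pos_density (fs tau).
Hypothesis K_gamma : extended_gamma K id alpha beta.
Hypothesis K_nofix : no_fixed_discontinuity K id.

Let mean tau (g : R -> R) : R :=
  fine (\int[leb]_(x in `]0%R, +oo[) (g x * fs tau x)%:E)%E.

Hypothesis Qprod : forall (s0 : seq R) (g : R -> R -> R) (G : iap_path R -> R),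
  uniq s0 -> (forall tau, tau \in s0 -> M tau) ->
  (forall tau, measurable_fun setT (g tau)) -> (forall tau y, 0 <= g tau y <= 1) ->
  measurable_fun setT G -> (forall X, 0 <= G X <= 1) ->
  (\int[Q]_X (\prod_(tau <- s0) g tau (jump X tau) * G (contpart M X))%:E =
   (\prod_(tau <- s0) mean tau (g tau))%:E * \int[K]_X (G X)%:E)%E.

Let mX : measurable_fun setT (id : iap_path R -> iap_path R).
Proof. exact: measurable_id. Qed.

Let mcp : measurable_fun setT (contpart M) := measurable_contpart cM.

Let mJ tau : measurable_fun setT (fun X : iap_path R => jump X tau).
Proof. by apply: measurable_jump => //; exact: measurable_cst. Qed.

Let Qcont E : measurable E -> K (id @^-1` E) = Q (contpart M @^-1` E).
Proof.
move=> mE; rewrite -(integral_indicT Q mcp mE).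
transitivity (\int[Q]_X (\prod_(tau <- [::] : seq R) 1 * \1_E (contpart M X))%:E)%E; last first.
  by apply: eq_integral => X _; rewrite big_nil mul1r.
rewrite (@Qprod [::] (fun _ _ => 1) \1_E)//.
- by rewrite big_nil mul1e integral_indic// setIT.
- by move=> _ _; rewrite ler01 lexx.
- by move=> X; exact: indic01.
Qed.

Let Qjump tau B : M tau -> measurable B ->
  Q [set X | B (jump X tau)] = (mean tau \1_B)%:E.
Proof.
move=> Mtau mB.
have -> : Q [set X | B (jump X tau)] = (\int[Q]_X (\1_B (jump X tau))%:E)%E.
  by rewrite (integral_indicT Q (mJ tau) mB).
transitivity (\int[Q]_X (\prod_(t <- [:: tau]) \1_B (jump X t) * 1)%:E)%E.
  by apply: eq_integral => X _; rewrite big_seq1 mulr1.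
rewrite (@Qprod [:: tau] (fun _ => \1_B) (fun=> 1))//.
- by rewrite big_seq1 (prob_cst K) mule1.
- by move=> t; rewrite inE => /eqP ->.
- by move=> t y; exact: indic01.
- by move=> X; rewrite ler01 lexx.
Qed.

Let meanE tau B : M tau -> measurable B ->
  (mean tau \1_B)%:E = (\int[@lebesgue_measure R]_(x in B `&` `]0%R, +oo[) (fs tau x)%:E)%E.
Proof.
move=> Mtau mB; have [mf f0 f1] := fs_density Mtau.
have mBI : measurable (B `&` `]0, +oo[%classic) by exact: measurableI.
rewrite integral_leb//; last 2 first.
- by apply: measurable_funTS; exact/measurable_EFinP.
- by move=> x _; rewrite lee_fin.
have e : (\int[leb]_(x in `]0%R, +oo[) (\1_B x * fs tau x)%:E =
    \int[leb]_(x in B `&` `]0%R, +oo[) (fs tau x)%:E)%E.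
  rewrite integral_setE [RHS]integral_setE; apply: eq_integral => x _.
  by rewrite indicI -!EFinM; congr (_%:E); rewrite /=; ring.
rewrite /mean e fineK// ge0_fin_numE; last by apply: integral_ge0 => x _; rewrite lee_fin.
apply: (@le_lt_trans _ _ 1%E); last by rewrite ltry.
rewrite -f1 integral_leb//; last 2 first.
- by apply: measurable_funTS; exact/measurable_EFinP.
- by move=> x _; rewrite lee_fin.
apply: ge0_subset_integral => //.
- by apply: measurable_funTS; exact/measurable_EFinP.
- by move=> x _; rewrite lee_fin.
Qed.

Let Qind : indep_jumps Q id M (contpart M).
Proof.
move=> n tau B E injt Mt mB mE J.
pose B' (y : R) : set R := if [pick i | tau i == y] is Some i then B i else set0.
have B'E i : B' (tau i) = B i.
  rewrite /B'; case: pickP => [j /eqP /injt ->//|/(_ i)]; by rewrite eqxx.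
have mB' y : measurable (B' y) by rewrite /B'; case: pickP.
have us : uniq [seq tau i | i <- index_enum 'I_n] by rewrite map_inj_uniq// index_enum_uniq.
set F := (X in Q X); have mF : measurable F.
  apply: measurableI; last exact: (measurable_pre mcp).
  by apply: fin_bigcap_measurable => // i _; exact: (measurable_pre (mJ _)).
have -> : (Q F = \int[Q]_w (\1_F w)%:E)%E by rewrite integral_indic// setIT.
have := @Qprod _ (fun y => \1_(B' y)) (\1_E) us.
rewrite big_map => H.
transitivity ((\prod_i mean (tau i) \1_(B' (tau i)))%:E * \int[K]_X (\1_E X)%:E)%E.
  rewrite -H//; first last.
  - by move=> X; exact: indic01.
  - by move=> t y; exact: indic01.
  - by move=> t /mapP[i _ ->].
  apply: eq_integral => w _; congr (_%:E).
  rewrite /F indicI/= indic_bigcap_ord big_map; congr (_ * _).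
  by apply: eq_bigr => i _; rewrite B'E.
rewrite (big_morph EFin (fun x y => EFinM x y) erefl); congr (_ * _)%E.
  by apply: eq_bigr => i _; rewrite B'E -Qjump.
by rewrite -Qcont// integral_indic// setIT.
Qed.

(** The product formula [Qprod] contains the laws of the jumps and of the continuous
    part and their independence. The increments are independent because the Laplace
    functional of the path is a limit of such products, hence multiplicative. *)
Lemma extended_gamma_fixed_intro : extended_gamma_fixed Q id M fs alpha beta.
Proof.
split; last first.
- exists (contpart M); split.
  + by move=> X; exact: decomposes_contpart.
  + exact: (extended_gamma_law mcp Qcont K_gamma).
  + exact: (no_fixed_discontinuity_law Qcont K_nofix).
  + exact: Qind.
- move=> tau Mtau; split; first exact: fs_density.
  by move=> B mB; rewrite -meanE//; exact: Qjump.
have [s_ [us nds sM]] := countable_enum cM.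
have [nu [nuE _]] := gamma_measure alpha mb.
have lapK := extended_gamma_laplace nuE K_gamma.
pose ex (theta : R -> R) (tau y : R) : R := expR (- (theta tau * `|y|)).
have mex theta tau : measurable_fun setT (ex theta tau).
  apply: measurableT_comp => //; apply: measurableT_comp => //.
  by apply: measurable_funM => //; exact: measurableT_comp.
have ex01 (theta : R -> R) : (forall x, 0 <= theta x) -> forall tau y, 0 <= ex theta tau y <= 1.
  by move=> t0 tau y; rewrite expR_ge0 -expR0 ler_expR oppr_le0 mulr_ge0.
pose np theta X : R := nexp (\int[LS X]_s (theta s)%:E)%E.
have mnp (theta : R -> R) : measurable_fun setT theta -> (forall x, 0 <= theta x) ->
    measurable_fun setT (np theta).
  by move=> mt t0; exact: measurable_nexp_path.
have np01 (theta : R -> R) : (forall x, 0 <= theta x) -> forall X, 0 <= np theta X <= 1.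
  by move=> t0 X; rewrite nexp_ge0 nexp_le1// path_integral_ge0.
pose u theta n := \prod_(tau <- s_ n) mean tau (ex theta tau) * fine (\int[K]_X (np theta X)%:E)%E.
have ucvg (theta : R -> R) : measurable_fun setT theta -> (forall x, 0 <= theta x)%R ->
    ((u theta n)%:E @[n --> \oo] --> \int[Q]_X (np theta X)%:E)%E.
  move=> mt t0; rewrite (_ : (fun n => (u theta n)%:E) = fun n =>
      (\int[Q]_X (\prod_(tau <- s_ n) ex theta tau (jump X tau) * np theta (contpart M X))%:E)%E); last first.
    apply/funext => n; rewrite Qprod//.
    - rewrite /u EFinM fineK//.
      exact: (integral_bnd_fin K (mnp _ mt t0) (np01 _ t0)).
    - by move=> tau h; apply/sM; exists n.
    - exact: ex01.
    - exact: mnp.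
    - exact: np01.
  apply: (bounded_convergence (C := 1)) => //.
  - by rewrite [X in (X < _)%E]probability_setT ltry.
  - move=> n; apply: measurable_funM.
      by apply: measurable_prodr => tau; apply: (measurableT_comp (mex theta tau)).
    exact: (measurableT_comp (mnp _ mt t0)).
  - move=> n X; have /andP[a0 a1] := prod01 (s_ n) (fun tau => ex01 _ t0 tau (jump X tau)).
    have /andP[b0 b1] := np01 _ t0 (contpart M X).
    by rewrite ger0_norm ?mulr_ge0// mulr_ile1.
  - move=> X; have := jumps_path_cvg cM us nds sM (X := X) mt t0.
    rewrite (_ : (fun n => _) = fun n => \prod_(tau <- s_ n) ex theta tau (jump X tau) * np theta (contpart M X))//.
    apply/funext => n; congr (_ * _); apply: eq_bigr => tau _.
    by rewrite /ex ger0_norm// jump_ge0.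
apply: increasing_additive_of_laplace => // a b ma mb' a0 b0 ab.
have mab : measurable_fun setT (fun x => a x + b x) by exact: measurable_funD.
have ab0 x : 0 <= a x + b x by rewrite addr_ge0.
have QE (theta : R -> R) : measurable_fun setT theta -> (forall x, 0 <= theta x) ->
    (\int[Q]_X (np theta X)%:E = (fine (\int[Q]_X (np theta X)%:E))%:E)%E.
  by move=> mt t0; rewrite fineK//; exact: (integral_bnd_fin Q (mnp _ mt t0) (np01 _ t0)).
have ucvg' (theta : R -> R) : measurable_fun setT theta -> (forall x, 0 <= theta x) ->
    u theta n @[n --> \oo] --> fine (\int[Q]_X (np theta X)%:E)%E.
  by move=> mt t0; have := ucvg _ mt t0; rewrite QE// => /fine_cvg.
change (\int[Q]_X (np (fun x => a x + b x) X)%:E =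
  \int[Q]_X (np a X)%:E * \int[Q]_X (np b X)%:E)%E.
rewrite (QE _ mab ab0) (QE a)// (QE b)// -EFinM; congr (_%:E).
apply: (cvg_unique _ (ucvg' _ mab ab0)) => //.
rewrite (_ : u (fun x => a x + b x) = fun n => u a n * u b n); first by apply: cvgM; exact: ucvg'.
apply/funext => n; rewrite /u mulrACA -big_split/=; congr (_ * _).
  rewrite [LHS]big_seq [RHS]big_seq; apply: eq_bigr => tau h.
  have Mtau : M tau by apply/sM; exists n.
  have one : mean tau (fun=> 1) = 1.
    have := meanE Mtau measurableT; rewrite setTI; have [_ _ ->] := fs_density Mtau.
    by rewrite indicT => -[].
  have ex1 theta : theta tau = 0 -> ex theta tau = fun=> 1.
    by move=> e; apply/funext => y; rewrite /ex e mul0r oppr0 expR0.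
  have := ab tau => /eqP; rewrite mulf_eq0 => /orP[] /eqP e.
    by rewrite (ex1 a)// one mul1r /ex e add0r.
  by rewrite (ex1 b)// one mulr1 /ex e addr0.
by rewrite /np !lapK//= lift_laplaceD.
Qed.

End fixed_characterisation.

(** * Images and mixtures of measures *)

Section measure_tools.
Context {R : realType}.

Lemma image_measure d (T : measurableType d) d' (S : measurableType d')
    (m : {measure set T -> \bar R}) (W : T -> R) (phi : T -> S) :
  measurable_fun setT W -> (forall x, 0 <= W x) -> measurable_fun setT phi ->
  exists m' : {measure set S -> \bar R},
    forall f : S -> \bar R, measurable_fun setT f -> (forall y, 0 <= f y)%E ->
    (\int[m']_y f y = \int[m]_x (f (phi x) * (W x)%:E))%E.
Proof.
move=> mW W0 mphi; have [m1 [m1E im1]] := density_measure m mW W0.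
exists (pushforward m1 phi) => f mf f0.
rewrite ge0_integral_pushforward// im1//.
  exact: (measurableT_comp mf mphi).
by move=> x; exact: f0.
Unshelve. exact: mphi.
Qed.

Lemma mixture_measure d (T : measurableType d) d' (S : measurableType d')
    (m : {measure set T -> \bar R}) (ker : T -> {measure set S -> \bar R}) :
  (forall A, measurable A -> measurable_fun setT (fun t => ker t A)) ->
  exists m' : {measure set S -> \bar R},
    (forall A, m' A = \int[m]_t ker t A)%E /\
    (forall f : S -> \bar R, measurable_fun setT f -> (forall y, 0 <= f y)%E ->
      \int[m']_y f y = \int[m]_t \int[ker t]_y f y)%E.
Proof.
move=> mker; pose nu (A : set S) := (\int[m]_t ker t A)%E.
have nu0 : nu set0 = 0%E.
  by rewrite /nu; apply: integral0_eq => t _; exact: measure0.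
have nuge0 A : (0 <= nu A)%E by apply: integral_ge0.
have nuD : semi_sigma_additive nu.
  move=> F mF tF mUF.
  have -> : nu (\bigcup_n F n) = (\sum_(0 <= i <oo) nu (F i))%E.
    rewrite /nu -integral_nneseries//; last by move=> i; exact: mker.
    apply: eq_integral => t _; apply: (eq_trans (measure_bigcup _ _ _ _ _)) => //.
    by apply: eq_eseriesl => i; rewrite in_setT.
  by apply: is_cvg_nneseries => i _ _; exact: nuge0.
pose B := isMeasure.Build _ _ _ nu nu0 nuge0 nuD.
pose m' : {measure set S -> \bar R} := HB.pack nu B.
have m'E A : m' A = (\int[m]_t ker t A)%E by [].
exists m'; split => // f mf f0.
pose g := nnsfun_approx measurableT mf.
have gf x : (g n x)%:E @[n --> \oo] --> f x by apply: cvg_nnsfun_approx.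
have ndg a b : (a <= b)%N -> forall x, g a x <= g b x.
  by move=> ab x; exact/lefP/nd_nnsfun_approx.
have mg n : measurable_fun setT (fun x => (g n x)%:E) by exact/measurable_EFinP.
have lim_g (m0 : {measure set S -> \bar R}) :
    (\int[m0]_x (g n x)%:E @[n --> \oo] --> \int[m0]_x f x)%E.
  have := @cvg_monotone_convergence _ _ _ m0 setT measurableT (fun n x => (g n x)%:E).
  rewrite (_ : (fun x => limn _) = f); last by apply/funext => x; apply/cvg_lim => //; exact: gf.
  apply; [exact: mg|by move=> n x _; rewrite lee_fin|].
  by move=> x _ a b ab; rewrite lee_fin; exact: ndg.
have simple n : (\int[m']_x (g n x)%:E = \int[m]_t \int[ker t]_x (g n x)%:E)%E /\
    measurable_fun setT (fun t => \int[ker t]_x (g n x)%:E)%E.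
  have [s [_ gE]] := nnsfun_decomp (g n).
  have e (m0 : {measure set S -> \bar R}) :
      (\int[m0]_x (g n x)%:E = \sum_(r <- s) `|r|%:E * m0 (g n @^-1` [set r]))%E.
    by rewrite -(gE (fun r : R => `|r|))//; apply: eq_integral => x _; rewrite ger0_norm.
  have mp r : measurable (g n @^-1` [set r]) by apply: measurable_funPTI.
  split.
    rewrite e; under [RHS]eq_integral do rewrite e.
    rewrite ge0_integral_sum//.
    - apply: eq_bigr => r _; rewrite ge0_integralZl ?lee_fin//.
      exact: mker.
    - by move=> r; apply: measurable_funeM; exact: mker.
  rewrite (_ : (fun t => _) = fun t => (\sum_(r <- s) `|r|%:E * ker t (g n @^-1` [set r]))%E).
    by apply: emeasurable_sum => r; apply: measurable_funeM; exact: mker.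
  by apply/funext => t; rewrite e.
apply: (cvge_eq (fun n => (simple n).1) (lim_g m')).
have := @cvg_monotone_convergence _ _ _ m setT measurableT (fun n t => \int[ker t]_x (g n x)%:E)%E.
rewrite (_ : (fun t => limn _) = fun t => \int[ker t]_x f x)%E; last first.
  by apply/funext => t; apply/cvg_lim => //; exact: lim_g.
apply.
- by move=> n; have [] := simple n.
- by move=> n t _; apply: integral_ge0 => x _; rewrite lee_fin.
- move=> t _ a b ab; apply: ge0_le_integral => //.
  + by move=> x _; rewrite lee_fin.
  + by move=> x _; rewrite lee_fin; exact: ndg.
Qed.

Lemma product_measure_ext d1 d2 (T1 : measurableType d1) (T2 : measurableType d2)
    (m1 m2 : {measure set (T1 * T2) -> \bar R}) :
  (m1 setT < +oo)%E ->
  (forall A B, measurable A -> measurable B -> m1 (A `*` B) = m2 (A `*` B)) ->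
  forall X, measurable X -> m1 X = m2 X.
Proof.
move=> fin E X mX.
pose G : set (set (T1 * T2)) := [set A `*` B | A in measurable & B in measurable].
have GI : setI_closed G.
  move=> _ _ [A mA [B mB <-]] [A' mA' [B' mB' <-]]; rewrite -setXI.
  by exists (A `&` A'); [exact: measurableI|exists (B `&` B'); [exact: measurableI|]].
apply: (@measure_unique _ _ _ G (fun=> setT) _ GI _ _ m1 m2) => //.
- exact: measurable_prod_measurableType.
- by move=> n; exists setT => //; exists setT => //; rewrite setXTT.
- by rewrite bigcup_const//; exists 0%N.
- by move=> _ [A mA [B mB <-]]; exact: E.
Qed.

Lemma one_sub_expRN_bounds (x : R) : 0 <= x -> x / (1 + x) <= 1 - expR (- x) <= x.
Proof.
move=> x0; have x1 : 0 < 1 + x by rewrite ltr_wpDr.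
apply/andP; split; last by rewrite lerBlDl -lerBlDr; exact: expR_ge1Dx.
rewrite expRN lerBrDl -lerBrDr (_ : 1 - x / (1 + x) = (1 + x)^-1); last by field; rewrite gt_eqF.
by rewrite lef_pV2 ?posrE ?expR_gt0//; exact: expR_ge1Dx.
Qed.

(** Squeezed by y/(1 + y/n) <= n(1 - e^{-y/n}) <= y. *)
Lemma cvg_slope (y_ : nat -> R) (y : R) : (forall n, 0 <= y_ n) ->
  y_ n @[n --> \oo] --> y ->
  (n.+1%:R * (1 - expR (- (y_ n / n.+1%:R))) : R) @[n --> \oo] --> y.
Proof.
move=> y0 yy.
have n1 n : 0 < n.+1%:R :> R by [].
have low : y_ n / (1 + y_ n * (n.+1%:R)^-1) @[n --> \oo] --> y.
  rewrite -[X in _ --> X]divr1 -[X in _ / X](addr0 1).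
  apply: cvgM => //; apply: cvgV; first by rewrite addr0 oner_neq0.
  apply: cvgD; first exact: cvg_cst.
  by rewrite -(mulr0 y); apply: cvgM => //; exact: cvg_harmonic.
apply: (squeeze_cvgr _ low yy); apply: nearW => n.
have h0 : 0 <= y_ n / n.+1%:R by rewrite divr_ge0.
have /andP[h1 h2] := one_sub_expRN_bounds h0.
apply/andP; split; last by rewrite mulrC -ler_pdivlMr.
rewrite (_ : _ / _ = n.+1%:R * (y_ n / n.+1%:R / (1 + y_ n / n.+1%:R))).
  by rewrite ler_wpM2l// ltW.
have d0 : 1 + y_ n / n.+1%:R != 0 by rewrite gt_eqF// ltr_wpDr.
by rewrite [RHS]mulrA mulrCA divff ?mulr1// gt_eqF.
Qed.

Lemma measurable_expRN d (T : measurableType d) (f : T -> R) :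
  measurable_fun setT f -> measurable_fun setT (fun x => expR (- f x)).
Proof. by move=> mf; apply: measurableT_comp => //; exact: measurableT_comp. Qed.

(** The exponential density of rate b, not normalised. *)
Definition exp_weight (b v : R) : R := (0 < v)%R%:R * expR (- (b * v)).

Lemma exp_weight_ge0 b v : 0 <= exp_weight b v.
Proof. by rewrite mulr_ge0// expR_ge0. Qed.

Lemma integral_exp_weight b : 0 < b -> (\int[leb]_v (exp_weight b v)%:E = (b^-1)%:E)%E.
Proof.
move=> b0.
have mexp : measurable_fun setT (fun v : R => (expR (- (b * v)))%:E).
  by apply/measurable_EFinP; apply: measurable_expRN; exact: measurable_funM.
have e0 (v : R) : (0 <= (expR (- (b * v)))%:E)%E by rewrite lee_fin expR_ge0.
transitivity (\int[leb]_(v in `]0%R, +oo[) (expR (- (b * v)))%:E)%E.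
  rewrite [RHS]integral_setE; apply: eq_integral => v _; rewrite indicE -EFinM; congr (_%:E).
  rewrite /exp_weight mulrC; congr (_ * _%:R); congr nat_of_bool.
  by apply/idP/idP; rewrite inE/= in_itv/= andbT.
rewrite -integral_leb//; last exact: measurable_funTS.
have H : (b%:E * \int[lebesgue_measure]_(v in `]0%R, +oo[) (expR (- (b * v)))%:E = 1)%E.
  rewrite -ge0_integralZl//; last 2 first.
  - exact: measurable_funTS.
  - by rewrite lee_fin ltW.
  rewrite integral_itv_obnd_cbnd; last first.
    by apply: measurable_funTS; exact: measurable_funeM.
  rewrite -(integral_exponential_pdf b0) integral_mkcond; apply: eq_integral => v _.
  rewrite /exponential_pdf !patchE; case: ifP => // _.
  by rewrite -EFinM mulNr.
set I := (X in X = _); rewrite -/I in H.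
have : (I = b^-1%:E * (b%:E * I))%E by rewrite muleA -EFinM mulVf ?gt_eqF// mul1e.
by rewrite H mule1.
Qed.

Lemma measurable_exp_weight b : measurable_fun setT (exp_weight b).
Proof.
apply: measurable_funM; last by apply: measurable_expRN; exact: measurable_funM.
apply: (measurableT_comp (f := fun z : R * R => (0 < z.2)%R%:R : R)
  (g := fun v : R => (0 : R, v))); [exact: measurable_pos2|exact: measurable_pair1].
Qed.

End measure_tools.

Lemma add_atomN {R : realType} (X : iap_path R) (v s : R) :
  add_atom X v s = add_atom X `|v| s.
Proof.
rewrite /add_atom /atom_measure; congr path_of.
have -> : NngNum (normr_ge0 v) = NngNum (normr_ge0 `|v|) by apply/val_inj; rewrite /= normr_id.
by [].
Qed.

Lemma measurable_add_atom {R : realType} d (T : measurableType d) (f : T -> iap_path R)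
    (v s : T -> R) : measurable_fun setT f -> measurable_fun setT v ->
  measurable_fun setT s -> measurable_fun setT (fun x => add_atom (f x) (v x) (s x)).
Proof.
move=> mf mv ms; apply: measurable_path => t.
rewrite (_ : (fun x => _) = fun x => f x t + `|v x| * \1_(ray t) (s x)).
  apply: measurable_funD; first exact: (measurableT_comp (measurable_eval t)).
  apply: measurable_funM; first exact: measurableT_comp.
  by apply: (measurableT_comp (measurable_indic (measurable_itv _))).
apply/funext => x; rewrite add_atomN add_atomE// indicE; congr (_ + _ * _%:R).
by congr nat_of_bool; apply/idP/idP; rewrite inE/= in_itv/=.
Qed.

(** The hypothesis on [kap] is the measurability of integrals with parameters, not a
    finiteness condition: the measures of paths may have infinite mass. *)
Lemma kernel_mixture {R : realType} d (T : measurableType d) d' (S : measurableType d')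
    d2 (O : measurableType d2) (m : {measure set T -> \bar R})
    (kap : T -> {measure set O -> \bar R}) (W : T * O -> R) (phi : T * O -> S) :
  (forall h : T * O -> \bar R, measurable_fun setT h -> (forall z, 0 <= h z)%E ->
    measurable_fun setT (fun t => \int[kap t]_s h (t, s))%E) ->
  measurable_fun setT W -> (forall z, 0 <= W z) -> measurable_fun setT phi ->
  exists m' : {measure set S -> \bar R},
    forall f : S -> \bar R, measurable_fun setT f -> (forall y, 0 <= f y)%E ->
    (\int[m']_y f y = \int[m]_t \int[kap t]_s (f (phi (t, s)) * (W (t, s))%:E))%E.
Proof.
move=> mkap mW W0 mphi.
have im t : exists mt : {measure set S -> \bar R},
    forall f : S -> \bar R, measurable_fun setT f -> (forall y, 0 <= f y)%E ->
    (\int[mt]_y f y = \int[kap t]_s (f (phi (t, s)) * (W (t, s))%:E))%E.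
  apply: image_measure; [|by []|].
  - by apply: (measurableT_comp mW); exact: measurable_pair1.
  - by apply: (measurableT_comp mphi); exact: measurable_pair1.
have [ker kerE] := choice im.
have mfW (f : S -> \bar R) : measurable_fun setT f ->
    measurable_fun setT (fun z => f (phi z) * (W z)%:E)%E.
  move=> mf; apply: emeasurable_funM; first exact: (measurableT_comp mf).
  exact/measurable_EFinP.
have mker A : measurable A -> measurable_fun setT (fun t => ker t A).
  move=> mA; rewrite (_ : (fun t => _) = fun t =>
      \int[kap t]_s ((\1_A (phi (t, s)))%:E * (W (t, s))%:E))%E.
    apply: (mkap (fun z => ((\1_A (phi z))%:E * (W z)%:E)%E)).
      by apply: (mfW (fun y => (\1_A y)%:E)); apply/measurable_EFinP; exact: measurable_indic.
    by move=> z; rewrite mule_ge0// lee_fin.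
  apply/funext => t; rewrite -(kerE t (fun y => (\1_A y)%:E)).
  - by rewrite integral_indic// setIT.
  - by apply/measurable_EFinP; exact: measurable_indic.
  - by move=> y; rewrite lee_fin.
have [m' [_ m'E]] := mixture_measure m mker.
exists m' => f mf f0; rewrite m'E//; apply: eq_integral => t _.
by rewrite kerE.
Qed.

(** * The Palm formula *)

Section palm.
Context {R : realType} d (Om : measurableType d).
Variables (P : probability Om R) (L : Om -> iap_path R) (M : set R).
Variables (alpha : {finite_measure set R -> \bar R}) (beta : R -> R).
Hypotheses (mL : measurable_fun setT L) (cM : countable M).
Hypotheses (mb : measurable_fun setT beta) (beta_ge0 : forall x, 0 <= beta x).
Let Lc w := contpart M (L w).
Hypotheses (ind : indep_jumps P L M Lc) (eg : extended_gamma P Lc alpha beta).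

Local Notation np theta X := (nexp (\int[LS X]_s (theta s)%:E)%E).

Let mLc : measurable_fun setT Lc.
Proof. exact: (measurableT_comp (measurable_contpart cM)). Qed.

Let np01 (theta : R -> R) (X : iap_path R) : (forall x, 0 <= theta x) -> 0 <= np theta X <= 1.
Proof. by move=> t0; rewrite nexp_ge0 nexp_le1// path_integral_ge0. Qed.

Let mnp (theta : R -> R) : measurable_fun setT theta -> (forall x, 0 <= theta x) ->
  measurable_fun setT (fun X : iap_path R => np theta X).
Proof. by move=> mt t0; exact: measurable_nexp_path. Qed.

Lemma measurable_expR_abs (c : R) : measurable_fun setT (fun y : R => expR (- (c * `|y|))).
Proof. by apply: measurable_expRN; apply: measurable_funM => //; exact: measurableT_comp. Qed.

Lemma expRN01 (x : R) : 0 <= x -> 0 <= expR (- x) <= 1.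
Proof. by move=> x0; rewrite expR_ge0 -expR0 ler_expR oppr_le0. Qed.

(** Weighted by e^{-int theta dL}, the continuous part is still a Poisson integral, of
    intensity e^{-theta(x) v} nu; the second factor is its Laplace functional. *)
Lemma joint_laplace (nu : {measure set (R * R) -> \bar R}) (theta h : R -> R) :
  (forall B, measurable B -> nu B = gamma_intensity alpha beta B) ->
  measurable_fun setT theta -> (forall x, 0 <= theta x) ->
  measurable_fun setT h -> (forall x, 0 <= h x) ->
  (\int[P]_w (np theta (L w) * np h (Lc w))%:E =
   \int[P]_w (np theta (L w))%:E *
   (nexp (\int[nu]_z (expR (- lift_fun theta z) * (1 - expR (- lift_fun h z)))%:E))%:E)%E.
Proof.
move=> nuE mt t0 mh h0.
have mnpL : measurable_fun setT (fun w => np theta (L w)) by exact: (measurableT_comp (mnp mt t0)).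
have mnpc : measurable_fun setT (fun w => np h (Lc w)) by exact: (measurableT_comp (mnp mh h0)).
have [c cE] : exists c, (\int[P]_w (np theta (L w))%:E = c%:E)%E.
  have := integral_bnd_fin P mnpL (fun w => np01 (L w) t0).
  by move=> /fineK <-; eexists.
have c0 : 0 <= c.
  by rewrite -lee_fin -cE; apply: integral_ge0 => w _; rewrite lee_fin nexp_ge0.
(* if e^{-int theta dL} vanishes almost surely there is nothing to normalise *)
have [c_eq0|cn0] := eqVneq c 0.
  rewrite cE c_eq0 mul0e; apply/eqP; rewrite eq_le; apply/andP; split; last first.
    by apply: integral_ge0 => w _; rewrite lee_fin mulr_ge0 ?nexp_ge0.
  have -> : 0%E = (\int[P]_w (np theta (L w))%:E)%E by rewrite cE c_eq0.
  apply: ge0_le_integral => //.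
  - by move=> w _; rewrite lee_fin mulr_ge0 ?nexp_ge0.
  - by apply/measurable_EFinP; exact: (measurable_funM mnpL mnpc).
  - apply/measurable_EFinP; exact: mnpL.
  - move=> w _; rewrite lee_fin ler_piMr ?nexp_ge0//.
    by have /andP[] := np01 (Lc w) h0.
have {}c0 : 0 < c by rewrite lt_neqAle eq_sym cn0.
have [s_ [us nds sM]] := countable_enum cM.
pose wt (tau y : R) : R := expR (- (theta tau * `|y|)).
have wt01 tau y : 0 <= wt tau y <= 1 by apply: expRN01; rewrite mulr_ge0.
have wlim w : \prod_(tau <- s_ n) wt tau (jump (L w) tau) * np theta (Lc w) @[n --> \oo] -->
    np theta (L w).
  have := jumps_path_cvg cM us nds sM (X := L w) mt t0.
  rewrite (_ : (fun n => _) = fun n => \prod_(tau <- s_ n) wt tau (jump (L w) tau) * np theta (Lc w))//.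
  apply/funext => n; congr (_ * _); apply: eq_bigr => tau _.
  by rewrite /wt ger0_norm// jump_ge0.
have wbd n w : \prod_(tau <- s_ n) wt tau (jump (L w) tau) * np theta (Lc w) <= 1.
  have /andP[a0 a1] := prod01 (s_ n) (fun tau => wt01 tau (jump (L w) tau)).
  by have /andP[b0 b1] := np01 (Lc w) t0; rewrite mulr_ile1.
have [_ Epos H] := tilt_product mL cM us nds sM ind
  (fun tau => measurable_expR_abs (theta tau)) wt01
  (mnp mt t0) (fun X => np01 X t0) wlim wbd cE c0.
have := H [::] (fun _ _ => 1) (fun X => np h X) isT (fun tau h => match notF h with end).
have c01 : 0 <= (1 : R) <= 1 by rewrite ler01 lexx.
move=> /(_ (fun=> measurable_cst _) (fun _ _ => c01) (mnp mh h0) (fun X => np01 X h0)) => H1.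
transitivity (\int[P]_w (\prod_(tau <- [::] : seq R) 1 * np h (Lc w) * np theta (L w))%:E)%E.
  by apply: eq_integral => w _; congr (_%:E); rewrite big_nil mul1r; exact: mulrC.
apply: (eq_trans H1); rewrite big_nil mul1r cE -EFinM; congr (_%:E); congr (_ * _).
have lapc := extended_gamma_laplace nuE eg.
have s1 z : 0 <= 1 - expR (- lift_fun theta z) by apply: one_sub_expRN_ge0; exact: lift_fun_ge0.
have s2 z : 0 <= 1 - expR (- lift_fun h z) by apply: one_sub_expRN_ge0; exact: lift_fun_ge0.
have s3 z : 0 <= expR (- lift_fun theta z) * (1 - expR (- lift_fun h z)).
  by rewrite mulr_ge0// expR_ge0.
move: Epos; rewrite lapc//= => Epos.
have -> : (\int[P]_x (np h (Lc x) * np theta (Lc x))%:E =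
    (nexp (\int[nu]_z (1 - expR (- lift_fun (fun x => theta x + h x) z))%:E))%:E)%E.
  rewrite -lapc.
  - by apply: eq_integral => w _; rewrite nexp_pathD// mulrC.
  - exact: measurable_funD.
  - by move=> x; rewrite addr_ge0.
have -> : (\int[nu]_z (1 - expR (- lift_fun (fun x => (theta x + h x)%R) z))%:E =
    \int[nu]_z (1 - expR (- lift_fun theta z))%:E +
    \int[nu]_z (expR (- lift_fun theta z) * (1 - expR (- lift_fun h z)))%:E)%E.
  rewrite -ge0_integralD//.
  - apply: eq_integral => z _; rewrite -EFinD; congr (_%:E).
    rewrite /lift_fun mulrDl opprD expRD; ring.
  - by move=> z _; rewrite lee_fin.
  - by apply/measurable_EFinP; apply: measurable_one_sub; exact: measurable_lift_fun.
  - by move=> z _; rewrite lee_fin.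
  - apply/measurable_EFinP; apply: measurable_funM.
      by apply: measurable_expRN; exact: measurable_lift_fun.
    by apply: measurable_one_sub; exact: measurable_lift_fun.
rewrite nexpD/=; do ?[by apply: integral_ge0 => z _; rewrite lee_fin].
by rewrite mulrC mulKf// gt_eqF.
Qed.

Let exp2 (theta : R -> R) (z : R * R) : R :=
  expR (- (theta z.1 * z.2)) * exp_weight (beta z.1) z.2.

Let mexp2 (theta : R -> R) : measurable_fun setT theta -> measurable_fun setT (exp2 theta).
Proof.
move=> mt; apply: measurable_funM.
  apply: measurable_expRN; apply: measurable_funM => //; exact: (measurableT_comp mt).
apply: measurable_funM; first exact: measurable_pos2.
apply: measurable_expRN; apply: measurable_funM => //; exact: (measurableT_comp mb).
Qed.

Lemma measurable_exp_weight2 : measurable_fun setT (fun z : R * R => exp_weight (beta z.1) z.2).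
Proof.
apply: measurable_funM; first exact: measurable_pos2.
apply: measurable_expRN; apply: measurable_funM => //; exact: (measurableT_comp mb).
Qed.


(** Differentiating the joint Laplace transform of L and of Lc(A) in the second
    argument. The factor exp(- L(ray a)) hidden in theta >= 1 on the ray makes the
    difference quotients bounded. *)
Lemma palm_laplace (A : set R) (a : R) (theta : R -> R) :
  measurable A -> A `<=` ray a ->
  measurable_fun setT theta -> (forall x, 0 <= theta x) ->
  (forall x, x <= a -> 1 <= theta x) ->
  (\int[P]_w ((np theta (L w))%:E * LS (Lc w) A) =
   \int[P]_w (np theta (L w))%:E *
   \int[alpha \x leb]_z (\1_A z.1 * exp2 theta z)%:E)%E /\
  (\int[P]_w ((np theta (L w))%:E * LS (Lc w) A) < +oo)%E.
Proof.
move=> mA Aa mt t0 t1.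
have [nu [nuE inu]] := gamma_measure alpha mb.
pose y w := fine (LS (Lc w) A).
have LcA w : (LS (Lc w) A <= LS (L w) (ray a))%E.
  rewrite LS_contpart//; apply: le_measure; rewrite ?inE//.
  - by apply: measurableD => //; exact: measurable_countable.
  - by move=> x [/Aa].
have yE w : LS (Lc w) A = (y w)%:E.
  rewrite fineK// ge0_fin_numE// (le_lt_trans (LcA w))//.
  by rewrite [X in (X < _)%E]LS_ray ltry.
have y0 w : 0 <= y w by rewrite fine_ge0.
have my : measurable_fun setT y.
  by apply: (measurableT_comp (fine_measurable _)) => //; apply: (measurableT_comp (measurable_LS mA)).
have npy w : np theta (L w) <= expR (- y w).
  rewrite -nexp_EFin -yE; apply: le_nexp => //; apply: (le_trans (LcA w)).
  have -> : LS (L w) (ray a) = (\int[LS (L w)]_s (\1_(ray a) s)%:E)%E.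
    by rewrite integral_indic// setIT.
  apply: ge0_le_integral => //.
  - by apply/measurable_EFinP; exact: measurable_indic.
  - exact/measurable_EFinP.
  - move=> x _; rewrite lee_fin indicE; case: (boolP (x \in _)) => [|_]//.
    by rewrite inE /= in_itv/= => /t1.
have mnpL : measurable_fun setT (fun w => np theta (L w)) by exact: (measurableT_comp (mnp mt t0)).
have [c cE] : exists c, (\int[P]_w (np theta (L w))%:E = c%:E)%E.
  have := integral_bnd_fin P mnpL (fun w => np01 (L w) t0).
  by move=> /fineK <-; eexists.
pose h n x : R := \1_A x / n.+1%:R.
have mh n : measurable_fun setT (h n) by apply: measurable_funM.
have h0 n x : 0 <= h n x by rewrite divr_ge0.
have hL n w : np (h n) (Lc w) = expR (- (y w / n.+1%:R)).
  rewrite -nexp_EFin; congr nexp; rewrite mulrC EFinM -yE.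
  under eq_integral do rewrite /h mulrC EFinM.
  rewrite ge0_integralZl ?lee_fin ?invr_ge0//; last by apply/measurable_EFinP; exact: measurable_indic.
  by rewrite integral_indic// setIT.
(* the right-hand side: intensity of the difference quotients *)
pose q n z : R := expR (- lift_fun theta z) *
  (n.+1%:R * (1 - expR (- (lift_fun \1_A z / n.+1%:R)))) * gamma_density beta z.
pose q' z : R := \1_A z.1 * exp2 theta z.
have mindA : measurable_fun setT (fun z : R * R => \1_A z.1 : R).
  by apply: (measurableT_comp (measurable_indic mA)).
have indA0 x : 0 <= \1_A x :> R by [].
have lA0 z : 0 <= lift_fun \1_A z by exact: lift_fun_ge0.
have mq n : measurable_fun setT (q n).
  apply: measurable_funM; last exact: measurable_gamma_density.
  apply: measurable_funM; first by apply: measurable_expRN; exact: measurable_lift_fun.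
  apply: measurable_funM => //; apply: measurable_one_sub.
  by apply: measurable_funM => //; exact: measurable_lift_fun.
have mq' : measurable_fun setT q' by apply: measurable_funM => //; exact: mexp2.
have q0 n z : 0 <= q n z.
  apply: mulr_ge0; last exact: gamma_density_ge0.
  apply: mulr_ge0; first exact: expR_ge0.
  by apply: mulr_ge0 => //; apply: one_sub_expRN_ge0; rewrite divr_ge0.
pose dom (z : R * R) : R := exp_weight 1 z.2.
have mdom : measurable_fun setT (fun z => (dom z)%:E).
  by apply/measurable_EFinP; apply: (measurableT_comp (measurable_exp_weight 1)).
have q'E z : q' z = expR (- lift_fun theta z) * lift_fun \1_A z * gamma_density beta z.
  rewrite /q' /exp2 /lift_fun /gamma_density /exp_weight.
  have [v0|v0] := ltP 0 z.2; last by rewrite !(mul0r, mulr0).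
  by rewrite !mul1r; field; rewrite gt_eqF.
have q'dom z : q' z <= dom z.
  rewrite /q' /dom /exp2 /exp_weight mul1r indicE.
  have [v0|v0] := ltP 0 z.2; last by rewrite !(mul0r, mulr0).
  rewrite !mul1r -expRD; case: (boolP (z.1 \in A)) => [|_]; last by rewrite mul0r expR_ge0.
  rewrite inE => /Aa; rewrite /= in_itv/= => /t1 th1.
  rewrite mul1r ler_expR -opprD lerN2 -mulrDl -[X in X <= _]mul1r ler_wpM2r//; first exact: ltW.
  by rewrite (le_trans th1)// lerDl.
have qq' n z : q n z <= q' z.
  rewrite q'E ler_wpM2r ?gamma_density_ge0// ler_wpM2l ?expR_ge0//.
  have h1 : 0 <= lift_fun \1_A z / n.+1%:R by rewrite divr_ge0.
  have /andP[_ h2] := one_sub_expRN_bounds h1.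
  by rewrite mulrC -ler_pdivlMr.
have q'0 z : 0 <= q' z by exact: le_trans (q0 0%N z) (qq' 0%N z).
have dom0 z : 0 <= dom z by exact: exp_weight_ge0.
have idom : ((alpha \x leb).-integrable setT (EFin \o dom))%E.
  apply/integrableP; split => //.
  under eq_integral do rewrite /= ger0_norm//.
  rewrite (fubini_tonelli1 (fun z => (dom z)%:E)) => //; rewrite /fubini_F /dom/=.
  under eq_integral do rewrite integral_exp_weight// invr1.
  by rewrite integral_cst// mul1e ltey_eq fin_num_measure.
have qcvg z : q n z @[n --> \oo] --> q' z.
  rewrite q'E; apply: cvgM; last exact: cvg_cst.
  apply: cvgM; first exact: cvg_cst.
  by apply: cvg_slope => //; exact: cvg_cst.
have Jcvg : (\int[alpha \x leb]_z (q n z)%:E @[n --> \oo] --> \int[alpha \x leb]_z (q' z)%:E)%E.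
  apply: (dominated_cvg _ _ _ _ idom) => //.
  - by move=> n; exact/measurable_EFinP.
  - by move=> z _; apply: cvg_EFin; [exact: nearW|exact: qcvg].
  - by move=> n z _; rewrite /= lee_fin ger0_norm// (le_trans (qq' n z)).
have idomf : (\int[alpha \x leb]_z (dom z)%:E < +oo)%E.
  have /integrableP[_] := idom; under eq_integral do rewrite /= ger0_norm//.
  by [].
have qfin' (g : R * R -> R) : measurable_fun setT g -> (forall z, 0 <= g z <= dom z) ->
    (\int[alpha \x leb]_z (g z)%:E)%E = (fine (\int[alpha \x leb]_z (g z)%:E))%:E.
  move=> mg g0; rewrite fineK// ge0_fin_numE; last first.
    by apply: integral_ge0 => z _; rewrite lee_fin; have /andP[] := g0 z.
  apply: le_lt_trans idomf; apply: ge0_le_integral => //.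
  - by move=> z _; rewrite lee_fin; have /andP[] := g0 z.
  - exact/measurable_EFinP.
  - by move=> z _; rewrite lee_fin; have /andP[] := g0 z.
have qfin n := qfin' (q n) (mq n) (fun z => introT andP (conj (q0 n z) (le_trans (qq' n z) (q'dom z)))).
have q'fin := qfin' q' mq' (fun z => introT andP (conj (q'0 z) (q'dom z))).
set J := fine (\int[alpha \x leb]_z (q' z)%:E)%E in q'fin.
pose yn n := fine (\int[alpha \x leb]_z (q n z)%:E)%E.
have yn0 n : 0 <= yn n by rewrite fine_ge0//; apply: integral_ge0 => z _; rewrite lee_fin.
have ynJ : yn n @[n --> \oo] --> J by move: Jcvg; rewrite q'fin => /fine_cvg.
have InE n : (\int[nu]_z (expR (- lift_fun theta z) * (1 - expR (- lift_fun (h n) z)))%:E =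
    (yn n / n.+1%:R)%:E)%E.
  rewrite inu; last 2 first.
  - apply/measurable_EFinP; apply: measurable_funM.
      by apply: measurable_expRN; exact: measurable_lift_fun.
    by apply: measurable_one_sub; exact: measurable_lift_fun.
  - move=> z; rewrite lee_fin mulr_ge0 ?expR_ge0//.
    by apply: one_sub_expRN_ge0; exact: lift_fun_ge0.
  rewrite mulrC EFinM -qfin -ge0_integralZl//; last 2 first.
  - exact/measurable_EFinP.
  - by move=> z _; rewrite lee_fin.
  rewrite (fubini_tonelli1 (fun z => (n.+1%:R^-1)%:E * (q n z)%:E)%E); last 2 first.
  - by apply: measurable_funeM; exact/measurable_EFinP.
  - by move=> z; rewrite mule_ge0// lee_fin// invr_ge0.
  apply: eq_integral => x _; apply: eq_integral => v _; rewrite -!EFinM; congr (_%:E).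
  rewrite /q (_ : lift_fun (h n) (x, v) = lift_fun \1_A (x, v) / n.+1%:R); last first.
    by rewrite /lift_fun /h/= mulrAC.
  by field.
pose D n w : R := np theta (L w) * (n.+1%:R * (1 - expR (- (y w / n.+1%:R)))).
have yq0 n w : 0 <= y w / n.+1%:R by rewrite divr_ge0.
have DE n : (\int[P]_w (D n w)%:E = (c * (n.+1%:R * (1 - expR (- (yn n / n.+1%:R)))))%:E)%E.
  have mD1 : measurable_fun setT (fun w => np theta (L w) * expR (- (y w / n.+1%:R))).
    by apply: (measurable_funM mnpL); apply: measurable_expRN; exact: measurable_funM.
  transitivity (n.+1%:R%:E * \int[P]_w (np theta (L w) - np theta (L w) * expR (- (y w / n.+1%:R)))%:E)%E.
    rewrite -ge0_integralZl//.
    - by apply: eq_integral => w _; rewrite -EFinM /D; congr (_%:E); ring.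
    - by apply/measurable_EFinP; exact: (measurable_funB mnpL mD1).
    - move=> w _; rewrite lee_fin subr_ge0 ler_piMr ?nexp_ge0//.
      by have /andP[] := expRN01 (yq0 n w).
  rewrite (integral_subE (C := 1) _ mnpL mD1); last 3 first.
  - by rewrite [X in (X < _)%E]probability_setT ltry.
  - move=> w; have /andP[e0 e1] := expRN01 (yq0 n w).
    by rewrite mulr_ge0 ?nexp_ge0//= ler_piMr ?nexp_ge0.
  - by move=> w; have /andP[] := np01 (L w) t0.
  have -> : (\int[P]_w (np theta (L w) * expR (- (y w / n.+1%:R)))%:E =
      (c * expR (- (yn n / n.+1%:R)))%:E)%E.
    have := joint_laplace nuE mt t0 (mh n) (h0 n).
    rewrite InE cE -EFinM nexp_EFin => <-.
    apply: eq_integral => w _; exact: (congr1 (fun x => (np theta (L w) * x)%:E) (esym (hL n w))).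
  rewrite cE -EFinB -EFinM; congr (_%:E); ring.
have Dcvg : (\int[P]_w (D n w)%:E @[n --> \oo] --> \int[P]_w (np theta (L w) * y w)%:E)%E.
  apply: (bounded_convergence (C := 1)).
  - by rewrite [X in (X < _)%E]probability_setT ltry.
  - move=> n; apply: (measurable_funM mnpL); apply: measurable_funM => //.
    by apply: measurable_one_sub; exact: measurable_funM.
  - move=> n w; have D0 : 0 <= n.+1%:R * (1 - expR (- (y w / n.+1%:R))).
      by rewrite mulr_ge0// one_sub_expRN_ge0.
    rewrite ger0_norm; last by rewrite mulr_ge0 ?nexp_ge0.
    have Dy : n.+1%:R * (1 - expR (- (y w / n.+1%:R))) <= y w.
      by have /andP[_ h2] := one_sub_expRN_bounds (yq0 n w); rewrite mulrC -ler_pdivlMr.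
    apply: (@le_trans _ _ (expR (- y w) * y w)); first by rewrite ler_pM ?nexp_ge0.
    rewrite expRN mulrC ler_pdivrMr ?expR_gt0// mul1r.
    by apply: le_trans (expR_ge1Dx _); rewrite lerDr.
  - move=> w; apply: cvgM; first exact: cvg_cst.
    by apply: cvg_slope => //; exact: cvg_cst.
have Rcvg : ((c * (n.+1%:R * (1 - expR (- (yn n / n.+1%:R)))))%:E @[n --> \oo] --> (c * J)%:E)%E.
  apply: cvg_EFin; first exact: nearW.
  by apply: cvgM; [exact: cvg_cst|exact: cvg_slope].
have : (\int[P]_w ((np theta (L w))%:E * LS (Lc w) A) = (c * J)%:E)%E.
  rewrite -(cvge_eq DE Dcvg Rcvg).
  by apply: eq_integral => w _; rewrite yE -EFinM.
by move=> ->; rewrite ltry cE q'fin -EFinM.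
Qed.

Lemma ray_monotone d' (S : measurableType d') (m : {measure set (S * R) -> \bar R})
    (f : S * R -> \bar R) : measurable_fun setT f -> (forall z, 0 <= f z)%E ->
  (\int[m]_z (f z * (\1_(ray (n%:R : R)) z.2)%:E) @[n --> \oo] --> \int[m]_z f z)%E.
Proof.
move=> mf f0; have := @cvg_monotone_convergence _ _ _ m setT measurableT
  (fun n z => f z * (\1_(ray (n%:R : R)) z.2)%:E)%E.
rewrite (_ : (fun z => limn _) = f); last first.
  apply/funext => z; apply/cvg_lim => //; apply: cvg_near_cst.
  exists (Num.bound `|z.2|) => // n /= hn; rewrite indicE mem_set ?mule1//.
  rewrite /= in_itv/= (le_trans (ler_norm _))// (le_trans (ltW (archi_boundP _)))//.
  by rewrite ler_nat.
apply.
- move=> n; apply: emeasurable_funM => //; apply/measurable_EFinP.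
  by apply: (measurableT_comp (measurable_indic (measurable_itv _))).
- by move=> n z _; rewrite mule_ge0// lee_fin.
- move=> z _ a b ab; apply: lee_wpmul2l; first exact: f0.
  rewrite lee_fin !indicE; have [|_] := boolP (z.2 \in ray (a%:R : R)) => //.
  rewrite inE /= in_itv/= => h; rewrite mem_set//= in_itv/= (le_trans h)//.
  by rewrite ler_nat.
Qed.

(** Both sides are integrals of H against measures on pairs (path X, time s), the second
    obtained by adding to L an atom of size v at s. Adding it multiplies e^{-int theta dL}
    by e^{-theta(s) v}; so, once weighted by e^{-X(a)} and restricted to s <= a, the two
    measures are finite and have the same Laplace functionals by [palm_laplace]. *)
Lemma palm_formula (H : iap_path R * R -> \bar R) :
  measurable_fun setT H -> (forall z, 0 <= H z)%E ->
  (\int[P]_w \int[LS (Lc w)]_s H (L w, s) =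
   \int[alpha \x leb]_z \int[P]_w
     (H (add_atom (L w) z.2 z.1, z.1) * (exp_weight (beta z.1) z.2)%:E))%E.
Proof.
move=> mH H0.
have c1 : measurable_fun setT (fun _ : Om * R => 1 : R) by exact: measurable_cst.
have mphi1 : measurable_fun setT (fun z : Om * R => (L z.1, z.2)).
  by apply: measurable_fun_pair => //; exact: (measurableT_comp mL).
have [N1 iN1'] := kernel_mixture P (kap := fun w => LS (Lc w)) (measurable_integral_LS mLc)
  c1 (fun=> ler01) mphi1.
have iN1 (f : iap_path R * R -> \bar R) : measurable_fun setT f -> (forall y, 0 <= f y)%E ->
    (\int[N1]_y f y = \int[P]_w \int[LS (Lc w)]_s f (L w, s))%E.
  move=> mf f0; rewrite iN1'//; apply: eq_integral => w _; apply: eq_integral => s _.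
  by rewrite mule1.
pose W2 (y : (R * R) * Om) : R := exp_weight (beta y.1.1) y.1.2.
have mW2 : measurable_fun setT W2.
  by apply: (measurableT_comp (measurable_exp_weight2) (g := fst)).
have W20 y : 0 <= W2 y by exact: exp_weight_ge0.
have mz1 : measurable_fun setT (fun y : (R * R) * Om => y.1.1).
  by apply: (measurableT_comp measurable_fst); exact: measurable_fst.
have mz2 : measurable_fun setT (fun y : (R * R) * Om => y.1.2).
  by apply: (measurableT_comp measurable_snd); exact: measurable_fst.
have mphi2 : measurable_fun setT (fun y : (R * R) * Om =>
    (add_atom (L y.2) y.1.2 y.1.1, y.1.1)).
  apply: measurable_fun_pair => //; apply: measurable_add_atom => //.
  exact: (measurableT_comp mL).
have mkP (h : (R * R) * Om -> \bar R) : measurable_fun setT h -> (forall z, 0 <= h z)%E ->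
    measurable_fun setT (fun z => \int[P]_w h (z, w))%E.
  by move=> mh h0; exact: (measurable_fun_fubini_tonelli_F (m2 := P) h mh h0).
have [N2 iN2'] := kernel_mixture (alpha \x leb)%E (kap := fun=> P) mkP mW2 W20 mphi2.
have iN2 (f : iap_path R * R -> \bar R) : measurable_fun setT f -> (forall y, 0 <= f y)%E ->
    (\int[N2]_y f y = \int[alpha \x leb]_z \int[P]_w
     (f (add_atom (L w) z.2 z.1, z.1) * (exp_weight (beta z.1) z.2)%:E))%E.
  by move=> mf f0; rewrite iN2'.
rewrite -iN1// -iN2//.
have mind (B : set R) : measurable B -> measurable_fun setT (fun z : iap_path R * R => \1_B z.2 : R).
  by move=> mB; apply: (measurableT_comp (measurable_indic mB)).
have mev (a : R) : measurable_fun setT (fun z : iap_path R * R => z.1 a).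
  by apply: (measurableT_comp (measurable_eval a)).
pose Wt (a : R) (B : set R) (z : iap_path R * R) : R := expR (- z.1 a) * \1_(B `&` ray a) z.2.
have mWt a B : measurable B -> measurable_fun setT (Wt a B).
  move=> mB; apply: measurable_funM; first exact: measurable_expRN.
  by apply: mind; apply: measurableI => //; exact: measurable_itv.
have Wt0 a B z : 0 <= Wt a B z by rewrite mulr_ge0 ?expR_ge0.
have key (a : R) (B : set R) (E : set (iap_path R)) : measurable B -> measurable E ->
    (\int[N1]_z ((\1_E z.1)%:E * (Wt a B z)%:E) = \int[N2]_z ((\1_E z.1)%:E * (Wt a B z)%:E))%E /\
    (\int[N1]_z (Wt a B z)%:E < +oo)%E.
  move=> mB mE.
  have mf1 : measurable_fun setT (fun z : iap_path R * R => z.1) by exact: measurable_fst.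
  have [m1 im1] := image_measure N1 (mWt a B mB) (Wt0 a B) mf1.
  have [m2 im2] := image_measure N2 (mWt a B mB) (Wt0 a B) mf1.
  have mA : measurable (B `&` ray a) by apply: measurableI => //; exact: measurable_itv.
  have Aa : B `&` ray a `<=` ray a by move=> x [].
  pose th (theta : R -> R) x : R := theta x + \1_(ray a) x.
  have mra : measurable_fun setT (\1_(ray a) : R -> R) by exact: measurable_indic.
  have mth (theta : R -> R) : measurable_fun setT theta -> measurable_fun setT (th theta).
    by move=> mt; exact: measurable_funD.
  have th0 (theta : R -> R) : (forall x, 0 <= theta x) -> forall x, 0 <= th theta x.
    by move=> t0 x; rewrite addr_ge0.
  have th1 (theta : R -> R) : (forall x, 0 <= theta x) -> forall x, x <= a -> 1 <= th theta x.
    by move=> t0 x xa; rewrite /th indicE mem_set ?lerDr//= in_itv.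
  have npth (theta : R -> R) (X : iap_path R) : measurable_fun setT theta ->
      (forall x, 0 <= theta x) -> np theta X * expR (- X a) = np (th theta) X.
    move=> mt t0; rewrite (@nexp_pathD _ X theta _ mt mra t0)//; congr (_ * _).
    transitivity (nexp (LS X (ray a))); first by rewrite LS_ray.
    by congr nexp; rewrite integral_indic// setIT.
  have L1 (theta : R -> R) : measurable_fun setT theta -> (forall x, 0 <= theta x) ->
      (\int[N1]_z ((np theta z.1)%:E * (Wt a B z)%:E) =
       \int[P]_w ((np (th theta) (L w))%:E * LS (Lc w) (B `&` ray a)))%E.
    move=> mt t0; rewrite iN1.
    - apply: eq_integral => w _.
      transitivity (\int[LS (Lc w)]_s ((np (th theta) (L w))%:E * (\1_(B `&` ray a) s)%:E))%E.
        by apply: eq_integral => s _; rewrite /Wt/= -npth// -!EFinM mulrA.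
      rewrite ge0_integralZl//.
      + by rewrite integral_indic// setIT.
      + by apply/measurable_EFinP; exact: measurable_indic.
      + by rewrite lee_fin nexp_ge0.
    - apply: emeasurable_funM; apply/measurable_EFinP; last exact: mWt.
      exact: (measurableT_comp (mnp mt t0) mf1).
    - by move=> z; rewrite mule_ge0// lee_fin ?nexp_ge0.
  have L2 (theta : R -> R) : measurable_fun setT theta -> (forall x, 0 <= theta x) ->
      (\int[N2]_z ((np theta z.1)%:E * (Wt a B z)%:E) =
       \int[P]_w (np (th theta) (L w))%:E * \int[alpha \x leb]_z (\1_(B `&` ray a) z.1 *
         (expR (- (th theta z.1 * z.2)) * exp_weight (beta z.1) z.2))%:E)%E.
    move=> mt t0; rewrite iN2; last 2 first.
    - apply: emeasurable_funM; apply/measurable_EFinP; last exact: mWt.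
      exact: (measurableT_comp (mnp mt t0) mf1).
    - by move=> z; rewrite mule_ge0// lee_fin ?nexp_ge0.
    have mnpL : measurable_fun setT (fun w => (np (th theta) (L w))%:E).
      apply/measurable_EFinP; exact: (measurableT_comp (mnp (mth _ mt) (th0 _ t0)) mL).
    have npL0 w : (0 <= (np (th theta) (L w))%:E)%E by rewrite lee_fin nexp_ge0.
    have e20 (z : R * R) : 0 <= \1_(B `&` ray a) z.1 *
        (expR (- (th theta z.1 * z.2)) * exp_weight (beta z.1) z.2) :> R.
      by rewrite mulr_ge0// mulr_ge0 ?expR_ge0 ?exp_weight_ge0.
    rewrite -ge0_integralZl//; last 3 first.
    - apply/measurable_EFinP; apply: measurable_funM.
        by apply: (measurableT_comp (measurable_indic mA)).
      apply: measurable_funM; last exact: measurable_exp_weight2.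
      apply: measurable_expRN; apply: measurable_funM => //.
      exact: (measurableT_comp (mth _ mt)).
    - by move=> z _; rewrite lee_fin.
    - exact: integral_ge0.
    apply: eq_integral => z _; rewrite muleC -ge0_integralZl ?lee_fin//.
    apply: eq_integral => w _; rewrite /= -!EFinM; congr (_%:E).
    have [v0|v0] := ltP 0 z.2; last first.
      by rewrite /exp_weight ltNge v0/= !(mul0r, mulr0).
    pose X' := add_atom (L w) z.2 z.1.
    have E1 : np theta X' * Wt a B (X', z.1) = np (th theta) X' * \1_(B `&` ray a) z.1.
      by rewrite -npth// -mulrA.
    have E2 : np (th theta) X' = np (th theta) (L w) * expR (- (th theta z.1 * z.2)).
      have mt' : measurable_fun setT (fun x => (th theta x)%:E) by apply/measurable_EFinP; exact: mth.
      have t0' x : (0 <= (th theta x)%:E)%E by rewrite lee_fin th0.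
      rewrite /X' integral_add_atom//; last exact: ltW.
      rewrite nexpD; first by rewrite -EFinM nexp_EFin [z.2 * _]mulrC.
        exact: integral_ge0.
      by rewrite -EFinM lee_fin mulr_ge0 ?th0// ltW.
    rewrite -/X' E1 E2; ring.
  have lapE (theta : R -> R) : measurable_fun setT theta -> (forall x, 0 <= theta x) ->
      (\int[N1]_z ((np theta z.1)%:E * (Wt a B z)%:E) =
       \int[N2]_z ((np theta z.1)%:E * (Wt a B z)%:E))%E.
    move=> mt t0; rewrite L1// L2//.
    by have [] := palm_laplace mA Aa (mth _ mt) (th0 _ t0) (th1 _ t0).
  have mz0 : measurable_fun setT (fun _ : R => 0 : R) by exact: measurable_cst.
  have np0 X : np (fun=> 0) X = 1 by rewrite integral0 nexp0.
  have fin1 : (\int[N1]_z (Wt a B z)%:E < +oo)%E.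
    have : (\int[N1]_z ((np (fun=> 0) z.1)%:E * (Wt a B z)%:E) < +oo)%E.
      rewrite L1//.
      by have [] := palm_laplace mA Aa (mth _ mz0) (th0 _ (fun=> lexx _)) (th1 _ (fun=> lexx _)).
    by under eq_integral do rewrite np0 mul1e.
  have fin2 : (\int[N2]_z (Wt a B z)%:E < +oo)%E.
    move: fin1; have := lapE _ mz0 (fun=> lexx _).
    under eq_integral do rewrite np0 mul1e.
    by under [RHS]eq_integral do rewrite np0 mul1e; move=> ->.
  have mT (m : {measure set (iap_path R) -> \bar R}) : m setT = (\int[m]_X 1%:E)%E.
    by rewrite integral_cst// mul1e.
  have m1T : (m1 setT < +oo)%E.
    by rewrite mT im1//; under eq_integral do rewrite mul1e.
  have m2T : (m2 setT < +oo)%E.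
    by rewrite mT im2//; under eq_integral do rewrite mul1e.
  split => //.
  have := path_laplace_unique m1T m2T _ mE.
  have mE' (m : {measure set (iap_path R) -> \bar R}) : m E = (\int[m]_X (\1_E X)%:E)%E.
    by rewrite integral_indic// setIT.
  rewrite !mE' im1 ?im2; do ?[by apply/measurable_EFinP; exact: measurable_indic|by move=> y; rewrite lee_fin].
  apply => theta mt t0; rewrite im1 ?im2.
  - exact: lapE.
  - apply/measurable_EFinP; exact: (mnp mt t0).
  - by move=> X; rewrite lee_fin nexp_ge0.
  - apply/measurable_EFinP; exact: (mnp mt t0).
  - by move=> X; rewrite lee_fin nexp_ge0.
(* from rectangles to all sets; the factor e^{X(a)} then undoes the weight *)
have trunc (a : R) (f : iap_path R * R -> \bar R) : measurable_fun setT f -> (forall z, 0 <= f z)%E ->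
    (\int[N1]_z (f z * (\1_(ray a) z.2)%:E) = \int[N2]_z (f z * (\1_(ray a) z.2)%:E))%E.
  move=> mf f0; have mWa := mWt a _ measurableT; have Wa0 := Wt0 a setT.
  have [n1 [n1E in1]] := density_measure N1 mWa Wa0.
  have [n2 [n2E in2]] := density_measure N2 mWa Wa0.
  have n1T : (n1 setT < +oo)%E.
    by rewrite n1E//; have [_] := key a _ _ measurableT measurableT.
  have nE : forall C, measurable C -> n1 C = n2 C.
    apply: product_measure_ext n1T _ => E B mE mB.
    have mEB : measurable (E `*` B) by exact: measurableX.
    rewrite n1E// n2E// integral_setE [RHS]integral_setE.
    have F z : ((Wt a setT z)%:E * (\1_(E `*` B) z)%:E = (\1_E z.1)%:E * (Wt a B z)%:E)%E.
      rewrite -!EFinM /Wt setTI [\1_(B `&` _)]indicI/=; congr (_%:E).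
      have -> : \1_(E `*` B) z = \1_E z.1 * \1_B z.2 :> R by rewrite !indicE in_setX/= -natrM mulnb.
      by rewrite /=; ring.
    under eq_integral do rewrite F.
    by under [RHS]eq_integral do rewrite F; have [] := key a B E mB mE.
  have G z : (f z * (\1_(ray a) z.2)%:E = f z * (expR (z.1 a))%:E * (Wt a setT z)%:E)%E.
    rewrite -muleA -EFinM /Wt setTI mulrA expRN mulfV ?mul1r// gt_eqF//; exact: expR_gt0.
  have mfe : measurable_fun setT (fun z => f z * (expR (z.1 a))%:E)%E.
    apply: emeasurable_funM => //; apply/measurable_EFinP.
    by apply: measurableT_comp => //; exact: mev.
  have fe0 z : (0 <= f z * (expR (z.1 a))%:E)%E by rewrite mule_ge0// lee_fin expR_ge0.
  under eq_integral do rewrite G.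
  under [RHS]eq_integral do rewrite G.
  rewrite -in1// -in2//.
  by apply: eq_measure_integral => C mC _; exact: nE.
have h1 := ray_monotone (m := N1) mH H0.
have h2 := ray_monotone (m := N2) mH H0.
by apply: (cvge_eq _ h1 h2) => n; exact: trunc.
Qed.

End palm.

(** * Measurability of the derivative of the kernel *)

Section derivative.
Context {R : realType}.

(** A Cauchy condition at 0 with countably many quantifiers, hence measurable in a
    parameter. *)
Definition rational_cauchy (q : R -> R) : Prop :=
  forall m : nat, exists n : nat, forall a b : rat,
    0 < `|ratr a : R| < n.+1%:R^-1 -> 0 < `|ratr b : R| < n.+1%:R^-1 ->
    `|q (ratr a) - q (ratr b)| <= m.+1%:R^-1.

Lemma invS_lt (e : R) : 0 < e -> exists n : nat, n.+1%:R^-1 < e.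
Proof.
move=> e0; exists (Num.bound e^-1).
rewrite invf_plt ?posrE//; apply: (lt_trans (archi_boundP _)); first by rewrite invr_ge0 ltW.
by rewrite ltr_nat.
Qed.

(** By continuity away from 0 the rational increments suffice. *)
Lemma punctured_cvg (q : R -> R) : (forall h, h != 0 -> {for h, continuous q}) ->
  rational_cauchy q <-> cvg (q h @[h --> 0^']).
Proof.
move=> qc; split; last first.
  move=> /cvg_ex[l ql] m.
  have e0 : 0 < m.+1%:R^-1 / 2 :> R by rewrite divr_gt0// invr_gt0.
  have /cvgrPdist_lt/(_ _ e0) := ql.
  rewrite /dnbhs/= => /nbhs_ballP[r /= r0 Hr].
  have [n nr] := invS_lt r0; exists n => a b /andP[a0 an] /andP[b0 bn].
  have Q (x : R) : 0 < `|x| -> `|x| < n.+1%:R^-1 -> `|l - q x| < m.+1%:R^-1 / 2.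
    move=> x0 xn; apply: Hr; last by rewrite -normr_gt0.
    by rewrite /ball/= sub0r normrN (lt_trans xn).
  rewrite (_ : q (ratr a) - q (ratr b) = (l - q (ratr b)) - (l - q (ratr a))); last by ring.
  rewrite (le_trans (ler_normB _ _))// ltW// [X in _ < X]splitr.
  by rewrite ltrD// Q.
move=> C; apply/cauchy_cvgP/cauchy_ballP => e e0.
have e4 : 0 < e / 4 by rewrite divr_gt0.
have [m me] := invS_lt e4.
have [n Hn] := C m.
have n0 : 0 < n.+1%:R^-1 :> R by rewrite invr_gt0.
pose U := [set h : R | 0 < `|h| < n.+1%:R^-1].
have oU : open U.
  have -> : U = (ball (0 : R) n.+1%:R^-1) `&` ~` [set 0].
    apply/seteqP; split => h; rewrite /U /ball/= sub0r normrN.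
      by rewrite normr_gt0 => /andP[/eqP].
    by move=> [-> /eqP]; rewrite -normr_gt0 => ->.
  by apply: openI; [exact: ball_open|exact/closed_openC/closed_eq].
have real_bound h : U h -> exists a : rat, U (ratr a) /\ `|q h - q (ratr a)| < e / 4.
  move=> Uh; have h0 : h != 0 by move: Uh => /andP[]; rewrite normr_gt0.
  have /cvgrPdist_lt/(_ _ e4) Hq := qc _ h0.
  have HU : nbhs h U by exact: open_nbhs_nbhs.
  have /nbhs_ballP[r /= r0 Hr] : nbhs h (U `&` [set x | `|q h - q x| < e / 4]) by exact: filterI.
  have hr : h - r < h + r by rewrite ltrBlDr -addrA ltrDl addr_gt0.
  have [a] := rat_in_itvoo hr; rewrite in_itv/= => /andP[h1 h2]; exists a; apply: Hr.
  by rewrite /ball/= ltr_norml; apply/andP; split; lra.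
have all_bound h h' : U h -> U h' -> `|q h - q h'| < e.
  move=> /real_bound[a [Ua qa]] /real_bound[b [Ub qb]].
  have qab : `|q (ratr a) - q (ratr b)| < e / 4 by rewrite (le_lt_trans (Hn _ _ Ua Ub)).
  by move: qa qb qab; rewrite !ltr_norml => /andP[? ?] /andP[? ?] /andP[? ?]; apply/andP; split; lra.
have FU : nbhs (0 : R)^' U.
  rewrite /dnbhs /=; apply/nbhs_ballP; exists n.+1%:R^-1 => //= x.
  rewrite /ball/= sub0r normrN => xn x0; by rewrite /U/= normr_gt0 x0.
exists (q @` U, q @` U).
  by split; apply: filterS FU => h Uh; exists h.
by move=> [x y] /= [[h Uh <-] [h' Uh' <-]]; exact: all_bound.
Qed.

Section kernel.
Variable k : R -> R -> R.
Hypothesis k_ok : kernel_assumptions k.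

Let quot (h : R) (z : R * R) : R := h^-1 * (k (h + z.1) z.2 - k z.1 z.2).

Lemma measurable_kernel_section t : measurable_fun setT (k t).
Proof.
have [mk _ _ _ _] := k_ok.
apply: (measurableT_comp (f := fun z : R * R => k z.1 z.2) (g := fun x : R => (t, x))) => //.
exact: measurable_pair1.
Qed.

Lemma kernel_continuous s : continuous (k ^~ s).
Proof.
have [_ _ _ ac _] := k_ok; move=> x; apply/cvgrPdist_lt => e e0.
have [dl dl0 H] := ac s (x - 1) (x + 1) e e0.
have m0 : 0 < Num.min dl 1 by rewrite lt_min dl0 ltr01.
apply/nbhs_ballP; exists (Num.min dl 1) => //= y; rewrite /ball/= lt_min => /andP[ydl y1].
pose I (i : 'I_1) : R * R := (Num.min x y, Num.max x y).
have := H 1%N I; rewrite !big_ord1 /I/= => {}H.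
have dE : Num.max x y - Num.min x y = `|x - y|.
  have [xy|xy] := leP x y; first by rewrite distrC ger0_norm// subr_ge0.
  by rewrite gtr0_norm// subr_gt0.
have kE : `|k (Num.max x y) s - k (Num.min x y) s| = `|k x s - k y s|.
  by have [xy|xy] := leP x y => //; rewrite distrC.
rewrite -kE; apply: H; last by rewrite dE.
- move=> _; move: y1; rewrite ltr_norml => /andP[y1 y2].
  by have [xy|xy] := leP x y; apply/and3P; split; lra.
- by apply/trivIsetP => i j _ _; rewrite !ord1.
Qed.

Let quot_continuous z h : h != 0 -> {for h, continuous (quot ^~ z)}.
Proof.
move=> h0; apply: continuousM; first exact: inv_continuous.
apply: continuousB; last exact: cst_continuous.
apply: (@continuous_comp _ _ _ (fun h : R => h + z.1) (k ^~ z.2)).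
  by apply: continuousD; [exact: cvg_id|exact: cst_continuous].
exact: kernel_continuous.
Qed.

Let mquot h : measurable_fun setT (quot h).
Proof.
have [mk _ _ _ _] := k_ok; apply: measurable_funM => //; apply: measurable_funB; last exact: mk.
apply: (measurableT_comp mk (g := fun z : R * R => (h + z.1, z.2))).
by apply: measurable_fun_pair => //; exact: measurable_funD.
Qed.

(** The derivative is the pointwise limit of difference quotients, cut off to the
    measurable set where these have a limit. *)
Lemma derive1_approx : exists g : nat -> R * R -> R,
  [/\ forall n, measurable_fun setT (g n),
      forall n z, g n z = 0 \/ g n z = quot n.+1%:R^-1 z &
      forall z, g n z @[n --> \oo] --> derive1 (k ^~ z.2) z.1].
Proof.
pose C := [set z | rational_cauchy (quot ^~ z)].
have mC : measurable C.
  pose B (m n : nat) (a b : rat) := [set z : R * R |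
    0 < `|ratr a : R| < n.+1%:R^-1 -> 0 < `|ratr b : R| < n.+1%:R^-1 ->
    `|quot (ratr a) z - quot (ratr b) z| <= m.+1%:R^-1].
  have mB m n a b : measurable (B m n a b).
    have [ha|ha] := pselect (0 < `|ratr a : R| < n.+1%:R^-1); last first.
      by rewrite (_ : B _ _ _ _ = setT)//; apply/seteqP; split => z //= ? ?.
    have [hb|hb] := pselect (0 < `|ratr b : R| < n.+1%:R^-1); last first.
      by rewrite (_ : B _ _ _ _ = setT)//; apply/seteqP; split => z //= ? ?.
    rewrite (_ : B _ _ _ _ = (fun z => `|quot (ratr a) z - quot (ratr b) z|) @^-1` ray m.+1%:R^-1).
      by apply: measurable_pre => //; apply: measurableT_comp => //; exact: measurable_funB.
    by apply/seteqP; split => z; rewrite /B/= in_itv/=; [apply|].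
  have mcap (F : rat -> set (R * R)) : (forall a, measurable (F a)) -> measurable (\bigcap_a F a).
    move=> mF; rewrite -[X in measurable X]setCK setC_bigcap; apply: measurableC.
    by apply: bigcupT_measurable_rat => a; exact: measurableC.
  rewrite (_ : C = \bigcap_m \bigcup_n \bigcap_a \bigcap_b B m n a b).
    apply: bigcapT_measurable => m; apply: bigcupT_measurable => n.
    by apply: (mcap _) => a; exact: mcap.
  apply/seteqP; split => z.
    by move=> Cz m _; have [n H] := Cz m; exists n => // a _ b _; exact: H.
  by move=> Cz m; have [n _ H] := Cz m I; exists n => a b; exact: (H a I b I).
exists (fun n z => \1_C z * quot n.+1%:R^-1 z); split.
- by move=> n; apply: measurable_funM.
- move=> n z; rewrite indicE; case: (z \in C); first by right; rewrite mul1r.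
  by left; rewrite mul0r.
- move=> z; have qE : (fun h => h^-1 *: (k (h + z.1) z.2 - k z.1 z.2)) = quot ^~ z by [].
  have [Cz|nCz] := pselect (C z); last first.
    rewrite /derive1 qE dvgP; last by move=> /(punctured_cvg (@quot_continuous z)).
    apply: cvg_near_cst; apply: nearW => n; rewrite indicE memNset// mul0r.
    by [].
  have cv : cvg (quot h z @[h --> 0^']) by apply/punctured_cvg => //; exact: quot_continuous.
  rewrite /derive1 qE; under eq_fun do rewrite indicE mem_set// mul1r.
  have cv0 : n.+1%:R^-1 @[n --> \oo] --> (0 : R)^'.
    move=> A /= /nbhs_ballP[r /= r0 Hr].
    have : \forall n \near \oo, n.+1%:R^-1 < r.
      have := @cvg_harmonic R; move=> /cvgrPdist_lt/(_ _ r0).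
      by apply: filterS => n; rewrite sub0r normrN ger0_norm// invr_ge0.
    apply: filterS => n nr; apply: Hr; last by rewrite invr_eq0.
    by rewrite /ball/= sub0r normrN ger0_norm// invr_ge0.
  exact: (cvg_comp _ _ cv0 cv).
Qed.

Lemma measurable_derive1 : measurable_fun setT (fun z : R * R => derive1 (k ^~ z.2) z.1).
Proof.
have [g [mg _ gl]] := derive1_approx.
by apply: (measurable_fun_cvg mg) => z _; exact: gl.
Qed.

Lemma derive1_ge0 t s : 0 <= derive1 (k ^~ s) t.
Proof.
have [g [mg gE gl]] := derive1_approx.
have := gl (t, s) => /= lim; rewrite -(cvg_lim _ lim)//.
apply: limr_ge; first by apply/cvg_ex; eexists; exact: lim.
apply: nearW => n; have [->|->] // := gE n (t, s).
have [_ _ ndk _ _] := k_ok.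
by rewrite mulr_ge0// ?invr_ge0// subr_ge0; apply: ndk; rewrite lerDr invr_ge0.
Qed.

(** Where k vanishes at a later time it is constant equal to 0 until then. *)
Lemma derive1_eq0 t s u : t < u -> k u s = 0 -> derive1 (k ^~ s) t = 0.
Proof.
move=> tu ku; have [g [mg gE gl]] := derive1_approx.
have := gl (t, s) => /= lim; rewrite -(cvg_lim _ lim)//.
apply/cvg_lim => //; apply: cvg_near_cst.
have [_ k0 ndk _ _] := k_ok.
have kz x : x <= u -> k x s = 0.
  by move=> xu; apply/eqP; rewrite eq_le k0 andbT -ku ndk.
have d0 : 0 < u - t by rewrite subr_gt0.
have [n0 n0r] := invS_lt d0.
exists n0 => // n /= n0n; have [->|->] // := gE n (t, s).
rewrite /quot/= (kz t) ?ltW// kz ?subrr ?mulr0//.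
rewrite -lerBrDr ltW// (le_lt_trans _ n0r)// lef_pV2 ?posrE// ler_nat.
by rewrite ltnS.
Qed.

End kernel.
End derivative.

(** * Normalised kernels and added atoms *)

Section normalized_kernel.
Context {R : realType} d (Z : measurableType d) d' (V : measurableType d').
Variable ker : Z -> {measure set V -> \bar R}.
Hypothesis mker : forall A, measurable A -> measurable_fun setT (fun z => ker z A).

(** The argument makes the measurability part of the term, for the kernel structure. *)
Definition family_kernel of (forall A, measurable A -> measurable_fun setT (fun z => ker z A)) :
  Z -> {measure set V -> \bar R} := ker.

HB.instance Definition _ := isKernel.Build _ _ Z V R (family_kernel mker) mker.

(** Where the mass of [ker z] is zero or infinite, Q z is a default law. *)
Lemma normalized_kernel : exists Q : R.-pker Z ~> V,
  forall z (c : R), 0 < c -> ker z setT = c%:E ->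
  forall f : V -> \bar R, measurable_fun setT f -> (forall y, 0 <= f y)%E ->
  (\int[Q z]_y f y = c^-1%:E * \int[ker z]_y f y)%E.
Proof.
exists (knormalize (family_kernel mker) (\d_point : probability V R)) => z c c0 cE f mf f0.
have c0' : 0 <= c^-1 by rewrite invr_ge0 ltW.
rewrite (@eq_measure_integral _ _ _ setT (mscale (NngNum c0') (ker z))).
  by rewrite ge0_integral_mscale.
move=> A mA _; rewrite /knormalize/= /mnormalize/= /family_kernel cE.
by rewrite !eqe gt_eqF//= /mscale/= muleC.
Qed.

End normalized_kernel.

Section atoms.
Context {R : realType}.
Implicit Types (X Y : iap_path R) (M : set R).

Lemma add_atom0 X s : add_atom X 0 s = X.
Proof. by apply: path_ext => t; rewrite add_atomE// mul0r addr0. Qed.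

Lemma jump_add_atom X v s tau : 0 <= v ->
  jump (add_atom X v s) tau = jump X tau + v * (tau == s)%:R.
Proof.
move=> v0; have mtau : measurable [set tau] by exact: measurable_set1.
have := LS_add_atom X s v0 mtau; rewrite (jumpE (add_atom X v s) tau) (jumpE X tau).
rewrite -EFinD => -[->]; congr (_ + _ * _%:R); congr nat_of_bool.
by apply/idP/eqP; rewrite inE/= => ->.
Qed.

Lemma contpart_eq M X Y : countable M ->
  (forall A, measurable A -> LS Y A = LS X (A `\` M)) -> contpart M X = Y.
Proof.
move=> cM h; apply: path_ext => t; apply: EFin_inj.
by rewrite -!LS_ray h// LS_contpart.
Qed.

Lemma countable_setU1 M s : countable M -> countable (M `|` [set s]).
Proof. move=> cM; rewrite (_ : _ `|` _ = \bigcup_b (if b then M else [set s])).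
  by apply: bigcup_countable => // -[] _ //; exact: countable1.
apply/seteqP; split => x; first by case=> h; [exists true|exists false].
by move=> [[] _ h]; [left|right]. Qed.

Lemma contpart_add_atom M X v s : countable M -> 0 <= v ->
  contpart (M `|` [set s]) (add_atom X v s) = contpart (M `|` [set s]) X.
Proof.
move=> cM v0; have cM' := countable_setU1 s cM.
have mM' := measurable_countable cM'.
apply: contpart_eq => // A mA; rewrite LS_contpart// LS_add_atom//; last exact: measurableD.
by rewrite indicE memNset ?mulr0 ?adde0//= => -[_] []; right.
Qed.

Lemma jump_contpart M X s : countable M -> ~ M s -> jump (contpart M X) s = jump X s.
Proof.
move=> cM nMs; apply: EFin_inj; rewrite -!jumpE LS_contpart//; congr (LS X _).
by apply/seteqP; split => x /=; [case|move=> ->].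
Qed.

Lemma contpart_setU1 M X s : countable M -> jump X s = 0 ->
  contpart (M `|` [set s]) X = contpart M X.
Proof.
move=> cM Xs0; have mM := measurable_countable cM.
have cM' := countable_setU1 s cM; have mM' := measurable_countable cM'.
apply: contpart_eq => // A mA; rewrite LS_contpart//.
have -> : LS X (A `\` M) = (LS X ((A `\` M) `\` [set s]) + LS X ((A `\` M) `&` [set s]))%E.
  by apply: measureDI => //; exact: measurableD.
have -> : LS X ((A `\` M) `&` [set s]) = 0%E.
  apply: (subset_measure0 (B := [set s])) => //.
  - by apply: measurableI => //; exact: measurableD.
  - by rewrite /= jumpE Xs0.
by rewrite adde0 setDDl.
Qed.

Lemma contpart_setU1_id M X s : M s -> contpart (M `|` [set s]) X = contpart M X.
Proof. by move=> Ms; congr contpart; apply/seteqP; split => x /=; [case=> [//|->]|left]. Qed.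

(** The atom removed is random too, hence measurability in the pair. *)
Lemma measurable_contpart_setU1 M d (T : measurableType d) (X : T -> iap_path R) (s : T -> R) :
  countable M -> measurable_fun setT X -> measurable_fun setT s ->
  measurable_fun setT (fun x => contpart (M `|` [set s x]) (X x)).
Proof.
move=> cM mX ms; have mM := measurable_countable cM.
apply: measurable_path => t; apply/measurable_EFinP.
rewrite (_ : _ \o _ = fun x => LS (X x) [set r | [set z : T * R | ray t z.2 /\ ~ M z.2 /\ z.2 <> s z.1] (x, r)]).
  apply: measurable_LS_section => //.
  rewrite (_ : [set _ | _] = (snd @^-1` ray t) `&` ((snd @^-1` (~` M)) `&` ~` [set z | z.2 = s z.1])).
    apply: measurableI; first exact: measurable_pre.
    apply: measurableI; first by apply: measurable_pre => //; exact: measurableC.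
    by apply: measurableC; exact: measurable_graph.
  by apply/seteqP; split => z /=.
apply/funext => x /=; rewrite -LS_ray LS_contpart//; last exact: countable_setU1.
congr (LS _ _); apply/seteqP; split => r /=.
  by move=> [rt nM]; split => //; split => h; apply: nM; [left|right].
by move=> [rt [nM ns]]; split => // -[].
Qed.

End atoms.

Lemma jump_law_integral {R : realType} d (Om : measurableType d) (P : probability Om R)
    (J : Om -> R) (f : R -> R) (h : R -> \bar R) :
  measurable_fun setT J -> pos_density f ->
  (forall B, measurable B -> P [set w | B (J w)] =
    (\int[@lebesgue_measure R]_(x in B `&` `]0%R, +oo[) (f x)%:E)%E) ->
  measurable_fun setT h -> (forall x, 0 <= h x)%E ->
  (\int[P]_w h (J w) = \int[leb]_(x in `]0%R, +oo[) (h x * (f x)%:E))%E.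
Proof.
move=> mJ [mf f0 _] law mh h0.
pose rho x : R := f x * \1_`]0%R, +oo[ x.
have mrho : measurable_fun setT rho by apply: measurable_funM.
have rho0 x : 0 <= rho x by rewrite mulr_ge0.
have [m [mE im]] := density_measure leb mrho rho0.
rewrite (@eq_law_integral _ _ _ _ _ _ _ P m J id)//.
- rewrite im// [RHS]integral_setE; apply: eq_integral => x _.
  by rewrite /rho EFinM muleA.
- move=> A mA; have := law A mA => /= ->; rewrite integral_leb.
  + transitivity (\int[leb]_(x in A) (rho x)%:E)%E; last by rewrite -mE.
    rewrite integral_setE [RHS]integral_setE; apply: eq_integral => x _.
    by rewrite /rho indicI -!EFinM; congr (_%:E); rewrite /=; ring.
  + by apply: measurableI => //; exact: measurable_itv.
  + by apply: measurable_funTS; exact/measurable_EFinP.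
  + by move=> x _; rewrite lee_fin.
Qed.

(** * Posterior law given the latent atom *)

Section posterior_at.
Context {R : realType} d (Om : measurableType d).
Variables (P : probability Om R) (L : Om -> iap_path R) (M : set R) (f : R -> R -> R).
Variables (alpha : {finite_measure set R -> \bar R}) (beta : R -> R).
Hypotheses (mL : measurable_fun setT L) (cM : countable M).
Hypotheses (mb : measurable_fun setT beta) (beta_ge0 : forall x, 0 <= beta x).
Let Lc w := contpart M (L w).
Hypotheses (ind : indep_jumps P L M Lc) (eg : extended_gamma P Lc alpha beta).
Hypothesis nofix : no_fixed_discontinuity P Lc.
Hypothesis jump_law : forall tau, M tau -> pos_density (f tau) /\
  forall B, measurable B -> P [set w | B (jump (L w) tau)] =
    (\int[@lebesgue_measure R]_(x in B `&` `]0%R, +oo[) (f tau x)%:E)%E.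

Variables (theta : R -> R) (s : R).
Hypotheses (mt : measurable_fun setT theta) (t0 : forall x, 0 <= theta x) (ts0 : 0 < theta s).
Hypothesis Zfin : {ae P, forall w, (\int[LS (L w)]_x (theta x)%:E < +oo)%E}.

Local Notation np X := (nexp (\int[LS X]_x (theta x)%:E)%E).

(** Posterior at a given latent atom s, with theta = u k(Ups, .). If s is a fixed
    atom, choosing it according to dL weights the path by its jump at s; otherwise the
    Palm formula puts an atom of some size v at s. Either way the path is weighted by
    e^{-int theta dL}, with the new atom counted in the weight of v. For a fixed atom,
    v is a dummy variable integrated over [0, 1], which gives both cases one form. *)
Definition path_weight (X : iap_path R) : R := (if `[<M s>] then jump X s else 1) * np X.
Definition size_weight (v : R) : R :=
  if `[<M s>] then \1_`[0%R, 1%R] v else exp_weight (beta s + theta s) v.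
Definition moved (X : iap_path R) (v : R) : iap_path R :=
  add_atom X (if `[<M s>] then 0 else v) s.

Let b := beta s + theta s.
Let b0 : 0 < b. Proof. by rewrite ltr_wpDl. Qed.

Let mJ tau : measurable_fun setT (fun w => jump (L w) tau).
Proof. by apply: measurable_jump => //; exact: measurable_cst. Qed.

Let mLc : measurable_fun setT Lc.
Proof. exact: (measurableT_comp (measurable_contpart cM)). Qed.

Let wt (tau y : R) : R := (if tau == s then `|y| else 1) * expR (- (theta tau * `|y|)).

(* a common bound for e^{-theta x} and for x e^{-theta(s) x} *)
Let C : R := 1 + (theta s)^-1.

Let mwt tau : measurable_fun setT (wt tau).
Proof.
apply: measurable_funM; last exact: measurable_expR_abs.
by case: (tau == s); [exact: measurableT_comp|exact: measurable_cst].
Qed.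

Let xexp y : 0 <= y -> y * expR (- (theta s * y)) <= (theta s)^-1.
Proof.
move=> y0; rewrite expRN ler_pdivrMr ?expR_gt0// -ler_pdivrMl ?invr_gt0// invrK.
by apply: le_trans (expR_ge1Dx _); rewrite lerDr.
Qed.

Let wtC tau y : 0 <= wt tau y <= C.
Proof.
have /andP[e0 e1] : 0 <= expR (- (theta tau * `|y|)) <= 1 by apply: expRN01; rewrite mulr_ge0.
rewrite /wt; case: eqP => [->|_]; last by rewrite mul1r e0/= (le_trans e1)// lerDl invr_ge0.
by rewrite mulr_ge0 ?expR_ge0//= (le_trans (xexp _))// lerDr.
Qed.

Let np01 (X : iap_path R) : 0 <= np X <= 1.
Proof. by rewrite nexp_ge0 nexp_le1// path_integral_ge0. Qed.

Let npC (X : iap_path R) : 0 <= np X <= C.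
Proof.
by have /andP[n0 n1] := np01 X; rewrite n0 (le_trans n1)// lerDl invr_ge0.
Qed.

Let mnp : measurable_fun setT (fun X : iap_path R => np X).
Proof. exact: measurable_nexp_path. Qed.

Lemma measurable_path_weight : measurable_fun setT path_weight.
Proof.
apply: measurable_funM => //; case: asboolP => _; last exact: measurable_cst.
by apply: measurable_jump => //; exact: measurable_cst.
Qed.

Lemma path_weight_ge0 X : 0 <= path_weight X.
Proof. by rewrite mulr_ge0 ?nexp_ge0//; case: ifP => // _; exact: jump_ge0. Qed.

Lemma size_weight_ge0 v : 0 <= size_weight v.
Proof. by rewrite /size_weight; case: ifP => _; [|exact: exp_weight_ge0]. Qed.

Lemma measurable_size_weight : measurable_fun setT size_weight.
Proof. by rewrite /size_weight; case: asboolP => _; [exact: measurable_indic|exact: measurable_exp_weight]. Qed.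

Let rc : R := if `[<M s>] then 1 else b^-1.

Let rcE : (\int[leb]_v (size_weight v)%:E = rc%:E)%E.
Proof.
rewrite /size_weight /rc; case: asboolP => _; last exact: integral_exp_weight.
rewrite integral_indic// setIT; apply: (eq_trans (lebesgue_measure_itv _)).
by rewrite /= lte_fin ltr01 -EFinB subr0.
Qed.

Let rc0 : 0 < rc. Proof. by rewrite /rc; case: ifP => _ //; rewrite invr_gt0. Qed.

Section with_enumeration.
Variable s_ : nat -> seq R.
Hypotheses (us : forall n, uniq (s_ n))
  (nds : forall m n, (m <= n)%N -> {subset s_ m <= s_ n})
  (sM : forall tau, M tau <-> exists n, tau \in s_ n).

Let a_ (n : nat) (X : iap_path R) : R := if s \in s_ n then jump X s else 1.

Let prod_wt n w : \prod_(tau <- s_ n) wt tau (jump (L w) tau) =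
  a_ n (L w) * \prod_(tau <- s_ n) expR (- (theta tau * jump (L w) tau)).
Proof.
rewrite big_split/=; congr (_ * _); last first.
  by apply: eq_bigr => tau _; rewrite ger0_norm// jump_ge0.
rewrite /a_; have [h|h] := boolP (s \in s_ n).
  rewrite (bigD1_seq s)//= eqxx ger0_norm ?jump_ge0// big1 ?mulr1// => tau /negbTE ->.
  by [].
by rewrite big1_seq// => tau /andP[_ ht]; rewrite ifN//; apply: contraNneq h => <-.
Qed.

Let wlim w : \prod_(tau <- s_ n) wt tau (jump (L w) tau) * np (Lc w) @[n --> \oo] -->
  path_weight (L w).
Proof.
have jl := jumps_path_cvg cM us nds sM (X := L w) mt t0.
rewrite (_ : (fun n => _) = fun n => a_ n (L w) *
    (\prod_(tau <- s_ n) expR (- (theta tau * jump (L w) tau)) * np (Lc w))); last first.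
  by apply/funext => n; rewrite prod_wt mulrA.
apply: cvgM => //; apply: cvg_near_cst; case: asboolP => [/sM[n0 h]|nMs].
  by exists n0 => // n /= n0n; rewrite /a_ (nds n0n h).
by apply: nearW => n; rewrite /a_ ifN//; apply/negP => h; apply: nMs; apply/sM; exists n.
Qed.

Let wbd n w : \prod_(tau <- s_ n) wt tau (jump (L w) tau) * np (Lc w) <= C.
Proof.
have /andP[n0 n1] := np01 (Lc w).
have e01 tau : 0 <= expR (- (theta tau * jump (L w) tau)) <= 1.
  by apply: expRN01; rewrite mulr_ge0// jump_ge0.
have P0 : 0 <= \prod_(tau <- s_ n) wt tau (jump (L w) tau).
  by apply: prodr_ge0 => tau _; have /andP[] := wtC tau (jump (L w) tau).
apply: (@le_trans _ _ (\prod_(tau <- s_ n) wt tau (jump (L w) tau))); first by rewrite ler_piMr.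
rewrite prod_wt /a_; case: ifP => h; last first.
  by rewrite mul1r; have /andP[_ p1] := prod01 (s_ n) e01; rewrite (le_trans p1)// lerDl invr_ge0.
rewrite (big_rem _ h)/= mulrA.
have /andP[r0 r1] := prod01 (rem s (s_ n)) e01.
apply: (@le_trans _ _ (jump (L w) s * expR (- (theta s * jump (L w) s)))).
  by rewrite ler_piMr// mulr_ge0 ?expR_ge0 ?jump_ge0.
by rewrite (le_trans (xexp (jump_ge0 _ _)))// lerDr.
Qed.

Let weightC w : 0 <= path_weight (L w) <= C.
Proof.
rewrite path_weight_ge0/=; have lim := @wlim w; rewrite -(cvg_lim _ lim)//.
apply: limr_le; first by apply/cvg_ex; eexists; exact: lim.
by apply: nearW => n; exact: wbd.
Qed.

Let mwL : measurable_fun setT (fun w => path_weight (L w)).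
Proof. exact: (measurableT_comp measurable_path_weight). Qed.

Let weight_mass : exists2 c1 : R, 0 < c1 & (\int[P]_w (path_weight (L w))%:E = c1%:E)%E.
Proof.
apply: (expectation_gt0 mwL weightC).
have Jpos : {ae P, forall w, M s -> 0 < jump (L w) s}.
  have [Ms|nMs] := pselect (M s); last by apply: nearW.
  have [_ law] := jump_law Ms.
  exists [set w | ray 0 (jump (L w) s)]; split.
  - by apply: (measurable_pre (mJ s)); exact: measurable_itv.
  - rewrite law; last exact: measurable_itv.
    rewrite (_ : _ `&` _ = set0) ?integral_set0//.
    apply/seteqP; split => x //= []; rewrite !in_itv/= andbT => h1 h2.
    by move: h1; rewrite leNgt h2.
  - move=> w /= h; rewrite in_itv/= leNgt; apply/negP => h'; apply: h => _; exact: h'.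
apply: filterS2 Jpos Zfin => w Jw Zw; apply: mulr_gt0; last first.
  by apply: nexp_gt0; rewrite path_integral_ge0.
by case: asboolP => // Ms; exact: Jw.
Qed.


Variable q : {measure set (iap_path R) -> \bar R}.
Hypothesis qE : forall g : iap_path R -> \bar R, measurable_fun setT g -> (forall X, 0 <= g X)%E ->
  (\int[q]_X g X = \int[leb]_v \int[P]_w
     (g (moved (L w) v) * (path_weight (L w) * size_weight v)%:E))%E.

Let EW tau : R := fine (\int[P]_w (wt tau (jump (L w) tau))%:E)%E.

(** A fixed atom has its density multiplied by its factor of the weight; a new atom at s
    has the exponential density of rate b. *)
Let fs (tau x : R) : R :=
  if ~~ `[<M s>] && (tau == s) then b * exp_weight b x
  else (0 < x)%R%:R * (wt tau x * f tau x / EW tau).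

Let mpos : measurable_fun setT (fun x : R => (0 < x)%R%:R : R).
Proof.
apply: (measurableT_comp (f := fun z : R * R => (0 < z.2)%R%:R : R)
  (g := fun v : R => (0 : R, v))); [exact: measurable_pos2|exact: measurable_pair1].
Qed.

Let fs_M tau : M tau -> fs tau = fun x => (0 < x)%R%:R * (wt tau x * f tau x / EW tau).
Proof.
move=> Mtau; apply/funext => x; rewrite /fs; case: asboolP => //= nMs.
by case: eqP => // e; move: Mtau; rewrite e.
Qed.

Let posE (h : R -> R) : (\int[leb]_(x in `]0%R, +oo[) ((0 < x)%R%:R * h x)%:E =
  \int[leb]_(x in `]0%R, +oo[) (h x)%:E)%E.
Proof.
by apply: eq_integral => x; rewrite inE/= in_itv/= andbT => ->; rewrite mul1r.
Qed.

Let leb_pos (h : R -> R) : measurable_fun setT h -> (forall x, 0 <= h x) ->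
  (\int[@lebesgue_measure R]_(x in `]0%R, +oo[) (h x)%:E =
   \int[leb]_(x in `]0%R, +oo[) (h x)%:E)%E.
Proof.
move=> mh h0; apply: integral_leb => //.
- by apply: measurable_funTS; exact/measurable_EFinP.
- by move=> x _; rewrite lee_fin.
Qed.

Let mean tau (g : R -> R) : R :=
  fine (\int[leb]_(x in `]0%R, +oo[) (g x * fs tau x)%:E)%E.

Let mean_M tau (g : R -> R) : M tau -> 0 < EW tau -> measurable_fun setT g ->
  (forall y, 0 <= g y) ->
  (\int[leb]_(x in `]0%R, +oo[) (g x * fs tau x)%:E)%E =
  ((EW tau)^-1%:E * \int[P]_w (g (jump (L w) tau) * wt tau (jump (L w) tau))%:E)%E.
Proof.
move=> Mtau EW0 mg g0; have [fd law] := jump_law Mtau; have [mf f0 _] := fd.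
have mgw : measurable_fun setT (fun x => (g x * wt tau x)%:E).
  by apply/measurable_EFinP; exact: measurable_funM.
have gw0 x : (0 <= (g x * wt tau x)%:E)%E.
  by rewrite lee_fin mulr_ge0//; have /andP[] := wtC tau x.
have -> := jump_law_integral (mJ tau) fd law mgw gw0.
rewrite fs_M// -ge0_integralZl//.
- transitivity (\int[leb]_(x in `]0%R, +oo[) ((0 < x)%R%:R * (g x * (wt tau x * f tau x / EW tau)))%:E)%E.
    by apply: eq_integral => x _; congr (_%:E); ring.
  by rewrite posE; apply: eq_integral => x _; rewrite -!EFinM; congr (_%:E); ring.
- by apply: measurable_funTS; apply: emeasurable_funM => //; exact/measurable_EFinP.
- by move=> x _; rewrite mule_ge0// lee_fin.
- by rewrite lee_fin invr_ge0 ltW.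
Qed.

Let fs_density tau : M tau \/ tau = s -> 0 < EW tau \/ ~ M tau -> pos_density (fs tau).
Proof.
move=> Mtau EW0.
have [/andP[nM /eqP ts]|h] := boolP (~~ `[<M s>] && (tau == s)).
  have e : fs tau = fun x => b * exp_weight b x.
    by apply/funext => x; rewrite /fs nM ts eqxx.
  have me : measurable_fun setT (fs tau).
    by rewrite e; apply: measurable_funM => //; exact: measurable_exp_weight.
  have f0 x : 0 <= fs tau x by rewrite e mulr_ge0 ?exp_weight_ge0// ltW.
  split => //; rewrite leb_pos//.
  transitivity (b%:E * \int[leb]_x (exp_weight b x)%:E)%E.
    rewrite -ge0_integralZl//; last 3 first.
    - by apply/measurable_EFinP; exact: measurable_exp_weight.
    - by move=> x _; rewrite lee_fin exp_weight_ge0.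
    - by rewrite lee_fin ltW.
    rewrite e; apply: (eq_trans (integral_setE _ _ _)); apply: eq_integral => x _.
    rewrite -!EFinM; congr (_%:E); rewrite indicE /exp_weight; case: (boolP (x \in _)) => [_|]; first by rewrite mulr1.
    by move/negP; rewrite inE/= in_itv/= andbT => /negP/negbTE ->; rewrite !(mul0r, mulr0).
  by rewrite integral_exp_weight// -EFinM divff// gt_eqF.
have Mt : M tau.
  by case: Mtau => // ts; move: h; rewrite ts eqxx andbT negbK => /asboolP.
have {}EW0 : 0 < EW tau by case: EW0.
have [[mf f0 _] _] := jump_law Mt.
have me : measurable_fun setT (fs tau).
  rewrite fs_M//; apply: measurable_funM => //; apply: measurable_funM => //.
  exact: measurable_funM.
have fs0 x : 0 <= fs tau x.
  rewrite fs_M//; apply: mulr_ge0 => //; apply: mulr_ge0; last by rewrite invr_ge0 ltW.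
  by apply: mulr_ge0 => //; have /andP[] := wtC tau x.
split => //; rewrite leb_pos//.
transitivity (\int[leb]_(x in `]0%R, +oo[) (1 * fs tau x)%:E)%E.
  by apply: eq_integral => x _; rewrite mul1r.
rewrite (@mean_M tau (fun=> 1))//.
have -> : (\int[P]_w (1 * wt tau (jump (L w) tau))%:E = (EW tau)%:E)%E.
  under eq_integral do rewrite mul1r.
  have mwJ : measurable_fun setT (fun w => wt tau (jump (L w) tau)) by apply: (measurableT_comp (mwt tau)).
  by rewrite fineK//; exact: (integral_bnd_fin P mwJ (fun w => wtC tau _)).
by rewrite -EFinM mulVf// gt_eqF.
Qed.


Let mprod (s0 : seq R) (g : R -> R -> R) : (forall tau, measurable_fun setT (g tau)) ->
  measurable_fun setT (fun X : iap_path R => \prod_(tau <- s0) g tau (jump X tau)).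
Proof.
move=> mg; apply: measurable_prodr => tau; apply: (measurableT_comp (mg tau)).
by apply: measurable_jump => //; exact: measurable_cst.
Qed.

Let cM' : countable (M `|` [set s]) := countable_setU1 s cM.

(** L almost surely has no jump at an s outside M: there the new path has the jump v,
    and all the rest is unchanged. *)
Let moved_atoms (s0 : seq R) (g : R -> R -> R) (G : iap_path R -> R) w v :
  uniq s0 -> (~ M s -> 0 < v /\ jump (L w) s = 0) ->
  \prod_(tau <- s0) g tau (jump (moved (L w) v) tau) *
    G (contpart (M `|` [set s]) (moved (L w) v)) =
  (if ~~ `[<M s>] && (s \in s0) then g s v else 1) *
  (\prod_(tau <- if `[<M s>] then s0 else rem s s0) g tau (jump (L w) tau) * G (Lc w)).
Proof.
move=> us0; rewrite /moved; case: asboolP => [Ms _|nMs /(_ nMs)[v0 Js]] /=.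
  by rewrite add_atom0 mul1r contpart_setU1_id.
have v0' := ltW v0.
rewrite contpart_add_atom// contpart_setU1// -/(Lc w) mulrA; congr (_ * _).
have jE tau : tau != s -> jump (add_atom (L w) v s) tau = jump (L w) tau.
  by move=> /negbTE ts; rewrite jump_add_atom// ts mulr0 addr0.
case: (boolP (s \in s0)) => h; last first.
  rewrite mul1r rem_id//; rewrite [LHS]big_seq [RHS]big_seq; apply: eq_bigr => tau ht.
  by rewrite jE//; apply: contraNneq h => <-.
rewrite (big_rem s h)/= jump_add_atom// eqxx mulr1 Js add0r; congr (_ * _).
rewrite [LHS]big_seq [RHS]big_seq; apply: eq_bigr => tau ht.
by rewrite jE//; move: ht; rewrite mem_rem_uniq// inE => /andP[].
Qed.

(** The weight of the path is a limit of products over the fixed atoms, so that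
    [tilt_product] applies; the size of the new atom factors out. *)
Lemma posterior_at_product : exists c : R, [/\ 0 < c, q setT = c%:E,
  forall tau, M tau -> 0 < EW tau &
  forall (Epsi : R), (\int[P]_w (np (Lc w))%:E = Epsi%:E)%E ->
  0 < Epsi /\
  forall (s0 : seq R) (g : R -> R -> R) (G : iap_path R -> R),
    uniq s0 -> (forall tau, tau \in s0 -> (M `|` [set s]) tau) ->
    (forall tau, measurable_fun setT (g tau)) -> (forall tau y, 0 <= g tau y <= 1) ->
    measurable_fun setT G -> (forall X, 0 <= G X <= 1) ->
    (\int[q]_X (\prod_(tau <- s0) g tau (jump X tau) * G (contpart (M `|` [set s]) X))%:E =
     (c * (\prod_(tau <- s0) mean tau (g tau) *
       (fine (\int[P]_w (G (Lc w) * np (Lc w))%:E)%E / Epsi)))%:E)%E].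
Proof.
have [c1 c10 c1E] := weight_mass.
have [EWp Epsip H] := tilt_product mL cM us nds sM ind mwt wtC mnp npC
  (fun w => @wlim w) wbd c1E c10.
have mcp' := measurable_contpart cM'.
have qTE : q setT = (c1 * rc)%:E.
  transitivity (\int[q]_X 1%:E)%E; first by rewrite integral_cst// mul1e.
  rewrite qE//.
  transitivity (\int[leb]_v (c1%:E * (size_weight v)%:E))%E.
    apply: eq_integral => v _.
    rewrite -c1E muleC -ge0_integralZl//.
    - by apply: eq_integral => w _; rewrite mul1e muleC.
    - exact/measurable_EFinP.
    - by move=> w _; rewrite lee_fin path_weight_ge0.
    - by rewrite lee_fin size_weight_ge0.
  rewrite ge0_integralZl//.
  - by rewrite rcE.
  - by apply/measurable_EFinP; exact: measurable_size_weight.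
  - by move=> v _; rewrite lee_fin size_weight_ge0.
  - by rewrite lee_fin ltW.
exists (c1 * rc); split => //; first by rewrite mulr_gt0.
move=> Epsi EpsiE; have Epsi_def : fine (\int[P]_w (np (Lc w))%:E)%E = Epsi by rewrite EpsiE.
rewrite Epsi_def in Epsip H; split => // s0 g G us0 s0M mg g01 mG G01.
rewrite qE; last 2 first.
- apply/measurable_EFinP; apply: measurable_funM; first exact: mprod.
  exact: (measurableT_comp mG).
- move=> X; have /andP[p0 _] := prod01 s0 (fun tau => g01 tau (jump X tau)).
  by rewrite lee_fin mulr_ge0//; have /andP[] := G01 (contpart (M `|` [set s]) X).
(* for a new atom, the test function at s concerns v instead of the path *)
pose s0' := if `[<M s>] then s0 else rem s s0.
have us0' : uniq s0' by rewrite /s0'; case: ifP => // _; exact: rem_uniq.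
have s0'M tau : tau \in s0' -> M tau.
  rewrite /s0'; case: asboolP => [Ms /s0M [//|->]//|nMs].
  by rewrite mem_rem_uniq// inE => /andP[/eqP ts /s0M [//|]].
pose gs v := if ~~ `[<M s>] && (s \in s0) then g s v else 1.
have gs01 v : 0 <= gs v <= 1 by rewrite /gs; case: ifP => // _; rewrite ler01 lexx.
have mgs : measurable_fun setT gs.
  by rewrite /gs; case: (_ && _); [exact: mg|exact: measurable_cst].
have HH := H s0' g G us0' s0'M mg g01 mG G01; rewrite -/Lc in HH.
set R0 := (X in _ = (c1 * X)%:E) in HH.
have R00 : 0 <= c1 * R0.
  rewrite -lee_fin -HH; apply: integral_ge0 => w _; rewrite lee_fin.
  have /andP[p0 _] := prod01 s0' (fun tau => g01 tau (jump (L w) tau)).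
  apply: mulr_ge0; last exact: path_weight_ge0.
  by apply: mulr_ge0; [exact: p0|have /andP[] := G01 (Lc w)].
transitivity (\int[leb]_v ((c1 * R0)%:E * (gs v * size_weight v)%:E))%E.
  apply: eq_integral => v _.
  have [sw0|sw0] := eqVneq (size_weight v) 0.
    by rewrite sw0 mulr0 mule0; apply: integral0_eq => w _; rewrite mulr0 mule0.
  have gsw0 : 0 <= gs v * size_weight v.
    by rewrite mulr_ge0 ?size_weight_ge0//; have /andP[] := gs01 v.
  have mI : measurable_fun setT (fun w => \prod_(tau <- s0') g tau (jump (L w) tau) * G (Lc w) *
      path_weight (L w)).
    apply: measurable_funM => //; apply: measurable_funM.
      by apply: measurable_prodr => tau; apply: (measurableT_comp (mg tau)).
    exact: (measurableT_comp mG).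
  have I0 w : 0 <= \prod_(tau <- s0') g tau (jump (L w) tau) * G (Lc w) * path_weight (L w).
    have /andP[p0 _] := prod01 s0' (fun tau => g01 tau (jump (L w) tau)).
    apply: mulr_ge0; last exact: path_weight_ge0.
  by apply: mulr_ge0; [exact: p0|have /andP[] := G01 (Lc w)].
  rewrite -HH muleC -ge0_integralZl//; last 2 first.
  - exact/measurable_EFinP.
  - by move=> w _; rewrite lee_fin.
  have vpos : ~ M s -> 0 < v.
    move=> nMs; move: sw0; rewrite /size_weight; case: asboolP => // _.
    by rewrite /exp_weight; have [//|_] := ltP 0 v; rewrite mul0r eqxx.
  have Jae : {ae P, forall w, ~ M s -> jump (L w) s = 0}.
    have [Ms|nMs] := pselect (M s); first by apply: nearW.
    exists [set w | jump (Lc w) s != 0]; split; [exact: measurable_jump_neq0|exact: nofix|].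
    - move=> w /= h; rewrite jump_contpart//; apply/eqP => e; apply: h => _; exact: e.
  have mmov : measurable_fun setT (fun w => moved (L w) v).
    by apply: measurable_add_atom => //; exact: measurable_cst.
  apply: ge0_ae_eq_integral => //.
  - apply: emeasurable_funM; apply/measurable_EFinP.
      apply: measurable_funM; first exact: (measurableT_comp (mprod s0 mg) mmov).
      exact: (measurableT_comp mG (measurableT_comp mcp' mmov)).
    exact: measurable_funM.
  - by apply: measurable_funeM; exact/measurable_EFinP.
  - move=> w _; have /andP[p0 _] := prod01 s0 (fun tau => g01 tau (jump (moved (L w) v) tau)).
    rewrite -EFinM lee_fin; apply: mulr_ge0; apply: mulr_ge0.
    + exact: p0.
    + by have /andP[] := G01 (contpart (M `|` [set s]) (moved (L w) v)).
    + exact: path_weight_ge0.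
    + exact: size_weight_ge0.
  - by move=> w _; rewrite mule_ge0// lee_fin.
  - apply: filterS Jae => w Jw _; rewrite -!EFinM; congr (_%:E).
    rewrite moved_atoms//; last by move=> nMs; split; [exact: vpos|exact: Jw].
    rewrite -/(gs v) -/s0'; ring.
have gsE : (\int[leb]_v (gs v * size_weight v)%:E)%E =
    (rc * (if ~~ `[<M s>] && (s \in s0) then mean s (g s) else 1))%:E.
  rewrite /gs; case: ifP => [/andP[nM _]|_]; last by rewrite mulr1 -rcE; under eq_integral do rewrite mul1r.
  have restrict (y : R) : g s y * (b * exp_weight b y) * \1_`]0%R, +oo[ y = b * (g s y * exp_weight b y).
    rewrite indicE /exp_weight; have -> : (y \in `]0, +oo[%classic) = (0 < y).
      by apply/idP/idP; rewrite inE/= in_itv/= andbT.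
    by case: (0 < y); rewrite /= ?(mul0r, mulr0, mul1r, mulr1)// mulrCA.
  have bE : (\int[leb]_(x in `]0%R, +oo[) (g s x * fs s x)%:E =
      b%:E * \int[leb]_v (g s v * size_weight v)%:E)%E.
    rewrite -ge0_integralZl//; last 3 first.
    - apply/measurable_EFinP; apply: measurable_funM => //; exact: measurable_size_weight.
    - by move=> v _; rewrite lee_fin mulr_ge0 ?size_weight_ge0//; have /andP[] := g01 s v.
    - by rewrite lee_fin ltW.
    apply: (eq_trans (integral_setE _ _ _)); apply: eq_integral => x _.
    rewrite -!EFinM; congr (_%:E).
    rewrite /fs nM eqxx/= /size_weight (negbTE nM) -/b; exact: restrict.
  have Ifin : (\int[leb]_v (g s v * size_weight v)%:E \is a fin_num)%E.
    rewrite ge0_fin_numE; last first.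
      by apply: integral_ge0 => v _; rewrite lee_fin mulr_ge0 ?size_weight_ge0//; have /andP[] := g01 s v.
    apply: (@le_lt_trans _ _ (\int[leb]_v (size_weight v)%:E)%E); last by rewrite rcE ltry.
    apply: ge0_le_integral => //.
    - by move=> v _; rewrite lee_fin mulr_ge0 ?size_weight_ge0//; have /andP[] := g01 s v.
    - apply/measurable_EFinP; apply: measurable_funM => //; exact: measurable_size_weight.
    - by apply/measurable_EFinP; exact: measurable_size_weight.
    - move=> v _; rewrite lee_fin ler_piMl ?size_weight_ge0//.
      by have /andP[] := g01 s v.
  rewrite /mean bE -(fineK Ifin) -EFinM/= /rc (negbTE nM); congr (_%:E).
  by rewrite mulKf// gt_eqF.
rewrite ge0_integralZl//; last 2 first.
- by apply/measurable_EFinP; apply: measurable_funM => //; exact: measurable_size_weight.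
- by move=> v _; rewrite lee_fin mulr_ge0 ?size_weight_ge0//; have /andP[] := gs01 v.
rewrite gsE -EFinM; congr (_%:E).
have meanM tau : M tau ->
    mean tau (g tau) = fine (\int[P]_w (g tau (jump (L w) tau) * wt tau (jump (L w) tau))%:E)%E / EW tau.
  move=> Mtau; have g0 y : 0 <= g tau y by have /andP[] := g01 tau y.
  rewrite /mean (mean_M Mtau (EWp _ Mtau) (mg tau) g0).
  have mgJ : measurable_fun setT (fun w => g tau (jump (L w) tau) * wt tau (jump (L w) tau)).
    by apply: measurable_funM; [apply: (measurableT_comp (mg tau))|apply: (measurableT_comp (mwt tau))].
  have Gb w : 0 <= g tau (jump (L w) tau) * wt tau (jump (L w) tau) <= C.
    have /andP[w0 w1] := wtC tau (jump (L w) tau); have /andP[h0 h1] := g01 tau (jump (L w) tau).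
    by rewrite mulr_ge0//= (le_trans _ w1)// ler_piMl.
  by rewrite -(fineK (integral_bnd_fin P mgJ Gb)) -EFinM/= mulrC.
have prodE : \prod_(tau <- s0) mean tau (g tau) =
    (if ~~ `[<M s>] && (s \in s0) then mean s (g s) else 1) * \prod_(tau <- s0') mean tau (g tau).
  rewrite /s0'; case: asboolP => _ /=; first by rewrite mul1r.
  by case: ifP => h; [rewrite (big_rem s h)|rewrite mul1r rem_id// h].
have R0E : R0 = \prod_(tau <- s0') mean tau (g tau) * (fine (\int[P]_w (G (Lc w) * np (Lc w))%:E)%E / Epsi).
  rewrite /R0; congr (_ * _); rewrite [LHS]big_seq [RHS]big_seq.
  by apply: eq_bigr => tau /s0'M Mtau; rewrite meanM.
rewrite R0E prodE; ring.
Qed.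

(** The product formula read as a description of the law. The law K of the continuous
    part does not involve s, which is why (t, u) determines it. *)
Lemma posterior_at : exists c : R, [/\ 0 < c, q setT = c%:E &
  exists fs' : R -> R -> R, [/\
    forall tau, M tau -> pos_density (fs' tau) /\ exists2 a : R, 0 < a &
      forall x, 0 < x -> fs' tau x =
        a * ((if tau == s then x else 1) * expR (- (theta tau * x)) * f tau x),
    ~ M s -> forall x, 0 < x -> fs' s x = b * expR (- (b * x)) &
    forall (kc : R) (Q K : probability (iap_path R) R),
      (\int[P]_w (np (Lc w))%:E = kc%:E)%E ->
      (forall g : iap_path R -> \bar R, measurable_fun setT g -> (forall X, 0 <= g X)%E ->
        \int[Q]_X g X = c^-1%:E * \int[q]_X g X)%E ->
      (forall g : iap_path R -> \bar R, measurable_fun setT g -> (forall X, 0 <= g X)%E ->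
        \int[K]_X g X = kc^-1%:E * \int[P]_w (g (Lc w) * (np (Lc w))%:E))%E ->
      extended_gamma K id alpha (fun x => beta x + theta x) ->
      no_fixed_discontinuity K id ->
      extended_gamma_fixed Q id (M `|` [set s]) fs' alpha (fun x => beta x + theta x) /\
      forall E, measurable E -> q (contpart (M `|` [set s]) @^-1` E) = (c%:E * K E)%E]].
Proof.
have [c [c0 qT EWp H]] := posterior_at_product.
exists c; split => //; exists fs; split.
- move=> tau Mt; split; first by apply: fs_density; left => //; exact: EWp.
  exists (EW tau)^-1; first by rewrite invr_gt0 EWp.
  by move=> x x0; rewrite fs_M// x0 mul1r /wt gtr0_norm//; exact: mulrC.
- by move=> nMs x x0; rewrite /fs asboolF//= eqxx /exp_weight x0 mul1r.
- move=> kc Q K kcE QE KE Kg Kn.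
  have [kc0 HH] := H kc kcE.
  have KG (G : iap_path R -> R) : measurable_fun setT G -> (forall X, 0 <= G X <= 1) ->
      (\int[K]_X (G X)%:E = (fine (\int[P]_w (G (Lc w) * np (Lc w))%:E)%E / kc)%:E)%E.
    move=> mG G01; rewrite KE; last 2 first.
    - exact/measurable_EFinP.
    - by move=> X; rewrite lee_fin; have /andP[] := G01 X.
    have mI : measurable_fun setT (fun w => G (Lc w) * np (Lc w)).
      by apply: measurable_funM; [exact: (measurableT_comp mG)|exact: (measurableT_comp mnp)].
    have I01 w : 0 <= G (Lc w) * np (Lc w) <= 1.
      have /andP[n0 n1] := np01 (Lc w); have /andP[g0 g1] := G01 (Lc w).
      by rewrite mulr_ge0//= mulr_ile1.
    by rewrite mulrC EFinM fineK//; exact: (integral_bnd_fin P mI I01).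
  split.
  + apply: (extended_gamma_fixed_intro (K := K)) => //.
    * by apply: measurable_funD.
    * move=> tau [Mt|->]; apply: fs_density; [by left|by left; exact: EWp|by right|].
      by have [Ms|nMs] := pselect (M s); [left; exact: EWp|right].
    * move=> s0 g G us0 s0M mg g01 mG G01; rewrite QE; last 2 first.
      - apply/measurable_EFinP; apply: measurable_funM; first exact: mprod.
        by apply: (measurableT_comp mG); exact: measurable_contpart.
      - move=> X; have /andP[p0 _] := prod01 s0 (fun tau => g01 tau (jump X tau)).
        by rewrite lee_fin mulr_ge0//; have /andP[] := G01 (contpart (M `|` [set s]) X).
      rewrite HH// KG// -!EFinM; congr (_%:E).
      by rewrite mulKf// gt_eqF.
  + move=> E mE; have mcp := measurable_contpart cM'.
    rewrite -(integral_indicT q mcp mE).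
    transitivity (\int[q]_X (\prod_(tau <- [::] : seq R) (1 : R) * \1_E (contpart (M `|` [set s]) X))%:E)%E.
      by apply: eq_integral => X _; rewrite big_nil mul1r.
    rewrite (HH [::] (fun _ _ => 1) \1_E)//; last 2 first.
    - by move=> _ _; rewrite ler01 lexx.
    - by move=> X; exact: indic01.
    rewrite big_nil mul1r EFinM; congr (_ * _)%E; rewrite -KG//.
    + by rewrite integral_indic// setIT.
    + by move=> X; exact: indic01.
Qed.

End with_enumeration.
End posterior_at.

Lemma nexp_mean_gt0 {R : realType} d (Om : measurableType d) (P : probability Om R)
    (h : Om -> \bar R) : measurable_fun setT h -> (forall w, 0 <= h w)%E ->
  {ae P, forall w, (h w < +oo)%E} ->
  exists2 c : R, 0 < c & (\int[P]_w (nexp (h w))%:E = c%:E)%E.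
Proof.
move=> mh h0 hfin.
apply: (@expectation_gt0 _ _ _ _ _ 1).
- exact: (measurableT_comp (@measurable_nexp R)).
- by move=> w; rewrite nexp_ge0 nexp_le1.
- by apply: filterS hfin => w hw; apply: nexp_gt0; rewrite h0.
Qed.

(** The posterior of the continuous part is the tilted prior. *)
Lemma tilted_continuous_part {R : realType} d (Om : measurableType d) (P : probability Om R)
    (Xc : Om -> iap_path R) (alpha : {finite_measure set R -> \bar R}) (beta theta : R -> R)
    (K : probability (iap_path R) R) (kc : R) :
  measurable_fun setT Xc -> measurable_fun setT beta -> extended_gamma P Xc alpha beta ->
  no_fixed_discontinuity P Xc ->
  measurable_fun setT theta -> (forall x, 0 <= theta x) -> 0 < kc ->
  (\int[P]_w (nexp (\int[LS (Xc w)]_x (theta x)%:E))%:E = kc%:E)%E ->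
  (forall g : iap_path R -> \bar R, measurable_fun setT g -> (forall X, 0 <= g X)%E ->
    \int[K]_X g X =
      kc^-1%:E * \int[P]_w (g (Xc w) * (nexp (\int[LS (Xc w)]_x (theta x)%:E))%:E))%E ->
  extended_gamma K id alpha (fun x => beta x + theta x) /\ no_fixed_discontinuity K id.
Proof.
move=> mXc mb eg nofix mt t0 kc0 kcE KE.
have mnp : measurable_fun setT (fun w => nexp (\int[LS (Xc w)]_x (theta x)%:E)%E).
  exact: (measurableT_comp (measurable_nexp_path _ _ _)).
have [P' [P'A P'E]] := tilted_probability mnp (fun w => nexp_ge0 _) kc0 kcE.
have law E : measurable E -> P' (Xc @^-1` E) = K (id @^-1` E).
  move=> mE; have -> : (P' (Xc @^-1` E) = \int[P']_w (\1_E (Xc w))%:E)%E by rewrite integral_indicT.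
  have -> : (K (id @^-1` E) = \int[K]_X (\1_E X)%:E)%E by rewrite integral_indic// setIT.
  rewrite P'E ?KE//.
  - by apply/measurable_EFinP; exact: measurable_indic.
  - by apply/measurable_EFinP; exact: measurable_indicT.
have mid : measurable_fun setT (id : iap_path R -> iap_path R) by exact: measurable_id.
split.
  by apply: (extended_gamma_law mid law); exact: (extended_gamma_tilt mb eg mt t0 kc0 kcE P'E).
suff Pn : no_fixed_discontinuity P' Xc by exact: (no_fixed_discontinuity_law law Pn).
move=> x; have mN := measurable_jump_neq0 x mXc.
apply: (eq_trans (P'A _ mN)); rewrite null_set_integral ?mule0//.
by apply/measurable_EFinP; exact: measurable_funTS.
Qed.

(** * Integration against the path *)

Section atom_exchange.
Context {R : realType} d (Om : measurableType d).
Variables (P : probability Om R) (L : Om -> iap_path R) (M : set R).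
Variables (alpha : {finite_measure set R -> \bar R}) (beta : R -> R).
Hypotheses (mL : measurable_fun setT L) (cM : countable M).
Hypotheses (mb : measurable_fun setT beta) (beta_ge0 : forall x, 0 <= beta x).
Let Lc w := contpart M (L w).
Hypotheses (ind : indep_jumps P L M Lc) (eg : extended_gamma P Lc alpha beta).

(** Law of the size of the atom at s under the measure dL(s): at a fixed atom the jump
    is a bias, and v a dummy variable; elsewhere e^{-beta(s) v} dv by [palm_formula]. *)
Definition atom_weight (s : R) (X : iap_path R) (v : R) : R :=
  if `[<M s>] then jump X s * \1_`[0%R, 1%R] v else exp_weight (beta s) v.

Let mM : measurable M := measurable_countable cM.

Let fixed_part (s_ : nat -> seq R) (h : iap_path R * R -> \bar R) :
  (forall n, uniq (s_ n)) -> (forall m n, (m <= n)%N -> {subset s_ m <= s_ n}) ->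
  (forall tau, M tau <-> exists n, tau \in s_ n) ->
  measurable_fun setT h -> (forall z, 0 <= h z)%E ->
  (\sum_(tau <- s_ n) \int[P]_w (h (L w, tau) * (jump (L w) tau)%:E) @[n --> \oo] -->
   \int[P]_w \int[LS (L w)]_(s in M) h (L w, s))%E.
Proof.
move=> us nds sM mh h0.
have mhs X : measurable_fun setT (fun s => h (X, s)).
  by apply: (measurableT_comp mh); exact: measurable_pair1.
have mhL tau : measurable_fun setT (fun w => h (L w, tau) * (jump (L w) tau)%:E)%E.
  apply: emeasurable_funM.
    apply: (measurableT_comp mh); apply: measurable_fun_pair => //; exact: measurable_cst.
  by apply/measurable_EFinP; apply: measurable_jump => //; exact: measurable_cst.
have hJ0 tau w : (0 <= h (L w, tau) * (jump (L w) tau)%:E)%E.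
  by rewrite mule_ge0// lee_fin jump_ge0.
pose g n w := (\sum_(tau <- s_ n) h (L w, tau) * (jump (L w) tau)%:E)%E.
have gE n w : g n w = (\int[LS (L w)]_(s in [set` s_ n]) h (L w, s))%E.
  rewrite integral_seqset// /g; apply: eq_bigr => tau _; congr (_ * _)%E; exact/esym/jumpE.
rewrite (_ : (fun n => _) = fun n => \int[P]_w g n w)%E; last first.
  by apply/funext => n; rewrite /g ge0_integral_sum.
rewrite (_ : (\int[P]_w _)%E = (\int[P]_w limn (g^~ w))%E); last first.
  apply: eq_integral => w _; apply/esym/cvg_lim => //.
  rewrite (_ : g^~ w = fun n => (\sum_(tau <- s_ n) h (L w, tau) * LS (L w) [set tau])%E); last first.
    by apply/funext => n; apply: eq_bigr => tau _; congr (_ * _)%E; exact/esym/jumpE.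
  exact: (seqset_cvg (mhs (L w)) (fun s => h0 (L w, s)) us nds sM).
apply: cvg_monotone_convergence => //.
- by move=> n; apply: emeasurable_sum => tau.
- by move=> n w _; apply: sume_ge0 => tau _.
- move=> w _ m n mn; rewrite !gE; apply: ge0_subset_integral => //.
  + exact: measurable_seqset.
  + exact: measurable_seqset.
  + exact: measurable_funTS.
  + by move=> x /=; exact: nds.
Qed.

Let continuous_part (h : iap_path R * R -> \bar R) :
  measurable_fun setT h -> (forall z, 0 <= h z)%E ->
  (\int[P]_w \int[LS (Lc w)]_s h (L w, s) =
   \int[alpha]_s \int[leb]_v \int[P]_w
     (h (add_atom (L w) v s, s) * (\1_(~` M) s)%:E * (exp_weight (beta s) v)%:E))%E.
Proof.
move=> mh h0.
have mhs X : measurable_fun setT (fun s => h (X, s)).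
  by apply: (measurableT_comp mh); exact: measurable_pair1.
have mind : measurable_fun setT (fun s : R => (\1_(~` M) s)%:E : \bar R).
  by apply/measurable_EFinP; apply: measurable_indic; exact: measurableC.
pose H (z : iap_path R * R) := (h z * (\1_(~` M) z.2)%:E)%E.
have mH : measurable_fun setT H.
  by apply: emeasurable_funM => //; exact: (measurableT_comp mind).
have H0 z : (0 <= H z)%E by rewrite mule_ge0// lee_fin.
transitivity (\int[P]_w \int[LS (Lc w)]_s H (L w, s))%E.
  apply: eq_integral => w _.
  have mHs : measurable_fun setT (fun s => H (L w, s)) by exact: emeasurable_funM.
  apply: (eq_trans (integral_contpart (L w) cM (mhs (L w)) (fun s => h0 (L w, s)))).
  apply/esym; apply: (eq_trans (integral_contpart (L w) cM mHs (fun s => H0 (L w, s)))).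
  by apply: eq_integral => s; rewrite inE/= => nMs; rewrite /H/= indicE mem_set// mule1.
rewrite (palm_formula mL cM mb beta_ge0 ind eg mH H0).
pose F (z : R * R) := (\int[P]_w (H (add_atom (L w) z.2 z.1, z.1) * (exp_weight (beta z.1) z.2)%:E))%E.
have mF : measurable_fun setT F.
  apply: (measurable_fun_fubini_tonelli_F (m2 := P)
    (fun y : (R * R) * Om => H (add_atom (L y.2) y.1.2 y.1.1, y.1.1) *
      (exp_weight (beta y.1.1) y.1.2)%:E)%E).
  - apply: emeasurable_funM.
      apply: (measurableT_comp mH); apply: measurable_fun_pair.
        apply: measurable_add_atom; first exact: (measurableT_comp mL).
        + by apply: (measurableT_comp measurable_snd); exact: measurable_fst.
        + by apply: (measurableT_comp measurable_fst); exact: measurable_fst.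
      by apply: (measurableT_comp measurable_fst); exact: measurable_fst.
    apply/measurable_EFinP.
    exact: (measurableT_comp (measurable_exp_weight2 mb) (g := fst)).
  - by move=> y; rewrite mule_ge0// lee_fin exp_weight_ge0.
have F0 z : (0 <= F z)%E.
  by apply: integral_ge0 => w _; rewrite mule_ge0// lee_fin exp_weight_ge0.
exact: (fubini_tonelli1 F mF F0).
Qed.

(** The fixed atoms are summed one by one, the others treated by the Palm formula:
    either way integrating against dL(s) amounts to placing an atom at s. *)
Lemma atom_exchange (h1 h2 : iap_path R * R -> \bar R) :
  measurable_fun setT h1 -> (forall z, 0 <= h1 z)%E ->
  measurable_fun setT h2 -> (forall z, 0 <= h2 z)%E ->
  (forall s, \int[leb]_v \int[P]_w (h1 (moved M s (L w) v, s) * (atom_weight s (L w) v)%:E) =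
   \int[leb]_v \int[P]_w (h2 (moved M s (L w) v, s) * (atom_weight s (L w) v)%:E))%E ->
  (\int[P]_w \int[LS (L w)]_s h1 (L w, s) = \int[P]_w \int[LS (L w)]_s h2 (L w, s))%E.
Proof.
move=> mh1 h10 mh2 h20 E.
have split_ h : measurable_fun setT h -> (forall z, 0 <= h z)%E ->
    (\int[P]_w \int[LS (L w)]_s h (L w, s) =
     \int[P]_w \int[LS (L w)]_(s in M) h (L w, s) +
     \int[P]_w \int[LS (Lc w)]_s h (L w, s))%E.
  move=> mh h0; rewrite -ge0_integralD//.
  - apply: eq_integral => w _; apply: path_integral_atoms => //.
    by apply: (measurableT_comp mh); exact: measurable_pair1.
  - by move=> w _; apply: integral_ge0.
  - under eq_fun do rewrite integral_setE.
    apply: (measurable_integral_LS mL (h := fun z => h (L z.1, z.2) * (\1_M z.2)%:E)%E).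
      apply: emeasurable_funM.
        by apply: (measurableT_comp mh); apply: measurable_fun_pair => //; exact: (measurableT_comp mL).
      by apply/measurable_EFinP; apply: (measurableT_comp (measurable_indic mM)).
    by move=> z; rewrite mule_ge0// lee_fin.
  - by move=> w _; apply: integral_ge0.
  - have mLc : measurable_fun setT Lc by exact: (measurableT_comp (measurable_contpart cM)).
    apply: (measurable_integral_LS mLc (h := fun z => h (L z.1, z.2))).
      by apply: (measurableT_comp mh); apply: measurable_fun_pair => //; exact: (measurableT_comp mL).
    by move=> z.
apply: (eq_trans (split_ _ mh1 h10)); apply/esym.
apply: (eq_trans (split_ _ mh2 h20)); apply/esym; congr (_ + _)%E.
- have [s_ [us nds sM]] := countable_enum cM.
  have c1 := fixed_part us nds sM mh1 h10; have c2 := fixed_part us nds sM mh2 h20.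
  apply: (cvge_eq _ c1 c2) => n; rewrite [LHS]big_seq [RHS]big_seq.
  apply: eq_bigr => tau ht; have Mt : M tau by apply/sM; exists n.
  have := E tau; rewrite /moved /atom_weight asboolT//.
  have I1 h : measurable_fun setT h -> (forall z, 0 <= h z)%E ->
      (\int[leb]_v \int[P]_w (h (add_atom (L w) 0 tau, tau) *
        (jump (L w) tau * \1_`[0%R, 1%R] v)%:E) =
       \int[P]_w (h (L w, tau) * (jump (L w) tau)%:E))%E.
    move=> mh h0.
    have mhL : measurable_fun setT (fun w => h (L w, tau) * (jump (L w) tau)%:E)%E.
      apply: emeasurable_funM.
        apply: (measurableT_comp mh); apply: measurable_fun_pair => //; exact: measurable_cst.
      by apply/measurable_EFinP; apply: measurable_jump => //; exact: measurable_cst.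
    have hJ0 w : (0 <= h (L w, tau) * (jump (L w) tau)%:E)%E.
      by rewrite mule_ge0// lee_fin jump_ge0.
    set I := RHS; have I0 : (0 <= I)%E by apply: integral_ge0.
    transitivity (\int[leb]_v (I * (\1_`[0%R, 1%R] v)%:E))%E.
      apply: eq_integral => v _; rewrite muleC -ge0_integralZl//.
      by apply: eq_integral => w _; rewrite add_atom0 EFinM muleA muleC.
    rewrite ge0_integralZl//; last by apply/measurable_EFinP; exact: measurable_indic.
    rewrite -[RHS]mule1; congr (_ * _)%E; rewrite integral_indic// setIT.
    by apply: (eq_trans (lebesgue_measure_itv _)); rewrite /= lte_fin ltr01 -EFinB subr0.
  by rewrite !I1.
- apply: (eq_trans (continuous_part mh1 h10)); apply/esym.
  apply: (eq_trans (continuous_part mh2 h20)); apply/esym; apply: eq_integral => s _.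
  have [Ms|nMs] := pselect (M s).
    have Z h : (\int[leb]_v \int[P]_w (h (add_atom (L w) v s, s) *
        (\1_(~` M) s)%:E * (exp_weight (beta s) v)%:E))%E = 0%E.
      apply: integral0_eq => v _; apply: integral0_eq => w _.
      by rewrite indicE memNset ?mule0 ?mul0e//= => /(_ Ms).
    by rewrite !Z.
  move: (E s); rewrite /moved /atom_weight (asboolF nMs) => Es.
  have Z h : (\int[leb]_v \int[P]_w (h (add_atom (L w) v s, s) *
        (\1_(~` M) s)%:E * (exp_weight (beta s) v)%:E) =
      \int[leb]_v \int[P]_w (h (add_atom (L w) v s, s) * (exp_weight (beta s) v)%:E))%E.
    apply: eq_integral => v _; apply: eq_integral => w _.
    by rewrite indicE mem_set// mule1.
  by rewrite !Z.
Qed.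

End atom_exchange.

(** * The law of the latent variables *)

Section leb_endpoints.
Context {R : realType}.
Variable F : R -> \bar R.
Hypotheses (mF : measurable_fun setT F) (F0 : forall x, (0 <= F x)%E).

Lemma integral_ge0_leb : (\int[@lebesgue_measure R]_(u in `[0%R, +oo[) F u =
  \int[leb]_u (F u * (0 < u)%R%:R%:E))%E.
Proof.
transitivity (\int[@lebesgue_measure R]_(u in `]0%R, +oo[) F u)%E.
  by apply/esym; apply: integral_itv_obnd_cbnd; exact: measurable_funTS.
rewrite integral_leb//; last exact: measurable_funTS.
apply: (eq_trans (integral_setE _ _ _)); apply: eq_integral => u _; rewrite indicE.
by rewrite mem_setE in_itv/= andbT.
Qed.

Lemma integral_le_leb a : (\int[@lebesgue_measure R]_(t in `]-oo, a]) F t =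
  \int[leb]_t (F t * (t < a)%R%:R%:E))%E.
Proof.
transitivity (\int[@lebesgue_measure R]_(t in `]-oo, a[) F t)%E.
  by apply/esym; apply: integral_itv_bndo_bndc; exact: measurable_funTS.
rewrite integral_leb//; last exact: measurable_funTS.
apply: (eq_trans (integral_setE _ _ _)); apply: eq_integral => t _; rewrite indicE.
by rewrite mem_setE in_itv.
Qed.

End leb_endpoints.

Section latent_law.
Context {R : realType}.
Variables (k : R -> R -> R) (Ups : R).
Hypothesis k_ok : kernel_assumptions k.
Local Notation triple := (R * R * R)%type.

Let mk : measurable_fun setT (k Ups) := measurable_kernel_section k_ok Ups.

Let k0 x : 0 <= k Ups x. Proof. by have [_ k0 _ _ _] := k_ok; exact: k0. Qed.

(** |u| makes the exponent nonnegative for every real u; the latent u is positive. *)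
Definition tilt_fun (u x : R) : R := `|u| * k Ups x.

Lemma tilt_fun_ge0 u x : 0 <= tilt_fun u x. Proof. exact: mulr_ge0. Qed.

Lemma measurable_tilt_fun u : measurable_fun setT (tilt_fun u).
Proof. by apply: measurable_funM. Qed.

Definition mass (X : iap_path R) : \bar R := (\int[LS X]_x (k Ups x)%:E)%E.

Lemma mass_ge0 X : (0 <= mass X)%E. Proof. exact: path_integral_ge0. Qed.

Lemma measurable_mass : measurable_fun setT mass.
Proof. exact: measurable_path_integral. Qed.

Lemma kmix_mass X : kmix k X Ups = mass X.
Proof. by rewrite /kmix integral_LS//; exact/measurable_EFinP. Qed.

Lemma integral_tilt_fun u X : (\int[LS X]_x (tilt_fun u x)%:E = `|u|%:E * mass X)%E.
Proof.
rewrite /mass -ge0_integralZl//.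
- exact/measurable_EFinP.
- by move=> x _; rewrite lee_fin.
Qed.

(** The part of the latent density that does not involve the path, without the
    endpoints t = Ups and u = 0. *)
Definition time_weight (z : triple) : R :=
  (z.1.1 < Ups)%R%:R * (0 < z.2)%R%:R * derive1 (k ^~ z.1.2) z.1.1.

Lemma time_weight_ge0 z : 0 <= time_weight z.
Proof. by rewrite mulr_ge0 ?mulr_ge0//; exact: derive1_ge0. Qed.

Lemma time_weight_eq0 t s u : ~~ ((t < Ups) && (0 < u)) -> time_weight (t, s, u) = 0.
Proof.
rewrite /time_weight/=; case: (t < Ups) => /=; last by rewrite !mul0r.
by move=> /negbTE ->; rewrite mulr0 mul0r.
Qed.

Lemma time_weight_pos t s u : t < Ups -> 0 < u -> time_weight (t, s, u) = derive1 (k ^~ s) t.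
Proof. by move=> tU u0; rewrite /time_weight/= tU u0 !mul1r. Qed.

Let mz11 : measurable_fun setT (fun z : triple => z.1.1).
Proof. by apply: (measurableT_comp measurable_fst); exact: measurable_fst. Qed.

Let mz12 : measurable_fun setT (fun z : triple => z.1.2).
Proof. by apply: (measurableT_comp measurable_snd); exact: measurable_fst. Qed.

Lemma measurable_lt_ind d (T : measurableType d) (a b : T -> R) :
  measurable_fun setT a -> measurable_fun setT b ->
  measurable_fun setT (fun z => (a z < b z)%R%:R : R).
Proof.
move=> ma mb; rewrite (_ : (fun z => _) = \1_[set z | a z < b z]).
  apply: measurable_indic; rewrite (_ : [set _ | _] = ~` (setT `&` [set z | b z <= a z])).
    by apply: measurableC; exact: measurable_fun_le.
  by rewrite setTI; apply/seteqP; split => z /=; rewrite ltNge => /negP.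
by apply/funext => z; rewrite indicE mem_setE.
Qed.

Lemma measurable_time_weight : measurable_fun setT time_weight.
Proof.
apply: measurable_funM.
  apply: measurable_funM; apply: measurable_lt_ind => //; exact: measurable_cst.
exact: (measurableT_comp (measurable_derive1 k_ok) (g := fst)).
Qed.

Section latent_measure.
Context d (Om : measurableType d).
Variables (P : probability Om R) (L : Om -> iap_path R).
Hypothesis mL : measurable_fun setT L.

Let inner (F : Om * triple -> \bar R) (y : (Om * R) * R) : \bar R :=
  (\int[LS (L y.1.1)]_s F (y.1.1, (y.1.2, s, y.2)))%E.

Let m_inner F : measurable_fun setT F -> (forall z, 0 <= F z)%E ->
  measurable_fun setT (inner F).
Proof.
move=> mF F0.
have mLy : measurable_fun setT (fun y : (Om * R) * R => L y.1.1).
  apply: (measurableT_comp mL); apply: (measurableT_comp measurable_fst).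
  exact: measurable_fst.
apply: (measurable_integral_LS mLy (h := fun z => F (z.1.1.1, (z.1.1.2, z.2, z.1.2)))) => //.
apply: (measurableT_comp mF); apply: measurable_fun_pair.
  apply: (measurableT_comp measurable_fst); apply: (measurableT_comp measurable_fst).
  exact: measurable_fst.
apply: measurable_fun_pair.
  apply: measurable_fun_pair => //.
  apply: (measurableT_comp measurable_snd); apply: (measurableT_comp measurable_fst).
  exact: measurable_fst.
by apply: (measurableT_comp measurable_snd); exact: measurable_fst.
Qed.

Let inner0 F y : (forall z, 0 <= F z)%E -> (0 <= inner F y)%E.
Proof. by move=> F0; apply: integral_ge0. Qed.

Let m_inner2 F : measurable_fun setT F -> (forall z, 0 <= F z)%E ->
  measurable_fun setT (fun z : Om * R => \int[leb]_u inner F (z, u))%E.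
Proof.
move=> mF F0; have mI := m_inner mF F0.
exact: (measurable_fun_fubini_tonelli_F (m2 := leb) _ mI (fun y => inner0 y F0)).
Qed.

Definition latent_integral (F : Om * triple -> \bar R) (w : Om) : \bar R :=
  (\int[leb]_t \int[leb]_u \int[LS (L w)]_s F (w, (t, s, u)))%E.

Lemma measurable_latent_integral F : measurable_fun setT F -> (forall z, 0 <= F z)%E ->
  measurable_fun setT (latent_integral F).
Proof.
move=> mF F0; have mI := m_inner2 mF F0.
apply: (measurable_fun_fubini_tonelli_F (m2 := leb) _ mI) => z.
by apply: integral_ge0 => u _; exact: inner0.
Qed.

Lemma latent_integral_ge0 F w : (forall z, 0 <= F z)%E -> (0 <= latent_integral F w)%E.
Proof. by move=> F0; do 3!(apply: integral_ge0 => ? _). Qed.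

Lemma latent_integral_swap F : measurable_fun setT F -> (forall z, 0 <= F z)%E ->
  (\int[P]_w latent_integral F w =
   \int[leb]_t \int[leb]_u \int[P]_w \int[LS (L w)]_s F (w, (t, s, u)))%E.
Proof.
move=> mF F0; have mI := m_inner mF F0; have mI2 := m_inner2 mF F0.
have I20 z : (0 <= \int[leb]_u inner F (z, u))%E by apply: integral_ge0 => u _; exact: inner0.
transitivity (\int[leb]_t \int[P]_w \int[leb]_u inner F ((w, t), u))%E.
  exact: (fubini_tonelli _ mI2 I20).
apply: eq_integral => t _.
have mJ : measurable_fun setT (fun y : Om * R => inner F ((y.1, t), y.2)).
  apply: (measurableT_comp mI); apply: measurable_fun_pair => //.
  by apply: measurable_fun_pair => //; exact: measurable_cst.
exact: (fubini_tonelli _ mJ (fun y => inner0 _ F0)).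
Qed.

(** The measure on paths and triples is built by adding t, u and s in turn. *)
Lemma latent_measure (W : iap_path R * triple -> R) :
  measurable_fun setT W -> (forall z, 0 <= W z) ->
  exists m : {measure set (iap_path R * triple) -> \bar R},
    forall q : iap_path R * triple -> \bar R, measurable_fun setT q -> (forall z, 0 <= q z)%E ->
    (\int[m]_z q z =
     \int[P]_w latent_integral (fun z => q (L z.1, z.2) * (W (L z.1, z.2))%:E) w)%E.
Proof.
move=> mW W0.
have mkleb d' (T' : measurableType d') (h : T' * R -> \bar R) :
    measurable_fun setT h -> (forall z, 0 <= h z)%E ->
    measurable_fun setT (fun z => \int[leb]_u h (z, u))%E.
  by move=> mh h0; exact: (measurable_fun_fubini_tonelli_F (m2 := leb) h mh h0).
have [N1 iN1] := kernel_mixture P (kap := fun=> leb) (@mkleb _ _)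
  (@measurable_cst _ _ _ _ setT (1 : R)) (fun=> ler01) (@measurable_id _ _ setT).
have [N2 iN2] := kernel_mixture N1 (kap := fun=> leb) (@mkleb _ _)
  (@measurable_cst _ _ _ _ setT (1 : R)) (fun=> ler01) (@measurable_id _ _ setT).
have mLy : measurable_fun setT (fun y : (Om * R) * R => L y.1.1).
  apply: (measurableT_comp mL); apply: (measurableT_comp measurable_fst).
  exact: measurable_fst.
pose phi (y : ((Om * R) * R) * R) : iap_path R * triple := (L y.1.1.1, (y.1.1.2, y.2, y.1.2)).
have mphi : measurable_fun setT phi.
  apply: measurable_fun_pair; first exact: (measurableT_comp mLy).
  apply: measurable_fun_pair.
    apply: measurable_fun_pair => //.
    apply: (measurableT_comp measurable_snd); apply: (measurableT_comp measurable_fst).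
    exact: measurable_fst.
  by apply: (measurableT_comp measurable_snd); exact: measurable_fst.
have [N3 iN3] := kernel_mixture N2 (kap := fun y => LS (L y.1.1)) (measurable_integral_LS mLy)
  (measurableT_comp mW mphi) (fun z => W0 (phi z)) mphi.
exists N3 => q mq q0; rewrite iN3//.
pose F (z : Om * triple) := (q (L z.1, z.2) * (W (L z.1, z.2))%:E)%E.
have mLz : measurable_fun setT (fun z : Om * triple => (L z.1, z.2)).
  by apply: measurable_fun_pair => //; exact: (measurableT_comp mL).
have mF : measurable_fun setT F.
  apply: emeasurable_funM; first exact: (measurableT_comp mq).
  by apply/measurable_EFinP; exact: (measurableT_comp mW).
have F0 z : (0 <= F z)%E by rewrite mule_ge0// lee_fin.
transitivity (\int[N2]_y inner F y)%E => //.
rewrite iN2; [|exact: m_inner|by move=> y; exact: inner0].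
transitivity (\int[N1]_z \int[leb]_u inner F (z, u))%E.
  by apply: eq_integral => z _; apply: eq_integral => u _; rewrite mule1.
rewrite iN1; [|exact: m_inner2|by move=> y; apply: integral_ge0 => u _; exact: inner0].
by apply: eq_integral => w _; apply: eq_integral => t _; rewrite mule1.
Qed.

End latent_measure.

(** The latent density, with e^{-u oo} = 0. *)
Definition latent_weight (X : iap_path R) (z : triple) : R :=
  time_weight z * nexp (\int[LS X]_x (tilt_fun z.2 x)%:E)%E.

Lemma latent_weight_ge0 X z : 0 <= latent_weight X z.
Proof. by rewrite mulr_ge0 ?time_weight_ge0 ?nexp_ge0. Qed.

(** The weight as it stands in [latent_law]; it differs from [latent_weight] for paths
    of infinite mass only. *)
Let fine_weight (X : iap_path R) (z : triple) : R :=
  time_weight z * expR (- (z.2 * fine (mass X))).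

Let fine_weight_ge0 X z : 0 <= fine_weight X z.
Proof. by rewrite mulr_ge0 ?time_weight_ge0 ?expR_ge0. Qed.

Let mtw2 : measurable_fun setT (fun y : iap_path R * triple => time_weight y.2).
Proof. exact: (measurableT_comp measurable_time_weight). Qed.

Lemma measurable_latent_weight :
  measurable_fun setT (fun y : iap_path R * triple => latent_weight y.1 y.2).
Proof.
apply: measurable_funM => //; apply: (measurableT_comp (@measurable_nexp R)).
under eq_fun do rewrite integral_tilt_fun.
apply: emeasurable_funM; last exact: (measurableT_comp measurable_mass).
apply/measurable_EFinP; apply: (measurableT_comp (@normr_measurable _ setT)).
by apply: (measurableT_comp measurable_snd); exact: measurable_snd.
Qed.

Let measurable_fine_weight :
  measurable_fun setT (fun y : iap_path R * triple => fine_weight y.1 y.2).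
Proof.
apply: measurable_funM => //; apply: measurable_expRN; apply: measurable_funM.
  by apply: (measurableT_comp measurable_snd); exact: measurable_snd.
apply: (measurableT_comp (fine_measurable measurableT)) => //.
exact: (measurableT_comp measurable_mass).
Qed.

Let latent_lawE X C : measurable C ->
  latent_law k Ups X C =
  (\int[leb]_t \int[leb]_u \int[LS X]_s ((\1_C (t, s, u))%:E * (fine_weight X (t, s, u))%:E))%E.
Proof.
move=> mC.
pose g (y : (R * R) * R) : R := \1_C (y.1.1, y.2, y.1.2) *
  (expR (- (y.1.2 * fine (kmix k X Ups))) * derive1 (k ^~ y.2) y.1.1).
have g0 y : 0 <= g y by rewrite mulr_ge0// mulr_ge0 ?expR_ge0//; exact: derive1_ge0.
have my11 : measurable_fun setT (fun y : (R * R) * R => y.1.1).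
  by apply: (measurableT_comp measurable_fst); exact: measurable_fst.
have my12 : measurable_fun setT (fun y : (R * R) * R => y.1.2).
  by apply: (measurableT_comp measurable_snd); exact: measurable_fst.
have mg : measurable_fun setT g.
  apply: measurable_funM.
    apply: (measurableT_comp (measurable_indic mC)); apply: measurable_fun_pair => //.
    exact: measurable_fun_pair.
  apply: measurable_funM.
    by apply: measurable_expRN; apply: measurable_funM => //; exact: measurable_cst.
  apply: (measurableT_comp (measurable_derive1 k_ok) (g := fun y : (R * R) * R => (y.1.1, y.2))).
  exact: measurable_fun_pair.
have mcX : measurable_fun setT (fun _ : R * R => X) by exact: measurable_cst.
pose G (y : R * R) := (\int[LS X]_s (g (y, s))%:E)%E.
have mG : measurable_fun setT G.
  apply: (measurable_integral_LS mcX (h := fun z => (g z)%:E)); first exact/measurable_EFinP.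
  by move=> z; rewrite lee_fin.
have G0 y : (0 <= G y)%E by apply: integral_ge0 => s _; rewrite lee_fin.
have mGt t : measurable_fun setT (fun u => G (t, u)).
  by apply: (measurableT_comp mG); exact: measurable_pair1.
pose H t := (\int[leb]_u (G (t, u) * (0 < u)%R%:R%:E))%E.
have mH : measurable_fun setT H.
  have mGi : measurable_fun setT (fun y : R * R => G y * (0 < y.2)%R%:R%:E)%E.
    by apply: emeasurable_funM => //; apply/measurable_EFinP; exact: measurable_pos2.
  apply: (measurable_fun_fubini_tonelli_F (m2 := leb) _ mGi) => y.
  by rewrite mule_ge0// lee_fin.
have H0 t : (0 <= H t)%E by apply: integral_ge0 => u _; rewrite mule_ge0// lee_fin.
have mgs (y : R * R) : measurable_fun setT (fun s : R => (g (y, s))%:E).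
  by apply/measurable_EFinP; apply: (measurableT_comp mg); exact: measurable_pair1.
transitivity (\int[@lebesgue_measure R]_(t in `]-oo, Ups]) H t)%E.
  apply: eq_integral => t _.
  rewrite /H -(integral_ge0_leb (mGt t) (fun u => G0 (t, u))).
  by apply: eq_integral => u _; exact: (integral_LS X (mgs (t, u)) (fun s => g0 ((t, u), s))).
rewrite (integral_le_leb mH H0); apply: eq_integral => t _.
have [tU|tU] := boolP (t < Ups); last first.
  rewrite mule0; apply/esym; apply: integral0_eq => u _; apply: integral0_eq => s _.
  by rewrite /fine_weight time_weight_eq0 ?mul0r ?mule0//= (negbTE tU).
rewrite mule1; apply: eq_integral => u _.
have [u0|u0] := boolP (0 < u); last first.
  rewrite mule0; apply/esym; apply: integral0_eq => s _.
  by rewrite /fine_weight time_weight_eq0 ?mul0r ?mule0//= (negbTE u0) andbF.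
rewrite mule1; apply: eq_integral => s _; rewrite -EFinM; congr (_%:E).
rewrite /g/= /fine_weight time_weight_pos//= kmix_mass; congr (_ * _).
exact: mulrC.
Qed.

Section latent_variables.
Context d (Om : measurableType d).
Variables (P : probability Om R) (L : Om -> iap_path R) (T S U : Om -> R).
Hypotheses (mL : measurable_fun setT L) (mT : measurable_fun setT T)
  (mS : measurable_fun setT S) (mU : measurable_fun setT U).
Hypothesis Zfin : {ae P, forall w, (mass (L w) < +oo)%E}.
Hypothesis latent : forall (E : set (iap_path R)) (C : set triple),
  measurable E -> measurable C ->
  P (L @^-1` E `&` [set w | C (T w, S w, U w)]) =
    (\int[P]_(w in L @^-1` E) latent_law k Ups (L w) C)%E.

Lemma measurable_latent : measurable_fun setT (fun w => (T w, S w, U w)).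
Proof. by do 2!apply: measurable_fun_pair => //. Qed.

(** The two sides are measures on pairs (path, triple) which agree on rectangles by
    hypothesis. *)
Lemma latent_expectation (q : iap_path R * triple -> \bar R) :
  measurable_fun setT q -> (forall z, 0 <= q z)%E ->
  (\int[P]_w q (L w, (T w, S w, U w)) =
   \int[leb]_t \int[leb]_u \int[P]_w \int[LS (L w)]_s
     (q (L w, (t, s, u)) * (latent_weight (L w) (t, s, u))%:E))%E.
Proof.
move=> mq q0.
have mTSU := measurable_latent.
have mLz : measurable_fun setT (fun z : Om * triple => (L z.1, z.2)).
  by apply: measurable_fun_pair => //; exact: (measurableT_comp mL).
have mLTSU : measurable_fun setT (fun w => (L w, (T w, S w, U w))).
  exact: measurable_fun_pair.
have mF (W : iap_path R * triple -> R) (p : iap_path R * triple -> \bar R) :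
    measurable_fun setT W -> measurable_fun setT p ->
    measurable_fun setT (fun z : Om * triple => p (L z.1, z.2) * (W (L z.1, z.2))%:E)%E.
  move=> mW mp; apply: emeasurable_funM; first exact: (measurableT_comp mp).
  by apply/measurable_EFinP; exact: (measurableT_comp mW).
have [m mE] := latent_measure P mL measurable_fine_weight (fun z => fine_weight_ge0 z.1 z.2).
have fw0 (p : iap_path R * triple -> \bar R) z : (forall z, 0 <= p z)%E ->
    (0 <= p (L z.1, z.2) * (fine_weight (L z.1) z.2)%:E)%E.
  by move=> p0; rewrite mule_ge0// lee_fin fine_weight_ge0.
have lw0 z : (0 <= q (L z.1, z.2) * (latent_weight (L z.1) z.2)%:E)%E.
  by rewrite mule_ge0// lee_fin latent_weight_ge0.
pose m1 := pushforward P (fun w => (L w, (T w, S w, U w))).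
transitivity (\int[m1]_z q z)%E; first by rewrite ge0_integral_pushforward.
transitivity (\int[m]_z q z)%E.
  apply: eq_measure_integral => A mA _; apply: product_measure_ext => //.
    apply: (@le_lt_trans _ _ 1%E); last by rewrite ltry.
    exact: (probability_le1 P measurableT).
  move=> E C mE' mC; transitivity (P (L @^-1` E `&` [set w | C (T w, S w, U w)])) => //.
  rewrite latent// integral_setE.
  have -> : m (E `*` C) = (\int[m]_z (\1_(E `*` C) z)%:E)%E.
    by rewrite integral_indic ?setIT//; exact: measurableX.
  rewrite mE; last 2 first.
  - by apply/measurable_EFinP; apply: measurable_indic; exact: measurableX.
  - by move=> z; rewrite lee_fin.
  apply: eq_integral => w _; rewrite latent_lawE// muleC indicE.
  case: (boolP (w \in _)) => wE.
    rewrite mul1e; apply: eq_integral => t _; apply: eq_integral => u _.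
    apply: eq_integral => s _; congr (_ * _)%E; rewrite !indicE; congr (_%:R%:E).
    congr nat_of_bool; apply/idP/idP; rewrite !inE/=; last by case.
    by move=> Cz; split => //; move: wE; rewrite inE.
  rewrite mul0e; apply/esym; apply: integral0_eq => t _; apply: integral0_eq => u _.
  apply: integral0_eq => s _; rewrite indicE memNset ?mul0e//= => -[Ew _].
  by move/negP: wE; apply; rewrite inE.
rewrite mE//; transitivity (\int[P]_w latent_integral L (fun z => q (L z.1, z.2) *
    (latent_weight (L z.1) z.2)%:E) w)%E; last first.
  by apply: latent_integral_swap => //; apply: (mF (fun z => latent_weight z.1 z.2)) => //;
    exact: measurable_latent_weight.
apply: ge0_ae_eq_integral => //.
- apply: measurable_latent_integral => //; last by move=> z; exact: fw0.
  by apply: (mF (fun z => fine_weight z.1 z.2)).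
- apply: measurable_latent_integral => //.
  by apply: (mF (fun z => latent_weight z.1 z.2)) => //; exact: measurable_latent_weight.
- by move=> w _; apply: latent_integral_ge0 => z; exact: fw0.
- by move=> w _; apply: latent_integral_ge0.
apply: filterS Zfin => w Zw _; apply: eq_integral => t _; apply: eq_integral => u _.
apply: eq_integral => s _; congr (_ * _%:E)%E.
rewrite /fine_weight /latent_weight/=; have [u0|u0] := boolP (0 < u); last first.
  by rewrite time_weight_eq0 ?mul0r//= (negbTE u0) andbF.
congr (_ * _); rewrite integral_tilt_fun gtr0_norm//.
by rewrite -[in RHS](@fineK _ (mass (L w))) ?ge0_fin_numE ?mass_ge0.
Qed.

End latent_variables.
End latent_law.

(** * Disintegration along the latent variables *)

Lemma measurable_if_in {R : realType} d (T : measurableType d) (M : set R) (s a b : T -> R) :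
  measurable M -> measurable_fun setT s -> measurable_fun setT a -> measurable_fun setT b ->
  measurable_fun setT (fun y => if `[<M (s y)>] then a y else b y).
Proof.
move=> mM ms ma mb.
rewrite (_ : (fun y => _) = fun y => \1_M (s y) * a y + \1_(~` M) (s y) * b y).
  apply: measurable_funD; apply: measurable_funM => //; apply: measurable_indicT => //.
  exact: measurableC.
apply/funext => y; rewrite !indicE; case: asboolP => h.
  by rewrite mem_set// memNset ?mul1r ?mul0r ?addr0//= => /(_ h).
by rewrite memNset// mem_set// mul1r mul0r add0r.
Qed.

Lemma kernel_probability {R : realType} d (Z : measurableType d) d' (V : measurableType d')
    (Q : R.-pker Z ~> V) z : exists p : probability V R, p = Q z :> {measure set V -> \bar R}.
Proof.
exists (mnormalize (Q z) (\d_point : probability V R)).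
apply: eq_measure; apply/funext => A.
by rewrite /= /mnormalize/= prob_kernel onee_eq0/= invr1 mule1.
Qed.

Section posterior_kernels.
Context {R : realType} d (Om : measurableType d).
Variables (P : probability Om R) (L : Om -> iap_path R) (M : set R).
Variables (alpha : {finite_measure set R -> \bar R}) (beta : R -> R).
Hypotheses (mL : measurable_fun setT L) (cM : countable M).
Hypotheses (mb : measurable_fun setT beta) (beta_ge0 : forall x, 0 <= beta x).
Variables (k : R -> R -> R) (Ups : R).
Hypothesis k_ok : kernel_assumptions k.
Local Notation triple := (R * R * R)%type.
Let Lc w := contpart M (L w).
Let th := tilt_fun k Ups.

Let th0 u x : 0 <= th u x. Proof. exact: tilt_fun_ge0. Qed.
Let mth u : measurable_fun setT (th u). Proof. exact: measurable_tilt_fun. Qed.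
Let mM : measurable M := measurable_countable cM.
Let mLc : measurable_fun setT Lc.
Proof. exact: (measurableT_comp (measurable_contpart cM)). Qed.

(** A new atom of size v multiplies e^{-int theta dX} by e^{-theta(s) v}, which turns
    e^{-beta(s) v} into e^{-(beta(s) + theta(s)) v}. *)
Lemma weight_moved (theta : R -> R) s X v : measurable_fun setT theta -> (forall x, 0 <= theta x) ->
  nexp (\int[LS (moved M s X v)]_x (theta x)%:E) * atom_weight M beta s X v =
  path_weight M theta s X * size_weight M beta theta s v.
Proof.
move=> mt t0; rewrite /moved /atom_weight /path_weight /size_weight.
case: asboolP => [Ms|nMs]; first by rewrite add_atom0 mulrCA mulrA.
have [v0|v0] := boolP (0 < v); last first.
  have ew0 b : exp_weight b v = 0 by rewrite /exp_weight (negbTE v0) mul0r.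
  by rewrite !ew0 !mulr0.
have -> : nexp (\int[LS (add_atom X v s)]_x (theta x)%:E)%E =
    nexp (\int[LS X]_x (theta x)%:E)%E * expR (- (v * theta s)).
  rewrite integral_add_atom ?ltW//; last exact/measurable_EFinP.
  rewrite nexpD; [|exact: path_integral_ge0|by rewrite -EFinM lee_fin mulr_ge0// ltW].
  by rewrite -EFinM nexp_EFin.
rewrite mul1r -mulrA; congr (_ * _); rewrite /exp_weight v0 !mul1r -expRD.
by congr expR; ring.
Qed.

Section joint_measurability.
Let Y := ((triple * R) * Om)%type.

Let my1 : measurable_fun setT (fun y : Y => y.1.1).
Proof. by apply: (measurableT_comp measurable_fst); exact: measurable_fst. Qed.

Let my_s : measurable_fun setT (fun y : Y => y.1.1.1.2).
Proof.
apply: (measurableT_comp measurable_snd); exact: (measurableT_comp measurable_fst my1).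
Qed.

Let my_u : measurable_fun setT (fun y : Y => y.1.1.2).
Proof. exact: (measurableT_comp measurable_snd my1). Qed.

Let my_v : measurable_fun setT (fun y : Y => y.1.2).
Proof. by apply: (measurableT_comp measurable_snd); exact: measurable_fst. Qed.

Let my_L : measurable_fun setT (fun y : Y => L y.2).
Proof. exact: (measurableT_comp mL). Qed.

Let my_th : measurable_fun setT (fun y : Y => th y.1.1.2 y.1.1.1.2).
Proof.
apply: measurable_funM; first exact: (measurableT_comp (@normr_measurable _ setT)).
exact: (measurableT_comp (measurable_kernel_section k_ok Ups)).
Qed.

Let cst1 : measurable_fun setT (fun _ : Y => 1 : R). Proof. exact: measurable_cst. Qed.
Let cst0 : measurable_fun setT (fun _ : Y => 0 : R). Proof. exact: measurable_cst. Qed.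

Lemma measurable_moved2 : measurable_fun setT (fun y : Y => moved M y.1.1.1.2 (L y.2) y.1.2).
Proof.
apply: measurable_add_atom => //.
exact: (measurable_if_in mM my_s cst0 my_v).
Qed.

Lemma measurable_post_weight : measurable_fun setT (fun y : Y =>
  path_weight M (th y.1.1.2) y.1.1.1.2 (L y.2) * size_weight M beta (th y.1.1.2) y.1.1.1.2 y.1.2).
Proof.
apply: measurable_funM.
- apply: measurable_funM; first by apply: measurable_if_in => //; exact: measurable_jump.
  apply: (measurableT_comp (@measurable_nexp R)).
  under eq_fun do rewrite integral_tilt_fun//.
  apply: emeasurable_funM; last by apply: (measurableT_comp (measurable_mass Ups k_ok)).
  by apply/measurable_EFinP; exact: (measurableT_comp (@normr_measurable _ setT)).
- apply: measurable_if_in => //.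
    by apply: (measurableT_comp (measurable_indic (measurable_itv `[0%R, 1%R]))).
  apply: measurable_funM; first exact: measurable_lt_ind.
  apply: measurable_expRN; apply: measurable_funM => //; apply: measurable_funD => //.
  exact: (measurableT_comp mb).
Qed.

End joint_measurability.

(** The measure described by [posterior_at], as a measurable family in (t, s, u). *)
Lemma posterior_kernel : exists ker : triple -> {measure set (iap_path R) -> \bar R},
  (forall z (g : iap_path R -> \bar R), measurable_fun setT g -> (forall X, 0 <= g X)%E ->
    (\int[ker z]_X g X = \int[leb]_v \int[P]_w (g (moved M z.1.2 (L w) v) *
      (path_weight M (th z.2) z.1.2 (L w) * size_weight M beta (th z.2) z.1.2 v)%:E))%E) /\
  forall A, measurable A -> measurable_fun setT (fun z => ker z A).
Proof.
have W0 (z : triple) v w : 0 <= path_weight M (th z.2) z.1.2 (L w) * size_weight M beta (th z.2) z.1.2 v :> R.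
  by rewrite mulr_ge0 ?size_weight_ge0// path_weight_ge0.
have mkP (h : R * Om -> \bar R) : measurable_fun setT h -> (forall z, 0 <= h z)%E ->
    measurable_fun setT (fun v => \int[P]_w h (v, w))%E.
  by move=> mh h0; exact: (measurable_fun_fubini_tonelli_F (m2 := P) h mh h0).
have mpair (z : triple) : measurable_fun setT (fun y : R * Om => ((z, y.1), y.2) : (triple * R) * Om).
  apply: measurable_fun_pair => //; apply: measurable_fun_pair => //; exact: measurable_cst.
have ex (z : triple) := kernel_mixture leb (kap := fun=> P) mkP
  (measurableT_comp measurable_post_weight (mpair z)) (fun y => W0 z y.1 y.2)
  (measurableT_comp measurable_moved2 (mpair z)).
have [ker kerE] := choice ex.
exists ker; split => [z g mg g0|A mA]; first exact: kerE.
pose F (y : (triple * R) * Om) : \bar R := ((\1_A (moved M y.1.1.1.2 (L y.2) y.1.2))%:E *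
  (path_weight M (th y.1.1.2) y.1.1.1.2 (L y.2) *
   size_weight M beta (th y.1.1.2) y.1.1.1.2 y.1.2)%:E)%E.
have mF : measurable_fun setT F.
  apply: emeasurable_funM; last by apply/measurable_EFinP; exact: measurable_post_weight.
  by apply/measurable_EFinP; exact: (measurable_indicT measurable_moved2).
have F0 y : (0 <= F y)%E by rewrite mule_ge0// lee_fin.
have mF1 : measurable_fun setT (fun y : triple * R => \int[P]_w F (y, w))%E.
  exact: (measurable_fun_fubini_tonelli_F (m2 := P) F mF F0).
rewrite (_ : (fun z => _) = fun z => \int[leb]_v \int[P]_w F ((z, v), w))%E.
  apply: (measurable_fun_fubini_tonelli_F (m2 := leb) _ mF1) => y.
  by apply: integral_ge0 => w _; exact: F0.
apply/funext => z; transitivity (\int[ker z]_X (\1_A X)%:E)%E.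
  by rewrite integral_indic// setIT.
rewrite kerE//.
by apply/measurable_EFinP; exact: measurable_indic.
Qed.

Lemma continuous_kernel : exists ker : R * R -> {measure set (iap_path R) -> \bar R},
  (forall z (g : iap_path R -> \bar R), measurable_fun setT g -> (forall X, 0 <= g X)%E ->
    (\int[ker z]_X g X =
     \int[P]_w (g (Lc w) * (nexp (\int[LS (Lc w)]_x (th z.2 x)%:E))%:E))%E) /\
  forall A, measurable A -> measurable_fun setT (fun z => ker z A).
Proof.
have mW (z : R * R) : measurable_fun setT (fun w => nexp (\int[LS (Lc w)]_x (th z.2 x)%:E)%E).
  exact: measurable_nexp_path.
have ex (z : R * R) := image_measure P (mW z) (fun w => nexp_ge0 _) mLc.
have [ker kerE] := choice ex.
exists ker; split => [z g mg g0|A mA]; first exact: kerE.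
pose F (y : (R * R) * Om) : \bar R := ((\1_A (Lc y.2))%:E *
  (nexp (\int[LS (Lc y.2)]_x (th y.1.2 x)%:E))%:E)%E.
have mLy : measurable_fun setT (fun y : (R * R) * Om => Lc y.2) by exact: (measurableT_comp mLc).
have mF : measurable_fun setT F.
  apply: emeasurable_funM; apply/measurable_EFinP; first exact: measurable_indicT.
  apply: (measurableT_comp (@measurable_nexp R)).
  under eq_fun do rewrite integral_tilt_fun//.
  apply: emeasurable_funM; last exact: (measurableT_comp (measurable_mass Ups k_ok)).
  apply/measurable_EFinP; apply: (measurableT_comp (@normr_measurable _ setT)).
  by apply: (measurableT_comp measurable_snd); exact: measurable_fst.
have F0 y : (0 <= F y)%E by rewrite mule_ge0// lee_fin nexp_ge0.
rewrite (_ : (fun z => _) = fun z => \int[P]_w F (z, w))%E.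
  exact: (measurable_fun_fubini_tonelli_F (m2 := P) F mF F0).
apply/funext => z; transitivity (\int[ker z]_X (\1_A X)%:E)%E.
  by rewrite integral_indic// setIT.
rewrite kerE//.
by apply/measurable_EFinP; exact: measurable_indic.
Qed.

Variables (T S U : Om -> R).
Hypotheses (mT : measurable_fun setT T) (mS : measurable_fun setT S) (mU : measurable_fun setT U).
Hypotheses (ind : indep_jumps P L M Lc) (eg : extended_gamma P Lc alpha beta).
Hypothesis Zfin : {ae P, forall w, (mass k Ups (L w) < +oo)%E}.
Hypothesis latent : forall (E : set (iap_path R)) (C : set triple),
  measurable E -> measurable C ->
  P (L @^-1` E `&` [set w | C (T w, S w, U w)]) =
    (\int[P]_(w in L @^-1` E) latent_law k Ups (L w) C)%E.

(** The condition k(Ups, s) > 0 makes the new atom exponential even if beta(s) = 0. *)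
Definition good_triples : set triple :=
  [set z | [/\ z.1.1 < Ups, 0 < z.2 & 0 < k Ups z.1.2]].

Lemma time_weight_off z : ~ good_triples z -> time_weight k Ups z = 0.
Proof.
case: z => -[t s] u ng.
have [/andP[tU u0]|h] := boolP ((t < Ups) && (0 < u)); last exact: time_weight_eq0.
have [_ k0 _ _ _] := k_ok.
rewrite time_weight_pos//; apply: (derive1_eq0 k_ok tU); apply/eqP.
by rewrite eq_le k0 andbT leNgt; apply/negP => ks; apply: ng.
Qed.

Lemma measurable_good_triples : measurable good_triples.
Proof.
have mz1 : measurable_fun setT (fun z : triple => z.1.1).
  by apply: (measurableT_comp measurable_fst); exact: measurable_fst.
have mz2 : measurable_fun setT (fun z : triple => z.1.2).
  by apply: (measurableT_comp measurable_snd); exact: measurable_fst.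
have mk : measurable_fun setT (fun z : triple => k Ups z.1.2).
  exact: (measurableT_comp (measurable_kernel_section k_ok Ups)).
rewrite (_ : good_triples = ((fun z : triple => z.1.1) @^-1` `]-oo, Ups[%classic) `&`
    ((snd @^-1` `]0%R, +oo[%classic) `&` ((fun z : triple => k Ups z.1.2) @^-1` `]0%R, +oo[%classic))).
  by apply: measurableI; last apply: measurableI; apply: measurable_pre => //; exact: measurable_itv.
apply/seteqP; split => z; rewrite /good_triples/= !in_itv/= !andbT.
  by move=> [].
by move=> [? []].
Qed.

(** The latent density vanishes elsewhere, because k(Ups, s) = 0 forces k(., s) to be
    constant up to Ups. *)
Lemma good_triples_full : P [set w | good_triples (T w, S w, U w)] = 1%E.
Proof.
have mTSU : measurable_fun setT (fun w => (T w, S w, U w)) := measurable_latent mT mS mU.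
have mG := measurable_good_triples.
apply: (prob_of_compl0 (measurable_pre mTSU mG)).
have mC : measurable (~` good_triples) by exact: measurableC.
have -> : (P (~` ((fun w => (T w, S w, U w)) @^-1` good_triples)) =
    \int[P]_w (\1_(~` good_triples) (T w, S w, U w))%:E)%E.
  by rewrite (integral_indicT P mTSU mC).
pose q (z : iap_path R * triple) : \bar R := (\1_(~` good_triples) z.2)%:E.
have mq : measurable_fun setT q.
  by apply/measurable_EFinP; apply: measurable_indicT => //.
have q0 z : (0 <= q z)%E by rewrite lee_fin.
apply: (eq_trans (latent_expectation k_ok mL mT mS mU Zfin latent mq q0)).
apply: integral0_eq => t _; apply: integral0_eq => u _; apply: integral0_eq => w _.
apply: integral0_eq => s _; rewrite /q/= indicE.
have [|h] := boolP ((t, s, u) \in ~` good_triples); last by rewrite mul0e.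
by rewrite inE/= => ng; rewrite mul1e /latent_weight time_weight_off// mul0r.
Qed.

Section disintegration.
Variable ker : triple -> {measure set (iap_path R) -> \bar R}.
Hypothesis kerE : forall z (g : iap_path R -> \bar R), measurable_fun setT g -> (forall X, 0 <= g X)%E ->
    (\int[ker z]_X g X = \int[leb]_v \int[P]_w (g (moved M z.1.2 (L w) v) *
      (path_weight M (th z.2) z.1.2 (L w) * size_weight M beta (th z.2) z.1.2 v)%:E))%E.
Hypothesis ker_mass : forall z, good_triples z -> exists2 c : R, 0 < c & ker z setT = c%:E.
Variable Q : R.-pker triple ~> iap_path R.
Hypothesis QE : forall z (c : R), 0 < c -> ker z setT = c%:E ->
  forall g : iap_path R -> \bar R, measurable_fun setT g -> (forall X, 0 <= g X)%E ->
  (\int[Q z]_X g X = c^-1%:E * \int[ker z]_X g X)%E.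

Lemma measurable_disintegrated (q : iap_path R * triple -> \bar R) :
  measurable_fun setT q -> (forall z, 0 <= q z)%E ->
  measurable_fun setT (fun z => \int[Q z]_X q (X, z))%E.
Proof.
move=> mq q0.
have mq' : measurable_fun setT (fun y : triple * iap_path R => q (y.2, y.1)).
  by apply: (measurableT_comp mq); exact: measurable_fun_pair.
exact: (measurable_fun_integral_finite_kernel _ Q (fun y => q0 (y.2, y.1)) mq').
Qed.

(** Bayes' rule. For given t and u, [atom_exchange] compares the two sides: for each s
    they become the integrals against [ker z] of q and of its mean under Q z, and Q z is
    [ker z] divided by its mass. *)
Lemma disintegration (q : iap_path R * triple -> \bar R) :
  measurable_fun setT q -> (forall z, 0 <= q z)%E ->
  (\int[P]_w q (L w, (T w, S w, U w)) =
   \int[P]_w \int[Q (T w, S w, U w)]_X q (X, (T w, S w, U w)))%E.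
Proof.
move=> mq q0; have mq2 := measurable_disintegrated mq q0.
pose q2 (y : iap_path R * triple) := (\int[Q y.2]_X q (X, y.2))%E.
have mq2' : measurable_fun setT q2 by exact: (measurableT_comp mq2).
have q20 y : (0 <= q2 y)%E by apply: integral_ge0.
apply: (eq_trans (latent_expectation k_ok mL mT mS mU Zfin latent mq q0)).
apply/esym; apply: (eq_trans (latent_expectation k_ok mL mT mS mU Zfin latent mq2' q20)).
apply/esym; apply: eq_integral => t _; apply: eq_integral => u _.
have mtri : measurable_fun setT (fun z : iap_path R * R => (z.1, (t, z.2, u))).
  apply: measurable_fun_pair => //; apply: measurable_fun_pair; last exact: measurable_cst.
  by apply: measurable_fun_pair => //; exact: measurable_cst.
pose h (p : iap_path R * triple -> \bar R) (z : iap_path R * R) : \bar R :=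
  (p (z.1, (t, z.2, u)) * (latent_weight k Ups z.1 (t, z.2, u))%:E)%E.
have mh p : measurable_fun setT p -> measurable_fun setT (h p).
  move=> mp; apply: emeasurable_funM; first exact: (measurableT_comp mp mtri).
  apply/measurable_EFinP.
  exact: (measurableT_comp (measurable_latent_weight Ups k_ok) mtri).
have h0 p z : (forall y, 0 <= p y)%E -> (0 <= h p z)%E.
  by move=> p0; rewrite mule_ge0// lee_fin latent_weight_ge0.
apply: (atom_exchange mL cM mb beta_ge0 ind eg (h1 := h q) (h2 := h q2)).
- exact: mh.
- by move=> z; exact: h0.
- exact: mh.
- by move=> z; exact: h0.
move=> s; set z : triple := (t, s, u).
have hE p : measurable_fun setT p -> (forall y, 0 <= p y)%E ->
    (\int[leb]_v \int[P]_w (h p (moved M s (L w) v, s) * (atom_weight M beta s (L w) v)%:E) =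
     \int[ker z]_X (p (X, z) * (time_weight k Ups z)%:E))%E.
  move=> mp p0; rewrite kerE.
  - apply: eq_integral => v _; apply: eq_integral => w _.
    rewrite /h/= -[LHS]muleA -[RHS]muleA; congr (_ * _)%E; rewrite -!EFinM; congr (_%:E).
    by rewrite /latent_weight -mulrA; congr (_ * _); exact: weight_moved.
  - apply: emeasurable_funM; last exact: measurable_cst.
    by apply: (measurableT_comp mp); exact: measurable_pair2.
  - by move=> X; rewrite mule_ge0// lee_fin time_weight_ge0.
rewrite !hE//.
have [gz|/time_weight_off ->] := pselect (good_triples z); last first.
  by transitivity (0%E : \bar R); [|apply/esym]; apply: integral0_eq => X _; rewrite mule0.
have [c c0 cE] := ker_mass gz.
have tw0 : (0 <= (time_weight k Ups z)%:E)%E by rewrite lee_fin time_weight_ge0.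
have mqz : measurable_fun setT (fun X => q (X, z)).
  by apply: (measurableT_comp mq); exact: measurable_pair2.
rewrite /q2/=; set I2 := (\int[Q z]_X q (X, z))%E.
transitivity ((\int[ker z]_X q (X, z)) * (time_weight k Ups z)%:E)%E.
  by apply: ge0_integralZr.
rewrite integral_cst//= cE /I2 (QE c0 cE mqz (fun X => q0 (X, z))).
by rewrite [RHS]muleC !muleA -EFinM divff ?mul1e// gt_eqF.
Qed.

End disintegration.
End posterior_kernels.

(** * The posterior of the path and of its continuous part *)

Section posterior.
Context {R : realType} d (Om : measurableType d).
Variables (P : probability Om R) (L : Om -> iap_path R) (M : set R) (f : R -> R -> R).
Variables (alpha : {finite_measure set R -> \bar R}) (beta : R -> R).
Hypotheses (mL : measurable_fun setT L) (cM : countable M).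
Hypotheses (mb : measurable_fun setT beta) (beta_ge0 : forall x, 0 <= beta x).
Variables (k : R -> R -> R) (Ups : R).
Hypothesis k_ok : kernel_assumptions k.
Local Notation triple := (R * R * R)%type.
Let Lc w := contpart M (L w).
Local Notation th := (tilt_fun k Ups).
Hypotheses (ind : indep_jumps P L M Lc) (eg : extended_gamma P Lc alpha beta).
Hypothesis nofix : no_fixed_discontinuity P Lc.
Hypothesis Zpos : {ae P, forall w, (0 < mass k Ups (L w) < +oo)%E}.

Let th0 u x : 0 <= th u x. Proof. exact: tilt_fun_ge0. Qed.
Let mth u : measurable_fun setT (th u). Proof. exact: measurable_tilt_fun. Qed.
Let mLc : measurable_fun setT Lc.
Proof. exact: (measurableT_comp (measurable_contpart cM)). Qed.

Let Zfin : {ae P, forall w, (mass k Ups (L w) < +oo)%E}.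
Proof. by apply: filterS Zpos => w /andP[]. Qed.

Let th_fin u : {ae P, forall w, (\int[LS (L w)]_x (th u x)%:E < +oo)%E}.
Proof.
apply: filterS Zfin => w Zw; rewrite integral_tilt_fun//.
by rewrite lte_mul_pinfty// lee_fin.
Qed.

Local Notation np u X := (nexp (\int[LS X]_x (th u x)%:E)%E).

Lemma continuous_posterior : exists K : R.-pker (R * R)%type ~> iap_path R,
  forall z, exists kc : R, [/\ 0 < kc, (\int[P]_w (np z.2 (Lc w))%:E = kc%:E)%E,
    forall g : iap_path R -> \bar R, measurable_fun setT g -> (forall X, 0 <= g X)%E ->
      (\int[K z]_X g X = kc^-1%:E * \int[P]_w (g (Lc w) * (np z.2 (Lc w))%:E))%E &
    extended_gamma (K z) id alpha (fun x => beta x + th z.2 x) /\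
    no_fixed_discontinuity (K z) id].
Proof.
have [ker [kerE mker]] := continuous_kernel P mL cM Ups k_ok.
have [K KE] := normalized_kernel mker.
exists K => z.
have mh : measurable_fun setT (fun w => \int[LS (Lc w)]_x (th z.2 x)%:E)%E.
  exact: measurable_path_integral.
have h0 w : (0 <= \int[LS (Lc w)]_x (th z.2 x)%:E)%E by exact: path_integral_ge0.
have hfin : {ae P, forall w, (\int[LS (Lc w)]_x (th z.2 x)%:E < +oo)%E}.
  apply: filterS (th_fin z.2) => w; apply: le_lt_trans.
  have mt : measurable_fun setT (fun x => (th z.2 x)%:E) by exact/measurable_EFinP.
  have t0 x : (0 <= (th z.2 x)%:E)%E by rewrite lee_fin.
  rewrite [leRHS](path_integral_atoms cM (L w) mt t0) leeDr//.
  by apply: integral_ge0.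
have [kc kc0 kcE] := nexp_mean_gt0 mh h0 hfin.
have massE : ker z setT = kc%:E.
  transitivity (\int[ker z]_X 1%:E)%E; first by rewrite integral_cst// mul1e.
  by rewrite kerE// -kcE; apply: eq_integral => w _; rewrite mul1e.
have Kz (g : iap_path R -> \bar R) : measurable_fun setT g -> (forall X, 0 <= g X)%E ->
    (\int[K z]_X g X = kc^-1%:E * \int[P]_w (g (Lc w) * (np z.2 (Lc w))%:E))%E.
  by move=> mg g0; rewrite (KE z kc kc0 massE)// kerE.
exists kc; split => //.
have [p pE] := kernel_probability K z; rewrite -pE.
have pI (g : iap_path R -> \bar R) : (\int[p]_X g X = \int[K z]_X g X)%E.
  by apply: eq_measure_integral => A mA _; rewrite -pE.
apply: (tilted_continuous_part mLc mb eg nofix (mth z.2) (th0 z.2) kc0 kcE) => g mg g0.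
by rewrite pI; exact: Kz.
Qed.

Variables (T S U : Om -> R).
Hypotheses (mT : measurable_fun setT T) (mS : measurable_fun setT S) (mU : measurable_fun setT U).
Hypothesis jump_law : forall tau, M tau -> pos_density (f tau) /\
  forall B, measurable B -> P [set w | B (jump (L w) tau)] =
    (\int[@lebesgue_measure R]_(x in B `&` `]0%R, +oo[) (f tau x)%:E)%E.
Hypothesis latent : forall (E : set (iap_path R)) (C : set triple),
  measurable E -> measurable C ->
  P (L @^-1` E `&` [set w | C (T w, S w, U w)]) =
    (\int[P]_(w in L @^-1` E) latent_law k Ups (L w) C)%E.


Variable K : R.-pker (R * R)%type ~> iap_path R.
Hypothesis K_posterior : forall z, exists kc : R, [/\ 0 < kc,
  (\int[P]_w (np z.2 (Lc w))%:E = kc%:E)%E,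
  forall g : iap_path R -> \bar R, measurable_fun setT g -> (forall X, 0 <= g X)%E ->
    (\int[K z]_X g X = kc^-1%:E * \int[P]_w (g (Lc w) * (np z.2 (Lc w))%:E))%E &
  extended_gamma (K z) id alpha (fun x => beta x + th z.2 x) /\
  no_fixed_discontinuity (K z) id].

Let mass_moved s X v : mass k Ups (moved M s X v) =
  (mass k Ups X + (`|if `[<M s>] then 0 else v| * k Ups s)%:E)%E.
Proof.
have [_ k0 _ _ _] := k_ok.
have mk : measurable_fun setT (fun x => (k Ups x)%:E).
  by apply/measurable_EFinP; exact: measurable_kernel_section.
by rewrite /moved add_atomN /mass integral_add_atom// => x; rewrite lee_fin.
Qed.

Let measurable_degenerate : measurable [set X | ~ (0 < mass k Ups X < +oo)%E].
Proof.
rewrite (_ : [set _ | _] = mass k Ups @^-1` (~` `]0%E, +oo%E[%classic)).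
  apply: measurable_pre; first exact: measurable_mass.
  by apply: measurableC; exact: emeasurable_itv.
by apply/seteqP; split => X /=; rewrite in_itv.
Qed.

(** An additional atom of size v adds v k(Ups, s) to the mass. *)
Let mass_posterior (q : {measure set (iap_path R) -> \bar R}) (W : R -> iap_path R -> R) s :
  0 < k Ups s -> (forall v X, 0 <= W v X) ->
  (forall g : iap_path R -> \bar R, measurable_fun setT g -> (forall X, 0 <= g X)%E ->
    (\int[q]_X g X = \int[leb]_v \int[P]_w (g (moved M s (L w) v) * (W v (L w))%:E))%E) ->
  (forall v, measurable_fun setT (W v)) ->
  q [set X | ~ (0 < mass k Ups X < +oo)%E] = 0%E.
Proof.
move=> ks W0 qE mW; have mN := measurable_degenerate; set N := [set X | _] in mN *.
transitivity (\int[q]_X (\1_N X)%:E)%E; first by rewrite integral_indic// setIT.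
rewrite qE; [|by apply/measurable_EFinP; exact: measurable_indic|by move=> X; rewrite lee_fin].
apply: integral0_eq => v _.
have mmov : measurable_fun setT (fun w => moved M s (L w) v).
  by apply: measurable_add_atom => //; exact: measurable_cst.
rewrite -[RHS](integral0 P setT); apply: ge0_ae_eq_integral => //.
- apply: emeasurable_funM; apply/measurable_EFinP; first exact: (measurable_indicT mmov).
  exact: (measurableT_comp (mW v)).
- by move=> w _; rewrite mule_ge0// lee_fin.
apply: filterS Zpos => w /andP[Z0 Z1] _; rewrite indicE memNset ?mul0e//=; apply/negP.
rewrite mass_moved; apply/andP; split; last by rewrite lte_add_pinfty// ltry.
by apply: lt_le_trans Z0 _; rewrite leeDl// lee_fin mulr_ge0// ltW.
Qed.

Lemma path_posterior : exists Q : R.-pker triple ~> iap_path R,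
  (forall q : iap_path R * triple -> \bar R, measurable_fun setT q -> (forall y, 0 <= q y)%E ->
    (\int[P]_w q (L w, (T w, S w, U w)) =
     \int[P]_w \int[Q (T w, S w, U w)]_X q (X, (T w, S w, U w)))%E) /\
  forall z, good_triples k Ups z ->
  [/\ exists fs : R -> R -> R, [/\
        forall tau, M tau -> pos_density (fs tau) /\ exists2 a : R, 0 < a &
          forall x, 0 < x -> fs tau x =
            a * ((if tau == z.1.2 then x else 1) * expR (- (th z.2 tau * x)) * f tau x),
        ~ M z.1.2 -> forall x, 0 < x ->
          fs z.1.2 x = (beta z.1.2 + th z.2 z.1.2) * expR (- ((beta z.1.2 + th z.2 z.1.2) * x)) &
        extended_gamma_fixed (Q z) id (M `|` [set z.1.2]) fs alpha (fun x => beta x + th z.2 x)],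
      forall E, measurable E -> Q z (contpart (M `|` [set z.1.2]) @^-1` E) = K (z.1.1, z.2) E &
      {ae Q z, forall X, (0 < mass k Ups X < +oo)%E}].
Proof.
have [s_ [us nds sM]] := countable_enum cM.
have [ker [kerE mker]] := posterior_kernel P mL cM mb Ups k_ok.
have [Q QE] := normalized_kernel mker.
have tgt0 z : good_triples k Ups z -> 0 < th z.2 z.1.2.
  by move=> [_ u0 k0]; rewrite mulr_gt0// normr_gt0 gt_eqF.
have post z (gz : good_triples k Ups z) :=
  posterior_at alpha mL cM mb beta_ge0 ind nofix jump_law (mth z.2) (th0 z.2) (tgt0 z gz)
    (th_fin z.2) us nds sM (kerE z).
have ker_mass z : good_triples k Ups z -> exists2 c : R, 0 < c & ker z setT = c%:E.
  by move=> /post[c [c0 cE _]]; exists c.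
exists Q; split.
  exact: (disintegration mL cM mb beta_ge0 k_ok mT mS mU ind eg Zfin latent kerE ker_mass QE).
move=> z gz; have [c [c0 cE [fs [fsM fss fsQ]]]] := post z gz.
have [kc [kc0 kcE KE [Keg Knf]]] := K_posterior (z.1.1, z.2).
have [pQ pQE] := kernel_probability Q z; have [pK pKE] := kernel_probability K (z.1.1, z.2).
have IQ (g : iap_path R -> \bar R) : (\int[pQ]_X g X = \int[Q z]_X g X)%E.
  by apply: eq_measure_integral => A mA _; rewrite -pQE.
have IK (g : iap_path R -> \bar R) : (\int[pK]_X g X = \int[K (z.1.1, z.2)]_X g X)%E.
  by apply: eq_measure_integral => A mA _; rewrite -pKE.
have [egf contE] : extended_gamma_fixed pQ id (M `|` [set z.1.2]) fs alpha (fun x => beta x + th z.2 x) /\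
    forall E, measurable E -> ker z (contpart (M `|` [set z.1.2]) @^-1` E) = (c%:E * pK E)%E.
  apply: (fsQ kc) => //.
  - by move=> g mg g0; rewrite IQ; exact: QE.
  - by move=> g mg g0; rewrite IK; exact: KE.
  - by rewrite pKE.
  - by rewrite pKE.
have QA A : measurable A -> Q z A = (c^-1%:E * ker z A)%E.
  move=> mA; transitivity (\int[Q z]_X (\1_A X)%:E)%E; first by rewrite integral_indic// setIT.
  rewrite (QE z c c0 cE); last 2 first.
  - by apply/measurable_EFinP; exact: measurable_indic.
  - by move=> X; rewrite lee_fin.
  by rewrite integral_indic// setIT.
split.
- by exists fs; split => //; rewrite -pQE.
- move=> E mE.
  have mcp := measurable_contpart (countable_setU1 z.1.2 cM).
  apply: (eq_trans (QA _ (measurable_pre mcp mE))).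
  apply: (eq_trans (congr1 (fun a => c^-1%:E * a)%E (contE E mE))).
  rewrite muleA -EFinM mulVf ?gt_eqF// mul1e.
  by rewrite -pKE.
- exists [set X | ~ (0 < mass k Ups X < +oo)%E].
  split; [exact: measurable_degenerate|apply: (eq_trans (QA _ measurable_degenerate))|by []].
  have [_ _ ks] := gz.
  have := mass_posterior (W := fun v X => path_weight M (th z.2) z.1.2 X *
    size_weight M beta (th z.2) z.1.2 v) ks _ (kerE z).
  move=> ->; rewrite ?mule0//.
  + by move=> v X; rewrite mulr_ge0 ?size_weight_ge0// path_weight_ge0.
  + by move=> v; apply: measurable_funM => //; exact: measurable_path_weight.
Qed.

End posterior.

(** * The posterior theorem *)

Lemma gamma_pdf_exponential {R : realType} (b x : R) : 0 < b -> 0 < x ->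
  gamma_pdf 1 b x = b * expR (- (b * x)).
Proof.
move=> b0 x0; rewrite /gamma_pdf subrr powRr1 ?ltW// powRr0 mulr1.
have -> : Gamma_fun 1 = 1 :> R; last by rewrite divr1.
rewrite /Gamma_fun subrr.
transitivity (fine (\int[leb]_v (exp_weight (1 : R) v)%:E)%E); last first.
  by rewrite integral_exp_weight//= invr1.
congr fine; transitivity (\int[leb]_(x in `]0%R, +oo[) (expR (- x) : R)%:E)%E.
  rewrite -integral_leb//.
    by apply: eq_integral => y _; rewrite powRr0 mul1r.
  by apply: measurable_funTS; apply/measurable_EFinP; exact: measurable_expRN.
rewrite integral_setE; apply: eq_integral => y _; rewrite -EFinM indicE mem_setE in_itv/= andbT.
by rewrite /exp_weight mul1r mulrC.
Qed.

Lemma measurable_nrm {R : realType} (k : R -> R -> R) (Ups : R) (E : set (R -> R)) :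
  kernel_assumptions k -> <<s @function_cylinders R >> E ->
  measurable [set X : iap_path R | E (nrm k Ups X)].
Proof.
move=> k_ok hE; have [_ k0 _ _ _] := k_ok; have mk := measurable_kernel_section k_ok.
have mmix t : measurable_fun setT (fun X : iap_path R => fine (kmix k X t)).
  apply: (measurableT_comp (fine_measurable measurableT)).
  rewrite (_ : (fun X => _) = fun X => \int[LS X]_x (k t x)%:E)%E; first exact: measurable_path_integral.
  apply/funext => X; apply: integral_LS; first exact/measurable_EFinP.
  by move=> x; rewrite lee_fin.
apply: (hE [set E' | measurable [set X : iap_path R | E' (nrm k Ups X)]]); split.
- split.
  + exact: measurable0.
  + move=> A /= mA; rewrite (_ : [set _ | _] = ~` [set X : iap_path R | A (nrm k Ups X)]).
      exact: measurableC.
    by apply/seteqP; split => X /=; [case|split].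
  + move=> A /= mA; rewrite (_ : [set _ | _] = \bigcup_n [set X : iap_path R | A n (nrm k Ups X)]).
      exact: bigcup_measurable.
    by apply/seteqP; split => X [n _ h]; exists n.
- move=> _ [t [B mB ->]].
  have mn : measurable_fun setT (fun X : iap_path R => nrm k Ups X t).
    apply: measurable_funM => //; exact: (measurableT_comp (@measurable_invr R)).
  exact: (measurable_pre mn mB).
Qed.

Theorem proposition4 (R : realType) (d : measure_display)
  (Om : measurableType d) (P : probability Om R)
  (k : R -> R -> R) (Ups : R)
  (alpha : {finite_measure set R -> \bar R}) (beta : R -> R)
  (M : set R) (f : R -> R -> R)
  (L : Om -> iap_path R) (T1 S1 U1 : Om -> R)
  (k_ok : kernel_assumptions k)
  (alpha_neq0 : alpha setT <> 0%E)
  (beta_ge0 : forall x, 0 <= beta x)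
  (beta_pc : piecewise_continuous beta)
  (M_countable : countable M)
  (L_prior : extended_gamma_fixed P L M f alpha beta)
  (Z_pos_fin : {ae P, forall w, (0 < kmix k (L w) Ups < +oo)%E})
  (T1_meas : measurable_fun setT T1)
  (S1_meas : measurable_fun setT S1)
  (U1_meas : measurable_fun setT U1)
  (T1_sample : forall (E : set (iap_path R)) t, measurable E -> t <= Ups ->
     P (L @^-1` E `&` [set w | T1 w <= t]) =
       (\int[P]_(w in L @^-1` E) (nrm k Ups (L w) t)%:E)%E)
  (latent : forall (E : set (iap_path R)) (C : set (R * R * R)),
     measurable E -> measurable C ->
     P (L @^-1` E `&` [set w | C (T1 w, S1 w, U1 w)]) =
       (\int[P]_(w in L @^-1` E) latent_law k Ups (L w) C)%E) :
  let betas (u x : R) := beta x + u * k Ups x in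
  (exists Q : R.-pker (R * R * R)%type ~> iap_path R,
    [/\ conditional_law P L (fun w => (T1 w, S1 w, U1 w)) Q,
        exists D : set (R * R * R),
        [/\ measurable D, P [set w | D (T1 w, S1 w, U1 w)] = 1%E &
          forall t1 s1 u1, D (t1, s1, u1) ->
          [/\ M s1 -> exists fs : R -> R -> R,
                (forall tau, M tau ->
                  (tau = s1 -> propto_density (fs tau)
                    (fun x => x * expR (- (u1 * k Ups tau * x)) * f tau x)) /\
                  (tau <> s1 -> tau <= Ups -> propto_density (fs tau)
                    (fun x => expR (- (u1 * k Ups tau * x)) * f tau x))) /\
                extended_gamma_fixed (Q (t1, s1, u1)) id M fs alpha (betas u1),
              ~ M s1 -> exists fs : R -> R -> R,
                [/\ forall x, 0 < x ->
                      fs s1 x = gamma_pdf 1 (beta s1 + u1 * k Ups s1) x,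
                    forall tau, M tau -> tau <= Ups -> propto_density (fs tau)
                      (fun x => expR (- (u1 * k Ups tau * x)) * f tau x)
                  & extended_gamma_fixed (Q (t1, s1, u1)) id (M `|` [set s1])
                      fs alpha (betas u1)]
            & {ae Q (t1, s1, u1), forall Ls, (0 < kmix k Ls Ups < +oo)%E}]]
      & forall (E : set (R -> R)) (C : set (R * R * R)),
          <<s @function_cylinders R >> E -> measurable C ->
          P [set w | E (nrm k Ups (L w)) /\ C (T1 w, S1 w, U1 w)] =
          (\int[P]_(w in [set w | C (T1 w, S1 w, U1 w)])
             Q (T1 w, S1 w, U1 w) [set Ls | E (nrm k Ups Ls)])%E]) /\
  (exists (Lc : Om -> iap_path R) (K : R.-pker (R * R)%type ~> iap_path R),
    [/\ forall w, decomposes (M `|` [set S1 w]) (L w) (Lc w),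
        measurable_fun setT Lc,
        conditional_law P Lc (fun w => (T1 w, U1 w)) K
      & exists D : set (R * R),
        [/\ measurable D, P [set w | D (T1 w, U1 w)] = 1%E &
          forall t1 u1, D (t1, u1) ->
            extended_gamma (K (t1, u1)) id alpha (betas u1) /\
            no_fixed_discontinuity (K (t1, u1)) id]]).
Proof.
move=> betas.
have [iapL jump_law [Xc [decXc]]] := L_prior.
have mL := iapL.1.
have -> : Xc = fun w => contpart M (L w).
  by apply/funext => w; exact: decomposes_unique.
move=> eg nofix ind.
have mb := measurable_piecewise_continuous beta_pc.
have Zpos : {ae P, forall w, (0 < mass k Ups (L w) < +oo)%E}.
  by apply: filterS Z_pos_fin => w; rewrite kmix_mass.
have Zfin : {ae P, forall w, (mass k Ups (L w) < +oo)%E}.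
  by apply: filterS Zpos => w /andP[].
have [K KP] := continuous_posterior mL M_countable mb k_ok eg nofix Zpos.
have [Q [disint post]] := path_posterior mL M_countable mb beta_ge0 k_ok ind eg nofix Zpos
  T1_meas S1_meas U1_meas jump_law latent KP.
have mTSU : measurable_fun setT (fun w => (T1 w, S1 w, U1 w)).
  exact: measurable_latent.
have mTU : measurable_fun setT (fun w => (T1 w, U1 w)) by exact: measurable_fun_pair.
have mG := measurable_good_triples Ups k_ok.
have full := good_triples_full mL k_ok T1_meas S1_meas U1_meas Zfin latent.
have betasE u : 0 < u -> (fun x => beta x + tilt_fun k Ups u x) = betas u.
  by move=> u0; apply/funext => x; rewrite /betas /tilt_fun gtr0_norm.
have condQ : conditional_law P L (fun w => (T1 w, S1 w, U1 w)) Q.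
  move=> E C mE mC.
  pose q (y : iap_path R * (R * R * R)) : \bar R := ((\1_E y.1 : R)%:E * (\1_C y.2)%:E)%E.
  have mq : measurable_fun setT q.
    by apply: emeasurable_funM; apply/measurable_EFinP; exact: measurable_indicT.
  have q0 y : (0 <= q y)%E by rewrite mule_ge0// lee_fin.
  transitivity (\int[P]_w q (L w, (T1 w, S1 w, U1 w)))%E.
    have mI : measurable (L @^-1` E `&` (fun w => (T1 w, S1 w, U1 w)) @^-1` C).
      by apply: measurableI; exact: measurable_pre.
    transitivity (\int[P]_w (\1_(L @^-1` E `&` (fun w => (T1 w, S1 w, U1 w)) @^-1` C) w)%:E)%E.
      by rewrite integral_indic// setIT.
    by apply: eq_integral => w _; rewrite indicI /q -EFinM.
  rewrite disint// [RHS]integral_setE; apply: eq_integral => w _.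
  have m1 : measurable_fun setT (fun X : iap_path R => (\1_E X : R)%:E).
    by apply/measurable_EFinP; exact: measurable_indic.
  transitivity ((\int[Q (T1 w, S1 w, U1 w)]_X (\1_E X)%:E) * (\1_C (T1 w, S1 w, U1 w))%:E)%E.
    by rewrite -ge0_integralZr.
  by rewrite integral_indic// setIT.
split.
- exists Q; split => //.
  + exists (good_triples k Ups); split => //.
    move=> t1 s1 u1 gz; have [[fs [fsM fss egf]] _ aeQ] := post _ gz.
    have [_ /= u0 ks] := gz; rewrite /= in fsM fss egf.
    rewrite betasE// in egf.
    have thE x : tilt_fun k Ups u1 x = u1 * k Ups x by rewrite /tilt_fun gtr0_norm.
    split.
    * move=> Ms; exists fs; split; last first.
        by rewrite (_ : M = M `|` [set s1])//; apply/seteqP; split => x; [left|case=> // ->].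
      move=> tau Mt; have [fd [a a0 aE]] := fsM tau Mt; split.
        move=> ts; split => //; exists a => // x x0; rewrite aE// ts eqxx thE; ring.
      move=> /eqP/negbTE ts _; split => //; exists a => // x x0; rewrite aE// ts mul1r thE; ring.
    * move=> nMs; exists fs; split => //.
        move=> x x0; rewrite gamma_pdf_exponential//; first by rewrite fss// thE.
        by rewrite ltr_wpDl// mulr_gt0.
      move=> tau Mt _; have [fd [a a0 aE]] := fsM tau Mt.
      split => //; exists a => // x x0; rewrite aE// thE.
      by have [e|_] := eqVneq tau s1; [move: Mt; rewrite e|rewrite mul1r].
    * by apply: filterS aeQ => X; rewrite kmix_mass.
  + move=> E C hE mC; have := condQ _ C (measurable_nrm Ups k_ok hE) mC.
    by move=> <-.
- exists (fun w => contpart (M `|` [set S1 w]) (L w)), K.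
  have mLc' := measurable_contpart_setU1 M_countable mL S1_meas.
  split => //.
  + by move=> w; apply: decomposes_contpart; exact: countable_setU1.
  + move=> E C mE mC.
    pose q (y : iap_path R * (R * R * R)) : \bar R :=
      ((\1_E (contpart (M `|` [set y.2.1.2]) y.1) : R)%:E * (\1_C (y.2.1.1, y.2.2))%:E)%E.
    have my1 : measurable_fun setT (fun y : iap_path R * (R * R * R) => y.2.1).
      by apply: (measurableT_comp measurable_fst); exact: measurable_snd.
    have my2 : measurable_fun setT (fun y : iap_path R * (R * R * R) => y.2.2).
      by apply: (measurableT_comp measurable_snd); exact: measurable_snd.
    have my11 : measurable_fun setT (fun y : iap_path R * (R * R * R) => y.2.1.1).
      exact: (measurableT_comp measurable_fst).
    have my12 : measurable_fun setT (fun y : iap_path R * (R * R * R) => y.2.1.2).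
      exact: (measurableT_comp measurable_snd).
    have mq : measurable_fun setT q.
      apply: emeasurable_funM; apply/measurable_EFinP; apply: measurable_indicT => //.
        by apply: measurable_contpart_setU1.
      exact: measurable_fun_pair.
    have q0 y : (0 <= q y)%E by rewrite mule_ge0// lee_fin.
    transitivity (\int[P]_w q (L w, (T1 w, S1 w, U1 w)))%E.
      set A := (X in _ @^-1` E `&` X).
      have mI : measurable ((fun w => contpart (M `|` [set S1 w]) (L w)) @^-1` E `&` A).
        by apply: measurableI; exact: measurable_pre.
      transitivity (\int[P]_w (\1_((fun w => contpart (M `|` [set S1 w]) (L w)) @^-1` E `&` A) w)%:E)%E.
        by rewrite integral_indic// setIT.
      by apply: eq_integral => w _; rewrite indicI /q -EFinM.
    rewrite disint// [RHS]integral_setE; apply: ge0_ae_eq_integral => //.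
    * exact: (measurableT_comp (measurable_disintegrated Q mq q0)).
    * apply: emeasurable_funM; last by apply/measurable_EFinP; exact: (measurable_indicT mTU).
      by apply: (measurableT_comp (measurable_kernel K E mE)).
    * by move=> w _; apply: integral_ge0.
    have gae : {ae P, forall w, good_triples k Ups (T1 w, S1 w, U1 w)}.
      exists (~` [set w | good_triples k Ups (T1 w, S1 w, U1 w)]); split => //.
        by apply: measurableC; exact: (measurable_pre mTSU mG).
      by apply: prob_compl0 => //; exact: (measurable_pre mTSU mG).
    (* Q (t, s, u) gives the continuous part the law K (t, u), whatever s *)
    apply: filterS gae => w /post[_ Kc _] _.
    have mcp := measurable_contpart (countable_setU1 (S1 w) M_countable).
    transitivity ((\int[Q (T1 w, S1 w, U1 w)]_X (\1_E (contpart (M `|` [set S1 w]) X))%:E) *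
        (\1_C (T1 w, U1 w))%:E)%E.
      rewrite -ge0_integralZr//.
      by apply/measurable_EFinP; exact: (measurable_indicT mcp).
    rewrite integral_indicT// -Kc//.
  + have mD : measurable [set z : R * R | 0 < z.2].
      rewrite (_ : [set _ | _] = snd @^-1` `]0%R, +oo[%classic).
        by apply: measurable_pre => //; exact: measurable_itv.
      by apply/seteqP; split => z /=; rewrite in_itv/= andbT.
    exists [set z | 0 < z.2]; split => //.
    * apply/eqP; rewrite eq_le probability_le1 ?andTb; last first.
        by apply: (measurable_pre mTU mD).
      rewrite -full; apply: le_measure; rewrite ?inE.
      - exact: (measurable_pre mTSU mG).
      - exact: (measurable_pre mTU mD).
      - by move=> w [].
    * move=> t1 u1 /= u0; have [kc [_ _ _]] := KP (t1, u1).
      by rewrite betasE.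
Qed.
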